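(* Let $M$ be a smooth real manifold and $\mathfrak{Z}(M)$ a distribution of complex vector fields on $M$ generated by a finite set $L_1,\dots,L_n$ of complex vector fields. Let $X_0\in\mathfrak{X}(M)$ be a real vector field. Set $$\mathbb{T}'_0(M)=\mathcal{C}^\infty(M,\mathbb{R})\cdot X_0+\mathfrak{T}_{\mathfrak{Z}}(M),\quad \mathbb{T}'_h(M)=[\mathfrak{A}_{\mathfrak{Z}}(M),\mathbb{T}'_{h-1}(M)]\ (h\ge1),\quad \mathfrak{T}'(M)=\sum_{h=0}^\infty\mathbb{T}'_h(M).$$ Then, for any choice of $Y_0\in\mathbb{T}^{(0)}_{\mathfrak{Z}}(M)$ and $a\in\mathcal{C}^\infty(M)$, the second order partial differential operator $$P(u)=a\cdot u+X_0(u)+iY_0(u)+\sum_{j=1}^n\bar L_jL_j(u)$$ is hypoelliptic at all points $p\in M$ where $\{X(p)\mid X\in\mathfrak{T}'(M)\}=T_pM$.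
   Context: $\mathcal{C}^\infty(M)$ denotes complex valued smooth functions, $\mathcal{C}^\infty(M,\mathbb{R})$ the real valued ones, $\mathcal{C}^\infty_0(U)$ the complex valued ones with compact support in the open set $U$; $\mathfrak{X}(M)$ and $\mathfrak{X}^{\mathbb{C}}(M)$ are the Lie algebras of smooth real and complex vector fields. $\|\cdot\|_0$ is the $L^2$ norm with respect to a fixed Riemannian metric on $M$. A distribution of complex vector fields is a $\mathcal{C}^\infty(M)$-submodule $\mathfrak{Z}(M)\subset\mathfrak{X}^{\mathbb{C}}(M)$. $\mathbb{E}_{\mathfrak{Z}}(M)$ is the set of $Z\in\mathfrak{X}^{\mathbb{C}}(M)$ such that for every relatively compact open $U\Subset M$ there are $L_1',\dots,L_k'\in\mathfrak{Z}(M)$ and $C>0$ with $\|Z(u)\|_0^2\le C(\sum_{j=1}^k\|L_j'(u)\|_0^2+\|u\|_0^2)$ for all $u\in\mathcal{C}^\infty_0(U)$. Set $\mathbb{A}_{\mathfrak{Z}}(M)=\mathbb{E}_{\mathfrak{Z}}(M)\cap\mathfrak{X}(M)$; $\mathfrak{A}_{\mathfrak{Z}}(M)$ is the Lie subalgebra of $\mathfrak{X}(M)$ generated by $\mathbb{A}_{\mathfrak{Z}}(M)$; $\mathbb{T}^{(0)}_{\mathfrak{Z}}(M)=\{Z+\bar Z\mid Z\in\mathfrak{Z}(M)\}$; for $h\ge1$, $\mathbb{T}^{(h)}_{\mathfrak{Z}}(M)$ is the real linear span of $\{[X,Y]\mid X\in\mathbb{A}_{\mathfrak{Z}}(M),\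 Y\in\mathbb{T}^{(h-1)}_{\mathfrak{Z}}(M)\}$; $\mathfrak{T}_{\mathfrak{Z}}(M)=\sum_{h\ge0}\mathbb{T}^{(h)}_{\mathfrak{Z}}(M)$. For spaces of vector fields, $[\mathbb{A},\mathbb{B}]$ denotes the linear span of the commutators $[X,Y]$, $X\in\mathbb{A}$, $Y\in\mathbb{B}$. (Thus $\mathfrak{T}'(M)$ is the $\mathfrak{A}_{\mathfrak{Z}}(M)$-Lie-submodule of $\mathfrak{X}(M)$ generated by $X_0$ and $\mathfrak{T}_{\mathfrak{Z}}(M)$.) ''Hypoelliptic'' means $\mathcal{C}^\infty$-hypoelliptic: $P$ is hypoelliptic at $p$ if $p$ has an open neighborhood $U$ such that, for every open $V\subset U$ and every (Schwartz) distribution $u$ on $V$, $P(u)\in\mathcal{C}^\infty(V)$ implies $u\in\mathcal{C}^\infty(V)$. *)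

(* Defs.v *)
From HB Require Import structures.
From mathcomp Require Import all_boot all_order all_algebra.
From mathcomp Require Import all_classical all_reals all_analysis.
From mathcomp Require Export complex.

Set Implicit Arguments.
Unset Strict Implicit.
Unset Printing Implicit Defensive.
Import Order.TTheory GRing.Theory Num.Theory.
Import numFieldNormedType.Exports.

Local Open Scope classical_set_scope.
Local Open Scope ring_scope.
Local Open Scope complex_scope.

Section Euclidean.
Context {R : realType}.

Definition partial {m : nat} (i : 'I_m) (f : 'rV[R]_m -> R) : 'rV[R]_m -> R :=
  fun x => 'D_(delta_mx 0 i) f x.

Definition iter_partial {m : nat} (w : seq 'I_m) (f : 'rV[R]_m -> R) :
  'rV[R]_m -> R := foldr partial f w.

(* [f] is C^oo on the open set [A]: all iterated partial derivatives exist and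
   are continuous at the points of [A]. *)
Definition smooth_rV {m : nat} (A : set 'rV[R]_m) (f : 'rV[R]_m -> R) : Prop :=
  forall (w : seq 'I_m) (x : 'rV[R]_m), A x ->
    {for x, continuous (iter_partial w f)} /\
    forall i : 'I_m, derivable (iter_partial w f) x (delta_mx 0 i).

(* The integral of a nonnegative Borel function against the [m]-dimensional
   Lebesgue measure, written as an iterated integral (Tonelli). *)
Fixpoint integral_rV {m : nat} : ('rV[R]_m -> \bar R) -> \bar R :=
  match m return ('rV[R]_m -> \bar R) -> \bar R with
  | 0%N => fun f => f 0
  | m'.+1 => fun f =>
      (\int[lebesgue_measure]_x
         integral_rV (fun v : 'rV[R]_m' => f (row_mx (x : R)%:M v)))%E
  end.

End Euclidean.

(* A chart is a homeomorphism from [chart_dom] onto an open set of [R^m];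
   the values of [chart_map] outside [chart_dom], and of [chart_inv] outside
   [chart_img], are irrelevant. *)
Record chart (R : realType) (m : nat) (T : topologicalType) := Chart {
  chart_dom : set T;
  chart_map : T -> 'rV[R]_m;
  chart_inv : 'rV[R]_m -> T }.

Definition chart_img {R : realType} {m : nat} {T : topologicalType}
  (c : chart R m T) : set 'rV[R]_m := chart_map c @` chart_dom c.

Definition is_chart {R : realType} {m : nat} {T : topologicalType}
    (c : chart R m T) : Prop :=
  [/\ open (chart_dom c), open (chart_img c),
      forall p, chart_dom c p -> chart_inv c (chart_map c p) = p,
      {within chart_dom c, continuous (chart_map c)} &
      {within chart_img c, continuous (chart_inv c)}].

(* The carrier is pointed because the library only puts a measurable structure
   on pointed types; this excludes just the empty manifold. *)
Record smooth_manifold (R : realType) (m : nat) := SmoothManifold {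
  carrier :> ptopologicalType;
  atlas : set (chart R m carrier);
  manifold_hausdorff : hausdorff_space carrier;
  manifold_second_countable : @second_countable carrier;
  atlas_chart : forall c, atlas c -> is_chart c;
  atlas_cover : \bigcup_(c in atlas) chart_dom c = setT;
  atlas_compat : forall c d, atlas c -> atlas d -> forall j : 'I_m,
    smooth_rV (chart_map c @` (chart_dom c `&` chart_dom d))
              (fun x => chart_map d (chart_inv c x) 0 j) }.

Section Manifold.
Context {R : realType} {m : nat} (M : smooth_manifold R m).
Local Notation C := R[i].

(* Smoothness on an open subset [V] of [M]; values outside [V] are ignored. *)
Definition smooth_real (V : set M) (f : M -> R) : Prop :=
  forall c, atlas c ->
    smooth_rV (chart_map c @` (chart_dom c `&` V)) (f \o chart_inv c).

Definition smooth (V : set M) (f : M -> C) : Prop :=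
  smooth_real V (fun x => complex.Re (f x)) /\ smooth_real V (fun x => complex.Im (f x)).

Definition tsupport (f : M -> C) : set M := closure [set x | f x != 0].

(* [C^oo_0(U)], its elements being extended by zero to [M]. *)
Definition test_function (U : set M) (f : M -> C) : Prop :=
  [/\ smooth setT f, compact (tsupport f) & tsupport f `<=` U].

Definition complex_of (f : M -> R) : M -> C := fun x => (f x)%:C.

Definition conjf (f : M -> C) : M -> C := fun x => conjc (f x).

Definition operator := (M -> C) -> (M -> C).

(* Smooth complex vector fields are the derivations of the algebra of smooth
   complex functions. They are represented as operators on all functions that
   vanish on the non-smooth ones, so that two vector fields are equal if and
   only if they agree on smooth functions. *)
Definition complex_vector_field : set operator := [set Z |
  [/\ forall f, smooth setT f -> smooth setT (Z f),
      forall f, ~ smooth setT f -> Z f = 0,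
      forall (k : C) (f g : M -> C), smooth setT f -> smooth setT g ->
        Z (k *: f + g) = k *: Z f + Z g &
      forall f g : M -> C, smooth setT f -> smooth setT g ->
        Z (f * g) = Z f * g + f * Z g]].

Definition field_conj (Z : operator) : operator := fun f => conjf (Z (conjf f)).

Definition real_vector_field : set operator :=
  [set X | complex_vector_field X /\ field_conj X = X].

Definition field_scale (phi : M -> C) (Z : operator) : operator :=
  fun f => phi * Z f.

Definition bracket (X Y : operator) : operator := fun f => X (Y f) - Y (X f).

Definition real_subspace (S : set operator) : Prop :=
  [/\ S 0, forall X Y, S X -> S Y -> S (X + Y) &
      forall (k : R) X, S X -> S (field_scale (cst k%:C) X)].

Definition real_span (S : set operator) : set operator :=
  smallest real_subspace S.

(* [[A, B]] for sets of vector fields. *)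
Definition bracket_span (A B : set operator) : set operator :=
  real_span [set bracket X Y | X in A & Y in B].

Definition lie_subalgebra (S : set operator) : Prop :=
  [/\ S `<=` real_vector_field, real_subspace S &
      forall X Y, S X -> S Y -> S (bracket X Y)].

Definition field_distribution (Z : set operator) : Prop :=
  [/\ Z `<=` complex_vector_field, Z 0,
      forall X Y, Z X -> Z Y -> Z (X + Y) &
      forall phi X, smooth setT phi -> Z X -> Z (field_scale phi X)].

Definition generated_distribution (S : set operator) : set operator :=
  smallest field_distribution S.

(* Tangent vectors at [p] are the derivations at [p] of the algebra of smooth
   real functions, normalized like vector fields on non-smooth functions. *)
Definition functional := (M -> R) -> R.

Definition tangent_space (p : M) : set functional := [set v |
  [/\ forall f, ~ smooth_real setT f -> v f = 0,
      forall (k : R) (f g : M -> R),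
        smooth_real setT f -> smooth_real setT g ->
        v (k *: f + g) = k * v f + v g &
      forall f g : M -> R, smooth_real setT f -> smooth_real setT g ->
        v (f * g) = v f * g p + f p * v g]].

(* [X(p)] for a real vector field [X]. *)
Definition field_at (X : operator) (p : M) : functional :=
  fun f => complex.Re (X (complex_of f) p).

Definition coord_vector (c : chart R m M) (p : M) (i : 'I_m) : functional :=
  fun f => if `[< smooth_real setT f >]
           then partial i (f \o chart_inv c) (chart_map c p) else 0.

Record riemannian_metric := RiemannianMetric {
  metric : M -> functional -> functional -> R;
  metric_sym : forall p v w, tangent_space p v -> tangent_space p w ->
    metric p v w = metric p w v;
  metric_linear : forall p (k : R) (v w z : functional),
    tangent_space p v -> tangent_space p w -> tangent_space p z ->
    metric p (fun f => k * v f + w f) z = k * metric p v z + metric p w z;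
  metric_pos : forall p v, tangent_space p v -> v <> cst 0 ->
    0 < metric p v v;
  metric_smooth : forall c, atlas c -> forall i j : 'I_m,
    smooth_rV (chart_img c)
      (fun x => metric (chart_inv c x) (coord_vector c (chart_inv c x) i)
                       (coord_vector c (chart_inv c x) j)) }.

Definition gram (g : riemannian_metric) (c : chart R m M) (p : M) : 'M[R]_m :=
  \matrix_(i, j) metric g p (coord_vector c p i) (coord_vector c p j).

Definition borel := g_sigma_algebraType (@open M).

(* [mu] is the Riemannian volume measure: in the coordinates of a chart it is
   [sqrt (det g_ij) dx]. This determines [mu] on all Borel sets, as [M] is
   covered by countably many chart domains. *)
Definition riemannian_volume (g : riemannian_metric)
    (mu : {measure set borel -> \bar R}) : Prop :=
  forall c, atlas c -> forall B : set borel, measurable B -> B `<=` chart_dom c ->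
    mu B = integral_rV (fun x : 'rV[R]_m =>
      (\1_(chart_map c @` B) x * Num.sqrt (\det (gram g c (chart_inv c x))))%:E).

Section Volume.
Context (mu : {measure set borel -> \bar R}).

Definition normL2_sqr (f : M -> C) : \bar R :=
  (\int[mu]_x ((Normc.normc (f x)) ^+ 2)%:E)%E.

Definition cintegral (f : M -> C) : C :=
  (\int[mu]_x complex.Re (f x))%R +i* (\int[mu]_x complex.Im (f x))%R.

Section Spaces.
Context (Z : set operator).

Definition subelliptic_fields : set operator := [set X |
  complex_vector_field X /\
  forall U : set M, open U -> compact (closure U) ->
    exists (k : nat) (L' : 'I_k -> operator) (K : R),
      [/\ forall j, Z (L' j), 0 < K &
          forall u, test_function U u ->
            (normL2_sqr (X u) <=
             K%:E * (\sum_(j < k) normL2_sqr (L' j u) + normL2_sqr u))%E]].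

Definition real_subelliptic_fields : set operator :=
  subelliptic_fields `&` real_vector_field.

Definition subelliptic_algebra : set operator :=
  smallest lie_subalgebra real_subelliptic_fields.

Definition T0 : set operator := [set X + field_conj X | X in Z].

Fixpoint Tn (h : nat) : set operator :=
  match h with
  | 0%N => T0
  | h'.+1 => bracket_span real_subelliptic_fields (Tn h')
  end.

Definition Tsum : set operator := real_span (\bigcup_h Tn h).

Section Extended.
Context (X0 : operator).

Definition T'0 : set operator := [set Y | exists phi X,
  [/\ smooth_real setT phi, Tsum X & Y = field_scale (complex_of phi) X0 + X]].

Fixpoint T'n (h : nat) : set operator :=
  match h with
  | 0%N => T'0
  | h'.+1 => bracket_span subelliptic_algebra (T'n h')
  end.

Definition T'sum : set operator := real_span (\bigcup_h T'n h).

End Extended.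
End Spaces.

(* Distributions on the open set [V]: linear forms on [C^oo_0(V)] that are
   continuous on the functions supported in any compact subset of a chart.
   Functions [f] are identified with the distributions [phi |-> \int f phi dmu].
   Values outside [C^oo_0(V)] are ignored. *)
Definition schwartz_distribution (V : set M) (u : (M -> C) -> C) : Prop :=
  (forall (k : C) (phi psi : M -> C), test_function V phi -> test_function V psi ->
     u (k *: phi + psi) = k * u phi + u psi) /\
  (forall (c : chart R m M) (K : set M), atlas c -> compact K ->
     K `<=` V `&` chart_dom c ->
     exists (N : nat) (A : R), forall phi, test_function V phi ->
       tsupport phi `<=` K ->
       forall B : R, 0 <= B ->
         (forall (w : seq 'I_m) (x : M), (size w <= N)%N -> K x ->
            `|iter_partial w (fun y => complex.Re (phi (chart_inv c y)))
                             (chart_map c x)| <= B /\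
            `|iter_partial w (fun y => complex.Im (phi (chart_inv c y)))
                             (chart_map c x)| <= B) ->
         Normc.normc (u phi) <= A * B).

Definition distribution_smooth (V : set M) (u : (M -> C) -> C) : Prop :=
  exists2 f : M -> C, smooth V f &
    forall phi, test_function V phi -> u phi = cintegral (f * phi).

(* [psi] is the formal transpose of [P] with respect to [mu], applied to
   [phi]; it is unique, and it exists when [P] is a differential operator. *)
Definition is_transpose (P : operator) (phi psi : M -> C) : Prop :=
  test_function setT psi /\
  forall f, smooth setT f -> cintegral (P f * phi) = cintegral (f * psi).

Definition transpose (P : operator) (phi : M -> C) : M -> C :=
  xget 0 (is_transpose P phi).

Definition distribution_apply (P : operator) (u : (M -> C) -> C) :
  (M -> C) -> C := fun phi => u (transpose P phi).

Definition hypoelliptic_at (P : operator) (p : M) : Prop :=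
  exists U : set M, [/\ open U, U p &
    forall V : set M, open V -> V `<=` U ->
    forall u, schwartz_distribution V u ->
      distribution_smooth V (distribution_apply P u) ->
      distribution_smooth V u].

End Volume.
End Manifold.

(* Main.v *)
(** Everything happens in one chart around [p], inside a box of side less than
    [2 pi], where test functions are replaced by their Fourier coefficients on
    [Z^m], and pseudo-differential calculus reduces to elementary estimates on
    sequences: Sobolev norms are weighted l^2 norms, multiplication by a smooth
    function is convolution with a rapidly decreasing sequence, and commutators
    with powers of the weight gain one order.

    Subelliptic estimate. Say that a real field [Y] gains [d] if the H^(d-1) norm
    of [Y phi] is controlled by the L^2 norms of [phi] and of the [L_j phi] and by
    the H^(-1/2) norm of [X0 phi]. The fields [X0] and [Z + conj Z] gain 1/2, and
    if [A] is bounded by the [L_j] in L^2 and [Y] gains [d], then [[A, Y]] gains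
    [d/2]. The real fields [A] for which [[A, Y]] gains something whenever [Y] does
    form a Lie algebra, by the Jacobi identity, so that all of T' gains; at [p] it
    spans the tangent space, hence the H^d norm of [phi] is controlled as well.

    Regularity. Let [P u] be smooth. Test the equation for a smoothed localization
    [phi] of [u] against [phi] (real part: it bounds the [L_j phi]; the term
    [i Y0] is the point of taking [Y0] in T^(0)) and against
    [Lambda^(-1) X0 phi] (it bounds [X0 phi] in H^(-1/2)). If the localizations of
    [u] are in H^s and those of the [L_j u] in H^(s - sigma), this improves the
    latter to H^(s - sigma/2) and the former to H^(s - sigma/2 + d). Starting from
    sigma = 1, which is automatic, halve sigma until it is at most [d]; from then
    on every step gains [d/2]. *)
Require Import Defs.
From mathcomp Require Import all_boot all_order all_algebra.
From mathcomp Require Import all_classical all_reals all_analysis.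
From mathcomp Require Import ring lra zify.
From mathcomp Require Import measurable_realfun.

Set Implicit Arguments.
Unset Strict Implicit.
Unset Printing Implicit Defensive.
Import Order.TTheory GRing.Theory Num.Theory.
Import numFieldNormedType.Exports.
Local Open Scope classical_set_scope.
Local Open Scope ring_scope.
Local Open Scope complex_scope.

(** * Unconditional sums *)

(** Test functions are not made periodic, and no change of variables is used. The measure enters
    through a functional [J] on the ball, of which only linearity, positivity, a sup bound,
    nontriviality and [J (d_j f) = 0] are used. Inversion is algebraic: a function vanishing at [y]
    is a combination of the functions [e_l - e_l(y)], whose inverse transform vanishes at [y], so
    transforming back and forth is multiplication by a constant. Components of vector fields must be
    cut off, so brackets become commutators only on functions supported in a smaller ball. Hence the
    nested radii, and estimates stated only for such functions. In the regularity step the norms of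
    the [L_j phi] are not bounded in advance. The smoothing truncates frequencies at level [n], with
    symbol bounds independent of [n]: the energy [E] is finite for each [n]. The error in which a
    derivative precedes the commutator of [L_j] with the smoothing is integrated by parts and costs
    one factor [E], so that [E^2 <= C (1 + E)]. The smoothing order s - sigma/2 puts the other
    errors in H^(-sigma/2) and [phi] in the dual space H^(sigma/2). *)

Section ComplexModulus.
Context {R : realType}.
Local Notation C := R[i].
Definition nrm : C -> R := @Normc.normc R.

Lemma nrm_ge0 z : 0 <= nrm z.
Proof. by case: z => a b; rewrite /nrm /= sqrtr_ge0. Qed.
Lemma nrmM x y : nrm (x * y) = nrm x * nrm y. Proof. exact: Normc.normcM. Qed.
Lemma nrmD x y : nrm (x + y) <= nrm x + nrm y. Proof. exact: le_normcD. Qed.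
Lemma nrmN x : nrm (- x) = nrm x. Proof. exact: normcN. Qed.
Lemma nrm0 : nrm 0 = 0. Proof. exact: Normc.normc0. Qed.
Lemma nrm1 : nrm 1 = 1. Proof. exact: Normc.normc1. Qed.
Lemma nrm0_eq0 x : nrm x = 0 -> x = 0. Proof. exact: Normc.eq0_normc. Qed.
Lemma nrmBC x y : nrm (x - y) = nrm (y - x). Proof. by rewrite -nrmN opprB. Qed.
Lemma nrm_real (x : R) : nrm x%:C = `|x|.
Proof. by rewrite /nrm /= expr0n addr0 sqrtr_sqr. Qed.
Lemma nrmJ x : nrm (conjc x) = nrm x.
Proof. by case: x => a b; rewrite /nrm /= sqrrN. Qed.
Lemma nrm_sqr x : nrm x ^+ 2 = complex.Re x ^+ 2 + complex.Im x ^+ 2.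
Proof. by case: x => a b; rewrite /nrm /= sqr_sqrtr // addr_ge0 ?sqr_ge0. Qed.
Lemma nrm_i : nrm 'i = 1.
Proof. by rewrite /nrm /= expr0n expr1n add0r sqrtr1. Qed.
Lemma nrm_Re x : `|complex.Re x| <= nrm x.
Proof.
rewrite -(ler_pXn2r (n := 2)) ?nnegrE ?nrm_ge0 //.
by rewrite nrm_sqr real_normK ?num_real // lerDl sqr_ge0.
Qed.
Lemma nrm_Im x : `|complex.Im x| <= nrm x.
Proof.
rewrite -(ler_pXn2r (n := 2)) ?nnegrE ?nrm_ge0 //.
by rewrite nrm_sqr real_normK ?num_real // lerDr sqr_ge0.
Qed.
Lemma nrm_leD x : nrm x <= `|complex.Re x| + `|complex.Im x|.
Proof.
rewrite {1}[x]complexE (le_trans (nrmD _ _)) // nrmM nrm_i mul1r.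
by rewrite !nrm_real.
Qed.
Lemma nrm_sum (I : Type) (s : seq I) (P : pred I) (F : I -> C) :
  nrm (\sum_(i <- s | P i) F i) <= \sum_(i <- s | P i) nrm (F i).
Proof.
elim/big_rec2: _ => [|i y1 y2 _ h]; first by rewrite nrm0.
by rewrite (le_trans (nrmD _ _)) // lerD2l.
Qed.
Lemma nrm_dist_triangle x y z : nrm (x - z) <= nrm (x - y) + nrm (y - z).
Proof. by rewrite -[x - z](subrKA y) nrmD. Qed.

End ComplexModulus.

Lemma sum_uniq_sub (V : nmodType) (K : choiceType) (f : K -> V) (s t : seq K) :
  uniq s -> uniq t -> {subset s <= t} ->
  \sum_(k <- t) f k = \sum_(k <- s) f k + \sum_(k <- t | k \notin s) f k.
Proof.
move=> us ut st; rewrite (bigID (mem s)) /=; congr (_ + _).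
rewrite -big_filter; apply: perm_big; apply: uniq_perm => //.
  exact: filter_uniq.
move=> k; rewrite mem_filter; apply/andP/idP => [[]//|ks].
by split=> //; exact: st.
Qed.

Lemma ler_sum_uniq_sub (R : numDomainType) (K : choiceType) (f : K -> R) (s t : seq K) :
  (forall k, 0 <= f k) -> uniq s -> uniq t -> {subset s <= t} ->
  \sum_(k <- s) f k <= \sum_(k <- t) f k.
Proof.
move=> f0 us ut st; rewrite (sum_uniq_sub _ us ut st) lerDl.
by rewrite sumr_ge0.
Qed.

Section UnconditionalSums.
Context {R : realType}.
Local Notation C := R[i].

(* Convergence along the net of finite subsets. *)
Definition has_sum {K : choiceType} (f : K -> C) (y : C) : Prop :=
  forall e : R, 0 < e -> exists s0 : seq K, forall s, uniq s ->
    {subset s0 <= s} -> nrm (\sum_(k <- s) f k - y) <= e.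

Definition csum {K : choiceType} (f : K -> C) : C := xget 0 (has_sum f).

(** Bounded finite sums of moduli stand for absolute convergence; the bound stays explicit because
    it also bounds the sum itself. *)
Definition abs_sum {K : choiceType} (f : K -> C) (B : R) : Prop :=
  forall s, uniq s -> \sum_(k <- s) nrm (f k) <= B.

Lemma uniq_undup_cat {K : choiceType} (s t : seq K) :
  [/\ uniq (undup (s ++ t)), {subset s <= undup (s ++ t)} &
      {subset t <= undup (s ++ t)}].
Proof.
split; first exact: undup_uniq.
  by move=> x xs; rewrite mem_undup mem_cat xs.
by move=> x xs; rewrite mem_undup mem_cat xs orbT.
Qed.

Lemma le_eps (x y : R) : (forall e, 0 < e -> x <= y + e) -> x <= y.
Proof. by move=> h; apply/ler_addgt0Pr. Qed.

Lemma has_sum_unique {K : choiceType} (f : K -> C) y z :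
  has_sum f y -> has_sum f z -> y = z.
Proof.
move=> fy fz; apply/eqP; rewrite -subr_eq0; apply/eqP/nrm0_eq0/le_anti.
rewrite nrm_ge0 andbT; apply: le_eps => e e0; rewrite add0r.
have e2 : 0 < e / 2 by rewrite divr_gt0.
have [s1 h1] := fy _ e2; have [s2 h2] := fz _ e2.
have [u a b] := uniq_undup_cat s1 s2.
rewrite (le_trans (nrm_dist_triangle y (\sum_(k <- undup (s1 ++ s2)) f k) z)) //.
by rewrite [leRHS]splitr lerD // 1?nrmBC ?h1 // nrmBC h2.
Qed.

Lemma has_sum_csum {K : choiceType} (f : K -> C) y : has_sum f y -> csum f = y.
Proof.
move=> fy; rewrite /csum; case: xgetP => [z _ fz|/(_ y)//].
exact: has_sum_unique fz fy.
Qed.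

Lemma has_sumD {K : choiceType} (f g : K -> C) y z :
  has_sum f y -> has_sum g z -> has_sum (fun k => f k + g k) (y + z).
Proof.
move=> fy gz e e0; have e2 : 0 < e / 2 by rewrite divr_gt0.
have [s1 h1] := fy _ e2; have [s2 h2] := gz _ e2.
exists (s1 ++ s2) => s us sub; rewrite big_split /= opprD addrACA.
rewrite (le_trans (nrmD _ _)) // [leRHS]splitr lerD //.
  by apply: h1 => // x xs; apply: sub; rewrite mem_cat xs.
by apply: h2 => // x xs; apply: sub; rewrite mem_cat xs orbT.
Qed.

Lemma has_sumZ {K : choiceType} (f : K -> C) y c :
  has_sum f y -> has_sum (fun k => c * f k) (c * y).
Proof.
move=> fy e e0; have c0 : 0 < nrm c + 1 by rewrite ltr_wpDl ?nrm_ge0.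
have [s1 h1] := fy _ (divr_gt0 e0 c0).
exists s1 => s us sub; rewrite -mulr_sumr -mulrBr nrmM.
rewrite (le_trans (ler_wpM2l (nrm_ge0 _) (h1 _ us sub))) //.
by rewrite mulrA ler_pdivrMr // mulrC ler_pM2l // lerDl.
Qed.

Lemma has_sum_map {K L : choiceType} (h : K -> L) (h' : L -> K) (f : L -> C) y :
  cancel h h' -> cancel h' h -> has_sum f y -> has_sum (f \o h) y.
Proof.
move=> hK h'K fy e e0; have [s1 h1] := fy _ e0.
exists (map h' s1) => s us sub.
have -> : \sum_(k <- s) (f \o h) k = \sum_(k <- map h s) f k by rewrite big_map.
apply: h1; first by rewrite map_inj_uniq //; exact: can_inj hK.
move=> x xs; rewrite -(h'K x) map_f // sub //.
by apply: map_f.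
Qed.

Lemma has_sumC {K : choiceType} (f : K -> C) y :
  has_sum f y -> has_sum (fun k => conjc (f k)) (conjc y).
Proof.
move=> fy e e0; have [s1 h1] := fy _ e0; exists s1 => s us sub.
by rewrite -(rmorph_sum (@conjc R)) -(rmorphB (@conjc R)) nrmJ h1.
Qed.

Lemma has_sum_bound {K : choiceType} (f : K -> C) y B :
  has_sum f y -> abs_sum f B -> nrm y <= B.
Proof.
move=> fy fB; apply: le_eps => e e0; have [s1 h1] := fy _ e0.
have u := undup_uniq s1.
have h := h1 _ u (fun x => etrans (mem_undup s1 x)).
rewrite -[y](subKr (\sum_(k <- undup s1) f k)) (le_trans (nrmD _ _)) //.
rewrite nrmN lerD //; apply: le_trans (fB _ u); exact: nrm_sum.
Qed.

Lemma has_sum_nonneg {K : choiceType} (f : K -> R) B :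
  (forall k, 0 <= f k) -> (forall s, uniq s -> \sum_(k <- s) f k <= B) ->
  exists2 y, 0 <= y & has_sum (fun k => (f k)%:C) y%:C.
Proof.
move=> f0 fB; pose A := [set x | exists2 s : seq K, uniq s & x = \sum_(k <- s) f k].
have supA : has_sup A.
  split; first by exists 0; exists [::] => //; rewrite big_nil.
  by exists B => _ [s us ->]; exact: fB.
exists (sup A) => [|e e0].
  by apply: (ub_le_sup (proj2 supA)); exists [::] => //; rewrite big_nil.
have [_ [s0 us0 ->] h0] := sup_adherent e0 supA.
exists s0 => s us sub.
rewrite -(rmorph_sum (real_complex R)) -(rmorphB (real_complex R)) nrm_real.
rewrite ler_norml; apply/andP; split.
  rewrite lerBrDl (le_trans (ltW h0)) //; exact: ler_sum_uniq_sub.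
rewrite lerBlDl (@le_trans _ _ (sup A)) ?lerDl ?(ltW e0) //.
by apply: (ub_le_sup (proj2 supA)); exists s.
Qed.

Lemma abs_sum_le {K : choiceType} (f : K -> C) (g : K -> R) B :
  (forall k, nrm (f k) <= g k) -> (forall s, uniq s -> \sum_(k <- s) g k <= B) ->
  abs_sum f B.
Proof. by move=> fg h s us; apply: le_trans (h s us); apply: ler_sum. Qed.

Lemma has_sum_real {K : choiceType} (f : K -> R) B :
  (forall s, uniq s -> \sum_(k <- s) `|f k| <= B) ->
  exists y, has_sum (fun k => (f k)%:C) y%:C.
Proof.
move=> fB.
(* The family is the difference of two nonnegative ones, |f| + f and |f|. *)
have [k|s us|y _ yE] := @has_sum_nonneg K (fun k => `|f k| + f k) (B + B).
- by rewrite -lerBlDr sub0r -normrN ler_norm.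
- rewrite big_split /= lerD ?fB // (le_trans _ (fB _ us)) //.
  by apply: ler_sum => k _; exact: ler_norm.
have [k|s us|z _ zE] := @has_sum_nonneg K (fun k => `|f k|) B.
- by [].
- exact: fB.
exists (y - z); rewrite rmorphB /=; have := has_sumD yE (has_sumZ (-1) zE).
rewrite mulN1r; congr has_sum; apply/funext => k.
by rewrite mulN1r -rmorphB /= addrAC subrr add0r.
Qed.

Lemma has_sum_abs {K : choiceType} (f : K -> C) B :
  abs_sum f B -> has_sum f (csum f).
Proof.
move=> fB.
have [s us|y yE] := @has_sum_real K (fun k => complex.Re (f k)) B.
  by apply: le_trans (fB s us); apply: ler_sum => k _; exact: nrm_Re.
have [s us|z zE] := @has_sum_real K (fun k => complex.Im (f k)) B.
  by apply: le_trans (fB s us); apply: ler_sum => k _; exact: nrm_Im.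
have h : has_sum f (y%:C + 'i * z%:C).
  have := has_sumD yE (has_sumZ 'i zE); congr has_sum; apply/funext => k.
  by rewrite -complexE.
by rewrite (has_sum_csum h).
Qed.

Lemma csumD {K : choiceType} (f g : K -> C) A B : abs_sum f A -> abs_sum g B ->
  csum (fun k => f k + g k) = csum f + csum g.
Proof. by move=> /has_sum_abs a /has_sum_abs b; exact/has_sum_csum/has_sumD. Qed.

Lemma csumZ {K : choiceType} (f : K -> C) A c : abs_sum f A ->
  csum (fun k => c * f k) = c * csum f.
Proof. by move=> /has_sum_abs a; exact/has_sum_csum/has_sumZ. Qed.

Lemma csumC {K : choiceType} (f : K -> C) A : abs_sum f A ->
  csum (fun k => conjc (f k)) = conjc (csum f).
Proof. by move=> /has_sum_abs a; exact/has_sum_csum/has_sumC. Qed.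

Lemma csum_bound {K : choiceType} (f : K -> C) B : abs_sum f B -> nrm (csum f) <= B.
Proof. by move=> h; exact: has_sum_bound (has_sum_abs h) h. Qed.

Lemma csum_map {K L : choiceType} (h : K -> L) (h' : L -> K) (f : L -> C) A :
  cancel h h' -> cancel h' h -> abs_sum f A -> csum (f \o h) = csum f.
Proof. by move=> hK h'K /has_sum_abs a; exact/has_sum_csum/(has_sum_map hK h'K). Qed.

Lemma abs_sum_map {K L : choiceType} (h : K -> L) (f : L -> C) A :
  injective h -> abs_sum f A -> abs_sum (f \o h) A.
Proof.
move=> hi fA s us.
have -> : \sum_(k <- s) nrm ((f \o h) k) = \sum_(k <- map h s) nrm (f k).
  by rewrite big_map.
by apply: fA; rewrite map_inj_uniq.
Qed.

Lemma has_sum_finite {K : choiceType} (f : K -> C) (s0 : seq K) : uniq s0 ->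
  (forall k, k \notin s0 -> f k = 0) -> has_sum f (\sum_(k <- s0) f k).
Proof.
move=> us0 f0 e e0; exists s0 => s us sub.
rewrite (sum_uniq_sub _ us0 us sub) addrC addKr big1 ?nrm0 ?ltW //.
Qed.

Lemma csum_finite {K : choiceType} (f : K -> C) (s0 : seq K) : uniq s0 ->
  (forall k, k \notin s0 -> f k = 0) -> csum f = \sum_(k <- s0) f k.
Proof. by move=> us0 f0; exact/has_sum_csum/has_sum_finite. Qed.

(** Fubini for the net of finite sets: a finite product set that contains [s0] and is large enough
    for every row of [s] approximates both sides. The error is shared among the rows, with
    [(size s).+1] in the denominator so that it is nonzero for empty [s]. *)
Lemma has_sum_iter {K L : choiceType} (f : K -> L -> C) (r : K -> C) S :
  has_sum (fun p : K * L => f p.1 p.2) S -> (forall k, has_sum (f k) (r k)) ->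
  has_sum r S.
Proof.
move=> fS fr e e0; have e2 : 0 < e / 2 by rewrite divr_gt0.
have [s0 h0] := fS _ e2; exists (map fst s0) => s us sub.
have n0 : 0 < (size s).+1%:R :> R by [].
have /choice[l lE] : forall k, exists l0 : seq L, forall l, uniq l ->
    {subset l0 <= l} -> nrm (\sum_(j <- l) f k j - r k) <= e / 2 / (size s).+1%:R.
  by move=> k; apply: fr; rewrite divr_gt0.
pose big := undup (map snd s0 ++ flatten (map l s)).
have ub : uniq big by exact: undup_uniq.
pose pr := [seq (k, j) | k <- s, j <- big].
have prE : \sum_(p <- pr) f p.1 p.2 = \sum_(k <- s) \sum_(j <- big) f k j.
  by rewrite big_allpairs_dep.
have upr : uniq pr by rewrite allpairs_uniq // => -[? ?] [? ?].
have subpr : {subset s0 <= pr}.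
  move=> [k j] kj; apply/allpairsP; exists (k, j); split=> //=.
    by apply: sub; exact: (map_f fst kj).
  by rewrite mem_undup mem_cat (map_f snd kj).
have := h0 _ upr subpr; rewrite prE => h.
rewrite (le_trans (nrm_dist_triangle _ (\sum_(k <- s) \sum_(j <- big) f k j) _)) //.
rewrite [leRHS]splitr lerD //.
rewrite nrmBC -sumrB (le_trans (nrm_sum _ _ _)) //.
rewrite (@le_trans _ _ (\sum_(k <- s) e / 2 / (size s).+1%:R)) //.
  rewrite big_seq [leRHS]big_seq; apply: ler_sum => k ks; apply: lE => // j jl.
  rewrite mem_undup mem_cat; apply/orP; right.
  by apply/flattenP; exists (l k) => //; exact: map_f.
rewrite -big_distrr /= big_const_seq count_predT iter_addr_0 -[leRHS]mulr1.
rewrite ler_wpM2l ?(ltW e2) // -[X in X *+ _]mul1r -mulrnAl.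
by rewrite ler_pdivrMr // mul1r ler_nat.
Qed.

(** A finite set of pairs is enlarged to the product of its two projections. *)
Lemma abs_sum_pair {K L : choiceType} (f : K * L -> C) (b : K -> R) B :
  (forall k, abs_sum (fun j => f (k, j)) (b k)) ->
  (forall s, uniq s -> \sum_(k <- s) b k <= B) -> abs_sum f B.
Proof.
move=> fb bB s us; pose s1 := undup (map fst s); pose s2 := undup (map snd s).
have u1 : uniq s1 by exact: undup_uniq.
have u2 : uniq s2 by exact: undup_uniq.
apply: le_trans (bB s1 u1).
pose pr := [seq (k, j) | k <- s1, j <- s2].
apply: (@le_trans _ _ (\sum_(p <- pr) nrm (f p))).
  apply: ler_sum_uniq_sub => //; first by move=> ?; exact: nrm_ge0.
    by rewrite allpairs_uniq // => -[? ?] [? ?].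
  move=> [k j] kj; apply/allpairsP; exists (k, j).
  by split; rewrite //= mem_undup ?(map_f fst kj) ?(map_f snd kj).
by rewrite big_allpairs_dep; apply: ler_sum => k _; exact: fb.
Qed.

Lemma abs_sum_swap {K L : choiceType} (f : K * L -> C) B :
  abs_sum f B -> abs_sum (fun p : L * K => f (p.2, p.1)) B.
Proof. by move=> h; apply: (abs_sum_map _ h) => -[? ?] [? ?] [-> ->]. Qed.

Lemma csum_pair {K L : choiceType} (f : K -> L -> C) B :
  abs_sum (fun p : K * L => f p.1 p.2) B ->
  csum (fun k => csum (f k)) = csum (fun p : K * L => f p.1 p.2).
Proof.
move=> h; apply: has_sum_csum; apply: has_sum_iter (has_sum_abs h) _ => k.
apply: (@has_sum_abs _ _ B) => s us.
have /h : uniq (map (pair k) s) by rewrite map_inj_uniq // => ? ? [].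
by rewrite big_map.
Qed.

Lemma csum_exchange {K L : choiceType} (f : K -> L -> C) B :
  abs_sum (fun p : K * L => f p.1 p.2) B ->
  csum (fun k => csum (f k)) = csum (fun j => csum (f^~ j)).
Proof.
move=> h; rewrite (csum_pair h) (csum_pair (abs_sum_swap h)).
have sw (A B' : Type) : cancel (fun p : A * B' => (p.2, p.1)) (fun p => (p.2, p.1)).
  by case.
by rewrite -(csum_map (sw L K) (sw K L) h).
Qed.

End UnconditionalSums.

Section FiniteCauchySchwarz.
Context {R : realType} {K : eqType}.
Implicit Types (x y : K -> R) (s : seq K).

(** The sum of the [(t * x k - y k) ^+ 2] is nonnegative for every [t], and so is the quadratic in
    [t] that bounds it. Stating the hypotheses with bounds [A] and [B] avoids square roots of
    sums. *)
Lemma cauchy_schwarz_seq s x y (A B : R) : 0 <= A -> 0 <= B ->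
  \sum_(k <- s) x k ^+ 2 <= A ^+ 2 -> \sum_(k <- s) y k ^+ 2 <= B ^+ 2 ->
  \sum_(k <- s) x k * y k <= A * B.
Proof.
move=> A0 B0 xA yB; set S := \sum_(k <- s) _.
have quad t : 0 <= t ^+ 2 * A ^+ 2 - t * S *+ 2 + B ^+ 2.
  apply: (@le_trans _ _ (\sum_(k <- s) (t * x k - y k) ^+ 2)).
    by apply: sumr_ge0 => k _; exact: sqr_ge0.
  have -> : \sum_(k <- s) (t * x k - y k) ^+ 2 =
    t ^+ 2 * (\sum_(k <- s) x k ^+ 2) - t * S *+ 2 + \sum_(k <- s) y k ^+ 2.
    rewrite /S !mulr_sumr -sumrMnl -sumrB -big_split /=.
    by apply: eq_bigr => k _; ring.
  by rewrite lerD // lerD // ler_wpM2l // sqr_ge0.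
have [S0|S0] := leP S 0; first by rewrite (le_trans S0) // mulr_ge0.
have [A_eq0|A_neq0] := eqVneq A 0.
  (* For [A = 0] and [S > 0] the quadratic is affine with negative slope, and this value of [t]
     makes it negative. *)
  have := quad ((B ^+ 2 + 1) / S).
  rewrite A_eq0 expr0n mulr0 add0r mulfVK ?gt_eqF // mulr2n.
  have := sqr_ge0 B; set b := B ^+ 2; lra.
have A20 : 0 < A ^+ 2 by rewrite exprn_gt0 // lt0r A_neq0.
have h := quad (S / A ^+ 2).
rewrite -(ler_pXn2r (n := 2)) ?nnegrE ?mulr_ge0 ?(ltW S0) //.
have E : (S / A ^+ 2) ^+ 2 * A ^+ 2 - S / A ^+ 2 * S *+ 2 + B ^+ 2
   = B ^+ 2 - S ^+ 2 / A ^+ 2 by field.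
by move: h; rewrite E subr_ge0 ler_pdivrMr // exprMn mulrC.
Qed.

Lemma minkowski_seq s x y (A B : R) : 0 <= A -> 0 <= B ->
  \sum_(k <- s) x k ^+ 2 <= A ^+ 2 -> \sum_(k <- s) y k ^+ 2 <= B ^+ 2 ->
  \sum_(k <- s) (x k + y k) ^+ 2 <= (A + B) ^+ 2.
Proof.
move=> A0 B0 xA yB; have xy := cauchy_schwarz_seq A0 B0 xA yB.
have -> : \sum_(k <- s) (x k + y k) ^+ 2 = \sum_(k <- s) x k ^+ 2 +
   (\sum_(k <- s) x k * y k) *+ 2 + \sum_(k <- s) y k ^+ 2.
  by rewrite -sumrMnl -!big_split /=; apply: eq_bigr => k _; ring.
by rewrite sqrrD lerD // lerD // lerMn2r xy.
Qed.

End FiniteCauchySchwarz.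

(** * Sobolev norms and operators on sequences *)

Section Weights.
Context {R : realType} {m : nat}.
Local Notation K := ('rV[int]_m).

(** The l^1 form, rather than the square root of 1 + |k|^2, makes the weight submultiplicative and
    its differences bounded by [wt (k - l)], both with constant 1; it is also exactly 1 plus the
    moduli of the symbols of the derivatives. *)
Definition wt (k : K) : R := 1 + \sum_j (`|k 0 j|)%:~R.

Lemma wt_ge1 k : 1 <= wt k.
Proof. by rewrite lerDl sumr_ge0 // => j _; rewrite ler0z. Qed.
Lemma wt_gt0 k : 0 < wt k. Proof. exact: lt_le_trans (wt_ge1 k). Qed.
Lemma wt_ge0 k : 0 <= wt k. Proof. exact: ltW (wt_gt0 k). Qed.
Lemma wt_neq0 k : wt k != 0. Proof. by rewrite gt_eqF ?wt_gt0. Qed.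
Lemma wtN k : wt (- k) = wt k.
Proof. by rewrite /wt; congr (_ + _); apply: eq_bigr => j _; rewrite mxE normrN. Qed.
Lemma wtBC k l : wt (k - l) = wt (l - k). Proof. by rewrite -wtN opprB. Qed.
Lemma wt_coord (k : K) j : (`|k 0 j|)%:~R <= wt k.
Proof.
rewrite /wt (bigD1 j) //= addrCA lerDl addr_ge0 // sumr_ge0 //.
Qed.
Lemma wt_leD k l : wt (k + l) <= wt k + wt l - 1.
Proof.
have : \sum_j (`|(k + l) 0 j|)%:~R <= \sum_j (`|k 0 j|)%:~R + \sum_j (`|l 0 j|)%:~R :> R.
  rewrite -big_split /=; apply: ler_sum => j _.
  by rewrite mxE -intrD ler_int ler_normD.
rewrite /wt; lra.
Qed.
Lemma wt_submult k l : wt (k + l) <= wt k * wt l.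
Proof.
apply: le_trans (wt_leD k l) _; rewrite -subr_ge0.
have -> : wt k * wt l - (wt k + wt l - 1) = (wt k - 1) * (wt l - 1) by ring.
by rewrite mulr_ge0 // subr_ge0 wt_ge1.
Qed.
Lemma wt_dist k l : `|wt k - wt l| <= wt (k - l).
Proof.
have h a b : wt a - wt b <= wt (a - b).
  by have := wt_leD (a - b) b; rewrite subrK; lra.
by rewrite ler_norml h lerNl opprB wtBC h.
Qed.

Lemma wtpE k r : wt k `^ r = expR (r * ln (wt k)).
Proof. by rewrite /powR gt_eqF ?wt_gt0. Qed.
Lemma wtp_gt0 k r : 0 < wt k `^ r. Proof. by rewrite powR_gt0 ?wt_gt0. Qed.
Lemma wtp_ge0 k r : 0 <= wt k `^ r. Proof. exact: ltW (wtp_gt0 k r). Qed.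
Lemma wtpD k r s : wt k `^ (r + s) = wt k `^ r * wt k `^ s.
Proof. by rewrite powRD // wt_neq0 implybT. Qed.
Lemma wtp0 k : wt k `^ 0 = 1. Proof. by rewrite powRr0. Qed.
Lemma wtp1 k : wt k `^ 1 = wt k. Proof. by rewrite powRr1 // wt_ge0. Qed.
Lemma wtp_mono k r s : r <= s -> wt k `^ r <= wt k `^ s.
Proof. by move=> rs; rewrite ler_powR // wt_ge1. Qed.
Lemma wtp_nat k n : wt k `^ n%:R = wt k ^+ n.
Proof. by rewrite powR_mulrn // wt_ge0. Qed.
Lemma wtp_ge1 k r : 0 <= r -> 1 <= wt k `^ r.
Proof. by move=> r0; rewrite -(wtp0 k) wtp_mono. Qed.

(** Peetre's inequality. For negative [r] it is submultiplicativity applied to [k = (k + l) - l]. *)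
Lemma wt_peetre k l r : wt (k + l) `^ r <= wt k `^ r * wt l `^ `|r|.
Proof.
have [r0|r0] := ltP r 0; last first.
  rewrite ger0_norm // -powRM ?wt_ge0 //.
  by rewrite ge0_ler_powR ?nnegrE ?mulr_ge0 ?wt_ge0 ?wt_submult.
rewrite -[X in X `^ r <= _](@mulr1 R) -[r]opprK powRN [in leRHS]powRN.
have nr0 : 0 <= - r by rewrite oppr_ge0 ltW.
rewrite mulr1 -[X in _ * _ `^ X]/(`|- - r|) normrN ger0_norm //.
rewrite -div1r ler_pdivrMr ?wtp_gt0 // mulrAC -[_ * _]mulrC mulrA mulrAC.
rewrite ler_pdivlMr ?wtp_gt0 // mul1r -powRM ?wt_ge0 // ge0_ler_powR ?nnegrE ?mulr_ge0 ?wt_ge0 //.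
have {1}-> : k = (k + l) + - l by rewrite addrK.
by rewrite mulrC -(wtN l) wt_submult.
Qed.

(* The mean value bound behind [[Lambda^r, M_a]] having order [r - 1]. *)
Lemma wtp_lipschitz r : exists2 c : R, 0 <= c & forall k l,
  `|wt k `^ r - wt l `^ r| <= c * wt (k - l) `^ (`|r| + 2) * wt l `^ (r - 1).
Proof.
exists (`|r| * 2); first by rewrite mulr_ge0.
have lnb (x y : R) : 0 < x -> 0 < y -> ln x - ln y <= (x - y) / y.
  move=> x0 y0; rewrite -ln_div ?posrE // (_ : (x - y) / y = x / y - 1).
    rewrite -[X in ln X](_ : 1 + (x / y - 1) = _); last by ring.
    by rewrite le_ln1Dx // ltrBrDl subrr divr_gt0.
  by field; rewrite gt_eqF.
have expb (a b : R) : `|expR a - expR b| <= `|a - b| * (expR a + expR b).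
  have e1 (u v : R) : u <= v -> expR v - expR u <= (v - u) * expR v.
    move=> uv; have := expR_ge1Dx (u - v); rewrite expRB.
    rewrite ler_pdivlMr ?expR_gt0 //; lra.
  wlog ab : a b / a <= b.
    move=> h; have [ab|/ltW ab] := leP a b; first exact: h.
    by rewrite distrC [`|a - b|]distrC [expR a + _]addrC; exact: h.
  rewrite distrC [`|a - b|]distrC !ger0_norm ?subr_ge0 ?ler_expR //.
  rewrite (le_trans (e1 _ _ ab)) // ler_wpM2l ?subr_ge0 //.
  by rewrite lerDr expR_ge0.
move=> k l; set q := wt (k - l).
have q1 : 1 <= q by exact: wt_ge1.
have q0 : 0 < q by exact: wt_gt0.
have kE : wt k <= wt l * q by have := wt_submult l (k - l); rewrite addrCA subrr addr0.
have lE : wt l <= wt k * q.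
  by have := wt_submult k (l - k); rewrite addrCA subrr addr0 wtBC.
(* Powers are compared as exponentials of [r * ln]; the difference of the logarithms supplies the
   factor [1 / wt l] that lowers the order. Exchanging [wt k] for [wt l] in a denominator costs one
   [q], whence [q * q] and the exponent |r| + 2. *)
have lnkl : `|ln (wt k) - ln (wt l)| <= q * q / wt l.
  rewrite ler_norml; apply/andP; split.
    rewrite lerNl opprB (le_trans (lnb _ _ (wt_gt0 l) (wt_gt0 k))) //.
    have d := wt_dist l k; rewrite -/q wtBC -/q in d.
    rewrite (@le_trans _ _ (q / wt k)) //.
      by rewrite ler_wpM2r ?invr_ge0 ?wt_ge0 // (le_trans (ler_norm _)).
    rewrite ler_pdivlMr ?wt_gt0 // mulrAC ler_pdivrMr ?wt_gt0 //.
    by rewrite -mulrA ler_wpM2l ?(ltW q0) // mulrC.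
  rewrite (le_trans (lnb _ _ (wt_gt0 k) (wt_gt0 l))) //.
  rewrite ler_wpM2r ?invr_ge0 ?wt_ge0 // (le_trans (ler_norm _)) //.
  rewrite (le_trans (wt_dist k l)) // -/q ler_peMr ?(ltW q0) //.
rewrite {1}wtpE {1}wtpE (le_trans (expb _ _)) // -mulrBr normrM.
rewrite -!mulrA ler_wpM2l //.
have kr : expR (r * ln (wt k)) <= wt l `^ r * q `^ `|r|.
  by have := wt_peetre l (k - l) r; rewrite addrCA subrr addr0 wtpE.
have lr : expR (r * ln (wt l)) = wt l `^ r by rewrite wtpE.
have qr1 : 1 <= q `^ `|r| by exact: wtp_ge1.
rewrite lr.
have h1 : expR (r * ln (wt k)) + wt l `^ r <= 2 * (q `^ `|r| * wt l `^ r).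
  rewrite (mulr_natl _ 2) mulr2n lerD //; first by rewrite [leRHS]mulrC.
  by rewrite ler_peMl // wtp_ge0.
rewrite (le_trans (ler_pM _ _ lnkl h1)) //.
  by rewrite addr_ge0 ?expR_ge0 ?wtp_ge0.
have e1 : wt l `^ (r - 1) = wt l `^ r / wt l.
  by rewrite wtpD powRN wtp1.
have e2 : wt (k - l) `^ (`|r| + 2) = q `^ `|r| * (q * q).
  by rewrite wtpD wtp_nat expr2.
rewrite -/q in e2; rewrite e1 e2 le_eqVlt; apply/orP; left; apply/eqP; field.
exact: wt_neq0.
Qed.

End Weights.

Section SobolevSequences.
Context {R : realType} {m : nat}.
Local Notation K := ('rV[int]_m).
Local Notation C := R[i].
Local Notation w := (@wt R m).
Implicit Types (s r B : R) (u v : K -> C) (k l : K).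

(* [bd s v B]: the Sobolev norm of order [s] of [v], seen as a sequence of
   Fourier coefficients, is at most [B]. *)
Definition bd s v B : Prop := 0 <= B /\
  forall t : seq K, uniq t -> \sum_(k <- t) (w k `^ s * nrm (v k)) ^+ 2 <= B ^+ 2.

Lemma bd_ge0 s v B : bd s v B -> 0 <= B. Proof. by case. Qed.

Lemma bd_le s v A B : A <= B -> bd s v A -> bd s v B.
Proof.
move=> AB [A0 h]; split; first exact: le_trans AB.
by move=> t ut; rewrite (le_trans (h t ut)) // lerXn2r ?nnegrE // (le_trans A0).
Qed.

Lemma bd_sub s r u v B : (forall k, w k `^ s * nrm (u k) <= w k `^ r * nrm (v k)) ->
  bd r v B -> bd s u B.
Proof.
move=> h [B0 H]; split=> // t ut; apply: le_trans (H t ut).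
apply: ler_sum => k _; rewrite lerXn2r ?nnegrE ?h //.
  by rewrite mulr_ge0 ?wtp_ge0 ?nrm_ge0.
by rewrite mulr_ge0 ?wtp_ge0 ?nrm_ge0.
Qed.

Lemma bd_mono s r v B : s <= r -> bd r v B -> bd s v B.
Proof. by move=> sr; apply: bd_sub => k; rewrite ler_wpM2r ?nrm_ge0 ?wtp_mono. Qed.

Lemma bd_0 s B : 0 <= B -> bd s (fun=> 0) B.
Proof.
move=> B0; split=> // t _; rewrite big1 ?exprn_ge0 // => k _.
by rewrite nrm0 mulr0 expr0n.
Qed.

Lemma bdD s u v A B : bd s u A -> bd s v B -> bd s (fun k => u k + v k) (A + B).
Proof.
move=> [A0 hA] [B0 hB]; split; first exact: addr_ge0.
move=> t ut; apply: le_trans (minkowski_seq A0 B0 (hA t ut) (hB t ut)).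
apply: ler_sum => k _; rewrite lerXn2r ?nnegrE ?addr_ge0 ?mulr_ge0 ?wtp_ge0 ?nrm_ge0 //.
by rewrite -mulrDr ler_wpM2l ?wtp_ge0 ?nrmD.
Qed.

Lemma bdZ s v c B : bd s v B -> bd s (fun k => c * v k) (nrm c * B).
Proof.
move=> [B0 h]; split; first by rewrite mulr_ge0 ?nrm_ge0.
move=> t ut; rewrite exprMn.
apply: le_trans (ler_wpM2l (sqr_ge0 (nrm c)) (h t ut)).
rewrite mulr_sumr; apply: ler_sum => k _.
by rewrite nrmM mulrCA exprMn.
Qed.

Lemma bdN s v B : bd s v B -> bd s (fun k => - v k) B.
Proof. by apply: bd_sub => k; rewrite nrmN. Qed.

Lemma bdB s u v A B : bd s u A -> bd s v B -> bd s (fun k => u k - v k) (A + B).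
Proof. by move=> hu /bdN; exact: bdD. Qed.

Lemma bd_sum s (I : Type) (t : seq I) (F : I -> K -> C) (B : I -> R) :
  (forall i, bd s (F i) (B i)) ->
  bd s (fun k => \sum_(i <- t) F i k) (\sum_(i <- t) B i).
Proof.
move=> h; elim: t => [|i t IH].
  rewrite big_nil (_ : (fun k => _) = fun=> 0); first exact: bd_0.
  by apply/funext => k; rewrite big_nil.
rewrite big_cons (_ : (fun k => _) = fun k => F i k + \sum_(j <- t) F j k).
  exact: bdD.
by apply/funext => k; rewrite big_cons.
Qed.

Lemma bd_pt s v B k : bd s v B -> w k `^ s * nrm (v k) <= B.
Proof.
move=> [B0 h]; rewrite -(ler_pXn2r (n := 2)) ?nnegrE //.
  by have := h [:: k] isT; rewrite big_seq1.
by rewrite mulr_ge0 ?wtp_ge0 ?nrm_ge0.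
Qed.

Lemma bd_pt' s v B k : bd s v B -> nrm (v k) <= w k `^ (- s) * B.
Proof.
by move=> h; rewrite powRN ler_pdivlMl ?wtp_gt0 // bd_pt.
Qed.

Lemma bd_shift s v B l : bd s v B ->
  bd s (fun k => v (k - l)) (w l `^ `|s| * B).
Proof.
move=> [B0 h]; split; first by rewrite mulr_ge0 ?wtp_ge0.
move=> t ut; rewrite exprMn.
have um : uniq (map (fun k => k - l) t) by rewrite map_inj_uniq //; exact: addIr.
apply: le_trans (ler_wpM2l (sqr_ge0 _) (h _ um)).
rewrite big_map mulr_sumr; apply: ler_sum => k _; rewrite -exprMn.
rewrite lerXn2r ?nnegrE ?mulr_ge0 ?wtp_ge0 ?nrm_ge0 //.
rewrite mulrA ler_wpM2r ?nrm_ge0 // mulrC.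
by rewrite -{1}(subrK l k) wt_peetre.
Qed.

(** Fatou property: only finite sets of indices are tested, so a Sobolev ball is closed under
    pointwise convergence. Operators given by infinite sums are bounded through their finite partial
    sums. *)
Lemma bd_lim s v B : (forall (t : seq K) e, 0 < e -> exists2 u, bd s u B &
    forall k, k \in t -> nrm (v k - u k) <= e) -> bd s v B.
Proof.
move=> h; have B0 : 0 <= B by have [u /bd_ge0] := h [::] 1 ltr01.
split=> // t ut; pose W := \sum_(k <- t) w k `^ s.
have W0 : 0 <= W by apply: sumr_ge0 => k _; exact: wtp_ge0.
have key e : 0 < e -> \sum_(k <- t) (w k `^ s * nrm (v k)) ^+ 2 <= (B + e * W) ^+ 2.
  move=> e0; have [u [_ bu] uv] := h t e e0.
  have eW : \sum_(k <- t) (e * w k `^ s) ^+ 2 <= (e * W) ^+ 2.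
    rewrite exprMn; under eq_bigr do rewrite exprMn.
    rewrite -mulr_sumr ler_wpM2l ?sqr_ge0 // expr2 /W mulr_suml.
    rewrite big_seq [leRHS]big_seq; apply: ler_sum => k kt.
    rewrite expr2 ler_wpM2l ?wtp_ge0 // (bigD1_seq k) //= lerDl.
    by apply: sumr_ge0 => j _; exact: wtp_ge0.
  have := minkowski_seq B0 (mulr_ge0 (ltW e0) W0) (bu t ut) eW.
  apply: le_trans; rewrite big_seq [leRHS]big_seq; apply: ler_sum => k kt.
  rewrite lerXn2r ?nnegrE ?addr_ge0 ?mulr_ge0 ?wtp_ge0 ?nrm_ge0 ?(ltW e0) //.
  rewrite [e * _]mulrC -mulrDr ler_wpM2l ?wtp_ge0 //.
  rewrite -[v k](subrK (u k)) addrC (le_trans (nrmD _ _)) // lerD2l.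
  exact: uv.
apply: le_eps => e e0; pose D := 2 * B * W + W ^+ 2 + 1.
have D0 : 0 < D by rewrite ltr_wpDl // addr_ge0 ?sqr_ge0 ?mulr_ge0.
pose e' := Num.min 1 (e / D).
have e'0 : 0 < e' by rewrite lt_min ltr01 divr_gt0.
apply: le_trans (key _ e'0) _.
have -> : (B + e' * W) ^+ 2 = B ^+ 2 + e' * (2 * B * W + e' * W ^+ 2) by ring.
rewrite lerD2l.
have e'1 : e' <= 1 by rewrite ge_min lexx.
have e'D : e' * D <= e by rewrite -ler_pdivlMr // ge_min lexx orbT.
apply: le_trans e'D; rewrite ler_wpM2l ?(ltW e'0) // /D -addrA lerD2l.
by rewrite (@le_trans _ _ (W ^+ 2)) ?lerDl // ler_piMl ?sqr_ge0.
Qed.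

(* Kernel operators: [c l k] is the matrix entry from [k - l] to [k]. *)
Definition gop (c : K -> K -> C) v : K -> C := fun k => csum (fun l => c l k * v (k - l)).

Lemma gop_abs (c : K -> K -> C) (al : K -> R) A r s v B k :
  (forall l k, nrm (c l k) <= al l * w (k - l) `^ r) ->
  (forall t, uniq t -> \sum_(l <- t) al l * w l `^ `|s| <= A) ->
  bd (s + r) v B -> abs_sum (fun l => c l k * v (k - l)) (A * w k `^ (- s) * B).
Proof.
move=> hc hA hv.
have B0 := bd_ge0 hv.
apply: (@abs_sum_le _ _ _ (fun l => al l * w l `^ `|s| * w k `^ (- s) * B)).
  move=> l; rewrite nrmM.
  have h1 : nrm (v (k - l)) <= w (k - l) `^ (- (s + r)) * B by exact: bd_pt'.
  apply: le_trans (ler_pM (nrm_ge0 _) (nrm_ge0 _) (hc l k) h1) _.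
  have al0 : 0 <= al l.
    have := le_trans (nrm_ge0 _) (hc l k).
    by rewrite pmulr_lge0 ?wtp_gt0.
  rewrite mulrA ler_wpM2r // -[leLHS]mulrA -wtpD opprD addrCA subrr addr0.
  rewrite -mulrA ler_wpM2l // mulrC -normrN -(wtN l).
  exact: wt_peetre.
move=> t ut; rewrite -!mulr_suml ler_wpM2r // ler_wpM2r ?wtp_ge0 //; exact: hA.
Qed.

(** Young's inequality with weights. The operator is a pointwise limit of finite sums of shifted
    sequences; Peetre's inequality bounds the shift by [l] at the price of the weight of [l] to the
    power |s|, and [A] sums these prices. *)
Lemma bd_gop (c : K -> K -> C) (al : K -> R) A r s v B :
  (forall l k, nrm (c l k) <= al l * w (k - l) `^ r) ->
  (forall t, uniq t -> \sum_(l <- t) al l * w l `^ `|s| <= A) ->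
  bd (s + r) v B -> bd s (gop c v) (A * B).
Proof.
move=> hc hA hv; have B0 := bd_ge0 hv.
have al0 l : 0 <= al l.
  have := le_trans (nrm_ge0 _) (hc l 0).
  by rewrite pmulr_lge0 ?wtp_gt0.
apply: bd_lim => t e e0.
have /choice[T hT] : forall k, exists T0 : seq K, forall T, uniq T -> {subset T0 <= T} ->
    nrm (\sum_(l <- T) c l k * v (k - l) - gop c v k) <= e.
  by move=> k; exact: (has_sum_abs (gop_abs k hc hA hv) e0).
pose big := undup (flatten (map T t)).
have ub : uniq big by exact: undup_uniq.
exists (fun k => \sum_(l <- big) c l k * v (k - l)); last first.
  move=> k kt; rewrite nrmBC; apply: hT => // l lT.
  by rewrite mem_undup; apply/flattenP; exists (T k) => //; exact: map_f.
apply: (@bd_le _ _ (\sum_(l <- big) al l * w l `^ `|s| * B)).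
  by rewrite -mulr_suml ler_wpM2r // hA.
apply: bd_sum => l.
have : bd s (fun k => (al l)%:C * ((w (k - l) `^ r)%:C * v (k - l))) (nrm (al l)%:C * (w l `^ `|s| * B)).
  apply: bdZ; apply: (@bd_shift s (fun k => (w k `^ r)%:C * v k)).
  apply: bd_sub hv => k; rewrite nrmM nrm_real ger0_norm ?wtp_ge0 //.
  by rewrite wtpD mulrA.
rewrite nrm_real ger0_norm // mulrA; apply: bd_sub => k.
rewrite ler_wpM2l ?wtp_ge0 // !nrmM !nrm_real !ger0_norm ?wtp_ge0 //.
by rewrite mulrA ler_wpM2r ?nrm_ge0.
Qed.

End SobolevSequences.

Section WeightSummability.
Context {R : realType} {m : nat}.
Local Notation K := ('rV[int]_m).

Lemma sum_inv_sqr_le4 (N : nat) : \sum_(n < N) (n.+1%:R ^- 2) <= 4 :> R.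
Proof.
case: N => [|N]; first by rewrite big_ord0.
suff : \sum_(n < N.+1) (n.+1%:R ^- 2) <= 2 - N.+1%:R^-1 :> R.
  have : 0 <= N.+1%:R^-1 :> R by rewrite invr_ge0.
  by move: (N.+1%:R^-1) (\sum_(n < _) _) => x S; lra.
elim: N => [|N IH]; first by rewrite big_ord1 expr1n invr1; lra.
rewrite big_ord_recr /= (le_trans (lerD IH (lexx _))) //.
have n1 : 0 < N.+1%:R :> R by [].
have e2 : N.+2%:R = N.+1%:R + 1 :> R by rewrite -natr1.
rewrite e2; set x : R := N.+1%:R in n1 *.
rewrite -subr_ge0.
have -> : 2 - (x + 1)^-1 - (2 - x^-1 + (x + 1) ^- 2) = (x + 1) ^- 2 / x :> R.
  by field; rewrite !gt_eqF // ltr_wpDl // ltW.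
by rewrite divr_ge0 ?invr_ge0 ?exprn_ge0 ?addr_ge0 ?(ltW n1).
Qed.

(** The weight dominates every 1 + |k_j|, so the term is at most the product of their squared
    inverses. Each one-dimensional sum is at most 8: two signs times the bound 4. *)
Lemma wt_summable : exists B : R, forall t : seq K, uniq t ->
  \sum_(k <- t) wt k `^ (- (m.*2)%:R) <= B.
Proof.
exists (8 ^+ m) => t ut.
pose g (k : K) : R := \prod_j ((absz (k ord0 j)).+1%:R ^- 2).
have wg k : wt k `^ (- (m.*2)%:R) <= g k.
  rewrite powRN wtp_nat /g prodfV lef_pV2 ?posrE ?exprn_gt0 ?wt_gt0 //; last first.
    by apply: prodr_gt0 => j _; rewrite exprn_gt0.
  rewrite -muln2 mulnC exprM -[X in _ ^+ X](card_ord m) -prodr_const.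
  apply: ler_prod => j _; rewrite exprn_ge0 //= lerXn2r ?nnegrE ?wt_ge0 //.
  rewrite /wt -natr1 addrC lerD2l (bigD1 j) //=.
  by rewrite pmulrn abszE lerDl sumr_ge0.
apply: (@le_trans _ _ (\sum_(k <- t) g k)); first exact: ler_sum.
pose N := \max_(k <- t) \max_j absz (k ord0 j).
have kN k j : k \in t -> (absz (k ord0 j) <= N)%N.
  move=> kt; apply: (@leq_trans (\max_j absz (k ord0 j))).
    exact: (leq_bigmax_cond (F := fun j => absz (k ord0 j))).
  exact: (leq_bigmax_seq (F := fun k : K => \max_j absz (k ord0 j))).
pose J := (bool * 'I_N.+1)%type.
(* Signs and absolute values embed [t] into a finite product, over which the sum of products
   factors. Zero occurs with both signs, which only enlarges the sum. *)
pose enc (k : K) : {ffun 'I_m -> J} := [ffun j => (k ord0 j < 0, inord (absz (k ord0 j)))].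
pose h (f : {ffun 'I_m -> J}) : R := \prod_j ((f j).2.+1%:R ^- 2).
have gh k : k \in t -> g k = h (enc k).
  by move=> kt; apply: eq_bigr => j _; rewrite ffunE /= inordK // ltnS kN.
have ue : uniq (map enc t).
  rewrite map_inj_in_uniq // => k k' kt k't /ffunP e; apply/rowP => j.
  have := e j; rewrite !ffunE => -[s] /(congr1 val) /=.
  rewrite !inordK ?ltnS ?kN // => a.
  rewrite [LHS]intEsign [RHS]intEsign s a //.
apply: (@le_trans _ _ (\sum_(f <- enum {ffun 'I_m -> J}) h f)).
  rewrite big_seq (eq_bigr _ gh) -big_seq.
  have -> : \sum_(k <- t) h (enc k) = \sum_(f <- map enc t) h f by rewrite big_map.
  apply: ler_sum_uniq_sub => //; last by move=> f _; rewrite mem_enum.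
    by move=> f; apply: prodr_ge0 => j _; rewrite invr_ge0 exprn_ge0.
  exact: enum_uniq.
rewrite big_enum /= /h.
rewrite -(bigA_distr_bigA (fun (j : 'I_m) (x : J) => x.2.+1%:R ^- 2)) /=.
rewrite -[X in _ ^+ X](card_ord m) -prodr_const.
apply: ler_prod => j _; apply/andP; split.
  by apply: sumr_ge0 => x _; rewrite invr_ge0 exprn_ge0.
rewrite -(pair_bigA _ (fun (b : bool) (n : 'I_N.+1) => n.+1%:R ^- 2)) /=.
have := sum_inv_sqr_le4 N.+1; rewrite big_bool /=.
set S := \sum_(n < N.+1) _; lra.
Qed.

End WeightSummability.

Section ConjugateRules.
Context {R : realType}.
Local Notation C := R[i].
Lemma conjc_RM (x : R) (z : C) : conjc (x%:C * z) = x%:C * conjc z.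
Proof.
by case: z => a b; apply/eqP; rewrite eq_complex /=; apply/andP; split; apply/eqP; ring.
Qed.
Lemma conjc_iM (n : int) (z : C) :
  conjc ('i * n%:~R * z) = - ('i * n%:~R * conjc z).
Proof.
rewrite (rmorphM (@conjc R)) (rmorphM (@conjc R)) (rmorph_int (@conjc R)) -!mulNr.
by congr (_ * _ * _); apply/eqP; rewrite eq_complex /= oppr0 !eqxx.
Qed.
Lemma mul_conjc (z : C) : z * conjc z = (nrm z ^+ 2)%:C.
Proof. by rewrite rmorphXn /= -sqr_normc normc_def -/(nrm z); case: z. Qed.
End ConjugateRules.

(** * Operators of finite order and the duality pairing *)

Section Operators.
Context {R : realType} {m : nat}.
Local Notation K := ('rV[int]_m).
Local Notation C := R[i].
Local Notation w := (@wt R m).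
Local Notation seqop := ((K -> C) -> K -> C).
Implicit Types (s r B : R) (u v : K -> C) (k l : K).

(** On the torus, [fin] and [rapid] are the coefficient sequences of distributions and of smooth
    functions. *)
Definition fin v := exists s B, bd s v B.
Definition rapid v := forall s, exists B, bd s v B.

Lemma rapid_fin v : rapid v -> fin v.
Proof. by move=> h; exists 0; exact: h. Qed.

Lemma rapidD u v : rapid u -> rapid v -> rapid (fun k => u k + v k).
Proof. by move=> hu hv s; have [A a] := hu s; have [B b] := hv s; exists (A + B); exact: bdD. Qed.

Lemma rapidN v : rapid v -> rapid (fun k => - v k).
Proof. by move=> hv s; have [B b] := hv s; exists B; exact: bdN. Qed.

Lemma finD u v : fin u -> fin v -> fin (fun k => u k + v k).
Proof.
move=> [s [A a]] [r [B b]]; exists (Num.min s r), (A + B).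
by apply: bdD; [apply: bd_mono a|apply: bd_mono b]; rewrite ge_min lexx ?orbT.
Qed.

Lemma finN v : fin v -> fin (fun k => - v k).
Proof. by move=> [s [B b]]; exists s, B; exact: bdN. Qed.

Lemma finB u v : fin u -> fin v -> fin (fun k => u k - v k).
Proof. by move=> hu /finN; exact: finD. Qed.

Lemma finZ c v : fin v -> fin (fun k => c * v k).
Proof. by move=> [s [B b]]; exists s, (nrm c * B); exact: bdZ. Qed.

Lemma fin0 : fin (fun=> 0). Proof. by exists 0, 0; exact: bd_0. Qed.

Lemma fin_sum (I : Type) (t : seq I) (F : I -> K -> C) :
  (forall i, fin (F i)) -> fin (fun k => \sum_(i <- t) F i k).
Proof.
move=> h; elim: t => [|i t IH].
  by rewrite (_ : (fun k => _) = fun=> 0);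
    [exact: fin0|apply/funext => k; rewrite big_nil].
rewrite (_ : (fun k => _) = fun k => F i k + \sum_(j <- t) F j k).
  exact: finD.
by apply/funext => k; rewrite big_cons.
Qed.

Lemma bd_finite_supp s v (t : seq K) :
  uniq t -> (forall k, k \notin t -> v k = 0) -> exists B, bd s v B.
Proof.
move=> ut h; exists (\sum_(k <- t) w k `^ s * nrm (v k)).
have pos k : 0 <= w k `^ s * nrm (v k) by rewrite mulr_ge0 ?wtp_ge0 ?nrm_ge0.
split; first exact: sumr_ge0.
move=> t' ut'.
rewrite (bigID (mem t)) /= [X in _ + X]big1 ?addr0; last first.
  by move=> k /h ->; rewrite nrm0 mulr0 expr0n.
rewrite -big_filter.
apply: (@le_trans _ _ (\sum_(k <- t) (w k `^ s * nrm (v k)) ^+ 2)).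
  apply: ler_sum_uniq_sub => //; last by move=> k; rewrite mem_filter => /andP[].
    by move=> k; exact: sqr_ge0.
  exact: filter_uniq.
rewrite [leRHS]expr2 mulr_suml big_seq [leRHS]big_seq; apply: ler_sum => k kt.
by rewrite expr2 ler_wpM2l // (bigD1_seq k) //= lerDl sumr_ge0.
Qed.

Lemma rapid_finite_supp v (t : seq K) :
  uniq t -> (forall k, k \notin t -> v k = 0) -> rapid v.
Proof. by move=> ut h s; exact: bd_finite_supp ut h. Qed.

(** Cauchy-Schwarz against the square summable weight of order - m costs [m] orders, which a rapid
    sequence can afford. *)
Lemma rapid_abs v s : rapid v -> exists A, forall t, uniq t ->
  \sum_(l <- t) nrm (v l) * w l `^ s <= A.
Proof.
move=> hv; have [D hD] := @wt_summable R m.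
have D0 : 0 <= D by have := hD [::] isT; rewrite big_nil.
have [B [B0 hB]] := hv (s + m%:R).
exists (B * (D + 1)) => t ut.
have e l : nrm (v l) * w l `^ s = (w l `^ (s + m%:R) * nrm (v l)) * w l `^ (- m%:R).
  by rewrite mulrAC -wtpD addrK mulrC.
rewrite (eq_bigr _ (fun l _ => e l)).
apply: cauchy_schwarz_seq (hB t ut) _ => //; first by rewrite addr_ge0.
apply: (@le_trans _ _ (\sum_(k <- t) w k `^ (- (m.*2)%:R))).
  apply: ler_sum => k _; rewrite expr2 -wtpD -opprD -mulr2n -mulrnA muln2.
  exact: lexx.
rewrite (le_trans (hD t ut)) // sqrrD expr1n mulr1.
have := sqr_ge0 D; lra.
Qed.

(* Sup bounds of every order already give rapid decrease. *)
Lemma rapid_sup v : (forall N : nat, exists B, forall k, w k ^+ N * nrm (v k) <= B) -> rapid v.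
Proof.
move=> h s; have [D hD] := @wt_summable R m.
have D0 : 0 <= D by have := hD [::] isT; rewrite big_nil.
pose N := (absz (Num.ceil `|s|) + m)%N.
have [B hB] := h N.
have B0 : 0 <= B.
  by apply: le_trans (hB 0); rewrite mulr_ge0 ?exprn_ge0 ?wt_ge0 ?nrm_ge0.
exists (B * (D + 1)); split; first by rewrite mulr_ge0 ?addr_ge0.
move=> t ut.
have hs : s + m%:R <= N%:R.
  rewrite natrD lerD2r (le_trans (ler_norm _)) //.
  rewrite (le_trans (Num.Theory.ceil_ge _)) // pmulrn abszE ler_int ler_norm //.
apply: (@le_trans _ _ (\sum_(k <- t) B ^+ 2 * w k `^ (- (m.*2)%:R))).
  apply: ler_sum => k _.
  have -> : w k `^ (- (m.*2)%:R) = (w k `^ (- m%:R)) ^+ 2 :> R.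
    by rewrite expr2 -wtpD -opprD -mulr2n -mulrnA muln2.
  rewrite -exprMn lerXn2r ?nnegrE ?mulr_ge0 ?wtp_ge0 ?nrm_ge0 //.
  rewrite powRN ler_pdivlMr ?wtp_gt0 // mulrAC -wtpD.
  apply: le_trans (hB k); rewrite ler_wpM2r ?nrm_ge0 // -wtp_nat.
  exact: wtp_mono.
rewrite -mulr_sumr exprMn ler_wpM2l ?sqr_ge0 // (le_trans (hD t ut)) //.
rewrite sqrrD expr1n mulr1; have := sqr_ge0 D; lra.
Qed.

(** Read on functions, [conv a] multiplies by the function with coefficients [a], [Dk j] is the
    derivative d_j, [mult tau] is a real Fourier multiplier and [Lam r] is the power of order [r] of
    the operator Lambda. *)
Definition conv (a : K -> C) : seqop := gop (fun l _ => a l).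
Definition Dk (j : 'I_m) : seqop := fun v k => 'i * (k 0 j)%:~R * v k.
Definition mult (tau : K -> R) : seqop := fun v k => (tau k)%:C * v k.
Definition Lam r : seqop := mult (fun k => w k `^ r).

(* Uniform order over an index type [I] of operators. *)
Definition op {I : Type} r (T : I -> seqop) := forall s, exists2 c, 0 <= c &
  forall i v B, bd (s + r) v B -> bd s (T i v) (c * B).

Definition op1 r (T : seqop) := op r (fun _ : unit => T).

Lemma op_cst (I : Type) r T : op1 r T -> op r (fun _ : I => T).
Proof. by move=> h s; have [c c0 hc] := h s; exists c => // _; exact: (hc tt). Qed.

Lemma op_comp (I : Type) r q (T U : I -> seqop) :
  op r T -> op q U -> op (r + q) (fun i v => T i (U i v)).
Proof.
move=> hT hU s; have [c c0 hc] := hT s; have [d d0 hd] := hU (s + r).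
exists (c * d) => [|i v B]; first exact: mulr_ge0.
by rewrite addrA -mulrA => h; apply: hc; exact: hd.
Qed.

Lemma opD (I : Type) r (T U : I -> seqop) : op r T -> op r U ->
  op r (fun i v k => T i v k + U i v k).
Proof.
move=> hT hU s; have [c c0 hc] := hT s; have [d d0 hd] := hU s.
exists (c + d) => [|i v B h]; first exact: addr_ge0.
by rewrite mulrDl; apply: bdD; [exact: hc|exact: hd].
Qed.

Lemma opN (I : Type) r (T : I -> seqop) : op r T -> op r (fun i v k => - T i v k).
Proof.
by move=> hT s; have [c c0 hc] := hT s; exists c => // i v B h; exact/bdN/hc.
Qed.

Lemma opB (I : Type) r (T U : I -> seqop) : op r T -> op r U ->
  op r (fun i v k => T i v k - U i v k).
Proof. by move=> hT /opN; exact: opD. Qed.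

Lemma op_sum (I J : Type) (t : seq J) r (T : J -> I -> seqop) :
  (forall j, op r (T j)) -> op r (fun i v k => \sum_(j <- t) T j i v k).
Proof.
move=> h; elim: t => [|j t IH].
  move=> s; exists 0 => // i v B hB; rewrite mul0r.
  rewrite (_ : (fun k => _) = fun=> 0); first exact: bd_0.
  by apply/funext => k; rewrite big_nil.
have := opD (h j) IH; congr op; apply/funext => i; apply/funext => v.
by apply/funext => k; rewrite big_cons.
Qed.

(** Identities between convolutions need convergent sums, so they are available only for [fin]
    sequences; these are the only ones an operator bound speaks of. *)
Lemma op_ext (I : Type) r (T U : I -> seqop) :
  (forall i v, fin v -> T i v = U i v) -> op r T -> op r U.
Proof.
move=> e hT s; have [c c0 hc] := hT s; exists c => // i v B h.
by rewrite -e; [exact: hc|exists (s + r), B].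
Qed.

Lemma op_fin (I : Type) r (T : I -> seqop) i v : op r T -> fin v -> fin (T i v).
Proof.
move=> h [s [B b]]; have [c _ hc] := h (s - r); exists (s - r), (c * B).
by apply: hc; rewrite subrK.
Qed.

Lemma op_rapid (I : Type) r (T : I -> seqop) i v : op r T -> rapid v -> rapid (T i v).
Proof.
move=> h hv s; have [c _ hc] := h s; have [B b] := hv (s + r).
by exists (c * B); exact: hc.
Qed.

Lemma op1_fin r T v : op1 r T -> fin v -> fin (T v).
Proof. exact: (@op_fin unit r (fun=> T) tt v). Qed.
Lemma op1_rapid r T v : op1 r T -> rapid v -> rapid (T v).
Proof. exact: (@op_rapid unit r (fun=> T) tt v). Qed.

Lemma op_conv a : rapid a -> op1 0 (conv a).
Proof.
move=> ha s; have [A hA] := rapid_abs `|s| ha.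
have A0 : 0 <= A by have := hA [::] isT; rewrite big_nil.
exists A => // _ v B h; apply: (bd_gop (r := 0) _ hA h) => l k.
by rewrite powRr0 mulr1.
Qed.

Lemma op_Dk j : op1 1 (Dk j).
Proof.
move=> s; exists 1 => // _ v B h; rewrite mul1r; apply: bd_sub h => k.
rewrite wtpD wtp1 -mulrA ler_wpM2l ?wtp_ge0 // !nrmM nrm_i mul1r.
rewrite ler_wpM2r ?nrm_ge0 //; apply: le_trans (wt_coord k j).
rewrite -(rmorph_int (real_complex R)) nrm_real -intr_norm; exact: lexx.
Qed.

Lemma op_mult (I : Type) (tau : I -> K -> R) c r : 0 <= c ->
  (forall i k, `|tau i k| <= c * w k `^ r) -> op r (fun i => mult (tau i)).
Proof.
move=> c0 h s; exists c => // i v B hv.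
have := bdZ c%:C hv; rewrite nrm_real ger0_norm // => {}hv.
have : bd s (fun k => c%:C * ((w k `^ r)%:C * v k)) (c * B).
  apply: bd_sub hv => k; rewrite wtpD !nrmM !nrm_real (ger0_norm c0).
  by rewrite ger0_norm ?wtp_ge0 // -mulrA ler_wpM2l ?wtp_ge0 // mulrCA.
apply: bd_sub => k; rewrite ler_wpM2l ?wtp_ge0 // !nrmM !nrm_real.
rewrite mulrA ler_wpM2r ?nrm_ge0 // (ger0_norm c0).
by rewrite (ger0_norm (wtp_ge0 _ _)).
Qed.

Lemma op_Lam r : op1 r (Lam r).
Proof.
apply: (@op_mult unit (fun _ k => w k `^ r) 1 r) => // _ k.
by rewrite mul1r ger0_norm ?wtp_ge0.
Qed.

Lemma bd_Lam s r v B : bd (s + r) v B -> bd s (Lam r v) B.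
Proof.
apply: bd_sub => k; rewrite nrmM nrm_real ger0_norm ?wtp_ge0 //.
by rewrite wtpD mulrA.
Qed.

Lemma conv_abs a v k : rapid a -> fin v -> exists B, abs_sum (fun l => a l * v (k - l)) B.
Proof.
move=> ha [s [B hB]]; have [A hA] := rapid_abs `|s| ha.
exists (A * w k `^ (- s) * B).
apply: (gop_abs (c := fun l _ => a l) (al := fun l => nrm (a l)) (r := 0)) => //.
  by move=> l k'; rewrite powRr0 mulr1.
by rewrite addr0.
Qed.

Lemma convDr a u v : rapid a -> fin u -> fin v ->
  conv a (fun k => u k + v k) = fun k => conv a u k + conv a v k.
Proof.
move=> ha hu hv; apply/funext => k; rewrite /conv /gop.
have [A hA] := conv_abs k ha hu; have [B hB] := conv_abs k ha hv.
rewrite -(csumD hA hB); congr csum; apply/funext => l; exact: mulrDr.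
Qed.

Lemma convDl a b v : rapid a -> rapid b -> fin v ->
  conv (fun k => a k + b k) v = fun k => conv a v k + conv b v k.
Proof.
move=> ha hb hv; apply/funext => k; rewrite /conv /gop.
have [A hA] := conv_abs k ha hv; have [B hB] := conv_abs k hb hv.
rewrite -(csumD hA hB); congr csum; apply/funext => l; exact: mulrDl.
Qed.

Lemma convZr a c v : rapid a -> fin v ->
  conv a (fun k => c * v k) = fun k => c * conv a v k.
Proof.
move=> ha hv; apply/funext => k; rewrite /conv /gop.
have [A hA] := conv_abs k ha hv; rewrite -(csumZ c hA); congr csum.
by apply/funext => l; rewrite mulrCA.
Qed.

Lemma convNr a v : rapid a -> fin v -> conv a (fun k => - v k) = fun k => - conv a v k.
Proof.
move=> ha hv; have := convZr (-1) ha hv.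
by rewrite (_ : (fun k => -1 * v k) = fun k => - v k);
  [move=> ->|]; apply/funext => k; rewrite mulN1r.
Qed.

Lemma convBr a u v : rapid a -> fin u -> fin v ->
  conv a (fun k => u k - v k) = fun k => conv a u k - conv a v k.
Proof. by move=> ha hu hv; rewrite convDr ?convNr //; exact: finN. Qed.

Lemma conv0r a : conv a (fun=> 0) = fun=> 0.
Proof.
apply/funext => k; rewrite /conv /gop.
rewrite (csum_finite (s0 := [::])) ?big_nil // => l _; exact: mulr0.
Qed.

Lemma conv_sumr (J : Type) (t : seq J) a (F : J -> K -> C) :
  rapid a -> (forall j, fin (F j)) ->
  conv a (fun k => \sum_(j <- t) F j k) = fun k => \sum_(j <- t) conv a (F j) k.
Proof.
move=> ha hF; elim: t => [|j t IH].
  rewrite (_ : (fun k => _) = fun=> 0); last by apply/funext => k; rewrite big_nil.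
  by rewrite conv0r; apply/funext => k; rewrite big_nil.
rewrite (_ : (fun k => _) = fun k => F j k + \sum_(i <- t) F i k); last first.
  by apply/funext => k; rewrite big_cons.
rewrite convDr ?IH //; last exact: fin_sum.
by apply/funext => k; rewrite big_cons.
Qed.

Lemma Dk_conv j a v : rapid a -> fin v ->
  Dk j (conv a v) = fun k => conv a (Dk j v) k + conv (Dk j a) v k.
Proof.
move=> ha hv; apply/funext => k; rewrite /Dk /conv /gop.
have [A hA] := conv_abs k ha hv.
have [B hB] := conv_abs k ha (op1_fin (op_Dk j) hv).
have [D hD] := conv_abs k (op1_rapid (op_Dk j) ha) hv.
rewrite -(csumZ _ hA) -(csumD hB hD); congr csum; apply/funext => l.
by rewrite /Dk !mxE intrD rmorphN /=; ring.
Qed.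

(** Joint summability of the double family, from which convolutions can be both exchanged and
    associated. *)
Lemma abs_sum_conv2 a b v k : rapid a -> rapid b -> fin v ->
  exists B, abs_sum (fun p : K * K => a p.1 * (b p.2 * v (k - p.1 - p.2))) B.
Proof.
move=> ha hb [s [B hB]]; have B0 := bd_ge0 hB.
have [A1 hA1] := rapid_abs `|s| ha; have [A2 hA2] := rapid_abs `|s| hb.
exists (A1 * (A2 * w k `^ (- s) * B)).
apply: (@abs_sum_pair _ _ _ _ (fun l => nrm (a l) * w l `^ `|s| * (A2 * w k `^ (- s) * B))).
  move=> l t ut /=; under eq_bigr do rewrite nrmM; rewrite -mulr_sumr -mulrA.
  rewrite ler_wpM2l ?nrm_ge0 //.
  have h := @gop_abs _ _ (fun l _ => b l) (fun l => nrm (b l)) A2 0 s v B (k - l).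
  apply: le_trans (h _ hA2 _ _ ut) _.
  - by move=> j k'; rewrite powRr0 mulr1.
  - by rewrite addr0.
  have A20 : 0 <= A2 by have := hA2 [::] isT; rewrite big_nil.
  have -> : w l `^ `|s| * (A2 * w k `^ (- s) * B) = A2 * (w k `^ (- s) * w l `^ `|s|) * B.
    by ring.
  rewrite ler_wpM2r // ler_wpM2l // -(wtN l) -normrN; exact: wt_peetre.
move=> t ut; rewrite -mulr_suml ler_wpM2r ?hA1 //.
have A20 : 0 <= A2 by have := hA2 [::] isT; rewrite big_nil.
by rewrite mulr_ge0 // mulr_ge0 // wtp_ge0.
Qed.

Lemma conv_convC a b v : rapid a -> rapid b -> fin v -> conv a (conv b v) = conv b (conv a v).
Proof.
move=> ha hb hv; apply/funext => k.
have [B hB] := abs_sum_conv2 k ha hb hv.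
transitivity (csum (fun l => csum (fun j => a l * (b j * v (k - l - j))))).
  rewrite {1}/conv /gop; congr csum; apply/funext => l.
  have [A hA] := conv_abs (k - l) hb hv.
  by rewrite /conv /gop (csumZ _ hA).
rewrite (csum_exchange (f := fun l j => a l * (b j * v (k - l - j))) hB).
rewrite [RHS]/conv /gop; congr csum; apply/funext => j.
have [A hA] := conv_abs (k - j) ha hv.
rewrite /conv /gop -(csumZ _ hA); congr csum; apply/funext => l.
by rewrite mulrCA addrAC.
Qed.

Definition ip u v : C := csum (fun k => u k * conjc (v k)).

Lemma ip_abs s u v A B : bd s u A -> bd (- s) v B ->
  abs_sum (fun k => u k * conjc (v k)) (A * B).
Proof.
move=> [A0 hA] [B0 hB] t ut.
have e k : nrm (u k * conjc (v k)) = (w k `^ s * nrm (u k)) * (w k `^ (- s) * nrm (v k)).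
  by rewrite nrmM nrmJ mulrACA -wtpD subrr powRr0 mul1r.
rewrite (eq_bigr _ (fun k _ => e k)).
exact: cauchy_schwarz_seq (hA _ ut) (hB _ ut).
Qed.

Lemma ip_bound s u v A B : bd s u A -> bd (- s) v B -> nrm (ip u v) <= A * B.
Proof. by move=> a b; apply: csum_bound; exact: ip_abs a b. Qed.

(* Pairs in duality, for which the pairing converges absolutely. *)
Definition dual u v := exists s A B, bd s u A /\ bd (- s) v B.

Lemma dualC u v : dual u v -> dual v u.
Proof. by move=> [s [A [B [a b]]]]; exists (- s), B, A; rewrite opprK. Qed.
Lemma dual_fr u v : fin u -> rapid v -> dual u v.
Proof. by move=> [s [A a]] /(_ (- s))[B b]; exists s, A, B. Qed.
Lemma dual_rf u v : rapid u -> fin v -> dual u v.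
Proof. by move=> hu hv; exact/dualC/dual_fr. Qed.
Lemma dual_abs u v : dual u v -> exists B, abs_sum (fun k => u k * conjc (v k)) B.
Proof. by move=> [s [A [B [a b]]]]; exists (A * B); exact: ip_abs a b. Qed.

Lemma ipDl u v x : dual u x -> dual v x -> ip (fun k => u k + v k) x = ip u x + ip v x.
Proof.
move=> /dual_abs[A a] /dual_abs[B b]; rewrite /ip -(csumD a b); congr csum.
by apply/funext => k; rewrite mulrDl.
Qed.

Lemma ipDr u v x : dual x u -> dual x v -> ip x (fun k => u k + v k) = ip x u + ip x v.
Proof.
move=> /dual_abs[A a] /dual_abs[B b]; rewrite /ip -(csumD a b); congr csum.
by apply/funext => k; rewrite rmorphD /= mulrDr.
Qed.

Lemma ipZl c u x : dual u x -> ip (fun k => c * u k) x = c * ip u x.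
Proof.
move=> /dual_abs[A a]; rewrite /ip -(csumZ _ a); congr csum.
by apply/funext => k; rewrite mulrA.
Qed.

Lemma ipNl u x : dual u x -> ip (fun k => - u k) x = - ip u x.
Proof.
move=> h; rewrite -mulN1r -ipZl //; congr ip; apply/funext => k.
by rewrite mulN1r.
Qed.

Lemma ipC u v : dual u v -> ip v u = conjc (ip u v).
Proof.
move=> /dual_abs[A a]; rewrite /ip -(csumC a); congr csum.
by apply/funext => k; rewrite rmorphM /= conjcK mulrC.
Qed.

Lemma ipNr u x : dual u x -> ip u (fun k => - x k) = - ip u x.
Proof.
move=> h; rewrite -ipNl //; congr csum; apply/funext => k.
by rewrite rmorphN /= mulrN mulNr.
Qed.

(** The coefficients of the conjugate function. *)
Definition star (a : K -> C) : K -> C := fun k => conjc (a (- k)).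

Lemma rapid_star a : rapid a -> rapid (star a).
Proof.
move=> ha s; have [B [B0 hB]] := ha s; exists B; split => // t ut.
have um : uniq (map -%R t) by rewrite map_inj_uniq //; exact: oppr_inj.
apply: le_trans (hB _ um); rewrite big_map; apply: ler_sum => k _.
by rewrite /star nrmJ wtN.
Qed.

Lemma starK a : star (star a) = a.
Proof. by apply/funext => k; rewrite /star opprK conjcK. Qed.

(** The adjoint of multiplication by a function is multiplication by its conjugate: both sides are
    the double sum of [a l * u k * conjc (v (k + l))], taken in the two orders. *)
Lemma ip_conv a u v : rapid a -> dual u v -> ip (conv a u) v = ip u (conv (star a) v).
Proof.
move=> ha [s [A [B [hA hB]]]].
have [A1 hA1] := rapid_abs `|s| ha.
have B0 := bd_ge0 hB; have A0 := bd_ge0 hA.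
have fu : fin u by exists s, A.
have fv : fin v by exists (- s), B.
have tot : abs_sum (fun p : K * K => a p.1 * u (p.2 - p.1) * conjc (v p.2)) (A1 * (A * B)).
  apply: (@abs_sum_pair _ _ _ _ (fun l => nrm (a l) * w l `^ `|s| * (A * B))).
    move=> l t ut /=; under eq_bigr do rewrite -mulrA nrmM.
    rewrite -mulr_sumr -mulrA ler_wpM2l ?nrm_ge0 // mulrA.
    exact: (ip_abs (bd_shift l hA) hB).
  by move=> t ut; rewrite -mulr_suml ler_wpM2r ?mulr_ge0 ?hA1.
transitivity (csum (fun k => csum (fun l => a l * u (k - l) * conjc (v k)))).
  congr csum; apply/funext => k; rewrite mulrC.
  have [D hD] := conv_abs k ha fu.
  rewrite -(csumZ _ hD); congr csum; apply/funext => l; exact: mulrC.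
rewrite -(csum_exchange (f := fun l k => a l * u (k - l) * conjc (v k)) tot).
have tot2 : abs_sum (fun p : K * K => a p.1 * u p.2 * conjc (v (p.2 + p.1))) (A1 * (A * B)).
  have inj : injective (fun p : K * K => (p.1, p.2 + p.1)).
    by move=> [x y] [x' y'] /= [-> /addIr ->].
  have := abs_sum_map inj tot; congr abs_sum; apply/funext => p /=.
  by rewrite addrK.
transitivity (csum (fun l => csum (fun k => a l * u k * conjc (v (k + l))))).
  congr csum; apply/funext => l.
  rewrite -(csum_map (h := fun k => k + l) (h' := fun k => k - l)
     (f := fun k => a l * u (k - l) * conjc (v k)) (A := A1 * (A * B))).
  - by congr csum; apply/funext => k /=; rewrite addrK.
  - by move=> k; rewrite addrK.
  - by move=> k; rewrite subrK.
  - move=> t ut; have /tot : uniq (map (pair l) t) by rewrite map_inj_uniq // => ? ? [].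
    by rewrite big_map.
rewrite (csum_exchange (f := fun l k => a l * u k * conjc (v (k + l))) tot2).
congr csum; apply/funext => k.
have [D hD] := conv_abs k (rapid_star ha) fv.
rewrite /conv /gop -(csumC hD).
have inj : injective (@GRing.opp K) by exact: oppr_inj.
have hD2 := abs_sum_map inj hD.
have opK : cancel (@GRing.opp K) -%R by exact: opprK.
have hDc : abs_sum (fun l => conjc (star a l * v (k - l))) D.
  by move=> t ut; under eq_bigr do rewrite nrmJ; exact: hD.
rewrite -(csum_map opK opK hDc) -(csumZ _ (abs_sum_map inj hDc)); congr csum.
apply/funext => l /=; rewrite /star !opprK rmorphM /= conjcK.
by rewrite mulrA [a l * _]mulrC.
Qed.

Lemma ip_Dk j u v : dual u (Dk j v) -> ip (Dk j u) v = - ip u (Dk j v).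
Proof.
move=> h; rewrite -ipNr //; congr csum; apply/funext => k; rewrite /Dk.
by rewrite rmorphN /= conjc_iM opprK mulrCA mulrA.
Qed.

Lemma ip_mult tau u v : ip (mult tau u) v = ip u (mult tau v).
Proof.
congr csum; apply/funext => k; rewrite /mult conjc_RM.
by rewrite mulrCA mulrA.
Qed.

(* For a rapid sequence the Sobolev norm is read off the quadratic form. *)
Lemma bd_of_ip s v B : 0 <= B -> rapid v ->
  nrm (ip v (Lam (s * 2) v)) <= B ^+ 2 -> bd s v B.
Proof.
move=> B0 hv h; split=> // t ut; apply: le_trans h.
have [A hA] := hv s.
have sm : abs_sum (fun k => v k * conjc (Lam (s * 2) v k)) (A * A).
  apply: (ip_abs (s := s)) => //; apply: bd_Lam.
  by rewrite (_ : - s + s * 2 = s) //; ring.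
pose f k : R := (w k `^ s * nrm (v k)) ^+ 2.
have fE k : v k * conjc (Lam (s * 2) v k) = (f k)%:C.
  rewrite /f /Lam /mult conjc_RM mulrCA mul_conjc.
  rewrite -(rmorphM (real_complex R)) exprMn; congr ((_ * _)%:C).
  by rewrite expr2 -wtpD (_ : s * 2 = s + s) //; ring.
have hs := has_sum_abs sm.
apply: le_eps => e e0; have [t0 ht0] := hs e e0.
have [ub st st0] := uniq_undup_cat t t0.
have := ht0 _ ub st0; rewrite nrmBC -/(ip v _).
set S := \sum_(k <- undup (t ++ t0)) _ => hS.
have SE : S = (\sum_(k <- undup (t ++ t0)) f k)%:C.
  by rewrite rmorph_sum; apply: eq_bigr => k _; rewrite fE.
apply: (@le_trans _ _ (nrm S)).
  rewrite SE nrm_real ger0_norm ?sumr_ge0 //; last by move=> k _; exact: sqr_ge0.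
  by apply: ler_sum_uniq_sub => // k; exact: sqr_ge0.
rewrite -[S](subrK (ip v (Lam (s * 2) v))) addrC (le_trans (nrmD _ _)) // lerD2l.
by rewrite nrmBC.
Qed.

End Operators.

(** * Commutator calculus and integration by parts *)

Section Commutators.
Context {R : realType} {m : nat}.
Local Notation K := ('rV[int]_m).
Local Notation C := R[i].
Local Notation w := (@wt R m).
Local Notation seqop := ((K -> C) -> K -> C).
Implicit Types (s r B : R) (u v : K -> C) (k l : K).

Definition com (T U : seqop) : seqop := fun v k => T (U v) k - U (T v) k.

(* In Fourier coefficients: the field [sum_j a_j d_j], and multiplication by its divergence. *)
Definition vf (a : 'I_m -> K -> C) : seqop := fun v k => \sum_j conv (a j) (Dk j v) k.
Definition dvf (a : 'I_m -> K -> C) : seqop := fun v k => \sum_j conv (Dk j (a j)) v k.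

(** Symbols of order [t], uniformly in the index. The second bound replaces the statement that the
    derivative of the symbol has order [t - 1]; its polynomial growth in [k - l] is harmless next to
    rapid coefficients. *)
Definition symb (I : Type) (t : R) (tau : I -> K -> R) := exists c q, [/\ 0 <= c,
  forall i k, `|tau i k| <= c * w k `^ t &
  forall i k l, `|tau i k - tau i l| <= c * w (k - l) `^ q * w l `^ (t - 1)].

Lemma symb_Lam (I : Type) r : symb r (fun (_ : I) k => w k `^ r).
Proof.
have [c c0 hc] := @wtp_lipschitz R m r.
exists (c + 1), (`|r| + 2); split.
- by rewrite addr_ge0.
- by move=> _ k; rewrite ger0_norm ?wtp_ge0 // ler_peMl ?wtp_ge0 // lerDr.
move=> _ k l; apply: le_trans (hc k l) _.
by rewrite ler_wpM2r ?wtp_ge0 // ler_wpM2r ?wtp_ge0 // lerDl.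
Qed.

Lemma op_symb (I : Type) t (tau : I -> K -> R) : symb t tau -> op t (fun i => mult (tau i)).
Proof. by move=> [c [q [c0 h _]]]; exact: op_mult h. Qed.

(** The kernel of the commutator is [(tau k - tau (k - l)) * a l], and the decay of [a] absorbs the
    growth in [l]. *)
Lemma com_symb_conv (I : Type) t (tau : I -> K -> R) a : symb t tau -> rapid a ->
  op (t - 1) (fun i => com (mult (tau i)) (conv a)).
Proof.
move=> ht ha; have ot := op_symb ht; have [c [q [c0 _ h2]]] := ht.
apply: (@op_ext _ _ _ _ (fun i => gop (fun l k => (tau i k - tau i (k - l))%:C * a l))).
  move=> i v hv; apply/funext => k; rewrite /com /mult /conv /gop.
  have [A hA] := conv_abs k ha hv.
  have [B hB] := conv_abs k ha (op_fin i ot hv).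
  rewrite -(csumZ _ hA) -mulN1r -(csumZ _ hB).
  have hA' : abs_sum (fun l => (tau i k)%:C * (a l * v (k - l))) (nrm (tau i k)%:C * A).
    move=> t' ut; under eq_bigr do rewrite nrmM; rewrite -mulr_sumr.
    by rewrite ler_wpM2l ?nrm_ge0 // hA.
  have hB' : abs_sum (fun l => -1 * (a l * mult (tau i) v (k - l))) B.
    by move=> t' ut; under eq_bigr do rewrite mulN1r nrmN; exact: hB.
  rewrite -(csumD hA' hB'); congr csum; apply/funext => l.
  by rewrite /mult rmorphB /=; ring.
move=> s; have [A hA] := rapid_abs (q + `|s|) ha.
have A0 : 0 <= A by have := hA [::] isT; rewrite big_nil.
exists (c * A) => [|i v B hB]; first exact: mulr_ge0.
apply: (bd_gop (al := fun l => c * w l `^ q * nrm (a l)) (r := t - 1)) => //.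
  move=> l k; rewrite nrmM nrm_real mulrAC ler_wpM2r ?nrm_ge0 //.
  by have := h2 i k (k - l); rewrite subKr.
move=> t' ut; apply: (@le_trans _ _ (\sum_(l <- t') c * (nrm (a l) * w l `^ (q + `|s|)))).
  apply: ler_sum => l _; rewrite wtpD le_eqVlt; apply/orP; left; apply/eqP; ring.
by rewrite -mulr_sumr ler_wpM2l // hA.
Qed.

Lemma op_vf a : (forall j, rapid (a j)) -> op1 1 (vf a).
Proof.
move=> ha; rewrite /op1 /vf.
apply: (@op_sum _ _ unit _ _ _ (fun j _ v => conv (a j) (Dk j v))) => j.
by have := op_comp (op_conv (ha j)) (op_Dk j); rewrite add0r.
Qed.

Lemma op_dvf a : (forall j, rapid (a j)) -> op1 0 (dvf a).
Proof.
move=> ha; apply: (@op_sum _ _ unit _ _ _ (fun j _ v => conv (Dk j (a j)) v)) => j.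
exact: op_conv (op1_rapid (op_Dk j) (ha j)).
Qed.

Lemma fin_conv a v : rapid a -> fin v -> fin (conv a v).
Proof. by move=> ha; exact: op1_fin (op_conv ha). Qed.
Lemma fin_Dk j v : fin v -> fin (Dk j v).
Proof. exact: op1_fin (op_Dk j). Qed.
Lemma rapid_conv a v : rapid a -> rapid v -> rapid (conv a v).
Proof. by move=> ha; exact: op1_rapid (op_conv ha). Qed.
Lemma rapid_Dk j v : rapid v -> rapid (Dk j v).
Proof. exact: op1_rapid (op_Dk j). Qed.
Lemma fin_vf a v : (forall j, rapid (a j)) -> fin v -> fin (vf a v).
Proof. by move=> ha; exact: op1_fin (op_vf ha). Qed.
Lemma rapid_vf a v : (forall j, rapid (a j)) -> rapid v -> rapid (vf a v).
Proof. by move=> ha; exact: op1_rapid (op_vf ha). Qed.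

Lemma Dk_mult j tau v : Dk j (mult tau v) = mult tau (Dk j v).
Proof. by apply/funext => k; rewrite /Dk /mult mulrCA. Qed.

Lemma DkC i j v : Dk i (Dk j v) = Dk j (Dk i v).
Proof. by apply/funext => k; rewrite /Dk; ring. Qed.

Lemma DkD j u v : Dk j (fun k => u k + v k) = fun k => Dk j u k + Dk j v k.
Proof. by apply/funext => k; exact: mulrDr. Qed.

Lemma Dk_sum j (J : Type) (t : seq J) (F : J -> K -> C) :
  Dk j (fun k => \sum_(i <- t) F i k) = fun k => \sum_(i <- t) Dk j (F i) k.
Proof. by apply/funext => k; exact: mulr_sumr. Qed.

Lemma multD tau u v : mult tau (fun k => u k + v k) = fun k => mult tau u k + mult tau v k.
Proof. by apply/funext => k; exact: mulrDr. Qed.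

Lemma mult_sum tau (J : Type) (t : seq J) (F : J -> K -> C) :
  mult tau (fun k => \sum_(i <- t) F i k) = fun k => \sum_(i <- t) mult tau (F i) k.
Proof. by apply/funext => k; exact: mulr_sumr. Qed.

Lemma vfD a u v : (forall j, rapid (a j)) -> fin u -> fin v ->
  vf a (fun k => u k + v k) = fun k => vf a u k + vf a v k.
Proof.
move=> ha hu hv; apply/funext => k; rewrite /vf -big_split /=; apply: eq_bigr => j _.
by rewrite DkD convDr //; exact: fin_Dk.
Qed.

Lemma vfZ a c v : (forall j, rapid (a j)) -> fin v ->
  vf a (fun k => c * v k) = fun k => c * vf a v k.
Proof.
move=> ha hv; apply/funext => k; rewrite /vf mulr_sumr; apply: eq_bigr => j _.
rewrite (_ : Dk j _ = fun k => c * Dk j v k).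
  by rewrite convZr //; exact: fin_Dk.
by apply/funext => l; rewrite /Dk mulrCA.
Qed.

Lemma vfN a v : (forall j, rapid (a j)) -> fin v ->
  vf a (fun k => - v k) = fun k => - vf a v k.
Proof.
move=> ha hv; have := vfZ (-1) ha hv.
by rewrite (_ : (fun k => -1 * v k) = fun k => - v k);
  [move=> ->|]; apply/funext => k; rewrite mulN1r.
Qed.

Lemma vfB a u v : (forall j, rapid (a j)) -> fin u -> fin v ->
  vf a (fun k => u k - v k) = fun k => vf a u k - vf a v k.
Proof. by move=> ha hu hv; rewrite vfD ?vfN //; exact: finN. Qed.

(** A multiplier commutes with [Dk]; only its commutator with the coefficients remains, of order
    [t - 1], applied after one derivative. *)
Lemma com_symb_vf (I : Type) t (tau : I -> K -> R) a : symb t tau -> (forall j, rapid (a j)) ->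
  op t (fun i => com (mult (tau i)) (vf a)).
Proof.
move=> ht ha.
have h j := op_comp (com_symb_conv ht (ha j)) (op_cst I (op_Dk j)).
have := op_sum (index_enum 'I_m) h; rewrite subrK; congr op.
apply/funext => i; apply/funext => v; apply/funext => k.
rewrite /com /vf mult_sum -sumrB; apply: eq_bigr => j _.
by rewrite Dk_mult.
Qed.

Lemma op_comN (I : Type) r (T U : I -> seqop) :
  op r (fun i => com (T i) (U i)) -> op r (fun i => com (U i) (T i)).
Proof.
move=> /opN; congr op; apply/funext => i; apply/funext => v; apply/funext => k.
by rewrite /com opprB.
Qed.

Lemma vf_conv a b v : (forall j, rapid (a j)) -> rapid b -> fin v ->
  vf a (conv b v) = fun k => conv b (vf a v) k + \sum_j conv (a j) (conv (Dk j b) v) k.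
Proof.
move=> ha hb hv; apply/funext => k.
rewrite /vf conv_sumr // => [|j]; last exact/fin_conv/fin_Dk.
rewrite -big_split /=; apply: eq_bigr => j _.
rewrite Dk_conv // convDr //; last 2 first.
- exact/fin_conv/fin_Dk.
- by apply: fin_conv => //; exact: rapid_Dk.
by rewrite conv_convC //; exact: fin_Dk.
Qed.

Lemma com_vf_conv a b : (forall j, rapid (a j)) -> rapid b -> op1 0 (com (vf a) (conv b)).
Proof.
move=> ha hb.
apply: (@op_ext _ _ unit 0 (fun _ v k => \sum_j conv (a j) (conv (Dk j b) v) k)).
  move=> _ v hv; apply/funext => k; rewrite /com vf_conv //.
  by rewrite addrC addKr.
apply: (@op_sum _ _ unit _ _ _ (fun j _ v => conv (a j) (conv (Dk j b) v))) => j.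
by have := op_comp (op_conv (ha j)) (op_conv (rapid_Dk j hb)); rewrite add0r.
Qed.

(** The second order parts cancel, since multiplications commute with one another and so do
    derivatives; what remains differentiates a coefficient. *)
Lemma com_vf_vf a b : (forall j, rapid (a j)) -> (forall j, rapid (b j)) ->
  op1 1 (com (vf a) (vf b)).
Proof.
move=> ha hb.
apply: (@op_ext _ _ unit 1 (fun _ v k => \sum_j (com (vf a) (conv (b j)) (Dk j v) k
    - com (vf b) (conv (a j)) (Dk j v) k))).
  move=> _ v hv; apply/funext => k; rewrite /com.
  have fa j : fin (vf a (Dk j v)) by exact/fin_vf/fin_Dk.
  have fb j : fin (vf b (Dk j v)) by exact/fin_vf/fin_Dk.
  have eD (c : 'I_m -> K -> C) u : (forall j, rapid (c j)) -> fin u ->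
      vf c u k = \sum_j conv (c j) (Dk j u) k by [].
  have L (c d : 'I_m -> K -> C) : (forall j, rapid (c j)) -> (forall j, rapid (d j)) ->
      vf c (vf d v) k = \sum_j vf c (conv (d j) (Dk j v)) k.
    move=> hc hd; rewrite /vf [in RHS]exchange_big /=; apply: eq_bigr => i _.
    rewrite Dk_sum conv_sumr // => j; exact/fin_Dk/fin_conv/fin_Dk.
  rewrite !L //.
  have S (c d : 'I_m -> K -> C) : (forall j, rapid (c j)) -> (forall j, rapid (d j)) ->
      \sum_j conv (c j) (vf d (Dk j v)) k = \sum_j \sum_i conv (c j) (conv (d i) (Dk i (Dk j v))) k.
    move=> hc hd; apply: eq_bigr => j _; rewrite /vf conv_sumr // => i.
    exact/fin_conv/fin_Dk/fin_Dk.
  have E : \sum_j conv (b j) (vf a (Dk j v)) k = \sum_j conv (a j) (vf b (Dk j v)) k.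
    rewrite !S // exchange_big /=; apply: eq_bigr => j _; apply: eq_bigr => i _.
    by rewrite (DkC j i) (conv_convC (hb i) (ha j)) //; exact/fin_Dk/fin_Dk.
  by rewrite !sumrB E opprB addrA subrK.
apply: (@op_sum _ _ unit _ _ _ (fun j _ v k => com (vf a) (conv (b j)) (Dk j v) k
    - com (vf b) (conv (a j)) (Dk j v) k)) => j.
have h c d : (forall j, rapid (c j)) -> (forall j, rapid (d j)) ->
    op1 1 (fun v => com (vf c) (conv (d j)) (Dk j v)).
  move=> hc hd; have := op_comp (com_vf_conv hc (hd j)) (op_Dk j).
  by rewrite add0r.
exact: opB (h _ _ ha hb) (h _ _ hb ha).
Qed.

(** Taking the commutator with [X] is a derivation on products of operators. *)
Lemma com_Lam (X W : seqop) r q : 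
  op1 1 W -> op1 q (com X W) -> op1 (r + q - 1) (com X (Lam r)) ->
  op1 (r + q) (com X (fun v => Lam r (W v))).
Proof.
move=> oW oXW oXL.
apply: (@op_ext _ _ unit _ (fun _ v k => com X (Lam r) (W v) k + Lam r (com X W v) k)).
  move=> _ v hv; apply/funext => k; rewrite /com /Lam /mult.
  by rewrite mulrBr subrKA.
apply: opD.
  by have := op_comp oXL oW; rewrite subrK.
exact: op_comp (op_Lam r) oXW.
Qed.

(** Integration by parts. In the adjoint the derivative also falls on the conjugated coefficients,
    which produces the divergence term [dvf]. *)
Lemma ip_vf a u v : (forall j, rapid (a j)) ->
  (fin u /\ rapid v) \/ (rapid u /\ fin v) ->
  ip (vf a u) v = - ip u (fun k => vf (fun j => star (a j)) v k + dvf (fun j => star (a j)) v k).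
Proof.
move=> ha huv.
(* One of the two sequences is rapid, so its image under an operator of finite order pairs with the
   image of the other one. *)
have D (T U : seqop) r q : op1 r T -> op1 q U -> dual (T u) (U v).
  move=> hT hU; case: huv => [[hu hv]|[hu hv]].
    by apply: dual_fr; [exact: op1_fin hT _|exact: op1_rapid hU _].
  by apply: dual_rf; [exact: op1_rapid hT _|exact: op1_fin hU _].
have fu : fin u by case: huv => [[]//|[/rapid_fin]].
have fv : fin v by case: huv => [[_ /rapid_fin]//|[]].
have id1 : op1 0 (fun v : K -> C => v).
  by move=> s; exists 1 => // _ x B; rewrite addr0 mul1r.
have rs j : rapid (star (a j)) by exact: rapid_star.
have Dv j := op_comp (op_conv (ha j)) (op_Dk j).
have sum_ip (I : Type) (t : seq I) (F : I -> seqop) r : (forall i, op1 r (F i)) ->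
    ip u (fun k => \sum_(i <- t) F i v k) = \sum_(i <- t) ip u (F i v).
  move=> hF; elim: t => [|i t IH].
    rewrite big_nil /ip (csum_finite (s0 := [::])) ?big_nil // => k _.
    by rewrite big_nil conjc0 mulr0.
  rewrite big_cons -IH -(ipDr (u := F i v)).
  - by congr ip; apply/funext => k; rewrite big_cons.
  - exact: D id1 (hF i).
  - have := @op_sum _ _ unit _ t r (fun i _ => F i) hF.
    exact: (D id _ _ _ id1).
have sum_ipl (I : Type) (t : seq I) (F : I -> seqop) r : (forall i, op1 r (F i)) ->
    ip (fun k => \sum_(i <- t) F i u k) v = \sum_(i <- t) ip (F i u) v.
  move=> hF; elim: t => [|i t IH].
    rewrite big_nil /ip (csum_finite (s0 := [::])) ?big_nil // => k _.
    by rewrite big_nil mul0r.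
  rewrite big_cons -IH -(ipDl (u := F i u)).
  - by congr ip; apply/funext => k; rewrite big_cons.
  - exact: D (hF i) id1.
  - have h := @op_sum _ _ unit _ t r (fun i _ => F i) hF.
    exact: (D _ id _ _ h id1).
rewrite (sum_ipl _ _ (fun j v => conv (a j) (Dk j v)) _ Dv).
have e : (fun k => vf (fun j => star (a j)) v k + dvf (fun j => star (a j)) v k)
   = fun k => \sum_j Dk j (conv (star (a j)) v) k.
  apply/funext => k; rewrite /vf /dvf -big_split /=; apply: eq_bigr => j _.
  by rewrite Dk_conv.
have Dv' j := op_comp (op_Dk j) (op_conv (rs j)).
rewrite e (sum_ip _ _ (fun j v => Dk j (conv (star (a j)) v)) _ Dv').
rewrite -sumrN; apply: eq_bigr => j _.
rewrite ip_conv //; last exact: D (op_Dk j) id1.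
by rewrite ip_Dk //; exact: D id1 (Dv' j).
Qed.

End Commutators.

(** * Gains of regularity *)

Section Subelliptic.
Context {R : realType} {m : nat}.
Local Notation K := ('rV[int]_m).
Local Notation C := R[i].
Local Notation seqop := ((K -> C) -> K -> C).
Implicit Types (s r B : R) (u v : K -> C).

Definition rapidf (a : 'I_m -> K -> C) := forall j, rapid (a j).
Definition starf (a : 'I_m -> K -> C) : 'I_m -> K -> C := fun j => star (a j).

Lemma rapidf_star a : rapidf a -> rapidf (starf a).
Proof. by move=> h j; exact: rapid_star. Qed.

(** The relation between the orders is a premise, so that it can be discharged by arithmetic instead
    of by rewriting orders in the goal. *)
Lemma op1_bd r q (T : seqop) : op1 r T -> exists2 c, 0 <= c &
  forall v B s, s = q + r -> bd s v B -> bd q (T v) (c * B).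
Proof. by move=> /(_ q)[c c0 h]; exists c => // v B _ -> hv; exact: (h tt). Qed.

Lemma com_vf_Lam a r : rapidf a -> op1 r (com (vf a) (Lam r)).
Proof.
move=> ha; apply: (@op_comN _ _ unit r (fun=> Lam r) (fun=> vf a)).
exact: com_symb_vf (symb_Lam unit r) ha.
Qed.

Lemma com_vf_Lam_comp a (W : seqop) r : rapidf a -> op1 1 W -> op1 1 (com (vf a) W) ->
  op1 (r + 1) (com (vf a) (fun v => Lam r (W v))).
Proof.
move=> ha oW oXW; apply: com_Lam => //.
by rewrite addrK; exact: com_vf_Lam.
Qed.

(* Moving a real field [X] across the pairing with [L v], where [L] has order
   [d - 1]: only [X v] in L^2 and [v] in L^2 are used. *)
Lemma ip_vf_bound a (T : seqop) r q : rapidf a -> op1 r T -> op1 r (com (vf a) T) ->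
  exists2 c, 0 <= c & forall u v A B, rapid u -> rapid v ->
    bd (- q) u A -> bd (q + r) v B -> bd (q + r) (vf a v) B ->
    nrm (ip (vf (starf a) u) (T v)) <= c * A * B.
Proof.
move=> ha oT oX.
have [c1 c10 h1] := op1_bd q oT; have [c2 c20 h2] := op1_bd q oX.
have od := op_comp (op_dvf ha) oT; rewrite add0r in od.
have [c3 c30 h3] := op1_bd q od.
exists (c1 + c2 + c3); first by rewrite !addr_ge0.
move=> u v A B hu hv hA hB hXB.
rewrite ip_vf; last 2 first.
- exact: rapidf_star.
- by right; split => //; apply: (op1_fin oT); exact: rapid_fin.
have -> : (fun j => star (starf a j)) = a by apply/funext => j; rewrite /starf starK.
rewrite nrmN (_ : (fun k => _) = fun k => T (vf a v) k + com (vf a) T v k + dvf a (T v) k).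
  have -> : (c1 + c2 + c3) * A * B = A * (c1 * B + c2 * B + c3 * B) by ring.
  apply: ip_bound hA _; rewrite opprK.
  apply: bdD; last exact: h3.
  by apply: bdD; [exact: h1|exact: h2].
by apply/funext => k; rewrite /com addrCA subrr addr0.
Qed.

(** With [T = Lambda^(d-2) [a, b]], of order [d - 1], the squared norm of order [d / 2 - 1] of
    [[a, b] v] is the pairing of [a b v - b a v] with [T v]. Moving [a] in the first term leaves
    [b v] in H^(d-1) and needs only [v] and [a v] in L^2; moving [b] in the second leaves [a v] in
    L^2 and needs [v] and [b v] in H^(d-1). The bracket is assumed to be a commutator at [v] only,
    because cut off components satisfy this just on functions supported in a small ball. *)
Lemma bracket_gain a b c d : rapidf a -> rapidf b -> rapidf c ->
  starf a = a -> starf b = b -> d <= 1 ->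
  exists2 D, 0 <= D & forall v B, rapid v ->
    vf c v = com (vf a) (vf b) v ->
    bd 0 v B -> bd 0 (vf a v) B -> bd (d - 1) (vf b v) B ->
    bd (d / 2 - 1) (vf c v) (D * B).
Proof.
move=> ha hb hc ra rb d1.
pose T v := Lam (d - 2) (vf c v).
have e1 : d - 2 + 1 = d - 1 by ring.
have oT : op1 (d - 1) T by have := op_comp (op_Lam (d - 2)) (op_vf hc); rewrite e1.
have oa : op1 (d - 1) (com (vf a) T).
  by rewrite -e1; apply: com_vf_Lam_comp (op_vf hc) (com_vf_vf ha hc).
have ob : op1 (d - 1) (com (vf b) T).
  by rewrite -e1; apply: com_vf_Lam_comp (op_vf hc) (com_vf_vf hb hc).
have [c1 c10 h1] := ip_vf_bound (1 - d) ha oT oa.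
have [c2 c20 h2] := ip_vf_bound 0 hb oT ob.
exists (c1 + c2 + 1); first by rewrite !addr_ge0.
move=> v B hv e b0 ba bb; have B0 := bd_ge0 b0.
have rY : rapid (vf b v) by exact: rapid_vf.
have rX : rapid (vf a v) by exact: rapid_vf.
apply: bd_of_ip; [by rewrite mulr_ge0 // !addr_ge0|exact: rapid_vf|].
have -> : (d / 2 - 1) * 2 = d - 2 by field.
rewrite -/(T v) {1}e.
have E : ip (com (vf a) (vf b) v) (T v) = ip (vf a (vf b v)) (T v) - ip (vf b (vf a v)) (T v).
  have fT : fin (T v) by apply: (op1_fin oT); exact: rapid_fin.
  rewrite -ipNl; last exact/dual_rf/fT/rapid_vf.
  by rewrite -ipDl //; [exact/dual_rf/fT/rapid_vf|exact/dual_rf/fT/rapidN/rapid_vf].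
rewrite E (le_trans (nrmD _ _)) // nrmN.
have b0' : bd (d - 1) v B by apply: bd_mono b0; rewrite subr_le0.
have z1 : 1 - d + (d - 1) = 0 by ring.
have z2 : 0 + (d - 1) = d - 1 by ring.
have i1 : nrm (ip (vf a (vf b v)) (T v)) <= c1 * B * B.
  by rewrite -{1}ra; apply: h1; rewrite ?z1 ?opprB.
have i2 : nrm (ip (vf b (vf a v)) (T v)) <= c2 * B * B.
  by rewrite -{1}rb; apply: h2; rewrite ?z2 ?oppr0.
rewrite (le_trans (lerD i1 i2)) // exprMn expr2.
have -> : c1 * B * B + c2 * B * B = (c1 + c2) * (B * B) by ring.
rewrite -expr2 ler_wpM2r ?sqr_ge0 //; set x := c1 + c2.
have x0 : 0 <= x by exact: addr_ge0.
rewrite -subr_ge0 (_ : _ - x = x ^+ 2 + x + 1); last by ring.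
by rewrite !addr_ge0 ?sqr_ge0.
Qed.

Lemma real_part_gain a : rapidf a -> exists2 D, 0 <= D & forall v B, rapid v ->
  bd 0 v B -> bd 0 (vf a v) B ->
  bd (- (1 / 2)) (fun k => vf a v k + vf (starf a) v k) (D * B).
Proof.
move=> ha; have hs := rapidf_star ha.
pose W : seqop := fun v k => vf a v k + vf (starf a) v k.
pose T v := Lam (- 1) (W v).
have oW : op1 1 W by exact: opD (op_vf ha) (op_vf hs).
have e1 : - 1 + 1 = 0 :> R by ring.
have oT : op1 0 T by have := op_comp (op_Lam (- 1)) oW; rewrite e1.
have oc : op1 1 (com (vf a) W).
  have := opD (com_vf_vf ha ha) (com_vf_vf ha hs).
  apply: op_ext => _ v hv; apply/funext => k; rewrite /com /W vfD //; try exact: fin_vf.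
  by rewrite addrACA opprD.
have oX : op1 0 (com (vf a) T) by rewrite -e1; exact: com_vf_Lam_comp oW oc.
have [c1 c10 h1] := ip_vf_bound 0 ha oT oX.
have [c2 c20 h2] := op1_bd 0 oT.
exists (c1 + c2 + 1); first by rewrite !addr_ge0.
move=> v B hv b0 ba; have B0 := bd_ge0 b0.
have rW : rapid (W v) by exact: op1_rapid oW hv.
apply: bd_of_ip; [by rewrite mulr_ge0 // !addr_ge0|exact: rW|].
have -> : - (1 / 2) * 2 = - 1 :> R by field.
rewrite -/(W v) -/(T v) {1}/W.
have fT : fin (T v) by apply: (op1_fin oT); exact: rapid_fin.
rewrite ipDl; try exact/dual_rf/fT/rapid_vf.
rewrite (le_trans (nrmD _ _)) //.
have i1 : nrm (ip (vf a v) (T v)) <= B * (c2 * B).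
  by apply: ip_bound ba _; rewrite oppr0; apply: h2 b0; rewrite addr0.
have i2 : nrm (ip (vf (starf a) v) (T v)) <= c1 * B * B.
  by apply: h1; rewrite ?oppr0 ?addr0.
rewrite (le_trans (lerD i1 i2)) // exprMn expr2.
have -> : B * (c2 * B) + c1 * B * B = (c1 + c2) * (B * B) by ring.
rewrite -expr2 ler_wpM2r ?sqr_ge0 //; set x := c1 + c2.
have x0 : 0 <= x by exact: addr_ge0.
rewrite -subr_ge0 (_ : _ - x = x ^+ 2 + x + 1); last by ring.
by rewrite !addr_ge0 ?sqr_ge0.
Qed.

End Subelliptic.

(** * Bounds uniform over a family, and truncated symbols *)

Section UniformBounds.
Context {R : realType} {m : nat}.
Local Notation K := ('rV[int]_m).
Local Notation C := R[i].
Local Notation w := (@wt R m).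
Local Notation seqop := ((K -> C) -> K -> C).

Lemma conv_convA a b v : rapid a -> rapid b -> fin v ->
  conv a (conv b v) = conv (conv a b) v :> (K -> C).
Proof.
move=> ha hb hv; apply/funext => k.
have [B hB] := abs_sum_conv2 k ha hb hv.
transitivity (csum (fun l => csum (fun j => a l * (b j * v (k - l - j))))).
  rewrite {1}/conv /gop; congr csum; apply/funext => l.
  have [A hA] := conv_abs (k - l) hb hv.
  by rewrite /conv /gop (csumZ _ hA).
pose F l j := a l * (b (j - l) * v (k - j)).
have inj : injective (fun p : K * K => (p.1, p.2 - p.1)).
  by move=> [x y] [x' y'] /= [-> /addIr ->].
have hF : abs_sum (fun p : K * K => F p.1 p.2) B.
  have := abs_sum_map inj hB; congr abs_sum; apply/funext => -[l j] /=.
  by rewrite /F (_ : k - l - (j - l) = k - j) // opprB addrA subrK.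
transitivity (csum (fun l => csum (F l))).
  congr csum; apply/funext => l.
  rewrite -(csum_map (h := fun j => j + l) (h' := fun j => j - l) (f := F l) (A := B)).
  - congr csum; apply/funext => j /=.
    by rewrite /F addrK opprD [- j - l]addrC addrA.
  - by move=> j; rewrite addrK.
  - by move=> j; rewrite subrK.
  - move=> t ut; have /hF : uniq (map (pair l) t) by rewrite map_inj_uniq // => ? ? [].
    by rewrite big_map.
rewrite (csum_exchange hF) {2}/conv /gop; congr csum; apply/funext => j.
have [A hA] := conv_abs j ha (rapid_fin hb).
rewrite mulrC -(csumZ _ hA); congr csum.
by apply/funext => l; rewrite /F; ring.
Qed.

Lemma rapid0 : rapid (fun _ : K => 0 : C).
Proof. by move=> s; exists 0; exact: bd_0. Qed.

Lemma rapid_sum (J : Type) (t : seq J) (F : J -> K -> C) :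
  (forall j, rapid (F j)) -> rapid (fun k => \sum_(j <- t) F j k).
Proof.
move=> h; elim: t => [|j t IH].
  rewrite (_ : (fun k => _) = fun=> 0); first exact: rapid0.
  by apply/funext => k; rewrite big_nil.
rewrite (_ : (fun k => _) = fun k => F j k + \sum_(i <- t) F i k).
  exact: rapidD.
by apply/funext => k; rewrite big_cons.
Qed.

Lemma conv_suml (J : Type) (t : seq J) (F : J -> K -> C) v : (forall j, rapid (F j)) -> fin v ->
  conv (fun k => \sum_(j <- t) F j k) v = fun k => \sum_(j <- t) conv (F j) v k.
Proof.
move=> hF hv; elim: t => [|j t IH].
  apply/funext => k; rewrite big_nil /conv /gop.
  by rewrite (csum_finite (s0 := [::])) ?big_nil // => l _; rewrite big_nil mul0r.
rewrite (_ : (fun k => _) = fun k => F j k + \sum_(i <- t) F i k); last first.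
  by apply/funext => k; rewrite big_cons.
rewrite convDl ?IH //; last exact: rapid_sum.
by apply/funext => k; rewrite big_cons.
Qed.

Lemma vf_convE (a : 'I_m -> K -> C) (b v : K -> C) : rapidf a -> rapid b -> fin v ->
  vf a (conv b v) = fun k => conv b (vf a v) k + conv (vf a b) v k.
Proof.
move=> ha hb hv; rewrite vf_conv //; apply/funext => k; congr (_ + _).
rewrite /vf conv_suml //; last by move=> j; exact/rapid_conv/rapid_Dk.
by apply: eq_bigr => j _; rewrite conv_convA //; exact: rapid_Dk.
Qed.

(** Bounds with one constant for the whole family, relative to a size [e]; the size is 1 or a
    quantity not yet known to be bounded. *)
Definition ube (I : Type) (q : R) (f : I -> K -> C) (e : I -> R) :=
  exists2 c, 0 <= c & forall i, bd q (f i) (c * e i).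

Definition bnd (I : Type) (x : I -> C) (e : I -> R) :=
  exists2 c, 0 <= c & forall i, nrm (x i) <= c * e i.

Section Rules.
Variable I : Type.
Implicit Types (f g : I -> K -> C) (e : I -> R) (x y : I -> C).

Lemma ubeD q f g e : ube q f e -> ube q g e -> ube q (fun i k => f i k + g i k) e.
Proof.
move=> [c c0 hc] [d d0 hd]; exists (c + d) => [|i]; first exact: addr_ge0.
by rewrite mulrDl; exact: bdD.
Qed.
Lemma ubeN q f e : ube q f e -> ube q (fun i k => - f i k) e.
Proof. by move=> [c c0 hc]; exists c => // i; exact: bdN. Qed.
Lemma ubeB q f g e : ube q f e -> ube q g e -> ube q (fun i k => f i k - g i k) e.
Proof. by move=> hf /ubeN; exact: ubeD. Qed.
Lemma ube_op q r (T : I -> seqop) f e : op r T -> ube (q + r) f e ->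
  ube q (fun i => T i (f i)) e.
Proof.
move=> /(_ q)[c c0 hT] [d d0 hd]; exists (c * d) => [|i]; first exact: mulr_ge0.
by rewrite -mulrA; exact: hT.
Qed.
Lemma ube_op1 q r T f e : op1 r T -> ube (q + r) f e -> ube q (fun i => T (f i)) e.
Proof. by move=> /(op_cst I); exact: ube_op. Qed.
Lemma ube_mono q r f e : q <= r -> ube r f e -> ube q f e.
Proof. by move=> qr [c c0 h]; exists c => // i; exact: bd_mono (h i). Qed.
Lemma ube_le q f e e' : (forall i, e i <= e' i) -> ube q f e -> ube q f e'.
Proof. by move=> ee [c c0 h]; exists c => // i; apply: bd_le (h i); rewrite ler_wpM2l. Qed.
Lemma ube_cst q v : (exists B, bd q v B) -> ube q (fun _ : I => v) (fun=> 1).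
Proof. by move=> [B hB]; exists B => [|i]; [exact: bd_ge0 hB|rewrite mulr1]. Qed.

Lemma bndD x y e : bnd x e -> bnd y e -> bnd (fun i => x i + y i) e.
Proof.
move=> [c c0 hc] [d d0 hd]; exists (c + d) => [|i]; first exact: addr_ge0.
by rewrite mulrDl (le_trans (nrmD _ _)) // lerD.
Qed.
Lemma bndN x e : bnd x e -> bnd (fun i => - x i) e.
Proof. by move=> [c c0 hc]; exists c => // i; rewrite nrmN. Qed.
Lemma bndB x y e : bnd x e -> bnd y e -> bnd (fun i => x i - y i) e.
Proof. by move=> hx /bndN; exact: bndD. Qed.
Lemma bndZ z x e : bnd x e -> bnd (fun i => z * x i) e.
Proof.
move=> [c c0 hc]; exists (nrm z * c) => [|i]; first by rewrite mulr_ge0 ?nrm_ge0.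
by rewrite nrmM -mulrA ler_wpM2l ?nrm_ge0.
Qed.
Lemma bnd_sum (J : Type) (t : seq J) (F : J -> I -> C) e : (forall j, bnd (F j) e) ->
  bnd (fun i => \sum_(j <- t) F j i) e.
Proof.
move=> h; elim: t => [|j t IH].
  by exists 0 => // i; rewrite big_nil nrm0 mul0r.
rewrite (_ : (fun i => _) = fun i => F j i + \sum_(l <- t) F l i); first exact: bndD.
by apply/funext => i; rewrite big_cons.
Qed.
Lemma bnd_le x e e' : (forall i, e i <= e' i) -> bnd x e -> bnd x e'.
Proof. by move=> ee [c c0 h]; exists c => // i; rewrite (le_trans (h i)) ?ler_wpM2l. Qed.
Lemma bnd_ip q f g e : ube q f (fun=> 1) -> ube (- q) g e -> bnd (fun i => ip (f i) (g i)) e.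
Proof.
move=> [c c0 hc] [d d0 hd]; exists (c * d) => [|i]; first exact: mulr_ge0.
by have := ip_bound (hc i) (hd i); rewrite mulr1 mulrA.
Qed.
Lemma bnd_ip' q f g e : ube q f e -> ube (- q) g (fun=> 1) -> bnd (fun i => ip (f i) (g i)) e.
Proof.
move=> [c c0 hc] [d d0 hd]; exists (c * d) => [|i]; first exact: mulr_ge0.
by have := ip_bound (hc i) (hd i); rewrite mulr1 mulrAC.
Qed.
End Rules.

Lemma wt_box_finite (N : nat) : exists2 t : seq K, uniq t & forall k, w k <= N%:R -> k \in t.
Proof.
pose f (g : {ffun 'I_m -> 'I_(N.*2.+1)}) : K := \row_j ((g j)%:Z - N%:Z).
exists (undup (map f (enum {ffun 'I_m -> 'I_(N.*2.+1)}))); first exact: undup_uniq.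
move=> k hk; rewrite mem_undup.
have kN j : `|k 0 j| <= N%:Z.
  have := le_trans (wt_coord k j) hk; rewrite -[N%:R]/(N%:~R) ler_int.
  by [].
have kb j : (absz (k 0 j + N%:Z)%R < N.*2.+1)%N.
  rewrite ltnS -lez_nat gez0_abs; have := kN j; rewrite ler_norml => /andP[]; lia.
pose g : {ffun 'I_m -> 'I_(N.*2.+1)} := [ffun j => Ordinal (kb j)].
have -> : k = f g.
  apply/rowP => j; rewrite mxE ffunE /= gez0_abs ?addrK //.
  by have := kN j; rewrite ler_norml => /andP[]; lia.
by apply: map_f; rewrite mem_enum.
Qed.

(** A Lipschitz cutoff is enough for [symb]. The truncated power [tcut t n] lives on the finitely
    many frequencies of weight below [2 * n.+1], so it maps every sequence to a finitely supported
    one. *)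
Definition hcut (x : R) : R := Num.max 0 (Num.min 1 (2 - x)).
Definition tcut (t : R) (n : nat) (k : K) : R := w k `^ t * hcut (w k / n.+1%:R).

Lemma hcut_ge0 x : 0 <= hcut x. Proof. by rewrite le_max lexx. Qed.
Lemma hcut_le1 x : hcut x <= 1. Proof. by rewrite ge_max ler01 ge_min lexx. Qed.
Lemma hcut_lip x y : `|hcut x - hcut y| <= `|x - y|.
Proof.
have d1 := ler_norm (x - y); have d2 := ler_norm (y - x); rewrite distrC in d2.
set d := `|x - y| in d1 d2 *.
rewrite ler_norml; apply/andP.
rewrite /hcut /Order.max /Order.min; do ![case: ifPn]; rewrite -?leNgt => *; split; lra.
Qed.
Lemma hcut1 x : x <= 1 -> hcut x = 1.
Proof. by move=> x1; rewrite /hcut min_l ?max_r //; lra. Qed.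
Lemma hcut0 x : 2 <= x -> hcut x = 0.
Proof. by move=> x2; rewrite /hcut max_l // ge_min; apply/orP; right; lra. Qed.

(** The bounds do not depend on [n]. The cutoff has slope [1 / n.+1], which is at most [4 / w l] as
    long as [w l <= 4 * n.+1]; for larger [w l] the difference vanishes unless [w (k - l)] is at
    least half of [w l]. *)
Lemma symb_tcut t : symb t (tcut t).
Proof.
have [c c0 hc] := @wtp_lipschitz R m t.
exists (c + 4), (`|t| + 2); split; first by rewrite addr_ge0.
  move=> n k; rewrite ger0_norm ?mulr_ge0 ?wtp_ge0 ?hcut_ge0 //.
  rewrite (@le_trans _ _ (w k `^ t)) //; first by rewrite ler_piMr ?wtp_ge0 ?hcut_le1.
  by rewrite ler_peMl ?wtp_ge0 //; lra.
move=> n k l; rewrite /tcut.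
set x := w k; set y := w l; set q := w (k - l).
have y0 : 0 < y by exact: wt_gt0.
have q1 : 1 <= q by exact: wt_ge1.
have xyq : `|x - y| <= q by exact: wt_dist.
have n0 : 0 < n.+1%:R :> R by [].
have hxy : `|hcut (x / n.+1%:R) - hcut (y / n.+1%:R)| <= 4 * q / y.
  have [y4|y4] := leP y (4 * n.+1%:R).
    rewrite (le_trans (hcut_lip _ _)) // -mulrBl normrM.
    rewrite [`|n.+1%:R^-1|]ger0_norm ?invr_ge0 //.
    rewrite -mulrA mulrCA ler_pM // ?invr_ge0 //.
    by rewrite ler_pdivlMr // mulrC ler_pdivrMr.
  rewrite [hcut (y / _)]hcut0 ?subr0 ?(ger0_norm (hcut_ge0 _)); last first.
    by rewrite ler_pdivlMr //; lra.
  rewrite ler_pdivlMr //.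
  have [x2|x2] := leP x (2 * n.+1%:R); last first.
    by rewrite hcut0 ?mul0r ?mulr_ge0 ?(le_trans _ q1) // ler_pdivlMr // ltW.
  rewrite (@le_trans _ _ y) //; first by rewrite ler_piMl ?hcut_le1 // ltW.
  have : y - x <= q by apply: le_trans xyq; rewrite distrC ler_norm.
  lra.
have -> : x `^ t * hcut (x / n.+1%:R) - y `^ t * hcut (y / n.+1%:R) =
  (x `^ t - y `^ t) * hcut (x / n.+1%:R) + y `^ t * (hcut (x / n.+1%:R) - hcut (y / n.+1%:R)) by ring.
rewrite (le_trans (ler_normD _ _)) // !normrM.
rewrite [`|hcut _|]ger0_norm ?hcut_ge0 // [`|y `^ t|]ger0_norm ?wtp_ge0 //.
have h1 : `|x `^ t - y `^ t| * hcut (x / n.+1%:R) <= c * q `^ (`|t| + 2) * y `^ (t - 1).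
  apply: le_trans (hc k l); by rewrite ler_piMr ?hcut_le1.
have h2 : y `^ t * `|hcut (x / n.+1%:R) - hcut (y / n.+1%:R)| <= 4 * q `^ (`|t| + 2) * y `^ (t - 1).
  rewrite (le_trans (ler_wpM2l (wtp_ge0 _ _) hxy)) //.
  have -> : y `^ t * (4 * q / y) = 4 * q * y `^ (t - 1).
    by rewrite /y wtpD powRN wtp1; ring.
  rewrite ler_wpM2r ?wtp_ge0 // ler_wpM2l //.
  rewrite -[leLHS](wtp1 (k - l)) wtp_mono //; have := normr_ge0 t; lra.
by rewrite (le_trans (lerD h1 h2)) // !mulrDl.
Qed.

Lemma tcut_finite t n (v : K -> C) : exists2 s : seq K, uniq s &
  forall k, k \notin s -> mult (tcut t n) v k = 0.
Proof.
have [s us hs] := wt_box_finite (2 * n.+1); exists s => // k ks.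
rewrite /mult /tcut hcut0 ?mulr0 ?mul0r // ler_pdivlMr //.
rewrite leNgt; apply/negP => /ltW h; move/negP: ks; apply; apply: hs.
by rewrite natrM.
Qed.

(** Passage to the limit in the truncation: on a given finite set of indices the cutoff is 1 once
    [n] is large. *)
Lemma ube_tcut t q (v : K -> C) :
  ube q (fun n => mult (tcut t n) v) (fun=> 1) -> exists B, bd (q + t) v B.
Proof.
move=> [c c0 h]; exists c; split=> // s us.
pose n := \sum_(k <- s) absz (Num.ceil (w k)).
have hn k : k \in s -> w k <= n.+1%:R.
  move=> ks; rewrite (le_trans (Num.Theory.ceil_ge _)) //.
  have c1 : 0 <= Num.ceil (w k) by rewrite -(ler_int R) (le_trans (wt_ge0 k)) // Num.Theory.ceil_ge.
  rewrite -[X in X%:~R](gez0_abs c1) -pmulrn ler_nat.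
  by rewrite /n (bigD1_seq k) //= -addnS leq_addr.
have [_ /(_ s us)] := h n; rewrite mulr1.
apply: le_trans; rewrite big_seq [leRHS]big_seq; apply: ler_sum => k ks.
rewrite /mult nrmM nrm_real /tcut hcut1 ?ler_pdivrMr ?mul1r ?hn //.
by rewrite mulr1 ger0_norm ?wtp_ge0 // mulrA -wtpD.
Qed.

End UniformBounds.

(** * One step of the regularity argument, on coefficient sequences *)

Section Bootstrap.
Context {R : realType} {m : nat}.
Local Notation K := ('rV[int]_m).
Local Notation C := R[i].
Local Notation seqop := ((K -> C) -> K -> C).

Lemma ip_self (v : K -> C) : rapid v -> exists2 x : R, 0 <= x & ip v v = x%:C.
Proof.
move=> hv; have [A hA] := hv 0.
have hA' : bd (- 0) v A by rewrite oppr0.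
have sm := ip_abs hA hA'.
have [k|s us|y y0 hy] := @has_sum_nonneg R K (fun k => nrm (v k) ^+ 2) (A * A).
- exact: sqr_ge0.
- apply: le_trans (sm s us); apply: ler_sum => k _.
  by rewrite nrmM nrmJ expr2.
have e : ip v v = y%:C.
  rewrite -(has_sum_csum hy); congr csum; apply/funext => k.
  by rewrite mul_conjc.
by exists y.
Qed.

Lemma ip_vf_star (a : 'I_m -> K -> C) (u v : K -> C) : rapidf a -> fin u -> rapid v ->
  ip (vf (starf a) u) v = - ip u (fun k => vf a v k + dvf a v k).
Proof.
move=> ha hu hv; rewrite ip_vf; last 2 first.
- exact: rapidf_star.
- by left.
have -> : (fun j => star (starf a j)) = a by apply/funext => j; exact: starK.
by [].
Qed.

Lemma ip_sum (J : Type) (r : seq J) (F : J -> K -> C) (v : K -> C) :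
  (forall j, fin (F j)) -> rapid v ->
  ip (fun k => \sum_(j <- r) F j k) v = \sum_(j <- r) ip (F j) v.
Proof.
move=> hF hv; elim: r => [|j r IH].
  rewrite big_nil /ip (csum_finite (s0 := [::])) ?big_nil // => k _.
  by rewrite big_nil mul0r.
rewrite big_cons -IH -ipDl.
- by congr ip; apply/funext => k; rewrite big_cons.
- exact: dual_fr.
- by apply: dual_fr => //; exact: fin_sum.
Qed.

Variables (N : nat) (l : 'I_N -> 'I_m -> K -> C) (x0 z : 'I_m -> K -> C) (a0 : K -> C).
(** [DV] stands for the coefficient sequences of test functions supported near the point; domination
    of [z] and the subelliptic estimate are available there. *)
Variables (DV : set (K -> C)) (d : R).
Hypothesis hl : forall j, rapidf (l j).
Hypothesis hx : rapidf x0.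
Hypothesis sx : starf x0 = x0.
Hypothesis hz : rapidf z.
Hypothesis ha : rapid a0.
Hypothesis d01 : 0 <= d <= 1.
Hypothesis z_dom : exists2 c, 0 <= c & forall v B, DV v -> bd 0 v B ->
  (forall j, bd 0 (vf (l j) v) B) -> bd 0 (vf z v) (c * B).
Hypothesis sube : exists2 c, 0 <= c & forall v B, DV v -> bd 0 v B ->
  (forall j, bd 0 (vf (l j) v) B) -> bd (- (1 / 2)) (vf x0 v) B -> bd d v (c * B).

(* The operator [P] of the theorem in Fourier coefficients; [z] is the field with [Y0 = Z + conj Z]. *)
Definition Pop : seqop := fun v k => conv a0 v k + vf x0 v k +
  'i * (vf z v k + vf (starf z) v k) + \sum_j vf (starf (l j)) (vf (l j) v) k.

Variables (chi U G : K -> C) (s sg : R).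
Hypothesis hchi : rapid chi.
Hypothesis schi : star chi = chi.
Hypothesis chi_DV : forall (v : K -> C) (t : seq K), uniq t ->
  (forall k, k \notin t -> v k = 0) -> DV (conv chi v).
Hypothesis hU : fin U.
Hypothesis hG : rapid G.
(** A finitely supported [v] is a trigonometric polynomial, so its product with the cutoff is an
    admissible test function for the equation. *)
Hypothesis weak : forall (v : K -> C) (t : seq K), uniq t ->
  (forall k, k \notin t -> v k = 0) -> ip (Pop U) (conv chi v) = ip G (conv chi v).
Hypothesis sg01 : 0 <= sg <= 1.
Hypothesis regU : exists B, bd s (conv chi U) B.
Hypothesis regx : exists B, bd s (conv (vf x0 chi) U) B.
Hypothesis regz : exists B, bd s (conv (vf z chi) U) B.
Hypothesis regz' : exists B, bd s (conv (vf (starf z) chi) U) B.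
Hypothesis regl : forall j, exists B, bd s (conv (vf (l j) chi) U) B.
Hypothesis regL : forall j, exists B, bd (s - sg) (conv chi (vf (l j) U)) B.
Hypothesis regL' : forall j, exists B,
  bd (s - sg) (conv (vf (starf (l j)) chi) (vf (l j) U)) B.

(** At this order the smoothed [phi] is bounded in H^(sg/2), because [chi U] is in H^s, while the
    errors involving [L_j U], known in H^(s - sg), are bounded in H^(-sg/2): the two can be
    paired. *)
Let t := s - sg / 2.
Let T (n : nat) : seqop := mult (tcut t n).
(** Cutting off on both sides makes [A n] symmetric for [ip], and gives it values in [DV]: the
    cutoff applied to finitely supported sequences. *)
Let A (n : nat) : seqop := fun v => conv chi (T n (conv chi v)).
Let u := conv chi U.
Let phi n := A n U.

Let sT : symb t (tcut (R := R) (m := m) t). Proof. exact: symb_tcut. Qed.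
Let oT : op t T. Proof. exact: op_symb sT. Qed.
Let fT n v : fin v -> fin (T n v). Proof. exact: op_fin oT. Qed.
Let rT n v : rapid v -> rapid (T n v). Proof. exact: op_rapid oT. Qed.
Let fu : fin u. Proof. exact: fin_conv. Qed.
Let oA : op t A.
Proof.
have := op_comp (op_cst nat (op_conv hchi)) (op_comp oT (op_cst nat (op_conv hchi))).
by rewrite add0r addr0.
Qed.
Let fA n v : fin v -> fin (A n v). Proof. exact: op_fin oA. Qed.
Let rTf n v : rapid (T n v).
Proof. by have [s0 us0 h0] := tcut_finite t n v; exact: rapid_finite_supp us0 h0. Qed.
Let rA n v : rapid (A n v). Proof. exact: rapid_conv. Qed.
Let rphi n : rapid (phi n). Proof. exact: rA. Qed.
Let DVphi n : DV (phi n).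
Proof. by have [s0 us0 h0] := tcut_finite t n u; exact: chi_DV us0 h0. Qed.

(** The commutator of [b] with [A n] applied to [V] is [chi (T (b chi) V - [T, b] chi V) + (b chi) T
    chi V], where every term has order [t] and sees [V] only through a localization. *)
Let comA b V q : rapidf b -> fin V -> (exists B, bd (q + t) (conv chi V) B) ->
  (exists B, bd (q + t) (conv (vf b chi) V) B) ->
  ube q (fun n k => vf b (A n V) k - A n (vf b V) k) (fun=> 1).
Proof.
move=> hb hV h1 h2; set x := conv chi V.
have rb : rapid (vf b chi) by exact: rapid_vf.
have fx : fin x by exact: fin_conv.
have e n : (fun k => vf b (A n V) k - A n (vf b V) k) =
   fun k => conv chi (fun k => T n (conv (vf b chi) V) k - com (T n) (vf b) x k) k
     + conv (vf b chi) (T n x) k.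
  have fc : fin (com (T n) (vf b) x).
    by apply: (op_fin n (com_symb_vf sT hb)).
  have fv : fin (conv (vf b chi) V) by exact: fin_conv.
  rewrite convBr //; last exact: fT.
  have fbV : fin (vf b V) by exact: fin_vf.
  have ex : vf b x = fun k => conv chi (vf b V) k + conv (vf b chi) V k by exact: vf_convE.
  have ec : com (T n) (vf b) x = fun k => T n (vf b x) k - vf b (T n x) k by [].
  rewrite ec convBr //; last 2 first.
    by apply: fT; exact: fin_vf.
    by apply: fin_vf => //; exact: fT.
  rewrite {1}ex /T multD -/(T n) convDr //; last 2 first.
    by apply: fT; exact: fin_conv.
    by apply: fT.
  apply/funext => k; rewrite /A -/x (vf_convE hb hchi (fT n fx)) /T; ring.
apply: (@ube_le _ _ _ _ _ (fun=> 1)) => //.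
have -> : (fun n k => vf b (A n V) k - A n (vf b V) k) = (fun n k => conv chi (fun k => T n (conv (vf b chi) V) k - com (T n) (vf b) x k) k
     + conv (vf b chi) (T n x) k) by apply/funext => n; exact: e.
apply: ubeD.
  apply: (ube_op1 (f := fun n k => T n (conv (vf b chi) V) k - com (T n) (vf b) x k)
    (op_conv hchi)); rewrite addr0; apply: ubeB.
    by apply: (ube_op oT); exact: ube_cst.
  by apply: (ube_op (com_symb_vf sT hb)); exact: ube_cst.
apply: (ube_op1 (f := fun n => T n x) (op_conv rb)); rewrite addr0.
apply: (ube_op oT); exact: ube_cst.
Qed.

Let ts : t <= s. Proof. by rewrite /t; case/andP: sg01 => ? ?; lra. Qed.
Let bdmono q r (v : K -> C) : q <= r -> (exists B, bd r v B) -> exists B, bd q v B.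
Proof. by move=> qr [B hB]; exists B; exact: bd_mono hB. Qed.

Let phi_sg : ube (sg / 2) phi (fun=> 1).
Proof.
apply: (ube_op1 (op_conv hchi)); rewrite addr0; apply: (ube_op oT).
by rewrite /t addrC subrK; exact: ube_cst.
Qed.
Let sg2 : 0 <= sg / 2. Proof. by case/andP: sg01 => ? ?; rewrite divr_ge0. Qed.
Let phi_0 : ube 0 phi (fun=> 1). Proof. exact: ube_mono phi_sg. Qed.

(** [E n] is a finite number for each [n] since [phi n] is rapid. Until [energy_bound] makes it
    bounded in [n], estimates are expressed in terms of [e n]. *)
Let nE n j := nrm (ip (vf (l j) (phi n)) (vf (l j) (phi n))).
Let E n := Num.sqrt (\sum_j nE n j).
Let e n := 1 + E n.
Let E0 n : 0 <= E n. Proof. exact: sqrtr_ge0. Qed.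
Let e1 n : 1 <= e n. Proof. by rewrite lerDl. Qed.

Let Lphi_E n j : bd 0 (vf (l j) (phi n)) (E n).
Proof.
apply: bd_of_ip => //; first exact: (rapid_vf (hl j) (rphi n)).
rewrite mul0r (_ : Lam 0 _ = vf (l j) (phi n)); last first.
  by apply/funext => k; rewrite /Lam /mult powRr0 mul1r.
have h0 : 0 <= \sum_i nE n i by apply: sumr_ge0 => i _; exact: nrm_ge0.
rewrite sqr_sqrtr // (bigD1 j) //= lerDl sumr_ge0 // => i _; exact: nrm_ge0.
Qed.

Let Lphi_e j : ube 0 (fun n => vf (l j) (phi n)) e.
Proof. by exists 1 => // n; apply: bd_le (Lphi_E n j); rewrite mul1r lerDr. Qed.

Let zphi_e : ube 0 (fun n => vf z (phi n)) e.
Proof.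
have [c c0 hc] := z_dom; have [d0 d00 hd] := phi_0.
exists (c * (d0 + 1)) => [|n]; first by rewrite mulr_ge0 ?addr_ge0.
rewrite -mulrA; apply: hc => //.
  apply: bd_le (hd n); rewrite ler_pM ?e1 // lerDl //.
move=> j; apply: bd_le (Lphi_E n j); rewrite mulrDl mul1r.
by rewrite (@le_trans _ _ (e n)) // ?lerDr // mulr_ge0 // (le_trans _ (e1 n)).
Qed.

Let AD n v v' : fin v -> fin v' -> A n (fun k => v k + v' k) = fun k => A n v k + A n v' k.
Proof.
move=> hv hv'; have f1 := fin_conv hchi hv; have f2 := fin_conv hchi hv'.
by rewrite /A convDr // /T multD convDr //; exact: fT.
Qed.
Let AZ n c v : fin v -> A n (fun k => c * v k) = fun k => c * A n v k.
Proof.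
move=> hv; have f1 := fin_conv hchi hv.
rewrite /A convZr // /T (_ : mult _ _ = fun k => c * T n (conv chi v) k).
  by rewrite convZr //; exact: fT.
by apply/funext => k; rewrite /T /mult mulrCA.
Qed.
Let A_sum n (J : Type) (r : seq J) (F : J -> K -> C) : (forall j, fin (F j)) ->
  A n (fun k => \sum_(j <- r) F j k) = fun k => \sum_(j <- r) A n (F j) k.
Proof.
move=> hF; have f1 j := fin_conv hchi (hF j).
by rewrite /A conv_sumr // /T mult_sum conv_sumr // => j; exact: fT.
Qed.

Let ip_A n v w' : fin v -> rapid w' -> ip (A n v) w' = ip v (A n w').
Proof.
move=> hv hw; rewrite /A ip_conv //; last first.
  by apply: dual_fr => //; apply: fT; exact: fin_conv.
rewrite schi /T ip_mult ip_conv ?schi //.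
by apply: dual_fr => //; apply: rT; exact: rapid_conv.
Qed.

(** Errors made in exchanging [P] with [A n]. For the second order part,
    [conj L L A U - A conj L L U] equals [conj L (L A U - A L U)] plus [D'], a commutator applied to
    [L U]. [rem] collects what is bounded in H^(-sg/2); the term with a derivative in front of
    [D (l j)] is kept apart, to be integrated by parts. *)
Let D b n : K -> C := fun k => vf b (phi n) k - A n (vf b U) k.
Let D' j n : K -> C := fun k => vf (starf (l j)) (A n (vf (l j) U)) k
  - A n (vf (starf (l j)) (vf (l j) U)) k.
Let D0 n : K -> C := fun k => conv a0 (phi n) k - A n (conv a0 U) k.
Let rem n : K -> C := fun k => D0 n k + D x0 n k + 'i * (D z n k + D (starf z) n k)
  + \sum_j D' j n k.

Let hsz : rapidf (starf z). Proof. exact: rapidf_star. Qed.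
Let hsl j : rapidf (starf (l j)). Proof. exact: rapidf_star. Qed.

Let D_0 b : rapidf b -> (exists B, bd s (conv (vf b chi) U) B) -> ube 0 (D b) (fun=> 1).
Proof.
move=> hb h; apply: (comA hb hU); rewrite add0r; first exact: bdmono ts regU.
exact: bdmono ts h.
Qed.

Let rem_sg : ube (- (sg / 2)) rem (fun=> 1).
Proof.
have sgN : - (sg / 2) <= 0 by rewrite oppr_le0.
have d0 : ube (- (sg / 2)) D0 (fun=> 1).
  apply: (ube_mono sgN); apply: ubeB.
    by apply: (ube_op1 (op_conv ha)); rewrite addr0.
  change (ube 0 (fun n => conv chi (T n (conv chi (conv a0 U)))) (fun=> 1)).
  apply: (ube_op1 (op_conv hchi)); rewrite addr0; apply: (ube_op oT).
  rewrite add0r conv_convC // -/u; apply: ube_cst.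
  have [B hB] := bdmono ts regU; have [c _ hc] := op_conv ha t.
  by exists (c * B); apply: (hc tt); rewrite addr0.
have dz : ube (- (sg / 2)) (fun n k => 'i * (D z n k + D (starf z) n k)) (fun=> 1).
  apply: (ube_mono sgN).
  have [c c0 hc] := ubeD (D_0 hz regz) (D_0 hsz regz').
  by exists c => // n; have := bdZ 'i (hc n); rewrite nrm_i mul1r.
apply: ubeD; first apply: ubeD dz.
  by apply: ubeD d0 (ube_mono sgN (D_0 hx regx)).
have h j : ube (- (sg / 2)) (D' j) (fun=> 1).
  have e0 : - (sg / 2) + t = s - sg by rewrite /t; field.
  by apply: (comA (hsl j) (fin_vf (hl j) hU)); rewrite e0; [exact: regL|exact: regL'].
elim: (index_enum _) => [|j r IH].
  exists 0 => // n; rewrite mul0r (_ : (fun k => _) = fun=> 0); first exact: bd_0.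
  by apply/funext => k; rewrite big_nil.
have := ubeD (h j) IH; congr ube; apply/funext => n; apply/funext => k.
by rewrite big_cons.
Qed.

Let Pop_fin v : fin v -> fin (Pop v).
Proof.
move=> hv; apply: finD; first apply: finD; first apply: finD.
- exact: fin_conv.
- exact: fin_vf.
- by apply: finZ; apply: finD; exact: fin_vf.
- by apply: fin_sum => j; exact: (fin_vf (hsl j) (fin_vf (hl j) hv)).
Qed.

Let Pphi_dec n : Pop (phi n) = fun k => A n (Pop U) k + rem n k +
  \sum_j vf (starf (l j)) (D (l j) n) k.
Proof.
have fV b : rapidf b -> fin (vf b U) by move=> hb; exact: fin_vf.
have -> : A n (Pop U) = fun k => A n (conv a0 U) k + A n (vf x0 U) k +
   'i * (A n (vf z U) k + A n (vf (starf z) U) k) +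
   \sum_j A n (vf (starf (l j)) (vf (l j) U)) k.
  rewrite /Pop AD.
  - rewrite AD; [|by apply: finD; [exact: fin_conv|exact: fV]|by apply: finZ; apply: finD; exact: fV].
    rewrite AD; [|exact: fin_conv|exact: fV].
    rewrite AZ; last by apply: finD; exact: fV.
    rewrite AD; [|exact: fV|exact: fV].
    by rewrite A_sum // => j; exact: (fin_vf (hsl j) (fV _ (hl j))).
  - apply: finD; last by apply: finZ; apply: finD; exact: fV.
    by apply: finD; [exact: fin_conv|exact: fV].
  - by apply: fin_sum => j; exact: (fin_vf (hsl j) (fV _ (hl j))).
have eL j : vf (starf (l j)) (D (l j) n) = fun k =>
    vf (starf (l j)) (vf (l j) (phi n)) k - vf (starf (l j)) (A n (vf (l j) U)) k.
  exact: (vfB (hsl j) (fin_vf (hl j) (rapid_fin (rphi n))) (fA n (fV _ (hl j)))).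
apply/funext => k.
have -> : \sum_j vf (starf (l j)) (D (l j) n) k = \sum_j (vf (starf (l j)) (vf (l j) (phi n)) k -
    vf (starf (l j)) (A n (vf (l j) U)) k) by apply: eq_bigr => j _; rewrite eL.
rewrite /Pop /rem /D0 /D /D'.
have -> : \sum_j (vf (starf (l j)) (vf (l j) (phi n)) k - vf (starf (l j)) (A n (vf (l j) U)) k)
  = \sum_j vf (starf (l j)) (vf (l j) (phi n)) k -
    \sum_j vf (starf (l j)) (A n (vf (l j) U)) k by rewrite sumrB.
have -> : \sum_j (vf (starf (l j)) (A n (vf (l j) U)) k - A n (vf (starf (l j)) (vf (l j) U)) k)
  = \sum_j vf (starf (l j)) (A n (vf (l j) U)) k -
    \sum_j A n (vf (starf (l j)) (vf (l j) U)) k by rewrite sumrB.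
generalize (\sum_j vf (starf (l j)) (vf (l j) (phi n)) k)
  (\sum_j vf (starf (l j)) (A n (vf (l j) U)) k)
  (\sum_j A n (vf (starf (l j)) (vf (l j) U)) k)
  (conv a0 (phi n) k) (vf x0 (phi n) k) (vf z (phi n) k) (vf (starf z) (phi n) k)
  (A n (conv a0 U) k) (A n (vf x0 U) k) (A n (vf z U) k) (A n (vf (starf z) U) k).
by move=> *; ring.
Qed.

Section TestedAgainst.
(** The two tests share one computation: [Q] is the identity for the energy and [Lambda^(-1) X0] for
    the transport term. *)
Variable Q : seqop.
Hypothesis oQ : op1 0 Q.
Hypothesis cQ : forall b, rapidf b -> op1 0 (com (vf b) Q).
Let psi n := Q (phi n).
Let rpsi n : rapid (psi n). Proof. exact: op1_rapid oQ _. Qed.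
Let psi_sg : ube (sg / 2) psi (fun=> 1).
Proof. by apply: (ube_op1 oQ); rewrite addr0. Qed.
Let psi_0 : ube 0 psi (fun=> 1). Proof. exact: ube_mono psi_sg. Qed.

Let vf_psi b n : vf b (psi n) = fun k => com (vf b) Q (phi n) k + Q (vf b (phi n)) k.
Proof. by apply/funext => k; rewrite /com subrK. Qed.

Let vf_psi_e b f : rapidf b -> (forall n, 1 <= f n) -> ube 0 (fun n => vf b (phi n)) f ->
  ube 0 (fun n => vf b (psi n)) f.
Proof.
move=> hb f1 h; have -> : (fun n => vf b (psi n)) =
    fun n k => com (vf b) Q (phi n) k + Q (vf b (phi n)) k.
  by apply/funext => n; exact: vf_psi.
apply: ubeD; last by apply: (ube_op1 oQ); rewrite addr0.
apply: (ube_le f1); apply: (ube_op1 (cQ hb)); by rewrite addr0.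
Qed.

Let dvf_psi b f : rapidf b -> (forall n, 1 <= f n) -> ube 0 (fun n => vf b (phi n)) f ->
  ube (- 0) (fun n k => vf b (psi n) k + dvf b (psi n) k) f.
Proof.
rewrite oppr0 => hb f1 h; apply: ubeD; first exact: vf_psi_e.
by apply: (ube_le f1); apply: (ube_op1 (op_dvf hb)); rewrite addr0.
Qed.

(** By symmetry [A n] moves onto [psi], where the equation can be used. Integrating by parts the
    derivative in front of [D (l j)] costs [L_j psi], hence a single factor [e n]: the bound is
    linear in the energy. *)
Lemma Pphi_tested : bnd (fun n => ip (Pop (phi n)) (psi n)) e.
Proof.
have sgN : - (sg / 2) <= 0 by rewrite oppr_le0.
have fD b n : rapidf b -> fin (D b n).
  move=> hb; apply: finB; first exact/fin_vf/rapid_fin.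
  by apply: fA; exact: fin_vf.
have frem n : fin (rem n) by have [c _ /(_ n) h] := rem_sg; exists (- (sg / 2)), (c * 1).
have E3 n : ip (Pop (phi n)) (psi n) = ip (A n G) (psi n) + ip (rem n) (psi n)
   - \sum_j ip (D (l j) n) (fun k => vf (l j) (psi n) k + dvf (l j) (psi n) k).
  have dl j : fin (vf (starf (l j)) (D (l j) n)) by exact: (fin_vf (hsl j) (fD _ n (hl j))).
  rewrite Pphi_dec ipDl; last 2 first.
  - apply: dual_fr => //; apply: finD => //; apply: fA; exact: Pop_fin.
  - by apply: dual_fr => //; exact: fin_sum.
  rewrite ipDl; last 2 first.
  - by apply: dual_fr => //; apply: fA; exact: Pop_fin.
  - exact: dual_fr.
  have -> : ip (A n (Pop U)) (psi n) = ip (A n G) (psi n).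
    rewrite (ip_A n (Pop_fin hU) (rpsi n)) (ip_A n (rapid_fin hG) (rpsi n)).
    by have [s0 us0 h0] := tcut_finite t n (conv chi (psi n)); exact: weak us0 h0.
  rewrite (ip_sum (index_enum 'I_N) dl (rpsi n)) -sumrN; congr (_ + _).
  by apply: eq_bigr => j _; exact: (ip_vf_star (hl j) (fD _ n (hl j)) (rpsi n)).
have -> : (fun n => ip (Pop (phi n)) (psi n)) = fun n => ip (A n G) (psi n) +
   ip (rem n) (psi n) - \sum_j ip (D (l j) n) (fun k => vf (l j) (psi n) k + dvf (l j) (psi n) k).
  by apply/funext.
have le1 : forall n, (fun=> 1) n <= e n by exact: e1.
apply: bndB; first apply: (bnd_le le1); first apply: bndD.
- apply: (bnd_ip (q := 0)); last by rewrite oppr0.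
  by apply: (ube_op oA); rewrite add0r; apply: ube_cst; exact: hG.
- by apply: (bnd_ip rem_sg); rewrite opprK.
- apply: bnd_sum => j; apply: (bnd_ip (D_0 (hl j) (regl j))).
  exact: dvf_psi.
Qed.

(* Everything in [P] except the transport term, tested against [psi]. *)
Lemma lower_tested f : (forall n, 1 <= f n) ->
  ube 0 (fun n => vf z (phi n)) f ->
  bnd (fun n => ip (conv a0 (phi n)) (psi n) +
    'i * (ip (vf z (phi n)) (psi n) + ip (vf (starf z) (phi n)) (psi n))) f.
Proof.
move=> f1 hzf; apply: bndD.
  apply: (bnd_le f1); apply: (bnd_ip (q := 0)); last by rewrite oppr0.
  by apply: (ube_op1 (op_conv ha)); rewrite addr0.
apply: bndZ; apply: bndD.
  by apply: (bnd_ip' hzf); rewrite oppr0.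
have -> : (fun n => ip (vf (starf z) (phi n)) (psi n)) =
   fun n => - ip (phi n) (fun k => vf z (psi n) k + dvf z (psi n) k).
  apply/funext => n; exact: (ip_vf_star hz (rapid_fin (rphi n)) (rpsi n)).
by apply: bndN; apply: (bnd_ip phi_0); exact: dvf_psi.
Qed.

Lemma Pphi_expand n : ip (Pop (phi n)) (psi n) =
  ip (conv a0 (phi n)) (psi n) + ip (vf x0 (phi n)) (psi n) +
  'i * (ip (vf z (phi n)) (psi n) + ip (vf (starf z) (phi n)) (psi n)) -
  \sum_j ip (vf (l j) (phi n)) (fun k => vf (l j) (psi n) k + dvf (l j) (psi n) k).
Proof.
have fp := rapid_fin (rphi n).
have r1 : fin (conv a0 (phi n)) by exact: fin_conv.
have r2 b : rapidf b -> fin (vf b (phi n)) by move=> hb; exact: fin_vf.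
have du v : fin v -> dual v (psi n) by move=> hv; exact: dual_fr.
have r3 : fin (fun k => vf z (phi n) k + vf (starf z) (phi n) k) by apply: finD; exact: r2.
have r4 j : fin (vf (starf (l j)) (vf (l j) (phi n))) by exact: (fin_vf (hsl j) (r2 _ (hl j))).
rewrite /Pop ipDl; last 2 first.
- by apply: du; apply: finD; [apply: finD => //; exact: r2|exact: finZ].
- by apply: du; exact: fin_sum.
rewrite ipDl; last 2 first.
- by apply: du; apply: finD => //; exact: r2.
- by apply: du; exact: finZ.
rewrite ipDl; last 2 first.
- exact: du.
- by apply: du; exact: r2.
rewrite ipZl; last exact: du.
rewrite ipDl; try by apply: du; exact: r2.
rewrite (ip_sum (index_enum 'I_N) r4 (rpsi n)) -sumrN; congr (_ + _).
by apply: eq_bigr => j _; exact: (ip_vf_star (hl j) (r2 _ (hl j)) (rpsi n)).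
Qed.

Lemma transport_tested : (forall j, ube 0 (fun n => vf (l j) (phi n)) (fun=> 1)) ->
  ube 0 (fun n => vf z (phi n)) (fun=> 1) ->
  bnd (fun n => ip (Pop (phi n)) (psi n)) (fun=> 1) ->
  bnd (fun n => ip (vf x0 (phi n)) (psi n)) (fun=> 1).
Proof.
move=> hL hZ hP.
have -> : (fun n => ip (vf x0 (phi n)) (psi n)) = fun n => ip (Pop (phi n)) (psi n) -
  (ip (conv a0 (phi n)) (psi n) +
    'i * (ip (vf z (phi n)) (psi n) + ip (vf (starf z) (phi n)) (psi n))) +
  \sum_j ip (vf (l j) (phi n)) (fun k => vf (l j) (psi n) k + dvf (l j) (psi n) k).
  by apply/funext => n; rewrite Pphi_expand; ring.
apply: bndD; first by apply: bndB => //; exact: lower_tested.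
by apply: bnd_sum => j; apply: (bnd_ip (hL j)); exact: dvf_psi.
Qed.

End TestedAgainst.

Let op_id : op1 0 (fun v : K -> C => v).
Proof. by move=> q; exists 1 => // _ v B; rewrite addr0 mul1r. Qed.

Let com_id b : rapidf b -> op1 0 (com (vf b) (fun v : K -> C => v)).
Proof.
move=> _ q; exists 0 => // _ v B h; rewrite mul0r.
have -> : com (vf b) (fun v => v) v = fun=> 0 by apply/funext => k; rewrite /com subrr.
exact: bd_0.
Qed.

(** Tested against [phi], the second order part yields the square of [E], and all other terms are at
    most linear in [e]: for [X0] because it is real, for [i Y0] because [z] is dominated by the
    [l j] and its conjugate can be integrated by parts. *)
Lemma energy_bound : exists2 c, 0 <= c & forall n, E n <= c.
Proof.
have hP := Pphi_tested op_id com_id.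
have hlow := lower_tested op_id com_id e1 zphi_e.
have hdl : bnd (fun n => \sum_j ip (vf (l j) (phi n)) (dvf (l j) (phi n))) e.
  apply: bnd_sum => j; apply: (bnd_ip' (Lphi_e j)); rewrite oppr0.
  by apply: (ube_op1 (op_dvf (hl j))); rewrite addr0.
have hdx : bnd (fun n => ip (phi n) (dvf x0 (phi n))) e.
  apply: (@bnd_le _ _ _ (fun=> 1) _ e1); apply: (bnd_ip phi_0); rewrite oppr0.
  by apply: (ube_op1 (op_dvf hx)); rewrite addr0.
have [c1 c10 h1] := bndB (bndB hlow hP) hdl.
have [c2 c20 h2] := hdx.
exists (c1 + c2 + 1) => [|n]; first by rewrite !addr_ge0.
have ipL j := ip_self (rapid_vf (hl j) (rphi n)).
have rl j : rapid (vf (l j) (phi n)) by exact: (rapid_vf (hl j) (rphi n)).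
have S : \sum_j ip (vf (l j) (phi n)) (vf (l j) (phi n)) = ((E n) ^+ 2)%:C.
  rewrite sqr_sqrtr; last by apply: sumr_ge0 => j _; exact: nrm_ge0.
  rewrite rmorph_sum; apply: eq_bigr => j _; rewrite /nE.
  by have [y y0 ->] := ipL j; rewrite nrm_real ger0_norm.
(* A real field is skew-symmetric up to its divergence, so this real part is minus half the real
   part of a pairing with [dvf x0]. *)
have ex : complex.Re (ip (vf x0 (phi n)) (phi n)) <= c2 * e n.
  have fp := rapid_fin (rphi n).
  have rv : rapid (vf x0 (phi n)) by exact: rapid_vf.
  have rd : rapid (dvf x0 (phi n)) by exact: op1_rapid (op_dvf hx) _.
  have := ip_vf (a := x0) (u := phi n) (v := phi n) hx (or_introl (conj fp (rphi n))).
  have -> : (fun j => star (x0 j)) = x0 by rewrite -[RHS]sx.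
  rewrite (ipDr (dual_fr fp rv) (dual_fr fp rd)) (ipC (dual_rf rv fp)).
  set y := ip (vf x0 (phi n)) (phi n); set y' := ip (phi n) (dvf x0 (phi n)) => ye.
  have hy' : `|complex.Re y'| <= c2 * e n := le_trans (nrm_Re _) (h2 n).
  have : complex.Re y = - (complex.Re y + complex.Re y').
    by rewrite {1}ye; case: (y) => ? ?; case: (y') => ? ? /=.
  have := ler_norm (- complex.Re y'); rewrite normrN; have := normr_ge0 (complex.Re y'); lra.
have key : ((E n) ^+ 2)%:C = (ip (conv a0 (phi n)) (phi n) +
    'i * (ip (vf z (phi n)) (phi n) + ip (vf (starf z) (phi n)) (phi n)) -
    ip (Pop (phi n)) (phi n) - \sum_j ip (vf (l j) (phi n)) (dvf (l j) (phi n)))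
    + ip (vf x0 (phi n)) (phi n).
  rewrite -S (Pphi_expand op_id n).
  have -> : \sum_j ip (vf (l j) (phi n)) (fun k => vf (l j) (phi n) k + dvf (l j) (phi n) k)
     = \sum_j ip (vf (l j) (phi n)) (vf (l j) (phi n)) +
       \sum_j ip (vf (l j) (phi n)) (dvf (l j) (phi n)).
    rewrite -big_split; apply: eq_bigr => j _; rewrite ipDr //; apply: dual_rf => //.
      exact: rapid_fin.
    by apply/rapid_fin/(op1_rapid (op_dvf (hl j))).
  ring.
have kR : E n ^+ 2 <= (c1 + c2) * e n.
  have := congr1 (@complex.Re R) key; rewrite [LHS]/= => ->.
  rewrite (raddfD (@complex.Re R)) /= mulrDl lerD //.
  by rewrite (le_trans (ler_norm _)) // (le_trans (nrm_Re _)).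
(* [E^2 <= c (1 + E)] forces [E <= c + 1]. *)
rewrite leNgt; apply/negP => hlt.
have := E0 n; move: kR; rewrite /e; set x := E n in hlt *; set c := c1 + c2 in hlt *.
have cc : 0 <= c by exact: addr_ge0.
move=> kR x_0; have : (c + 1) * (x - 1) < x ^+ 2 by nra.
nra.
Qed.

Let e_bd : exists2 c, 0 <= c & forall n, e n <= c * 1.
Proof.
have [c c0 h] := energy_bound; exists (1 + c) => [|n]; first exact: addr_ge0.
by rewrite mulr1 lerD2l.
Qed.

Let ube_e1 q (f : nat -> K -> C) : ube q f e -> ube q f (fun=> 1).
Proof.
move=> [c c0 h]; have [c' c'0 h'] := e_bd; exists (c * c') => [|n]; first exact: mulr_ge0.
by apply: bd_le (h n); rewrite mulr1 ler_wpM2l // -[c']mulr1.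
Qed.

Let bnd_e1 (x : nat -> C) : bnd x e -> bnd x (fun=> 1).
Proof.
move=> [c c0 h]; have [c' c'0 h'] := e_bd; exists (c * c') => [|n]; first exact: mulr_ge0.
by apply: le_trans (h n) _; rewrite mulr1 ler_wpM2l // -[c']mulr1.
Qed.

(** Both [Q] and its commutators with fields have order 0, and the energy is bounded by now, so
    every term of the tested equation other than the transport term is bounded. *)
Lemma transport_bound : ube (- (1 / 2)) (fun n => vf x0 (phi n)) (fun=> 1).
Proof.
pose Q v := Lam (- 1) (vf x0 v).
have e0 : - 1 + 1 = 0 :> R by ring.
have oQ : op1 0 Q by have := op_comp (op_Lam (- 1)) (op_vf hx); rewrite e0.
have cQ b : rapidf b -> op1 0 (com (vf b) Q).
  by move=> hb; rewrite -e0; apply: com_vf_Lam_comp (op_vf hx) (com_vf_vf hb hx).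
have [c c0 h] := transport_tested oQ cQ (fun j => ube_e1 (Lphi_e j)) (ube_e1 zphi_e)
  (bnd_e1 (Pphi_tested oQ cQ)).
exists (c + 1) => [|n]; first exact: addr_ge0.
apply: bd_of_ip; [by rewrite mulr1 addr_ge0|exact: rapid_vf|].
have -> : - (1 / 2) * 2 = - 1 :> R by field.
rewrite (le_trans (h n)) // !mulr1 sqrrD expr1n mulr1; have := sqr_ge0 c.
set x := c ^+ 2; lra.
Qed.

Lemma phi_gain : ube d phi (fun=> 1).
Proof.
have [c c0 hc] := sube; have [c1 c10 h1] := phi_0.
have [c2 c20 h2] := energy_bound; have [c3 c30 h3] := transport_bound.
exists (c * (c1 + c2 + c3)) => [|n]; first by rewrite mulr_ge0 ?addr_ge0.
rewrite mulr1; apply: hc => //.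
- by apply: bd_le (h1 n); rewrite mulr1 -addrA lerDl addr_ge0.
- move=> j; apply: bd_le (Lphi_E n j); apply: le_trans (h2 n) _.
  by rewrite addrAC lerDr addr_ge0.
- by apply: bd_le (h3 n); rewrite mulr1 lerDr addr_ge0.
Qed.

(** The truncation of [chi u] is [phi n] plus [[T n, chi] u]. This commutator has order [t - 1], so
    it is bounded in H^1, which covers the gain [d <= 1] as well as one application of a field. *)
Lemma bootstrap_step : (exists B, bd (s - sg / 2 + d) (conv chi u) B) /\
  forall j, exists B, bd (s - sg / 2) (vf (l j) (conv chi u)) B.
Proof.
have fcu : fin (conv chi u) by exact: fin_conv.
have dec n : T n (conv chi u) = fun k => phi n k + com (T n) (conv chi) u k.
  by apply/funext => k; rewrite /com addrCA subrr addr0.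
have oc := com_symb_conv sT hchi.
have cu q : q <= 1 -> ube q (fun n => com (T n) (conv chi) u) (fun=> 1).
  move=> q1; apply: (ube_op oc); apply: ube_cst; apply: bdmono regU.
  by move: ts; lra.
split.
  rewrite addrC; apply: ube_tcut; rewrite -/t -/T.
  have -> : (fun n => mult (tcut t n) (conv chi u)) = fun n k => phi n k + com (T n) (conv chi) u k.
    by apply/funext => n; exact: dec.
  by apply: ubeD phi_gain (cu _ _); case/andP: d01.
move=> j; rewrite -[s - _]add0r; apply: ube_tcut; rewrite -/t.
have -> : (fun n => mult (tcut t n) (vf (l j) (conv chi u))) = fun n k =>
   vf (l j) (phi n) k + vf (l j) (com (T n) (conv chi) u) k + com (T n) (vf (l j)) (conv chi u) k.
  apply/funext => n; apply/funext => k.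
  have fc : fin (com (T n) (conv chi) u) by exact: (op_fin n oc).
  have -> : vf (l j) (phi n) k + vf (l j) (com (T n) (conv chi) u) k = vf (l j) (T n (conv chi u)) k.
    by rewrite dec (vfD (hl j) (rapid_fin (rphi n)) fc).
  by rewrite /com addrCA subrr addr0.
apply: ubeD; first apply: ubeD.
- exact: ube_e1.
- by apply: (ube_op1 (op_vf (hl j))); apply: cu; rewrite add0r.
- apply: (ube_op (com_symb_vf sT (hl j))); rewrite add0r; apply: ube_cst.
  have [B hB] := bdmono ts regU; have [c _ hc] := op_conv hchi t.
  by exists (c * B); apply: (hc tt); rewrite addr0.
Qed.

End Bootstrap.

(** * Smooth functions on R^m *)

Section SmoothCalculus.
Context {R : realType}.

(** Recursion on the order supports induction for products and compositions, which the definition by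
    words of derivatives does not; by [smooth_Cn] the two notions agree. *)
Fixpoint Cn {m : nat} n (A : set 'rV[R]_m) (f : 'rV[R]_m -> R) : Prop :=
  (forall x, A x -> {for x, continuous f}) /\
  match n with
  | 0 => True
  | n'.+1 => forall i : 'I_m, (forall x, A x -> derivable f x (delta_mx 0 i)) /\
      Cn n' A (partial i f)
  end.

Lemma near_forall_ord {T : Type} (F : set_system T) (FF : Filter F) m (P : 'I_m -> T -> Prop) :
  (forall i, \forall x \near F, P i x) -> \forall x \near F, forall i, P i x.
Proof. exact: (@filter_forall T 'I_m). Qed.

Section FixedDimension.
Context {m : nat}.
Local Notation X := ('rV[R]_m).
Implicit Types (A : set X) (f g : X -> R) (n : nat) (i : 'I_m).

Lemma Cn_cont n A f x : Cn n A f -> A x -> {for x, continuous f}.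
Proof. by case: n => [|n] [h _] Ax; exact: h. Qed.

Lemma Cn_S n A f : Cn n.+1 A f -> Cn n A f.
Proof.
elim: n f => [|n IH] f [h1 h2]; split=> //.
by move=> i; have [h3 h4] := h2 i; split=> //; exact: IH.
Qed.

Lemma smooth_Cn A f : smooth_rV A f <-> forall n, Cn n A f.
Proof.
split=> [h n|h w].
  suff H w : Cn n A (iter_partial w f) by exact: (H [::]).
  elim: n w => [|n IH] w.
    by split=> // x Ax; have [] := h w x Ax.
  split=> [x Ax|i]; first by have [] := h w x Ax.
  by split=> [x Ax|]; [have [_ /(_ i)] := h w x Ax|exact: (IH (i :: w))].
have H : forall n, Cn n A (iter_partial w f).
  elim: w => [//|i w IH] n /=.
  by have [_ /(_ i)[]] := IH n.+1.
move=> x Ax; split; first exact: Cn_cont (H 0%N) Ax.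
by move=> i; have [_ /(_ i)[]] := H 1%N => h1 _; exact: h1.
Qed.

Lemma near_open (A : set X) x : open A -> A x -> \forall y \near x, A y.
Proof. by move=> oA Ax; exact: open_nbhs_nbhs. Qed.

Lemma partial_ext A f g i x : open A -> A x -> (forall y, A y -> f y = g y) ->
  partial i f x = partial i g x.
Proof.
move=> oA Ax fg; apply: near_eq_derive.
by apply: filterS (near_open oA Ax) => y; exact: fg.
Qed.

Lemma Cn_ext n A f g : open A -> (forall x, A x -> f x = g x) -> Cn n A f -> Cn n A g.
Proof.
move=> oA; have cont f' g' : (forall x, A x -> f' x = g' x) ->
    (forall x, A x -> {for x, continuous f'}) -> forall x, A x -> {for x, continuous g'}.
  move=> fg h x Ax; rewrite /prop_for /continuous_at -(fg x Ax).
  apply: cvg_trans (h x Ax); apply: (@near_eq_cvg _ _ (nbhs x)).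
  by apply: filterS (near_open oA Ax) => y Ay; rewrite fg.
elim: n f g => [|n IH] f g fg [h1 h2].
  by split=> //; exact: cont fg h1.
split=> [|i]; first exact: cont fg h1.
have [h3 h4] := h2 i; split=> [x Ax|].
  apply: near_eq_derivable (h3 x Ax).
  by apply: filterS (near_open oA Ax) => y; exact: fg.
by apply: IH h4 => x Ax; exact: partial_ext fg.
Qed.

Lemma Cn_cst n A c : Cn n A (fun=> c).
Proof.
elim: n c => [|n IH] c; split=> //; try by move=> x _; exact: cst_continuous.
move=> i; split=> [x _|]; first exact: derivable_cst.
rewrite (_ : partial i _ = fun=> 0) //.
by apply/funext => x; exact: derive_cst.
Qed.

Lemma CnD n A f g : open A -> Cn n A f -> Cn n A g -> Cn n A (fun x => f x + g x).
Proof.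
move=> oA; elim: n f g => [|n IH] f g [f1 f2] [g1 g2].
  by split=> // x Ax; exact: (cvgD (f1 x Ax) (g1 x Ax)).
split=> [x Ax|i]; first by exact: (cvgD (f1 x Ax) (g1 x Ax)).
have [f3 f4] := f2 i; have [g3 g4] := g2 i; split=> [x Ax|].
  by apply: derivableD; [exact: f3|exact: g3].
apply: (@Cn_ext _ _ (fun x => partial i f x + partial i g x)) => //; last exact: IH.
by move=> x Ax; rewrite /partial [RHS]deriveD //; [exact: f3|exact: g3].
Qed.

Lemma CnM n A f g : open A -> Cn n A f -> Cn n A g -> Cn n A (fun x => f x * g x).
Proof.
move=> oA; elim: n f g => [|n IH] f g Hf Hg.
  by case: Hf => f1 _; case: Hg => g1 _; split=> // x Ax; exact: (cvgM (f1 x Ax) (g1 x Ax)).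
have [f1 f2] := Hf; have [g1 g2] := Hg.
split=> [x Ax|i]; first by exact: (cvgM (f1 x Ax) (g1 x Ax)).
have [f3 f4] := f2 i; have [g3 g4] := g2 i; split=> [x Ax|].
  by apply: derivableM; [exact: f3|exact: g3].
apply: (@Cn_ext _ _ (fun x => f x * partial i g x + g x * partial i f x)) => //.
  by move=> x Ax; rewrite /partial [RHS]deriveM //; [exact: f3|exact: g3].
by apply: CnD => //; apply: IH => //; exact: Cn_S.
Qed.

Lemma is_derive_line f x v d :
  is_derive x v f d <-> is_derive (0 : R) (1 : R) (fun h : R => f (h *: v + x)) d.
Proof.
have e : (fun h : R => h^-1 *: ((f \o shift x) (h *: v) - f x)) =
   (fun h : R => h^-1 *: (((fun h : R => f (h *: v + x)) \o shift 0) (h *: 1) - (fun h : R => f (h *: v + x)) 0)).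
  by apply/funext => h /=; rewrite addr0 scale0r add0r [_%:A]mulr1.
by split=> -[h1 h2]; split; move: h1 h2; rewrite /derivable /derive e.
Qed.

Lemma Cn_coord n A (j : 'I_m) : Cn n A (fun x => x 0 j).
Proof.
case: n => [|n]; first by split=> // x _; exact: coord_continuous.
split=> [x _|i]; first exact: coord_continuous.
have d x : is_derive x (delta_mx 0 i) (fun x : X => x 0 j) (i == j)%:R.
  apply/is_derive_line.
  have -> : (fun h : R => (h *: delta_mx 0 i + x) 0 j) = (fun h => h * (i == j)%:R + x 0 j).
    by apply/funext => h; rewrite !mxE eqxx /= [j == i]eq_sym.
  by apply: is_derive_eq; rewrite addr0 scaler0 add0r [_%:A]mulr1.
split=> [x _|]; first by have [] := d x.
rewrite (_ : partial i _ = fun=> (i == j)%:R); first exact: Cn_cst.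
by apply/funext => x; rewrite /partial; have [_] := d x.
Qed.

(** Taylor formula along a coordinate line with a prescribed slope [c]; it serves differentiability,
    differentiation under an integral and the comparison of derivatives with difference quotients on
    a grid. *)
Lemma mvt_line f (y : X) i (t c eta : R) :
  (forall s, `|s| <= `|t| -> derivable f (s *: delta_mx 0 i + y) (delta_mx 0 i)) ->
  (forall s, `|s| <= `|t| -> `|partial i f (s *: delta_mx 0 i + y) - c| <= eta) ->
  `|f (t *: delta_mx 0 i + y) - f y - t * c| <= eta * `|t|.
Proof.
move=> df h; pose g s := f (s *: delta_mx 0 i + y).
have dg s : `|s| <= `|t| -> is_derive s (1 : R) g (partial i f (s *: delta_mx 0 i + y)).
  move=> st; have /derivableP/is_derive_line hd := df s st.
  have : is_derive (s - s) (1 : R) (fun h => f (h *: delta_mx 0 i + (s *: delta_mx 0 i + y)))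
      (partial i f (s *: delta_mx 0 i + y)) by rewrite subrr.
  move=> hd2.
  have hs : is_derive s (1 : R) (fun u : R => u - s) 1 by apply: is_derive_eq; rewrite subr0.
  have := is_derive1_comp (g := fun u : R => u - s) hd2 hs.
  rewrite mulr1; congr is_derive; apply/funext => u /=.
  by rewrite addrA -scalerDl subrK.
have cg (a b : R) : (forall s, a <= s <= b -> `|s| <= `|t|) -> {within `[a, b], continuous g}.
  move=> ab; apply: derivable_within_continuous => s; rewrite in_itv /= => /ab /dg [] //.
have [t0|t0|->] := ltgtP t 0.
- have tt s : t <= s <= 0 -> `|s| <= `|t|.
    by case/andP=> ts s0; rewrite !ler0_norm ?(ltW t0) // lerN2.
  have [u|xi] := @MVT R g (fun s => partial i f (s *: delta_mx 0 i + y)) t 0 t0 _ (cg _ _ tt).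
    by rewrite in_itv /= => /andP[a b]; apply: dg; apply: tt; rewrite !ltW.
  rewrite in_itv /= => /andP[a b]; rewrite /g scale0r add0r sub0r => e.
  have -> : f (t *: delta_mx 0 i + y) - f y - t * c =
     (partial i f (xi *: delta_mx 0 i + y) - c) * t.
    by rewrite -[X in X - _]opprB e; ring.
  rewrite normrM ler_wpM2r // h // tt //; by rewrite !ltW.
- have tt s : 0 <= s <= t -> `|s| <= `|t|.
    by case/andP=> s0 ts; rewrite !ger0_norm ?(ltW t0).
  have [u|xi] := @MVT R g (fun s => partial i f (s *: delta_mx 0 i + y)) 0 t t0 _ (cg _ _ tt).
    by rewrite in_itv /= => /andP[a b]; apply: dg; apply: tt; rewrite !ltW.
  rewrite in_itv /= => /andP[a b]; rewrite /g scale0r add0r subr0 => e.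
  have -> : f (t *: delta_mx 0 i + y) - f y - t * c =
     (partial i f (xi *: delta_mx 0 i + y) - c) * t by rewrite e; ring.
  rewrite normrM ler_wpM2r // h // tt //; by rewrite !ltW.
by rewrite scale0r add0r subrr mul0r subr0 normr0 mulr0.
Qed.

Lemma coord_le_norm (x : X) j : `|x 0 j| <= `|x|.
Proof.
rewrite [X in _ <= X]/Num.norm /= mx_normrE.
exact: (le_bigmax_cond 0 (j := ((0 : 'I_1), j)) (P := xpredT) (fun ij => `|x ij.1 ij.2|)).
Qed.

Lemma norm_le_coord (x : X) e : 0 <= e -> (forall j, `|x 0 j| <= e) -> `|x| <= e.
Proof.
move=> e0 h; rewrite [X in X <= _]/Num.norm /= mx_normrE.
apply: bigmax_le => // -[i j] _ /=; rewrite ord1; exact: h.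
Qed.

(** The increment is split along a path that changes one coordinate at a time; [p k] has its first
    [k] coordinates moved. *)
Lemma C1_differential A f x : open A -> Cn 1 A f -> A x -> forall e, 0 < e ->
  \forall h \near (0 : X),
    `|f (h + x) - f x - \sum_i h 0 i * partial i f x| <= e * `|h|.
Proof.
move=> oA [_ hf] Ax e e0.
have m0 : 0 < m.+1%:R :> R by [].
pose eta := e / m.+1%:R; have eta0 : 0 < eta by rewrite divr_gt0.
have hA : \forall y \near x, A y by exact: near_open.
have hp : \forall y \near x, forall i, `|partial i f y - partial i f x| <= eta.
  apply: (@near_forall_ord _ (nbhs x)) => i; have [_ [cp _]] := hf i.
  have /cvgrPdist_le := cp x Ax; move=> /(_ _ eta0).
  by apply: filterS => y; rewrite distrC.
have /nbhs_ballP [r /= r0 hr] : nbhs x [set y | A y /\ forall i, `|partial i f y - partial i f x| <= eta].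
  by apply: filterI.
apply/nbhs_ballP; exists r => //= h; rewrite -ball_normE /= sub0r normrN => hh.
pose p k : X := \row_(j < m) (if (j < k)%N then h 0 j else 0) + x.
have p0 : p 0%N = x by rewrite /p; apply/rowP => j; rewrite !mxE add0r.
have pm : p m = h + x by rewrite /p; apply/rowP => j; rewrite !mxE ltn_ord.
have pS (k : 'I_m) : p k.+1 = h 0 k *: delta_mx 0 k + p k.
  apply/rowP => j; rewrite !mxE eqxx /= addrA; congr (_ + _).
  rewrite ltnS leq_eqVlt -[(j == k :> nat)]/(j == k).
  by case: eqP => [->|_] /=; rewrite ?ltnn ?mulr1 ?addr0 ?mulr0 ?add0r.
have near_p (k : 'I_m) s : `|s| <= `|h 0 k| -> ball x r (s *: delta_mx 0 k + p k).
  move=> sh; rewrite -ball_normE /= distrC /p addrA addrK.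
  apply: le_lt_trans hh; apply: norm_le_coord => // j; rewrite !mxE eqxx /=.
  case: eqP => [->|_]; rewrite ?ltnn ?mulr1 ?addr0 ?mulr0 ?add0r.
    exact: le_trans sh (coord_le_norm _ _).
  by case: ifP; rewrite ?normr0 // coord_le_norm.
have -> : f (h + x) - f x = \sum_(k < m) (f (p k.+1) - f (p k)).
  have := telescope_sumr (fun k => f (p k)) (leq0n m).
  by rewrite big_mkord p0 pm.
rewrite -sumrB (le_trans (ler_norm_sum _ _ _)) //.
apply: (@le_trans _ _ (\sum_(k < m) eta * `|h|)); last first.
  rewrite sumr_const card_ord -mulr_natl mulrA ler_wpM2r // /eta.
  by rewrite mulrC -mulrA ler_piMr ?(ltW e0) // mulrC ler_pdivrMr // mul1r ler_nat.
apply: ler_sum => k _; rewrite pS.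
apply: le_trans (ler_wpM2l (ltW eta0) (coord_le_norm h k)).
apply: mvt_line => s sh.
  by have [] := hf k => + _; apply; have [] := hr _ (near_p k s sh).
by have [_] := hr _ (near_p k s sh).
Qed.

End FixedDimension.

Lemma chain_rule {m : nat} (A : set 'rV[R]_m) (f : 'rV[R]_m -> R) (gam : R -> 'rV[R]_m)
  (d : 'I_m -> R) : open A -> Cn 1 A f -> A (gam 0) ->
  (forall j, is_derive (0 : R) (1 : R) (fun t => gam t 0 j) (d j)) ->
  is_derive (0 : R) (1 : R) (f \o gam) (\sum_j d j * partial j f (gam 0)).
Proof.
move=> oA hf Ag hd; set x := gam 0; set D := \sum_j _.
pose q (h : R) : 'rV[R]_m := gam h - x.
have hq j : (h^-1 * q h 0 j) @[h --> 0^'] --> d j.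
  have [h1 h2] := hd j; rewrite -h2; move/cvg_ex: h1 => [l hl].
  rewrite /derive (cvg_lim _ hl) //.
  by apply: cvg_trans hl; apply: near_eq_cvg; near=> h; rewrite /= addr0 [_%:A]mulr1 /q !mxE.
have cg : gam h @[h --> (0 : R)] --> x.
  apply/cvgrPdist_le => e e0.
  have : \forall h \near (0 : R), forall j, `|x 0 j - gam h 0 j| <= e.
    apply: (@near_forall_ord _ (nbhs (0 : R))) => j.
    have [h1 _] := hd j.
    have /differentiable_continuous/cvgrPdist_le := proj1 (derivable1_diffP _ _) h1.
    by move=> /(_ _ e0).
  apply: filterS => h hh; apply: norm_le_coord; first exact: ltW.
  by move=> j; rewrite !mxE; exact: hh.
have main : (h^-1 * (f (gam h) - f x)) @[h --> 0^'] --> D.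
  have lin : (\sum_j (h^-1 * q h 0 j) * partial j f x) @[h --> 0^'] --> D.
    by apply: cvg_big => [|j _]; [exact: add_continuous|apply: cvgMr_tmp; exact: hq].
  pose M := \sum_j `|d j| + 1.
  have M0 : 0 < M by rewrite ltr_wpDl // sumr_ge0.
  have qM : \forall h \near (0 : R)^', `|h^-1 *: q h| <= M.
    have : \forall h \near (0 : R)^', forall j, `|d j - h^-1 * q h 0 j| <= 1.
      apply: (@near_forall_ord _ (nbhs (0 : R)^')) => j.
      by have /cvgrPdist_le := hq j => /(_ _ ltr01).
    apply: filterS => h hh; apply: norm_le_coord; first exact: ltW.
    move=> j; rewrite !mxE -[X in `|X|](subrK (d j)) (le_trans (ler_normD _ _)) //.
    rewrite [leLHS]addrC /M lerD //; first by rewrite (bigD1 j) //= lerDl sumr_ge0.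
    by have := hh j; rewrite !mxE distrC.
  apply/cvgrPdist_le => e e0.
  have e2 : 0 < e / 2 / M by rewrite !divr_gt0.
  have hdiff := C1_differential oA hf Ag e2.
  have /cvgrPdist_le/(_ _ (divr_gt0 e0 (ltr0n _ 2))) hlin := lin.
  have hdq : \forall h \near (0 : R)^',
      `|f (q h + x) - f x - \sum_i q h 0 i * partial i f x| <= e / 2 / M * `|q h|.
    have hq0 : q h @[h --> (0 : R)] --> (0 : 'rV[R]_m).
      by rewrite -(subrr x); apply: cvgB => //; exact: cvg_cst.
    by move: (hq0 _ hdiff); apply: (@filterS _ (nbhs (0 : R))) => h H _; exact: H.
  near=> h.
  have h0 : h != 0 by near: h; exact: nbhs_dnbhs_neq.
  have H1 : `|D - \sum_j (h^-1 * q h 0 j) * partial j f x| <= e / 2 by near: h; exact: hlin.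
  have H2 : `|f (q h + x) - f x - \sum_i q h 0 i * partial i f x| <= e / 2 / M * `|q h|.
    by near: h; exact: hdq.
  have H3 : `|h^-1 *: q h| <= M by near: h; exact: qM.
  have qx : q h + x = gam h by rewrite /q subrK.
  rewrite qx in H2.
  rewrite -[D](subrK (\sum_j (h^-1 * q h 0 j) * partial j f x)) -addrA.
  rewrite (le_trans (ler_normD _ _)) // [leRHS]splitr lerD //.
  have -> : \sum_j (h^-1 * q h 0 j) * partial j f x - h^-1 * (f (gam h) - f x) =
     - (h^-1 * (f (gam h) - f x - \sum_i q h 0 i * partial i f x)).
    rewrite [X in _ = - X]mulrBr opprB mulr_sumr; congr (_ - _); apply: eq_bigr => j _.
    by rewrite mulrA.
  rewrite normrN normrM.
  apply: (@le_trans _ _ (`|h^-1| * (e / 2 / M * `|q h|))).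
    by rewrite ler_wpM2l.
  rewrite mulrCA -mx_normZ -[leRHS](divfK (lt0r_neq0 M0)) ler_wpM2l //.
  by rewrite !divr_ge0 // ?(ltW e0) ?(ltW M0).
split.
  apply/cvg_ex; exists D; apply: cvg_trans main; apply: near_eq_cvg.
  by near=> h; rewrite /= addr0 [_%:A]mulr1.
apply: cvg_lim => //; apply: cvg_trans main; apply: near_eq_cvg.
by near=> h; rewrite /= addr0 [_%:A]mulr1.
Unshelve. all: by end_near. Qed.

End SmoothCalculus.

Section SmoothClosure.
Context {R : realType}.

Lemma continuous_rV {m n : nat} (Phi : 'rV[R]_m -> 'rV[R]_n) x :
  (forall j, {for x, continuous (fun y => Phi y 0 j)}) -> {for x, continuous Phi}.
Proof.
move=> h; rewrite /prop_for /continuous_at.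
apply/(@cvgrPdist_le _ _ _ (nbhs x) _) => e e0.
have : \forall y \near x, forall j, `|Phi x 0 j - Phi y 0 j| <= e.
  apply: (@near_forall_ord _ (nbhs x)) => j.
  by have /cvgrPdist_le := h j => /(_ _ e0).
apply: filterS => y hy; apply: norm_le_coord; first exact: ltW.
by move=> j; rewrite !mxE; exact: hy.
Qed.

Lemma Cn_le {m : nat} (A : set 'rV[R]_m) f n k : (n <= k)%N -> Cn k A f -> Cn n A f.
Proof.
move=> /subnK <-; elim: (k - n)%N => [//|d IH]; rewrite addSn => /Cn_S; exact: IH.
Qed.

Lemma Cn_sum {m : nat} (A : set 'rV[R]_m) n (I : Type) (s : seq I) (F : I -> 'rV[R]_m -> R) :
  open A -> (forall i, Cn n A (F i)) -> Cn n A (fun x => \sum_(i <- s) F i x).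
Proof.
move=> oA hF; elim: s => [|i s IH].
  by rewrite (_ : (fun x => _) = fun=> 0); [exact: Cn_cst|apply/funext => x; rewrite big_nil].
rewrite (_ : (fun x => _) = fun x => F i x + \sum_(j <- s) F j x); first exact: CnD.
by apply/funext => x; rewrite big_cons.
Qed.

Lemma Cn_comp {m p : nat} n (A : set 'rV[R]_m) (B : set 'rV[R]_p) f (Phi : 'rV[R]_m -> 'rV[R]_p) :
  open A -> open B -> (forall x, A x -> B (Phi x)) -> Cn n B f ->
  (forall j, Cn n A (fun x => Phi x 0 j)) -> Cn n A (f \o Phi).
Proof.
move=> oA oB AB; elim: n f => [|n IH] f hf hPhi.
  split=> // x Ax; apply: continuous_comp; last by case: hf => h _; apply: h; exact: AB.
  by apply: continuous_rV => j; case: (hPhi j) => h _; exact: h.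
have cP x : A x -> {for x, continuous Phi}.
  by move=> Ax; apply: continuous_rV => j; exact: Cn_cont (hPhi j) Ax.
split=> [x Ax|i].
  apply: continuous_comp; first exact: cP.
  exact: Cn_cont hf (AB _ Ax).
have hf1 : Cn 1 B f by exact: Cn_le hf.
have d x : A x -> is_derive x (delta_mx 0 i) (f \o Phi)
    (\sum_j partial i (fun x => Phi x 0 j) x * partial j f (Phi x)).
  move=> Ax; apply/is_derive_line.
  have := @chain_rule R p B f (fun t : R => Phi (t *: delta_mx 0 i + x))
    (fun j => partial i (fun x => Phi x 0 j) x) oB hf1.
  rewrite scale0r add0r => /(_ (AB x Ax)); apply.
  move=> j; apply/(is_derive_line (fun x => Phi x 0 j)); apply/derivableP.
  by have [_ /(_ i)[h _]] := hPhi j; exact: h.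
split=> [x Ax|]; first by have [] := d x Ax.
apply: (@Cn_ext _ _ _ _ (fun x => \sum_j partial i (fun x => Phi x 0 j) x * partial j f (Phi x))) => //.
  by move=> x Ax; rewrite /partial; have [_ ->] := d x Ax.
apply: Cn_sum => // j; apply: CnM => //; first by have [_ /(_ i)[]] := hPhi j.
apply: (IH (partial j f)); first by have [_ /(_ j)[]] := hf.
by move=> k; exact: Cn_S (hPhi k).
Qed.

(** A family of one-variable functions closed under differentiation, up to constants, is treated by
    a single induction. Its instances are real powers, sine and cosine, and the functions
    [flat p]. *)
Lemma Cn_outer {m : nat} (I : Type) (G : I -> R -> R) (D : set R) :
  (forall i, exists c j, forall x, D x -> is_derive x (1 : R) (G i) (c * G j x)) ->
  forall n i (A : set 'rV[R]_m) f, open A -> (forall x, A x -> D (f x)) -> Cn n A f ->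
  Cn n A (fun x => G i (f x)).
Proof.
move=> hG n i A f oA AD; elim: n i => [|n IH] i hf.
  have [c [j hc]] := hG i; split=> // x Ax.
  apply: continuous_comp; first exact: Cn_cont hf Ax.
  apply: differentiable_continuous; apply/derivable1_diffP.
  by have [] := hc _ (AD x Ax).
have [c [j hc]] := hG i.
split=> [x Ax|k].
  apply: continuous_comp; first exact: Cn_cont hf Ax.
  apply: differentiable_continuous; apply/derivable1_diffP.
  by have [] := hc _ (AD x Ax).
have [_ /(_ k)[df cf]] := hf.
have d x : A x -> is_derive x (delta_mx 0 k) (fun x => G i (f x)) (c * G j (f x) * partial k f x).
  move=> Ax; apply/is_derive_line.
  apply: (@is_derive1_comp R (G i) (fun t : R => f (t *: delta_mx 0 k + x))).
    by rewrite scale0r add0r; apply: hc; exact: AD.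
  by apply/is_derive_line; apply/derivableP; exact: df.
split=> [x Ax|]; first by have [] := d x Ax.
apply: (@Cn_ext _ _ _ _ (fun x => c * G j (f x) * partial k f x)) => //.
  by move=> x Ax; rewrite /partial; have [_ ->] := d x Ax.
apply: CnM => //; apply: CnM => //; first exact: Cn_cst.
by apply: IH; exact: Cn_S.
Qed.

(* An opaque copy of [smooth_rV], so that failing unifications are not unfolded. *)
Variant smo {m : nat} (A : set 'rV[R]_m) (f : 'rV[R]_m -> R) : Prop :=
  Smo of smooth_rV A f.

Lemma smo_rV {m : nat} (A : set 'rV[R]_m) (f : 'rV[R]_m -> R) : smo A f <-> smooth_rV A f.
Proof. by split=> [[]|h]; [|split]. Qed.

Lemma smoP {m : nat} (A : set 'rV[R]_m) (f : 'rV[R]_m -> R) : smo A f <-> forall n, Cn n A f.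
Proof. by split=> [[/smooth_Cn]|/smooth_Cn h]; [|split]. Qed.

Section Smooth.
Context {m : nat}.
Local Notation X := ('rV[R]_m).
Implicit Types (A : set X) (f g : X -> R).

Lemma smooth_ext A f g : open A -> (forall x, A x -> f x = g x) ->
  smo A f -> smo A g.
Proof. by move=> oA e /smoP h; apply/smoP => n; exact: Cn_ext (h n). Qed.
Lemma smooth_cst A c : smo A (fun=> c).
Proof. by apply/smoP => n; exact: Cn_cst. Qed.
Lemma smooth_coord A (j : 'I_m) : smo A (fun x : X => x 0 j).
Proof. by apply/smoP => n; exact: Cn_coord. Qed.
Lemma smoothD A f g : open A -> smo A f -> smo A g -> smo A (fun x => f x + g x).
Proof. by move=> oA /smoP a /smoP b; apply/smoP => n; exact: CnD. Qed.
Lemma smoothM A f g : open A -> smo A f -> smo A g -> smo A (fun x => f x * g x).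
Proof. by move=> oA /smoP a /smoP b; apply/smoP => n; exact: CnM. Qed.
Lemma smoothN A f : open A -> smo A f -> smo A (fun x => - f x).
Proof.
move=> oA hf; have := smoothM oA (@smooth_cst A (-1)) hf.
by rewrite (_ : (fun x => -1 * f x) = fun x => - f x) //; apply/funext => x; rewrite mulN1r.
Qed.
Lemma smoothB A f g : open A -> smo A f -> smo A g -> smo A (fun x => f x - g x).
Proof. by move=> oA hf hg; apply: smoothD => //; exact: smoothN. Qed.
Lemma smooth_sum A (I : Type) (s : seq I) (F : I -> X -> R) : open A ->
  (forall i, smo A (F i)) -> smo A (fun x => \sum_(i <- s) F i x).
Proof.
move=> oA h; apply/smoP => n; apply: Cn_sum => // i.
exact: (proj1 (smoP _ _) (h i)).
Qed.
Lemma smooth_prod A (I : Type) (s : seq I) (F : I -> X -> R) : open A ->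
  (forall i, smo A (F i)) -> smo A (fun x => \prod_(i <- s) F i x).
Proof.
move=> oA hF; elim: s => [|i s IH].
  by rewrite (_ : (fun x => _) = fun=> 1); [exact: smooth_cst|apply/funext => x; rewrite big_nil].
rewrite (_ : (fun x => _) = fun x => F i x * \prod_(j <- s) F j x); first exact: smoothM.
by apply/funext => x; rewrite big_cons.
Qed.
Lemma smooth_partial A f i : smo A f -> smo A (partial i f).
Proof.
case=> h; split=> w x Ax; have := h (rcons w i) x Ax.
by rewrite /iter_partial foldr_rcons.
Qed.
Lemma smooth_sub A B f : B `<=` A -> smo A f -> smo B f.
Proof. by move=> BA [h]; split=> w x /BA; exact: h. Qed.
Lemma smooth_cover A f : (forall x, A x -> exists2 B, B x & smo B f) -> smo A f.
Proof. by move=> h; split=> w x /h[B Bx [hB]]; exact: hB. Qed.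
Lemma smooth_continuous A f x : smo A f -> A x -> {for x, continuous f}.
Proof. by move=> [h] /(h [::] x)[]. Qed.
Lemma smooth_derivable A f x i : smo A f -> A x -> derivable f x (delta_mx 0 i).
Proof. by move=> [h] /(h [::] x)[_]; exact. Qed.

Lemma smooth_outer (I : Type) (G : I -> R -> R) (D : set R) :
  (forall i, exists c j, forall x, D x -> is_derive x (1 : R) (G i) (c * G j x)) ->
  forall i A f, open A -> (forall x, A x -> D (f x)) -> smo A f ->
  smo A (fun x => G i (f x)).
Proof.
by move=> hG i A f oA AD /smoP h; apply/smoP => n; exact: (Cn_outer hG).
Qed.

Lemma smooth_powR A f a : open A -> (forall x, A x -> 0 < f x) -> smo A f ->
  smo A (fun x => f x `^ a).
Proof.
move=> oA f0 hf; apply: (smooth_outer (G := fun a x => x `^ a) (D := [set x | 0 < x])) => // b.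
by exists b, (b - 1) => x x0; exact: is_derive1_powR.
Qed.

Lemma smooth_inv A f : open A -> (forall x, A x -> f x != 0) -> smo A f ->
  smo A (fun x => (f x)^-1).
Proof.
move=> oA f0 hf.
(* Squaring makes the base positive, so that real powers apply whatever the sign of [f]. *)
apply: (@smooth_ext _ (fun x => f x * (f x * f x) `^ (-1))) => //.
  move=> x Ax; have fx := f0 x Ax.
  rewrite powRN powRr1; last by rewrite -expr2 sqr_ge0.
  by field.
apply: smoothM => //; apply: smooth_powR => //; last exact: smoothM.
by move=> x Ax; rewrite -expr2 exprn_even_gt0 // f0.
Qed.

Lemma smooth_sqrt A f : open A -> (forall x, A x -> 0 < f x) -> smo A f ->
  smo A (fun x => Num.sqrt (f x)).
Proof.
move=> oA f0 hf; apply: (@smooth_ext _ (fun x => f x `^ (2^-1))) => //.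
  by move=> x Ax; rewrite powR12_sqrt // ltW // f0.
exact: smooth_powR.
Qed.

Lemma smooth_sin_cos (b : bool) A f : open A -> smo A f ->
  smo A (fun x => (if b then cos else @sin R) (f x)).
Proof.
move=> oA hf; apply: (smooth_outer (G := fun (b : bool) x => (if b then cos else @sin R) x)
  (D := setT)) => // -[].
  exists (-1), false => x _; rewrite mulN1r; exact: is_derive_cos.
by exists 1, true => x _; rewrite mul1r; exact: is_derive_sin.
Qed.

Lemma smooth_det A (p : nat) (F : X -> 'M[R]_p) : open A ->
  (forall i j, smo A (fun x => F x i j)) -> smo A (fun x => \det (F x)).
Proof.
move=> oA h; rewrite /determinant; apply: smooth_sum => // s.
apply: smoothM => //; first exact: smooth_cst.
by apply: smooth_prod => // i; exact: h.
Qed.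

End Smooth.

Lemma smooth_comp {m p : nat} (A : set 'rV[R]_m) (B : set 'rV[R]_p) f (Phi : 'rV[R]_m -> 'rV[R]_p) :
  open A -> open B -> (forall x, A x -> B (Phi x)) -> smo B f ->
  (forall j, smo A (fun x => Phi x 0 j)) -> smo A (f \o Phi).
Proof.
move=> oA oB AB /smoP hf hPhi; apply/smoP => n.
apply: (Cn_comp oA oB AB (hf n)) => j; exact: (proj1 (smoP _ _) (hPhi j)).
Qed.

End SmoothClosure.

Section Bump.
Context {R : realType}.

Definition flat (p : {poly R}) (x : R) : R := if 0 < x then p.[x^-1] * expR (- x^-1) else 0.

Lemma horner_bound (p : {poly R}) : exists C, forall y : R, 1 <= y -> `|p.[y]| <= C * y ^+ (size p).
Proof.
exists (\sum_(i < size p) `|p`_i|) => y y1; rewrite horner_coef mulr_suml.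
apply: le_trans (ler_norm_sum _ _ _) _; apply: ler_sum => i _.
rewrite normrM ler_wpM2l // normrX ger0_norm ?(le_trans ler01) //.
by rewrite ler_weXn2l // ltnW.
Qed.

(** From expR (y / N) >= y / N one gets expR (- y) <= (N / y)^N; the choice of [N] beats the growth
    of [p] and leaves two powers of [x], enough for a vanishing derivative at 0. *)
Lemma flat_le (p : {poly R}) : exists C, 0 <= C /\ forall x, `|x| <= 1 -> `|flat p x| <= C * x ^+ 2.
Proof.
have [D hD] := horner_bound p; pose N := (size p + 2)%N.
have D0 : 0 <= D.
  by apply: le_trans (_ : `|p.[1]| <= _) => //; have := hD 1 (lexx _); rewrite expr1n mulr1.
exists (D * N%:R ^+ N); split=> [|x x1]; first by rewrite mulr_ge0 ?exprn_ge0.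
rewrite /flat; case: ifPn => x0; last by rewrite normr0 mulr_ge0 ?sqr_ge0 ?mulr_ge0 ?exprn_ge0.
rewrite ger0_norm ?(ltW x0) // in x1.
set y := x^-1; have y1 : 1 <= y by rewrite invf_ge1.
have y0 : 0 < y by rewrite invr_gt0.
have N0 : 0 < N%:R :> R by rewrite ltr0n /N addn2.
have ey : expR (- y) <= N%:R ^+ N / y ^+ N.
  rewrite expRN -[leRHS]invrK lef_pV2 ?posrE ?expR_gt0 ?invr_gt0 ?divr_gt0 ?exprn_gt0 //.
  have -> : (N%:R ^+ N / y ^+ N)^-1 = (y / N%:R) ^+ N by rewrite invf_div expr_div_n.
  have -> : expR y = expR (y / N%:R) ^+ N.
    by rewrite -expRM_natl mulrC divfK // lt0r_neq0.
  rewrite lerXn2r ?nnegrE ?divr_ge0 ?expR_ge0 ?(ltW y0) ?(ltW N0) //.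
  by rewrite (le_trans _ (expR_ge1Dx _)) // lerDr.
rewrite normrM (ger0_norm (expR_ge0 _)).
rewrite (le_trans (ler_pM _ _ (hD y y1) ey)) ?expR_ge0 //.
rewrite mulrACA -[leRHS]mulrA -[leLHS]mulrA ler_wpM2l //.
have -> : y ^+ size p / y ^+ N = x ^+ 2.
  rewrite /N exprD invfM mulrA mulfV ?expf_neq0 ?gt_eqF //.
  by rewrite mul1r /y exprVn invrK.
by [].
Qed.

Lemma is_derive_flat (p : {poly R}) (x : R) :
  is_derive x (1 : R) (flat p) (1 * flat ('X^2 * (p - p^`())) x).
Proof.
rewrite mul1r; have [x0|x0|->] := ltgtP x 0.
- rewrite {2}/flat ltNge (ltW x0) /=.
  apply: (@near_eq_is_derive _ _ _ (fun=> 0)) (is_derive_cst 0 x 1).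
  by near=> y; rewrite /flat ltNge ltW //; near: y; exact: lt_nbhsl.
- rewrite {2}/flat x0.
  apply: (@near_eq_is_derive _ _ _ (fun y : R => p.[y^-1] * expR (- y^-1))).
    by near=> y; rewrite /flat ifT //; near: y; exact: lt_nbhsr.
  have xn : x != 0 by rewrite gt_eqF.
  have dV : is_derive x (1 : R) (fun y : R => y^-1) (- x ^- 2).
    have := @is_deriveV R (fun y : R => y) x 1 1 xn (@is_derive_id R R x 1).
    by rewrite [_%:A]mulr1 /=; congr is_derive.
  have d1 := is_derive1_comp (is_derive_poly p x^-1) dV.
  have dN : is_derive x (1 : R) (fun y : R => - y^-1) (x ^- 2).
    by have := is_deriveN dV; rewrite opprK.
  have d2 := is_derive1_comp (g := fun y : R => - y^-1) (is_derive_expR (- x^-1)) dN.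
  have d3 := is_deriveM d1 d2.
  suff -> : ('X^2 * (p - p^`())).[x^-1] * expR (- x^-1) =
      (horner p \o GRing.inv) x *: (expR (- x^-1) / x ^+ 2) +
      (expR \o (fun y : R => - y^-1)) x *: (p^`().[x^-1] * - x ^- 2) by exact: d3.
  by rewrite /= !hornerE /= /GRing.scale /=; field.
(* At 0 the quadratic bound makes the difference quotient tend to 0. *)
- rewrite {2}/flat ltxx; have [C [C0 hC]] := flat_le p.
  have main : h^-1 *: (flat p (h *: 1 + 0) - flat p 0) @[h --> (0 : R)^'] --> (0 : R).
    apply/cvgr0Pnorm_le => e e0; near=> h.
    have h0 : h != 0 by near: h; exact: nbhs_dnbhs_neq.
    have h1 : `|h| <= Num.min 1 (e / (C + 1)).
      near: h; apply: dnbhs0_le; rewrite lt_min ltr01 divr_gt0 //.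
      by rewrite ltr_wpDl.
    rewrite addr0 [_%:A]mulr1 {2}/flat ltxx subr0 normrM normfV.
    rewrite ler_pdivrMl ?normr_gt0 // (le_trans (hC h _)) //.
      by rewrite (le_trans h1) // ge_min lexx.
    rewrite -real_normK ?num_real // expr2 mulrCA ler_wpM2l //.
    rewrite (@le_trans _ _ ((C + 1) * (e / (C + 1)))) //.
      apply: ler_pM => //; first by rewrite lerDl.
      by rewrite (le_trans h1) // ge_min lexx orbT.
    by rewrite mulrCA divff ?mulr1 // gt_eqF // ltr_wpDl.
  split; first by apply/cvg_ex; exists 0.
  by apply: cvg_lim.
Unshelve. all: by end_near. Qed.

Definition ramp (x : R) : R := flat 1 x / (flat 1 x + flat 1 (1 - x)).

Lemma flat1_ge0 x : 0 <= flat 1 x.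
Proof. by rewrite /flat hornerE mul1r; case: ifP => // _; exact: expR_ge0. Qed.
Lemma flat1_gt0 x : 0 < x -> 0 < flat 1 x.
Proof. by move=> x0; rewrite /flat x0 hornerE mul1r expR_gt0. Qed.
Lemma flat1_eq0 x : x <= 0 -> flat 1 x = 0.
Proof. by move=> x0; rewrite /flat ltNge x0. Qed.
Lemma ramp_den x : 0 < flat 1 x + flat 1 (1 - x).
Proof.
have [x0|x0] := leP x 0.
  by rewrite ltr_wpDl ?flat1_ge0 // flat1_gt0 // subr_gt0 (le_lt_trans x0).
by rewrite ltr_wpDr ?flat1_ge0 // flat1_gt0.
Qed.
Lemma ramp0 x : x <= 0 -> ramp x = 0.
Proof. by move=> x0; rewrite /ramp flat1_eq0 // mul0r. Qed.
Lemma ramp1 x : 1 <= x -> ramp x = 1.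
Proof.
move=> x1; rewrite /ramp [flat 1 (1 - x)]flat1_eq0 ?subr_le0 // addr0 divff //.
by rewrite gt_eqF // flat1_gt0 // (lt_le_trans ltr01).
Qed.
Lemma ramp_ge0 x : 0 <= ramp x.
Proof. by rewrite divr_ge0 ?flat1_ge0 // ltW // ramp_den. Qed.

Context {m : nat}.
Local Notation X := ('rV[R]_m).

Lemma smooth_flat (A : set X) f p : open A -> smo A f -> smo A (fun x => flat p (f x)).
Proof.
move=> oA hf; apply: (smooth_outer (D := setT)) => // q.
by exists 1, ('X^2 * (q - q^`())) => x _; exact: is_derive_flat.
Qed.

Lemma smooth_ramp (A : set X) f : open A -> smo A f -> smo A (fun x => ramp (f x)).
Proof.
move=> oA hf; apply: smoothM => //; first exact: smooth_flat.
apply: smooth_inv => //; first by move=> x _; rewrite gt_eqF ?ramp_den.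
apply: smoothD => //; first exact: smooth_flat.
by apply: smooth_flat => //; apply: smoothB => //; exact: smooth_cst.
Qed.

(* Equal to 1 on the box of radius [a] around [q], and to 0 outside that of radius [b]. *)
Definition bump (q : X) (a b : R) (x : X) : R :=
  \prod_j ramp ((b ^+ 2 - (x 0 j - q 0 j) ^+ 2) / (b ^+ 2 - a ^+ 2)).

Lemma smooth_bump (A : set X) q a b : open A -> smo A (bump q a b).
Proof.
move=> oA; apply: smooth_prod => // j; apply: smooth_ramp => //.
apply: smoothM => //; last exact: smooth_cst.
apply: smoothB => //; first exact: smooth_cst.
have h : smo A (fun x : X => x 0 j - q 0 j).
  by apply: smoothB => //; [exact: smooth_coord|exact: smooth_cst].
exact: smoothM.
Qed.

Lemma bump_ge0 q a b x : 0 <= bump q a b x.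
Proof. by apply: prodr_ge0 => j _; exact: ramp_ge0. Qed.
Lemma bump_eq1 (q : X) a b (x : X) : 0 <= a -> a < b -> `|x - q| <= a -> bump q a b x = 1.
Proof.
move=> a0 ab xq; rewrite /bump big1 // => j _; apply: ramp1.
have ab2 : 0 < b ^+ 2 - a ^+ 2 by rewrite subr_gt0 ltrXn2r // ?(le_trans a0) ?ltW.
rewrite ler_pdivlMr // mul1r lerD2l lerN2.
rewrite -real_normK ?num_real // lerXn2r ?nnegrE //.
by apply: le_trans xq; have := coord_le_norm (x - q : X) j; rewrite !mxE.
Qed.
Lemma bump_eq0 (q : X) a b (x : X) : 0 <= a -> a < b -> (exists j, b <= `|x 0 j - q 0 j|) -> bump q a b x = 0.
Proof.
move=> a0 ab [j hj]; rewrite /bump (bigD1 j) //= ramp0 ?mul0r //.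
have ab2 : 0 < b ^+ 2 - a ^+ 2 by rewrite subr_gt0 ltrXn2r // ?(le_trans a0) ?ltW.
rewrite pmulr_lle0 ?invr_gt0 // subr_le0 -[leRHS]real_normK ?num_real //.
by rewrite lerXn2r ?nnegrE // (le_trans a0) // ltW.
Qed.

End Bump.

Section Hadamard.
Context {R : realType} {m : nat}.
Local Notation X := ('rV[R]_m).
Local Notation mu := (@lebesgue_measure R).
Implicit Types (f phi : X -> R).

Let unit_itv : set R := `[(0 : R), 1]%classic.

Lemma unit_integrable (g : R -> R) : continuous g -> mu.-integrable unit_itv (EFin \o g).
Proof.
move=> cg; apply: continuous_compact_integrable; first exact: segment_compact.
exact: continuous_subspaceT.
Qed.

Lemma unit_measurable : measurable (unit_itv : set (measurableTypeR R)).
Proof. exact: measurable_itv. Qed.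

Lemma unit_mu : mu unit_itv = 1%E.
Proof.
have := lebesgue_measure_itv `[(0 : R), 1]%R.
by rewrite /= lte_fin ltr01 oppr0 adde0.
Qed.

Lemma unit_int_cst c : \int[mu]_(s in unit_itv) cst c s = c.
Proof.
have h := @Rintegral_cst _ _ R mu unit_itv unit_measurable c.
rewrite h; apply: etrans (mulr1 c); congr (c * _).
exact: (congr1 (@fine R) unit_mu).
Qed.

Lemma unit_int_bound (g : R -> R) e : continuous g ->
  (forall s, unit_itv s -> `|g s| <= e) -> `|\int[mu]_(s in unit_itv) g s| <= e.
Proof.
move=> cg ge; have ig := unit_integrable cg; have mI := unit_measurable.
have h1 := le_normr_Rintegral mI ig.
apply: (@le_trans _ R _ _ _ h1).
apply: (@le_trans _ _ (\int[mu]_(s in unit_itv) cst e s)).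
  apply: le_Rintegral => //.
    by apply: (unit_integrable (g := fun s => `|g s|)) => s; apply: cvg_norm; exact: cg.
  by apply: unit_integrable; exact: cst_continuous.
by rewrite unit_int_cst.
Qed.

Section Segment.
Variable y : X.

Definition seg (s : R) (x : X) : X := s *: (x - y) + y.

Lemma continuous_seg (s : R) (x : X) : seg p.1 p.2 @[p --> (s, x)] --> seg s x.
Proof.
apply: cvgD; last exact: cvg_cst.
apply: cvgZ; first exact: cvg_fst.
by apply: cvgB; [exact: cvg_snd|exact: cvg_cst].
Qed.

Lemma continuous_segl (x : X) : continuous (seg ^~ x).
Proof. by move=> s; apply: cvgD; [apply: cvgZr_tmp; exact: cvg_id|exact: cvg_cst]. Qed.

(** Compactness of the unit interval gives continuity uniform in the parameter, and replaces
    dominated convergence under the integral. *)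
Lemma seg_uniform phi x e : continuous phi -> 0 < e ->
  \forall x' \near x, forall s, unit_itv s -> `|phi (seg s x') - phi (seg s x)| <= e.
Proof.
move=> cphi e0.
have /compact_near_coveringP H : compact unit_itv by exact: segment_compact.
apply: (H _ (nbhs x) (fun x' s => `|phi (seg s x') - phi (seg s x)| <= e)) => s0 _.
have e2 : 0 < e / 2 by rewrite divr_gt0.
have c0 : phi (seg p.1 p.2) @[p --> (s0, x)] --> phi (seg s0 x).
  exact: (cvg_comp _ phi (@continuous_seg s0 x) (cphi _)).
have /cvgrPdist_le/(_ _ e2) h1 := c0.
have h2 : \forall p \near (s0, x), `|phi (seg s0 x) - phi (seg p.1 x)| <= e / 2.
  have : phi (seg p.1 x) @[p --> (s0, x)] --> phi (seg s0 x).
    apply: (cvg_comp (fun p : R * X => seg p.1 x) phi _ (cphi _)).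
    apply: (cvg_comp (fst : R * X -> R) (seg ^~ x) _ (@continuous_segl x s0)).
    exact: cvg_fst.
  by move=> /cvgrPdist_le/(_ _ e2).
near=> p; rewrite -(subrKA (phi (seg s0 x))) (le_trans (ler_normD _ _)) // [leRHS]splitr.
by apply: lerD; [rewrite distrC; near: p; exact: h1|near: p; exact: h2].
Unshelve. all: by end_near. Qed.

(** The power of [s] makes the family closed under differentiation: each derivative in [x] brings
    out one factor [s]. *)
Definition segI (k : nat) phi (x : X) : R :=
  \int[mu]_(s in unit_itv) (s ^+ k * phi (seg s x)).

Lemma continuous_segI_arg k phi (x : X) : continuous phi -> continuous (fun s : R => s ^+ k * phi (seg s x)).
Proof.
move=> cphi s; apply: cvgM; first exact: exprn_continuous.
exact: (cvg_comp _ phi (@continuous_segl x s) (cphi _)).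
Qed.

Lemma unit_expr k s : unit_itv s -> `|s ^+ k| <= 1.
Proof.
rewrite /unit_itv /= in_itv /= => /andP[s0 s1].
by rewrite normrX ger0_norm // exprn_ile1.
Qed.

Lemma continuous_segI k phi : continuous phi -> continuous (segI k phi).
Proof.
move=> cphi x; apply/(@cvgrPdist_le _ _ _ (nbhs x) _) => e e0.
apply: filterS (@seg_uniform phi x e cphi e0) => x' hx'.
rewrite /segI -RintegralB; [|exact: unit_measurable|exact/unit_integrable/continuous_segI_arg..].
apply: unit_int_bound => [s|s us].
  by apply: cvgB; exact: continuous_segI_arg.
by rewrite -mulrBr normrM distrC -[leRHS]mul1r ler_pM // ?unit_expr // hx'.
Qed.

Lemma is_derive_segI k phi i x : continuous phi -> (forall z, derivable phi z (delta_mx 0 i)) ->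
  continuous (partial i phi) ->
  is_derive x (delta_mx 0 i) (segI k phi) (segI k.+1 (partial i phi) x).
Proof.
move=> cphi dphi cp; set D := segI _ _ x.
have main : h^-1 *: (segI k phi (h *: delta_mx 0 i + x) - segI k phi x) @[h --> (0 : R)^'] --> D.
  apply/cvgrPdist_le => e e0.
  have hu := @seg_uniform (partial i phi) x e cp e0.
  have hu' : \forall h \near (0 : R), forall t : R, `|t| <= `|h| ->
      forall s, unit_itv s -> `|partial i phi (seg s (t *: delta_mx 0 i + x)) - partial i phi (seg s x)| <= e.
    move/nbhs_ballP: hu => [r /= r0 hr]; apply/nbhs_ballP; exists r => //= h.
    rewrite -ball_normE /= sub0r normrN => hh t th; apply: hr; rewrite -ball_normE /=.
    rewrite distrC addrK; apply: le_lt_trans hh; apply: norm_le_coord => // j.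
    by rewrite !mxE eqxx /=; case: eqP; rewrite ?mulr1 ?mulr0 ?normr0.
  near=> h.
  have h0 : h != 0 by near: h; exact: nbhs_dnbhs_neq.
  have hh : forall t : R, `|t| <= `|h| ->
      forall s, unit_itv s -> `|partial i phi (seg s (t *: delta_mx 0 i + x)) - partial i phi (seg s x)| <= e.
    by near: h; move: hu'; apply: (@filterS _ (nbhs (0 : R))) => h H _; exact: H.
  pose c1 a := @continuous_segI_arg k phi a cphi.
  pose c2 a := @continuous_segI_arg k.+1 (partial i phi) a cp.
  have -> : D - h^-1 *: (segI k phi (h *: delta_mx 0 i + x) - segI k phi x) =
     \int[mu]_(s in unit_itv) (s ^+ k.+1 * partial i phi (seg s x) -
       h^-1 * (s ^+ k * phi (seg s (h *: delta_mx 0 i + x)) - s ^+ k * phi (seg s x))).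
    rewrite RintegralB; [|exact: unit_measurable|exact/unit_integrable/c2|]; last first.
      by apply: (unit_integrable (g := fun s => h^-1 * (s ^+ k * phi (seg s (h *: delta_mx 0 i + x)) - s ^+ k * phi (seg s x)))) => s;
        apply: cvgM; [exact: cvg_cst|apply: cvgB; exact: c1].
    rewrite RintegralZl; [|exact: unit_measurable|]; last first.
      by apply: (unit_integrable (g := fun s => s ^+ k * phi (seg s (h *: delta_mx 0 i + x)) - s ^+ k * phi (seg s x))) => s;
        apply: cvgB; exact: c1.
    by rewrite RintegralB //; [exact: unit_measurable|exact/unit_integrable/c1..].
  apply: unit_int_bound => [s|s us].
    apply: cvgB; first exact: c2.
    by apply: cvgM; [exact: cvg_cst|apply: cvgB; exact: c1].
  have e1 : seg s (h *: delta_mx 0 i + x) = (s * h) *: delta_mx 0 i + seg s x.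
    by rewrite /seg -addrA scalerDr scalerA addrA.
  rewrite -mulrBr e1 mulrCA exprSr -mulrA -mulrBr normrM -[leRHS]mul1r.
  apply: ler_pM => //; first exact: unit_expr.
  rewrite -[X in X - _](mulKf h0) -mulrBr normrM normfV ler_pdivrMl ?normr_gt0 //.
  rewrite distrC mulrA [h * s]mulrC; apply: le_trans (_ : e * `|s * h| <= _).
    apply: mvt_line => t ts; first exact: dphi.
    have [s0|s0] := eqVneq s 0.
      move: ts; rewrite s0 mul0r normr0 normr_le0 => /eqP ->.
      by rewrite scale0r add0r subrr normr0 ltW.
    have e2 : s * (t / s) = t by rewrite mulrC divfK.
    have := hh (t / s) _ s us; rewrite /seg -addrA scalerDr scalerA addrA e2.
    apply; rewrite normrM normfV ler_pdivrMr ?normr_gt0 // mulrC.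
    by rewrite -normrM.
  rewrite normrM mulrC ler_wpM2r // ?(ltW e0) // ler_piMl //.
  by have := unit_expr 1 us; rewrite expr1.
split; first by apply/cvg_ex; exists D.
exact: cvg_lim.
Unshelve. all: by end_near. Qed.

Lemma smooth_segI k phi : smo setT phi -> smo setT (segI k phi).
Proof.
move=> /smoP hphi; apply/smoP => n; elim: n k phi hphi => [|n IH] k phi hphi.
  by split=> // x _; apply: continuous_segI => z; exact: (Cn_cont (hphi 0%N)).
have cphi : continuous phi by move=> z; exact: (Cn_cont (hphi 0%N)).
have hp i : forall q, Cn q setT (partial i phi) by move=> q; have [_ /(_ i)[]] := hphi q.+1.
have d i x : is_derive x (delta_mx 0 i) (segI k phi) (segI k.+1 (partial i phi) x).
  apply: is_derive_segI => //; last by move=> z; exact: (Cn_cont (hp i 0%N)).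
  by move=> z; have [_ /(_ i)[+ _]] := hphi 1%N; apply.
split=> [x _|i]; first exact: continuous_segI.
split=> [x _|]; first by have [] := d i x.
rewrite (_ : partial i _ = segI k.+1 (partial i phi)); first exact: IH.
by apply/funext => x; rewrite /partial; have [_] := d i x.
Qed.

Lemma is_derive_seg f s x : smo setT f ->
  is_derive s (1 : R) (fun s => f (seg s x)) (\sum_j (x 0 j - y 0 j) * partial j f (seg s x)).
Proof.
move=> /smoP hf.
have d0 : is_derive (s - s) (1 : R) (f \o (fun t => seg (s + t) x))
    (\sum_j (x 0 j - y 0 j) * partial j f (seg s x)).
  have := @chain_rule R m setT f (fun t => seg (s + t) x) (fun j => x 0 j - y 0 j) openT (hf 1%N) I.
  rewrite addr0 subrr; apply=> j.
  have -> : (fun t => seg (s + t) x 0 j) = fun t => (s + t) * (x 0 j - y 0 j) + y 0 j.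
    by apply/funext => t; rewrite !mxE.
  by apply: is_derive_eq; rewrite !addr0 scaler0 !add0r [_%:A]mulr1.
have hs : is_derive s (1 : R) (fun u : R => u - s) 1 by apply: is_derive_eq; rewrite subr0.
have := is_derive1_comp (g := fun u : R => u - s) d0 hs.
by rewrite mulr1; congr is_derive; apply/funext => t /=; rewrite subrKC.
Qed.

Lemma hadamard f : smo setT f -> exists h : 'I_m -> X -> R, [/\
  forall j, smo setT (h j), forall j, h j y = partial j f y &
  forall x, f x = f y + \sum_j (x 0 j - y 0 j) * h j x].
Proof.
move=> hf; exists (fun j => segI 0 (partial j f)); split=> [j|j|x].
- by apply: smooth_segI; exact: smooth_partial.
- rewrite /segI; have -> : (fun s => s ^+ 0 * partial j f (seg s y)) = cst (partial j f y).
    by apply/funext => s; rewrite /seg subrr scaler0 add0r mul1r.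
  exact: unit_int_cst.
have cp j : continuous (partial j f).
  by move=> z; exact: (smooth_continuous (smooth_partial j hf)).
pose G s := f (seg s x); pose g s := \sum_j (x 0 j - y 0 j) * partial j f (seg s x).
have dG s : is_derive s (1 : R) G (g s) by exact: is_derive_seg.
have cG : continuous G.
  by move=> s; apply: differentiable_continuous; apply/derivable1_diffP; have [] := dG s.
have cg : continuous g.
  move=> s; apply: cvg_big => [|j _]; first exact: add_continuous.
  apply: cvgM; first exact: cvg_cst.
  exact: (cvg_comp _ (partial j f) (@continuous_segl x s) (cp j _)).
have := @continuous_FTC2 R g G 0 1 ltr01 (continuous_subspaceT cg).
have -> : G 0 = f y by rewrite /G /seg scale0r add0r.
have -> : G 1 = f x by rewrite /G /seg scale1r subrK.
move=> H; have {}H : \int[mu]_(s in unit_itv) g s = f x - f y.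
  rewrite /Rintegral H //.
    split; first by move=> s _; have [] := dG s.
    - by apply: cvg_at_right_filter; exact: cG.
    - by apply: cvg_at_left_filter; exact: cG.
  by move=> s _; rewrite derive1E; have [_] := dG s.
apply/eqP; rewrite addrC -subr_eq -H; apply/eqP.
have step (r : seq 'I_m) : \int[mu]_(s in unit_itv) (\sum_(j <- r) (x 0 j - y 0 j) * partial j f (seg s x)) =
    \sum_(j <- r) (x 0 j - y 0 j) * segI 0 (partial j f) x.
  elim: r => [|j r IH].
    under eq_Rintegral do rewrite big_nil.
    by rewrite big_nil (unit_int_cst 0).
  under eq_Rintegral do rewrite big_cons.
  have c1 : continuous (fun s => partial j f (seg s x)).
    by move=> s; exact: (cvg_comp _ (partial j f) (@continuous_segl x s) (cp j _)).
  rewrite RintegralD; last 3 first.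
  - exact: unit_measurable.
  - apply: (unit_integrable (g := fun s => (x 0 j - y 0 j) * partial j f (seg s x))) => s.
    by apply: cvgM; [exact: cvg_cst|exact: c1].
  - apply: (unit_integrable (g := fun s => \sum_(j <- r) (x 0 j - y 0 j) * partial j f (seg s x))) => s.
    apply: cvg_big => [|l _]; first exact: add_continuous.
    apply: cvgM; first exact: cvg_cst.
    exact: (cvg_comp _ (partial l f) (@continuous_segl x s) (cp l _)).
  rewrite big_cons IH RintegralZl //; [|exact: unit_measurable|exact: unit_integrable].
  congr (_ * _ + _); apply: eq_Rintegral => s _; by rewrite mul1r.
exact: step.
Qed.

End Segment.
End Hadamard.

Section ComplexSmooth.
Context {R : realType} {m : nat}.
Local Notation X := ('rV[R]_m).
Local Notation K := ('rV[int]_m).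
Local Notation C := R[i].
Implicit Types (A : set X) (f g : X -> R) (F G : X -> C) (x y : X).

Variant csm A F : Prop := Csm of
  smo A (fun x => complex.Re (F x)) & smo A (fun x => complex.Im (F x)).

Definition cpartial (j : 'I_m) F : X -> C := fun x =>
  (partial j (fun x => complex.Re (F x)) x) +i* (partial j (fun x => complex.Im (F x)) x).

Lemma cReD (z w : C) : complex.Re (z + w) = complex.Re z + complex.Re w. Proof. by case: z; case: w. Qed.
Lemma cImD (z w : C) : complex.Im (z + w) = complex.Im z + complex.Im w. Proof. by case: z; case: w. Qed.
Lemma cReN (z : C) : complex.Re (- z) = - complex.Re z. Proof. by case: z. Qed.
Lemma cImN (z : C) : complex.Im (- z) = - complex.Im z. Proof. by case: z. Qed.
Lemma cReM (z w : C) : complex.Re (z * w) = complex.Re z * complex.Re w - complex.Im z * complex.Im w.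
Proof. by case: z; case: w. Qed.
Lemma cImM (z w : C) : complex.Im (z * w) = complex.Re z * complex.Im w + complex.Im z * complex.Re w.
Proof. by case: z; case: w. Qed.

Lemma csm_ext A F G : open A -> (forall x, A x -> F x = G x) -> csm A F -> csm A G.
Proof. by move=> oA e [h1 h2]; split; [apply: smooth_ext h1|apply: smooth_ext h2] => // x /e ->. Qed.
Lemma csm_sub A B F : B `<=` A -> csm A F -> csm B F.
Proof. by move=> BA [h1 h2]; split; [apply: smooth_sub h1|apply: smooth_sub h2]. Qed.
Lemma csm_cover A F : (forall x, A x -> exists2 B, B x & csm B F) -> csm A F.
Proof.
move=> h; split; apply: smooth_cover => x /h[B Bx [h1 h2]]; exists B => //.
Qed.
Lemma csm_cst A c : csm A (fun=> c).
Proof. by split; exact: smooth_cst. Qed.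
Lemma csm_real A f : smo A f -> csm A (fun x => (f x)%:C).
Proof. by split => //; exact: smooth_cst. Qed.
Lemma csmD A F G : open A -> csm A F -> csm A G -> csm A (fun x => F x + G x).
Proof.
move=> oA [f1 f2] [g1 g2]; split.
  by apply: smooth_ext (smoothD oA f1 g1) => // x _; rewrite cReD.
by apply: smooth_ext (smoothD oA f2 g2) => // x _; rewrite cImD.
Qed.
Lemma csmM A F G : open A -> csm A F -> csm A G -> csm A (fun x => F x * G x).
Proof.
move=> oA [f1 f2] [g1 g2]; split.
  apply: smooth_ext (smoothB oA (smoothM oA f1 g1) (smoothM oA f2 g2)) => // x _.
  by rewrite cReM.
apply: smooth_ext (smoothD oA (smoothM oA f1 g2) (smoothM oA f2 g1)) => // x _.
by rewrite cImM.
Qed.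
Lemma csmN A F : open A -> csm A F -> csm A (fun x => - F x).
Proof.
move=> oA h; apply: csm_ext (csmM oA (csm_cst A (-1)) h) => // x _; exact: mulN1r.
Qed.
Lemma csmZ A c F : open A -> csm A F -> csm A (fun x => c * F x).
Proof. by move=> oA h; apply: (csmM oA (csm_cst A c) h). Qed.
Lemma csmB A F G : open A -> csm A F -> csm A G -> csm A (fun x => F x - G x).
Proof. by move=> oA hF hG; exact: (csmD oA hF (csmN oA hG)). Qed.
Lemma csmC A F : open A -> csm A F -> csm A (fun x => conjc (F x)).
Proof.
move=> oA [h1 h2]; split; first by apply: smooth_ext h1 => // x _; case: (F x).
by apply: smooth_ext (smoothN oA h2) => // x _; case: (F x).
Qed.
Lemma csm_sum A (I : Type) (s : seq I) (F : I -> X -> C) : open A ->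
  (forall i, csm A (F i)) -> csm A (fun x => \sum_(i <- s) F i x).
Proof.
move=> oA h; elim: s => [|i s IH].
  by apply: csm_ext (csm_cst A 0) => // x _; rewrite big_nil.
by apply: csm_ext (csmD oA (h i) IH) => // x _; rewrite big_cons.
Qed.
Lemma csm_partial A F j : csm A F -> csm A (cpartial j F).
Proof. by move=> [h1 h2]; split; exact: smooth_partial. Qed.
Lemma conjcM (z w : C) : conjc (z * w) = conjc z * conjc w.
Proof. exact: (rmorphM (@conjc R)). Qed.
Lemma conjcV (z : C) : conjc z^-1 = (conjc z)^-1.
Proof. exact: (fmorphV (@conjc R)). Qed.
Lemma conjcR (a : R) : conjc a%:C = a%:C.
Proof. by rewrite /= oppr0. Qed.
Lemma conjcZ : conjc 0 = 0 :> C.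
Proof. by rewrite /= oppr0. Qed.

Lemma complexP (z w : C) : complex.Re z = complex.Re w -> complex.Im z = complex.Im w -> z = w.
Proof. by case: z; case: w => a b c d /= -> ->. Qed.

Lemma realcM (a : R) (z : C) : a%:C * z = (a * complex.Re z) +i* (a * complex.Im z).
Proof. by apply: complexP; rewrite (cReM, cImM) /= ?mul0r ?subr0 ?addr0. Qed.

Lemma cpartial_ext A F G j x : open A -> A x -> (forall y, A y -> F y = G y) ->
  cpartial j F x = cpartial j G x.
Proof.
move=> oA Ax h; rewrite /cpartial; congr (_ +i* _);
  by apply: (partial_ext _ oA Ax) => y /h ->.
Qed.
Lemma cpartial_cst j c x : cpartial j (fun=> c) x = 0.
Proof. by rewrite /cpartial /partial !derive_cst. Qed.
Lemma cpartialD A F G j x : A x -> csm A F -> csm A G ->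
  cpartial j (fun x => F x + G x) x = cpartial j F x + cpartial j G x.
Proof.
move=> Ax [f1 f2] [g1 g2]; rewrite /cpartial /partial.
under eq_fun do rewrite cReD.
rewrite [in X in _ +i* X](_ : (fun x => complex.Im (F x + G x)) =
  fun x => complex.Im (F x) + complex.Im (G x)); last by apply/funext => y; rewrite cImD.
by rewrite !deriveD //; exact: (@smooth_derivable _ _ A).
Qed.
Lemma cpartialM A F G j x : A x -> csm A F -> csm A G ->
  cpartial j (fun x => F x * G x) x = cpartial j F x * G x + F x * cpartial j G x.
Proof.
move=> Ax [f1 f2] [g1 g2]; rewrite /cpartial /partial.
rewrite (_ : (fun x => complex.Re (F x * G x)) =
   (fun x => complex.Re (F x) * complex.Re (G x)) - (fun x => complex.Im (F x) * complex.Im (G x))).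
  2: by apply/funext => y; rewrite cReM.
rewrite (_ : (fun x => complex.Im (F x * G x)) =
   (fun x => complex.Re (F x) * complex.Im (G x)) + (fun x => complex.Im (F x) * complex.Re (G x))).
  2: by apply/funext => y; rewrite cImM.
have d (h : X -> R) : smo A h -> derivable h x (delta_mx 0 j) by move=> hh; exact: (@smooth_derivable R m A h x j hh Ax).
have {}f1 := d _ f1; have {}f2 := d _ f2; have {}g1 := d _ g1; have {}g2 := d _ g2.
have dMd (u v : X -> R) : derivable u x (delta_mx 0 j) -> derivable v x (delta_mx 0 j) ->
    derivable (fun x => u x * v x) x (delta_mx 0 j) by move=> hu hv; exact: (derivableM hu hv).
have dM (u v : X -> R) : derivable u x (delta_mx 0 j) -> derivable v x (delta_mx 0 j) ->
    'D_(delta_mx 0 j) (fun x => u x * v x) x =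
    u x * 'D_(delta_mx 0 j) v x + v x * 'D_(delta_mx 0 j) u x.
  by move=> hu hv; exact: (deriveM hu hv).
rewrite (deriveB (dMd _ _ f1 g1) (dMd _ _ f2 g2)) (deriveD (dMd _ _ f1 g2) (dMd _ _ f2 g1)).
rewrite (dM _ _ f1 g1) (dM _ _ f2 g2) (dM _ _ f1 g2) (dM _ _ f2 g1).
apply: complexP; rewrite (cReD, cImD) !(cReM, cImM) /=; ring.
Qed.
Lemma cpartialC A F j x : A x -> csm A F -> cpartial j (fun x => conjc (F x)) x = conjc (cpartial j F x).
Proof.
move=> Ax [h1 h2]; rewrite /cpartial /partial.
rewrite (_ : (fun x => complex.Re (conjc (F x))) = fun x => complex.Re (F x)).
  2: by apply/funext => y; case: (F y).
rewrite (_ : (fun x => complex.Im (conjc (F x))) = - fun x => complex.Im (F x)).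
  2: by apply/funext => y; rewrite [RHS]/GRing.opp /=; case: (F y).
by rewrite deriveN //; exact: (@smooth_derivable R m A _ x j).
Qed.

Lemma chadamard F y : csm setT F -> exists H : 'I_m -> X -> C, [/\
  forall j, csm setT (H j), forall j, H j y = cpartial j F y &
  forall x, F x = F y + \sum_j (x 0 j - y 0 j)%:C * H j x].
Proof.
move=> [/(hadamard y)[h1 [s1 e1 f1]] /(hadamard y)[h2 [s2 e2 f2]]].
exists (fun j x => (h1 j x) +i* (h2 j x)); split=> [j|j|x]; first by split; [exact: s1|exact: s2].
  by rewrite e1 e2.
have re (z : 'I_m -> C) : complex.Re (\sum_j z j) = \sum_j complex.Re (z j).
  by apply: (big_morph (@complex.Re R) cReD (erefl : complex.Re 0 = 0)).
have im (z : 'I_m -> C) : complex.Im (\sum_j z j) = \sum_j complex.Im (z j).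
  by apply: (big_morph (@complex.Im R) cImD (erefl : complex.Im 0 = 0)).
apply: complexP; rewrite (cReD, cImD) (re, im) (f1, f2); congr (_ + _); apply: eq_bigr => j _;
  by rewrite realcM.
Qed.

(* The function vanishes outside a closed ball (for the sup norm) of radius [< r]. *)
Variant tst (q : X) (r : R) F : Prop := Tst of csm setT F &
  exists2 r', 0 < r' < r & forall x, r' <= `|x - q| -> F x = 0.

Section Tests.
Variables (q : X) (r : R).
Hypothesis r0 : 0 < r.

Lemma tst0 : tst q r (fun=> 0).
Proof.
by split; [exact: csm_cst|exists (r / 2) => //; rewrite divr_gt0 // ltr_pdivrMr // ltr_pMr // ltr1n].
Qed.
Lemma tst_csm F : tst q r F -> csm setT F. Proof. by case. Qed.
Lemma tst_supp F x : tst q r F -> r <= `|x - q| -> F x = 0.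
Proof. by move=> [_ [r' /andP[_ lr] h]] hx; apply: h; apply: le_trans (ltW lr) hx. Qed.
Lemma tstM F G : tst q r F -> csm setT G -> tst q r (fun x => F x * G x).
Proof.
move=> [hF [r' h e]] hG; split; first exact: (csmM openT hF hG).
by exists r' => // x /e ->; rewrite mul0r.
Qed.
Lemma tstMl F G : tst q r F -> csm setT G -> tst q r (fun x => G x * F x).
Proof. by move=> hF hG; under eq_fun do rewrite mulrC; exact: tstM. Qed.
Lemma tstZ c F : tst q r F -> tst q r (fun x => c * F x).
Proof. by move=> hF; apply: tstMl => //; exact: csm_cst. Qed.
Lemma tstN F : tst q r F -> tst q r (fun x => - F x).
Proof. by move=> /(tstZ (-1)); under eq_fun do rewrite mulN1r. Qed.
Lemma tstD F G : tst q r F -> tst q r G -> tst q r (fun x => F x + G x).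
Proof.
move=> [hF [a /andP[a0 ar] ha]] [hG [b /andP[b0 br] hb]]; split; first exact: (csmD openT hF hG).
exists (Num.max a b) => [|x]; first by rewrite lt_max a0 gt_max ar br.
by rewrite ge_max => /andP[/ha -> /hb ->]; rewrite addr0.
Qed.
Lemma tstB F G : tst q r F -> tst q r G -> tst q r (fun x => F x - G x).
Proof. by move=> hF /tstN; exact: tstD. Qed.
Lemma tst_sum (I : Type) (s : seq I) (F : I -> X -> C) :
  (forall i, tst q r (F i)) -> tst q r (fun x => \sum_(i <- s) F i x).
Proof.
move=> h; elim: s => [|i s IH].
  by under eq_fun do rewrite big_nil; exact: tst0.
by under eq_fun do rewrite big_cons; exact: tstD.
Qed.
Lemma tstC F : tst q r F -> tst q r (fun x => conjc (F x)).
Proof.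
move=> [hF [r' h e]]; split; first exact: (csmC openT hF).
by exists r' => // x /e ->; rewrite conjc0.
Qed.
Lemma continuous_dist x : {for x, continuous (fun x : X => `|x - q|)}.
Proof.
apply/(@cvgrPdist_le _ _ _ (nbhs x) _) => e e0.
have : \forall y \near x, `|x - y| <= e.
  by have /cvgrPdist_le/(_ _ e0) : id y @[y --> x] --> x by exact: cvg_id.
apply: filterS => y hy; apply: le_trans hy.
by apply: le_trans (ler_dist_dist _ _) _; rewrite opprB addrA subrK.
Qed.
Lemma open_out (b : R) : open [set x : X | b < `|x - q|].
Proof.
apply: (@open_comp _ _ (fun x : X => `|x - q|) [set t | b < t]); last exact: open_gt.
by move=> x _; exact: continuous_dist.
Qed.
Lemma open_in (b : R) : open [set x : X | `|x - q| < b].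
Proof.
apply: (@open_comp _ _ (fun x : X => `|x - q|) [set t | t < b]); last exact: open_lt.
by move=> x _; exact: continuous_dist.
Qed.
Lemma tst_partial j F : tst q r F -> tst q r (cpartial j F).
Proof.
move=> [hF [r' /andP[r'0 h] e]]; split; first exact: csm_partial.
exists ((r' + r) / 2); first by rewrite midf_lt // andbT divr_gt0 // addr_gt0.
move=> x hx; rewrite -(cpartial_cst j 0 x).
apply: (cpartial_ext j (@open_out r')) => [|y /= /ltW /e //].
by rewrite /=; apply: lt_le_trans hx; exact: (midf_lt h).1.
Qed.
(** Beyond radius [r'] the function is zero, so smoothness inside the ball already gives smoothness
    everywhere. *)
Lemma tst_local F r' : 0 < r' < r -> csm [set x | `|x - q| < r] F ->
  (forall x, r' <= `|x - q| -> F x = 0) -> tst q r F.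
Proof.
move=> /andP[r'0 h] hF e; split; last by exists r' => //; rewrite r'0.
apply: csm_cover => x _; have [hx|hx] := ltP `|x - q| r.
  by exists [set x | `|x - q| < r].
exists [set x | r' < `|x - q|]; first exact: lt_le_trans hx.
by apply: csm_ext (csm_cst _ 0) => [|y /= /ltW /e //]; exact: open_out.
Qed.
Lemma tst_bump a b : 0 < a -> a < b -> b < r -> tst q r (fun x => (bump q a b x)%:C).
Proof.
move=> a0 ab br; split; first by apply: csm_real; apply: smooth_bump; exact: openT.
have b0 := lt_trans a0 ab.
exists ((b + r) / 2); first by rewrite (midf_lt br).2 andbT divr_gt0 // addr_gt0.
move=> x hx; rewrite bump_eq0 ?(ltW a0) //.
have : b < `|x - q| by apply: lt_le_trans hx; exact: (midf_lt br).1.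
apply: contraPP => /forallNP h; apply/negP; rewrite -leNgt; apply: norm_le_coord; first exact: ltW.
by move=> j; rewrite !mxE; have /negP := h j; rewrite -ltNge => /ltW.
Qed.
(** A real cutoff that acts as a unit on [F]; it localizes auxiliary factors, and its coefficients
    are invariant under [star]. *)
Lemma tst_unit F : tst q r F -> exists th, [/\ tst q r th,
  forall x, th x * F x = F x & forall x, conjc (th x) = th x].
Proof.
move=> [hF [r' /andP[r'0 h] e]].
have [h1 h2] := midf_lt h; exists (fun x => (bump q r' ((r' + r) / 2) x)%:C); split.
- exact: tst_bump.
- move=> x; have [hx|hx] := leP r' `|x - q|; first by rewrite e // mulr0.
  by rewrite bump_eq1 ?mul1r // ltW.
- by move=> x; rewrite /= oppr0.
Qed.
End Tests.

Lemma tst_mono q r s F : r <= s -> tst q r F -> tst q s F.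
Proof.
move=> rs [hF [r' /andP[r'0 h] e]]; split=> //; exists r' => //.
by rewrite r'0 (lt_le_trans h).
Qed.

Lemma compact_ball q r : 0 <= r -> compact [set x : X | `|x - q| <= r].
Proof.
move=> r0; have -> : [set x : X | `|x - q| <= r] =
    [set x : X | forall j, `[q 0 j - r, q 0 j + r]%classic (x ord0 j)].
  apply/seteqP; split=> x /= h.
    move=> j; rewrite in_itv /= -ler_distl.
    by apply: le_trans h; have := coord_le_norm (x - q) j; rewrite !mxE.
  apply: norm_le_coord => // j; rewrite !mxE ler_distl.
  by have := h j; rewrite in_itv.
apply: (rV_compact (A := fun j => `[q 0 j - r, q 0 j + r]%classic)) => j.
exact: segment_compact.
Qed.

End ComplexSmooth.

(** * Fourier coefficients *)

Section TrigSeries.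
Context {R : realType}.
Local Notation C := R[i].

Implicit Types (s t : R).

Lemma cReMr (a : R) (z : C) : complex.Re (a%:C * z) = a * complex.Re z.
Proof. by rewrite realcM. Qed.
Lemma cImMr (a : R) (z : C) : complex.Im (a%:C * z) = a * complex.Im z.
Proof. by rewrite realcM. Qed.

Definition cis (t : R) : C := cos t +i* sin t.

Lemma cisD s t : cis (s + t) = cis s * cis t.
Proof. by apply: complexP; rewrite ?(cReM, cImM) /= ?(cosD, sinD) // addrC. Qed.
Lemma cisN t : cis (- t) = conjc (cis t).
Proof. by rewrite /cis cosN sinN. Qed.
Lemma cis0 : cis 0 = 1.
Proof. by rewrite /cis cos0 sin0. Qed.
Lemma nrm_cis t : nrm (cis t) = 1.
Proof.
apply/eqP; rewrite -(eqrXn2 (n := 2)) ?nrm_ge0 // nrm_sqr /=.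
by rewrite cos2Dsin2 expr1n.
Qed.
Lemma sin_le t : `|sin t| <= `|t|.
Proof.
wlog t0 : t / 0 < t.
  move=> H; have [t0|t0|->] := ltgtP t 0; last by rewrite sin0 normr0.
    by rewrite -normrN -sinN -(normrN t); apply: H; rewrite oppr_gt0.
  exact: H.
have [|x _] := @MVT R sin cos 0 t t0 (fun x _ => is_derive_sin x).
  exact/continuous_subspaceT/continuous_sin.
rewrite sin0 !subr0 => ->; rewrite normrM ler_piMl //.
by rewrite ler_norml cos_geN1 cos_le1.
Qed.
Lemma cos_taylor t : `|cos t - 1| <= `|t| ^+ 2.
Proof.
wlog t0 : t / 0 < t.
  move=> H; have [t0|t0|->] := ltgtP t 0; last by rewrite cos0 subrr normr0 sqr_ge0.
    by rewrite -cosN -(normrN t); apply: H; rewrite oppr_gt0.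
  exact: H.
have [|x] := @MVT R cos (fun x => - sin x) 0 t t0 (fun x _ => is_derive_cos x).
  exact/continuous_subspaceT/continuous_cos.
rewrite in_itv /= cos0 !subr0 => /andP[x0 xt] ->; rewrite normrM normrN expr2 ler_wpM2r //.
by apply: le_trans (sin_le x) _; rewrite !ger0_norm ?(ltW x0) ?(ltW t0) ?(ltW xt).
Qed.
Lemma cos_le t : `|cos t - 1| <= `|t| * 2.
Proof.
have [t1|t1] := leP `|t| 1.
  apply: le_trans (cos_taylor t) _; rewrite expr2 ler_wpM2l //.
  by apply: le_trans t1 _; rewrite ler1n.
apply: le_trans (ler_normB _ _) _; rewrite normr1.
apply: (@le_trans _ _ 2); last by rewrite ler_peMl // ltW.
by rewrite -[leRHS](_ : 1 + 1 = 2) // lerD2r ler_norml cos_geN1 cos_le1.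
Qed.
Lemma sin_taylor t : `|sin t - t| <= `|t| ^+ 2 * 2.
Proof.
wlog t0 : t / 0 < t.
  move=> H; have [t0|t0|->] := ltgtP t 0; last by rewrite sin0 subrr !normr0 expr0n mul0r.
    have := H (- t); rewrite oppr_gt0 => /(_ t0); rewrite sinN normrN.
    by rewrite -opprD normrN.
  exact: H.
have dd (x : R) : is_derive x (1 : R) (fun x => sin x - x) (cos x - 1) by exact: is_deriveB.
have [|x] := @MVT R (fun x => sin x - x) (fun x => cos x - 1) 0 t t0 (fun x _ => dd x).
  apply: continuous_subspaceT => x; apply: cvgB; [exact: continuous_sin|exact: cvg_id].
rewrite in_itv /= sin0 !subr0 => /andP[x0 xt] ->; rewrite normrM expr2 mulrAC ler_wpM2r //.
apply: le_trans (cos_le x) _; rewrite ler_wpM2r //.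
by rewrite !ger0_norm ?(ltW x0) ?(ltW t0) ?(ltW xt).
Qed.
Lemma cis_taylor t : nrm (cis t - 1 - 'i * t%:C) <= 3 * `|t| ^+ 2.
Proof.
have -> : cis t - 1 - 'i * t%:C = (cos t - 1) +i* (sin t - t).
  by apply: complexP; rewrite ?(cReD, cImD, cReN, cImN, cReM, cImM) /= ; ring.
apply: le_trans (nrm_leD _) _ => /=; have := cos_taylor t; have := sin_taylor t; lra.
Qed.
Lemma cis_lip t : nrm (cis t - 1) <= 3 * `|t|.
Proof.
have -> : cis t - 1 = (cos t - 1) +i* sin t.
  by apply: complexP; rewrite ?(cReD, cImD, cReN, cImN) /= ; ring.
apply: le_trans (nrm_leD _) _ => /=.
have := cos_le t; have := sin_le t; lra.
Qed.

Context {m : nat}.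
Local Notation X := ('rV[R]_m).
Local Notation K := ('rV[int]_m).
Local Notation w := (@wt R m).
Implicit Types (k l : K) (x y : X) (a b : K -> C).

Definition kdot k x : R := \sum_j (k 0 j)%:~R * x 0 j.
Definition ek k x : C := cis (kdot k x).

Lemma kdotDl k l x : kdot (k + l) x = kdot k x + kdot l x.
Proof.
rewrite /kdot -big_split; apply: eq_bigr => j _ /=.
by rewrite !mxE intrD mulrDl.
Qed.
Lemma kdotDr k x y : kdot k (x + y) = kdot k x + kdot k y.
Proof. by rewrite /kdot -big_split; apply: eq_bigr => j _ /=; rewrite !mxE mulrDr. Qed.
Lemma kdotNl k x : kdot (- k) x = - kdot k x.
Proof. by rewrite /kdot -sumrN; apply: eq_bigr => j _ /=; rewrite !mxE intrN mulNr. Qed.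
Lemma kdot0 x : kdot 0 x = 0.
Proof. by rewrite /kdot big1 // => j _; rewrite mxE mul0r. Qed.
Lemma kdot_delta k (j : 'I_m) (h : R) : kdot k (h *: delta_mx 0 j) = (k 0 j)%:~R * h.
Proof.
rewrite /kdot (bigD1 j) //= !mxE !eqxx /= mulr1 big1 ?addr0 // => i /negPf ij.
by rewrite !mxE ij andbF !mulr0.
Qed.
Lemma kdot_deltal (j : 'I_m) x : kdot (delta_mx 0 j) x = x 0 j.
Proof.
rewrite /kdot (bigD1 j) //= !mxE !eqxx /= mul1r big1 ?addr0 // => i /negPf ij.
by rewrite !mxE ij andbF mul0r.
Qed.
Lemma kdot_le k x : `|kdot k x| <= w k * `|x|.
Proof.
apply: le_trans (ler_norm_sum _ _ _) _.
apply: (@le_trans _ _ (\sum_j (`|k 0 j|)%:~R * `|x|)); last first.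
  by rewrite -mulr_suml ler_wpM2r // /wt lerDr.
apply: ler_sum => j _; rewrite normrM intr_norm ler_wpM2l //; exact: coord_le_norm.
Qed.
Lemma ekD k l x : ek (k + l) x = ek k x * ek l x.
Proof. by rewrite /ek kdotDl cisD. Qed.
Lemma ekN k x : ek (- k) x = conjc (ek k x).
Proof. by rewrite /ek kdotNl cisN. Qed.
Lemma ek0 x : ek 0 x = 1.
Proof. by rewrite /ek kdot0 cis0. Qed.
Lemma nrm_ek k x : nrm (ek k x) = 1.
Proof. exact: nrm_cis. Qed.
Lemma smooth_kdot (A : set X) k : open A -> smo A (kdot k).
Proof.
move=> oA; apply: (smooth_sum _ oA) => j; apply: (smoothM oA); first exact: smooth_cst.
exact: smooth_coord.
Qed.
Lemma csm_ek (A : set X) k : open A -> csm A (ek k).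
Proof.
move=> oA; have h := smooth_kdot k oA; split.
  exact: (smooth_sin_cos true oA h).
exact: (smooth_sin_cos false oA h).
Qed.

Lemma nrm_partial F G j x B : open (setT : set X) -> 0 <= B ->
  (forall h : R, nrm (F (h *: delta_mx 0 j + x) - F x - h%:C * G) <= B * `|h| ^+ 2) ->
  is_derive x (delta_mx 0 j) (fun x => complex.Re (F x)) (complex.Re G) /\
  is_derive x (delta_mx 0 j) (fun x : X => complex.Im (F x)) (complex.Im G).
Proof.
move=> _ B0 hB.
have main (f : X -> R) g : (forall h : R, `|f (h *: delta_mx 0 j + x) - f x - h * g| <= B * `|h| ^+ 2) ->
    is_derive x (delta_mx 0 j) f g.
  move=> hf; have H : h^-1 *: (f (h *: delta_mx 0 j + x) - f x) @[h --> (0 : R)^'] --> g.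
    apply/cvgrPdist_le => e e0; near=> h.
    have h0 : h != 0 by near: h; exact: nbhs_dnbhs_neq.
    have he : `|h| <= e / (B + 1) by near: h; apply: dnbhs0_le; rewrite divr_gt0 // ltr_wpDl.
    rewrite -[g](mulKf h0) -mulrBr normrM normfV ler_pdivrMl ?normr_gt0 // distrC.
    apply: le_trans (hf h) _; rewrite expr2 mulrCA ler_wpM2l //.
    apply: (@le_trans _ _ ((B + 1) * (e / (B + 1)))).
      by apply: ler_pM => //; rewrite lerDl.
    by rewrite mulrCA divff ?mulr1 // gt_eqF // ltr_wpDl.
  by split; [apply/cvg_ex; exists g|apply: cvg_lim].
split; apply: main => h; apply: le_trans (hB h).
  by apply: le_trans (nrm_Re _); rewrite !(cReD, cReN) cReMr.
by apply: le_trans (nrm_Im _); rewrite !(cImD, cImN) cImMr.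
Unshelve. all: by end_near. Qed.

Lemma ek_taylor k j (h : R) x :
  nrm (ek k (h *: delta_mx 0 j + x) - ek k x - h%:C * ('i * (k 0 j)%:~R * ek k x))
    <= 3 * w k ^+ 2 * `|h| ^+ 2.
Proof.
rewrite /ek kdotDr cisD kdot_delta.
have -> : cis ((k 0 j)%:~R * h) * cis (kdot k x) - cis (kdot k x) -
   h%:C * ('i * (k 0 j)%:~R * cis (kdot k x)) =
  (cis ((k 0 j)%:~R * h) - 1 - 'i * ((k 0 j)%:~R * h)%:C) * cis (kdot k x).
  have -> : ((k 0 j)%:~R * h)%:C = (k 0 j)%:~R * h%:C :> C.
    by rewrite rmorphM /= rmorph_int.
  ring.
rewrite nrmM nrm_cis mulr1; apply: le_trans (cis_taylor _) _.
rewrite -mulrA ler_wpM2l // -exprMn lerXn2r ?nnegrE ?mulr_ge0 ?wt_ge0 //.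
by rewrite normrM ler_wpM2r // -intr_norm wt_coord.
Qed.

Lemma cpartial_ek k j x : cpartial j (ek k) x = 'i * (k 0 j)%:~R * ek k x.
Proof.
have B0 : 0 <= 3 * w k ^+ 2 by rewrite mulr_ge0 ?exprn_ge0 ?wt_ge0.
have [d1 d2] := @nrm_partial (ek k) ('i * (k 0 j)%:~R * ek k x) j x _ openT B0 (fun h => ek_taylor k j h x).
rewrite /cpartial /partial.
have [_ ->] := d1; have [_ ->] := d2.
by apply: complexP.
Qed.

Definition trig a x : C := csum (fun k => a k * ek k x).

Lemma abs_trig a x : rapid a -> exists B, abs_sum (fun k => a k * ek k x) B.
Proof.
move=> ha; have [B hB] := rapid_abs 0 ha; exists B; apply: abs_sum_le hB => k.
by rewrite nrmM nrm_ek mulr1 powRr0 mulr1.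
Qed.
Lemma has_sum_trig a x : rapid a -> has_sum (fun k => a k * ek k x) (trig a x).
Proof. by move=> /abs_trig - /(_ x)[B]; exact: has_sum_abs. Qed.

Lemma has_sumB (f g : K -> C) (y z : C) : has_sum f y -> has_sum g z -> has_sum (fun k => f k - g k) (y - z).
Proof.
move=> hf /(has_sumZ (-1)); rewrite mulN1r => /(has_sumD hf).
by congr has_sum; apply/funext => k; rewrite mulN1r.
Qed.

(** Taylor's bound for each exponential, summed against the squared weight, gives termwise
    differentiation of the series. *)
Lemma trig_taylor a j : rapid a -> exists2 B, 0 <= B & forall h x,
  nrm (trig a (h *: delta_mx 0 j + x) - trig a x - h%:C * trig (Dk j a) x) <= B * `|h| ^+ 2.
Proof.
move=> ha; have [B hB] := rapid_abs 2 ha.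
have B0 : 0 <= B by have := hB [::] isT; rewrite big_nil.
exists (3 * B) => [|h x]; first by rewrite mulr_ge0.
have h1 := has_sum_trig (h *: delta_mx 0 j + x) ha; have h2 := has_sum_trig x ha.
have h3 := has_sumZ h%:C (has_sum_trig x (rapid_Dk j ha)).
apply: has_sum_bound (has_sumB (has_sumB h1 h2) h3) _ => s us.
rewrite mulrAC; apply: (@le_trans _ _ (3 * `|h| ^+ 2 * \sum_(k <- s) nrm (a k) * w k `^ 2)); last first.
  by rewrite ler_wpM2l ?mulr_ge0 // hB.
rewrite mulr_sumr; apply: ler_sum => k _.
have -> : a k * ek k (h *: delta_mx 0 j + x) - a k * ek k x - h%:C * (Dk j a k * ek k x) =
  a k * (ek k (h *: delta_mx 0 j + x) - ek k x - h%:C * ('i * (k 0 j)%:~R * ek k x)).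
  by rewrite /Dk; ring.
rewrite nrmM [leRHS]mulrCA ler_wpM2l ?nrm_ge0 //; apply: le_trans (ek_taylor _ _ _ _) _.
by rewrite (wtp_nat k 2) mulrAC.
Qed.

Lemma trig_lip a : rapid a -> exists2 B, 0 <= B & forall x y, nrm (trig a x - trig a y) <= B * `|x - y|.
Proof.
move=> ha; have [B hB] := rapid_abs 1 ha.
have B0 : 0 <= B by have := hB [::] isT; rewrite big_nil.
exists (3 * B) => [|x y]; first by rewrite mulr_ge0.
apply: has_sum_bound (has_sumB (has_sum_trig x ha) (has_sum_trig y ha)) _ => s us.
rewrite mulrAC; apply: (@le_trans _ _ (3 * `|x - y| * \sum_(k <- s) nrm (a k) * w k `^ 1)); last first.
  by rewrite ler_wpM2l ?mulr_ge0 // hB.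
rewrite mulr_sumr; apply: ler_sum => k _.
rewrite -mulrBr nrmM mulrCA ler_wpM2l ?nrm_ge0 // wtp1.
have -> : ek k x - ek k y = (cis (kdot k (x - y)) - 1) * ek k y.
  by rewrite mulrBl mul1r -cisD -kdotDr subrK.
rewrite nrmM nrm_ek mulr1; apply: le_trans (cis_lip _) _; rewrite -mulrA ler_wpM2l //.
by rewrite mulrC; apply: le_trans (kdot_le _ _) _; rewrite mulrC.
Qed.

Lemma cpartial_trig a j x : rapid a -> cpartial j (trig a) x = trig (Dk j a) x.
Proof.
move=> ha; have [B B0 hB] := trig_taylor j ha.
have [d1 d2] := @nrm_partial (trig a) (trig (Dk j a) x) j x _ openT B0 (fun h => hB h x).
rewrite /cpartial /partial; have [_ ->] := d1; have [_ ->] := d2.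
by apply: complexP.
Qed.

Lemma csm_trig a : rapid a -> csm setT (trig a).
Proof.
move=> ha; have H n : forall b, rapid b -> Cn n setT (fun x => complex.Re (trig b x)) /\
    Cn n setT (fun x => complex.Im (trig b x)).
  have cont b : rapid b -> continuous (fun x => complex.Re (trig b x)) /\
      continuous (fun x => complex.Im (trig b x)).
    move=> hb; have [B B0 hB] := trig_lip hb.
    have main (f : X -> R) : (forall x y, `|f x - f y| <= B * `|x - y|) -> continuous f.
      move=> hf x; apply/(@cvgrPdist_le _ _ _ (nbhs x) _) => e e0.
      have e1 : 0 < e / (B + 1) by rewrite divr_gt0 // ltr_wpDl.
      have : \forall y \near x, `|x - y| <= e / (B + 1).
        by have /cvgrPdist_le/(_ _ e1) : id y @[y --> x] --> x by exact: cvg_id.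
      apply: filterS => y hy; apply: le_trans (hf _ _) _.
      apply: (@le_trans _ _ ((B + 1) * (e / (B + 1)))).
        by apply: ler_pM => //; rewrite lerDl.
      by rewrite mulrCA divff ?mulr1 // gt_eqF // ltr_wpDl.
    split; apply: main => x y; apply: le_trans (hB x y).
      by apply: le_trans (nrm_Re _); rewrite cReD cReN.
    by apply: le_trans (nrm_Im _); rewrite cImD cImN.
  elim: n => [|n IH] b hb; have [c1 c2] := cont b hb; first by split; split=> // x _; [exact: c1|exact: c2].
  have d j x : is_derive x (delta_mx 0 j) (fun x => complex.Re (trig b x)) (complex.Re (trig (Dk j b) x)) /\
      is_derive x (delta_mx 0 j) (fun x => complex.Im (trig b x)) (complex.Im (trig (Dk j b) x)).
    have [B B0 hB] := trig_taylor j hb.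
    exact: (@nrm_partial (trig b) (trig (Dk j b) x) j x _ openT B0 (fun h => hB h x)).
  split; split=> [x _|j]; [exact: c1| |exact: c2|].
    split=> [x _|]; first by have [[]] := d j x.
    rewrite (_ : partial j _ = fun x => complex.Re (trig (Dk j b) x)).
      exact: (proj1 (IH _ (rapid_Dk j hb))).
    by apply/funext => x; rewrite /partial; have [[_ ->]] := d j x.
  split=> [x _|]; first by have [_ []] := d j x.
  rewrite (_ : partial j _ = fun x => complex.Im (trig (Dk j b) x)).
    exact: (proj2 (IH _ (rapid_Dk j hb))).
  by apply/funext => x; rewrite /partial; have [_ [_ ->]] := d j x.
by split; apply/smoP => n; have [] := H n a ha.
Qed.

End TrigSeries.

(** * Inversion and Parseval formulas for an abstract functional *)

Section Fourier.
Context {R : realType} {m : nat}.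
Local Notation X := ('rV[R]_m).
Local Notation K := ('rV[int]_m).
Local Notation C := R[i].
Local Notation w := (@wt R m).
Implicit Types (k l : K) (a b : K -> C) (f : X -> R) (F G : X -> C).

Lemma tst_Re q r F : tst q r F -> tst q r (fun x => (complex.Re (F x))%:C).
Proof.
by move=> [[h1 h2] [r' h e]]; split; [exact: csm_real|exists r' => // x /e ->].
Qed.
Lemma tst_Im q r F : tst q r F -> tst q r (fun x => (complex.Im (F x))%:C).
Proof.
by move=> [[h1 h2] [r' h e]]; split; [exact: csm_real|exists r' => // x /e ->].
Qed.

Lemma bounded_on_ball f q r : smo setT f -> 0 <= r ->
  exists2 B, 0 <= B & forall x, `|x - q| <= r -> `|f x| <= B.
Proof.
move=> hf r0; have cf : continuous f by move=> x; exact: (smooth_continuous hf).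
have := continuous_compact (continuous_subspaceT cf) (@compact_ball _ _ q r r0).
move=> /compact_bounded[M [_ hM]]; exists (`|M| + 1) => [|x hx]; first by rewrite addr_ge0.
apply: (hM (`|M| + 1)); last by exists x.
by rewrite (le_lt_trans (ler_norm M)) // ltrDl.
Qed.

Lemma csm_bounded F q r : csm setT F -> 0 <= r ->
  exists2 B, 0 <= B & forall x, `|x - q| <= r -> nrm (F x) <= B.
Proof.
move=> [h1 h2] r0; have [A A0 hA] := bounded_on_ball q h1 r0; have [B B0 hB] := bounded_on_ball q h2 r0.
exists (A + B) => [|x hx]; first by rewrite addr_ge0.
by apply: le_trans (nrm_leD _) _; apply: lerD; [exact: hA|exact: hB].
Qed.

Lemma tst_bounded q r F : 0 < r -> tst q r F -> exists2 B, 0 <= B & forall x, nrm (F x) <= B.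
Proof.
move=> r0 h; have [B B0 hB] := csm_bounded q (tst_csm h) (ltW r0); exists B => // x.
have [hx|hx] := leP `|x - q| r; first exact: hB.
by rewrite (tst_supp h (ltW hx)) nrm0.
Qed.

Lemma trig_unif a : rapid a -> forall e, 0 < e -> exists s0 : seq K, forall s : seq K, uniq s -> {subset s0 <= s} ->
  forall x : X, nrm (trig a x - \sum_(k <- s) a k * ek k x) <= e.
Proof.
move=> ha e e0; have [B hB] := rapid_abs 0 ha.
have e2 : 0 < e / 2 by rewrite divr_gt0.
have hB' (s : seq K) : uniq s -> \sum_(k <- s) nrm (a k) <= B.
  by move=> /hB; apply: le_trans; apply: ler_sum => k _; rewrite powRr0 mulr1.
have [y y0 hy] := has_sum_nonneg (fun k => nrm_ge0 (a k)) hB'.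
have [s0 h0] := hy _ e2; exists s0 => s us sub x.
pose b k := if k \in s then 0 else a k.
have hs : has_sum (fun k => b k * ek k x) (trig a x - \sum_(k <- s) a k * ek k x).
  have h2 : has_sum (fun k => if k \in s then a k * ek k x else 0) (\sum_(k <- s) a k * ek k x).
    have := @has_sum_finite _ _ (fun k => if k \in s then a k * ek k x else 0) s us.
    rewrite (eq_big_seq (fun k => a k * ek k x)); last by move=> k ks; rewrite ks.
    by apply => k /negPf ->.
  have := has_sumB (has_sum_trig x ha) h2; congr has_sum; apply/funext => k; rewrite /b.
  by case: ifP; rewrite ?subr0 // subrr mul0r.
apply: has_sum_bound hs _ => t ut.
have [u1 u2 u3] := uniq_undup_cat s t; set u := undup (s ++ t) in u1 u2 u3.
have es : \sum_(k <- s) nrm (a k) >= y - e / 2.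
  have := h0 s us sub; rewrite -(rmorph_sum (real_complex R)) -rmorphB nrm_real.
  by rewrite ler_norml => /andP[+ _]; lra.
have eu : \sum_(k <- u) nrm (a k) <= y + e / 2.
  have := h0 u u1 (fun k ks => u2 k (sub k ks)); rewrite -(rmorph_sum (real_complex R)) -rmorphB nrm_real.
  by rewrite ler_norml => /andP[_]; lra.
have : \sum_(k <- t) nrm (b k * ek k x) <= \sum_(k <- u) nrm (b k).
  have -> : \sum_(k <- t) nrm (b k * ek k x) = \sum_(k <- t) nrm (b k).
    by apply: eq_bigr => k _; rewrite nrmM nrm_ek mulr1.
  by apply: ler_sum_uniq_sub => // k; exact: nrm_ge0.
move/le_trans; apply.
have -> : \sum_(k <- u) nrm (b k) = \sum_(k <- u | k \notin s) nrm (a k).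
  rewrite [RHS]big_mkcond; apply: eq_bigr => k _; rewrite /b.
  by case: (k \in s) => //; rewrite nrm0.
have := sum_uniq_sub (fun k => nrm (a k)) us u1 u2; lra.
Qed.

(** [J] plays the role of Lebesgue integration over the ball. The condition on [r] keeps coordinate
    differences below 1, hence below pi, so that the exponentials separate the points of the
    ball. *)
Variables (q : X) (r : R) (J : (X -> R) -> R).
Hypothesis r0 : 0 < r.
Hypothesis r1 : r * 2 <= 1.
Local Notation T := (tst q r).
Local Notation rT f := (T (fun x => (f x)%:C)).
Hypothesis JD : forall f g, rT f -> rT g -> J (fun x => f x + g x) = J f + J g.
Hypothesis JZ : forall c f, rT f -> J (fun x => c * f x) = c * J f.
Hypothesis J_bound : exists2 A, 0 <= A & forall f B, rT f -> (forall x, `|f x| <= B) -> `|J f| <= A * B.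
Hypothesis J_ge0 : forall f, rT f -> (forall x, 0 <= f x) -> 0 <= J f.
Hypothesis J_partial : forall f j, rT f -> J (partial j f) = 0.
Hypothesis J_neq0 : exists2 f, rT f & J f != 0.

Definition JC F : C := (J (fun x => complex.Re (F x))) +i* (J (fun x => complex.Im (F x))).

Lemma JCD F G : T F -> T G -> JC (fun x => F x + G x) = JC F + JC G.
Proof.
move=> hF hG; rewrite /JC; under eq_fun do rewrite cReD.
rewrite [in X in _ +i* X](_ : (fun x => complex.Im (F x + G x)) =
  fun x => complex.Im (F x) + complex.Im (G x)); last by apply/funext => y; rewrite cImD.
rewrite !JD //; try exact: tst_Re; exact: tst_Im.
Qed.

Lemma JCZ c F : T F -> JC (fun x => c * F x) = c * JC F.
Proof.
move=> hF; have hR := tst_Re hF; have hI := tst_Im hF.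
have zR (a : R) f : rT f -> rT (fun x => a * f x).
  by move=> /(tstZ a%:C); under eq_fun do rewrite -rmorphM.
have e1 : J (fun x => complex.Re (c * F x)) = complex.Re c * J (fun x => complex.Re (F x)) +
    (- complex.Im c) * J (fun x => complex.Im (F x)).
  rewrite -!JZ // -JD; [|exact: zR..]; congr J; apply/funext => x; rewrite cReM; ring.
have e2 : J (fun x => complex.Im (c * F x)) = complex.Re c * J (fun x => complex.Im (F x)) +
    complex.Im c * J (fun x => complex.Re (F x)).
  rewrite -!JZ // -JD; [|exact: zR..]; congr J; apply/funext => x; rewrite cImM; ring.
rewrite /JC e1 e2; apply: complexP; rewrite (cReM, cImM) /=; ring.
Qed.

Lemma JC0 : JC (fun=> 0) = 0.
Proof. by have := JCZ 0 (tst0 q r0); under eq_fun do rewrite mul0r; rewrite mul0r. Qed.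

Lemma JCN F : T F -> JC (fun x => - F x) = - JC F.
Proof. by move=> h; rewrite -mulN1r -JCZ //; congr JC; apply/funext => x; rewrite mulN1r. Qed.

Lemma JCC F : T F -> JC (fun x => conjc (F x)) = conjc (JC F).
Proof.
move=> hF; rewrite /JC /=; congr (_ +i* _); first by congr J; apply/funext => x; case: (F x).
rewrite -mulN1r -JZ; last exact: tst_Im.
by congr J; apply/funext => x; rewrite mulN1r; case: (F x).
Qed.

Lemma JC_sum (I : Type) (s : seq I) (F : I -> X -> C) : (forall i, T (F i)) ->
  JC (fun x => \sum_(i <- s) F i x) = \sum_(i <- s) JC (F i).
Proof.
move=> h; elim: s => [|i s IH].
  by rewrite big_nil -[RHS]JC0; congr JC; apply/funext => x; rewrite big_nil.
rewrite big_cons -IH -JCD //; last exact: tst_sum.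
by congr JC; apply/funext => x; rewrite big_cons.
Qed.

Lemma JC_bound : exists2 A, 0 <= A & forall F B, T F -> (forall x, nrm (F x) <= B) -> nrm (JC F) <= A * B.
Proof.
have [A A0 hA] := J_bound; exists (A + A) => [|F B hF hB]; first by rewrite addr_ge0.
apply: le_trans (nrm_leD _) _; rewrite mulrDl; apply: lerD; apply: hA => [|x].
- exact: tst_Re.
- exact: le_trans (nrm_Re _) (hB x).
- exact: tst_Im.
- exact: le_trans (nrm_Im _) (hB x).
Qed.

Lemma JC_partial F j : T F -> JC (cpartial j F) = 0.
Proof.
move=> hF; rewrite /JC /cpartial /= !J_partial //; [exact: tst_Im|exact: tst_Re].
Qed.

Definition jh F : K -> C := fun k => JC (fun x => F x * ek (- k) x).

Lemma tst_ek F k : T F -> T (fun x => F x * ek k x).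
Proof. by move=> h; apply: tstM => //; exact: csm_ek openT. Qed.

Lemma jhD F G : T F -> T G -> jh (fun x => F x + G x) = fun k => jh F k + jh G k.
Proof.
move=> hF hG; apply/funext => k; rewrite /jh -JCD; [|exact: tst_ek..].
by congr JC; apply/funext => x; rewrite mulrDl.
Qed.
Lemma jhZ c F : T F -> jh (fun x => c * F x) = fun k => c * jh F k.
Proof.
move=> hF; apply/funext => k; rewrite /jh -JCZ; last exact: tst_ek.
by congr JC; apply/funext => x; rewrite mulrA.
Qed.

Lemma jh_Dk j F : T F -> jh (cpartial j F) = Dk j (jh F).
Proof.
move=> hF; apply/funext => k; rewrite /Dk /jh.
have := JC_partial j (tst_ek (- k) hF).
have -> : cpartial j (fun x => F x * ek (- k) x) =
   fun x => cpartial j F x * ek (- k) x + (- ('i * (k 0 j)%:~R)) * (F x * ek (- k) x).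
  apply/funext => x; rewrite (cpartialM (A := setT)) ?cpartial_ek //.
  - by rewrite !mxE intrN; ring.
  - exact: tst_csm hF.
  - exact: csm_ek openT.
rewrite JCD; [|by apply: tst_ek; exact: tst_partial|by apply: tstZ => //; exact: tst_ek].
rewrite JCZ; last exact: tst_ek.
by move/eqP; rewrite mulNr subr_eq0 => /eqP.
Qed.

(** Each integration by parts brings out a factor [k_j], and the weight is 1 plus the sum of the
    |k_j|. *)
Lemma jh_rapid F : T F -> rapid (jh F).
Proof.
move=> hF; apply: rapid_sup => N; elim: N F hF => [|N IH] F hF.
  have [A A0 hA] := JC_bound; have [B B0 hB] := tst_bounded r0 hF.
  exists (A * B) => k; rewrite mul1r; apply: hA => [|x]; first exact: tst_ek.
  by rewrite nrmM nrm_ek mulr1.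
have [B hB] := IH F hF.
have /choice[D hD] : forall j, exists B, forall k, w k ^+ N * nrm (jh (cpartial j F) k) <= B.
  by move=> j; apply: IH; exact: tst_partial.
exists (B + \sum_j D j) => k; rewrite exprSr /wt mulrDr mulr1 mulrDl; apply: lerD; first exact: hB.
rewrite mulr_sumr mulr_suml; apply: ler_sum => j _; apply: le_trans (hD j k).
by rewrite jh_Dk // /Dk !nrmM nrm_i mul1r -(rmorph_int (real_complex R)) nrm_real -intr_norm mulrA.
Qed.

Lemma jh_shift l F : jh (fun x => F x * ek l x) = fun k => jh F (k - l).
Proof.
apply/funext => k; rewrite /jh; congr JC; apply/funext => x.
by rewrite -mulrA -ekD opprB.
Qed.

Lemma JC_trig F a : T F -> rapid a ->
  has_sum (fun k => a k * JC (fun x => F x * ek k x)) (JC (fun x => F x * trig a x)).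
Proof.
move=> hF ha e e0; have [A A0 hA] := JC_bound; have [B B0 hB] := tst_bounded r0 hF.
have AB : 0 < A * B + 1 by rewrite ltr_wpDl // mulr_ge0.
have [s0 h0] := trig_unif ha (divr_gt0 e0 AB).
have hT : T (fun x => F x * trig a x) by apply: tstM => //; exact: csm_trig.
exists s0 => s us sub.
have -> : \sum_(k <- s) a k * JC (fun x => F x * ek k x) = JC (fun x => \sum_(k <- s) a k * (F x * ek k x)).
  rewrite JC_sum => [|k]; last by apply: tstZ => //; exact: tst_ek.
  by apply: eq_bigr => k _; rewrite JCZ //; exact: tst_ek.
have hS : T (fun x => \sum_(k <- s) a k * (F x * ek k x)).
  by apply: tst_sum => // k; apply: tstZ => //; exact: tst_ek.
rewrite -JCN // -JCD //; last exact: tstN.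
apply: (@le_trans _ _ (A * (B * (e / (A * B + 1))))).
  apply: hA => [|x]; first by apply: tstD => //; exact: tstN.
  have -> : \sum_(k <- s) a k * (F x * ek k x) - F x * trig a x =
     F x * - (trig a x - \sum_(k <- s) a k * ek k x).
    rewrite opprB mulrBr mulr_sumr; congr (_ - _); apply: eq_bigr => k _; ring.
  rewrite nrmM nrmN; apply: ler_pM; rewrite ?nrm_ge0 //; exact: h0.
rewrite mulrA mulrCA -[leRHS]mulr1 ler_wpM2l ?(ltW e0) //.
by rewrite ler_pdivrMr // mul1r lerDl.
Qed.

Lemma trigD a b (x : X) : rapid a -> rapid b -> trig (fun k => a k + b k) x = trig a x + trig b x.
Proof.
move=> ha hb; apply: has_sum_csum; have := has_sumD (has_sum_trig x ha) (has_sum_trig x hb).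
by congr has_sum; apply/funext => k; rewrite mulrDl.
Qed.
Lemma trigZ c a (x : X) : rapid a -> trig (fun k => c * a k) x = c * trig a x.
Proof.
move=> ha; apply: has_sum_csum; have := has_sumZ c (has_sum_trig x ha).
by congr has_sum; apply/funext => k; rewrite mulrA.
Qed.
Lemma trig_shift a l (x : X) : rapid a -> trig (fun k => a (k - l)) x = ek l x * trig a x.
Proof.
move=> ha; apply: has_sum_csum; have := has_sumZ (ek l x) (has_sum_trig x ha).
move/(has_sum_map (h := fun k => k - l) (h' := fun k => k + l)).
have h1 : cancel (fun k => k - l) (fun k => k + l) by move=> k; rewrite subrK.
have h2 : cancel (fun k => k + l) (fun k => k - l) by move=> k; rewrite addrK.
move/(_ h1 h2); congr has_sum; apply/funext => k /=.
by rewrite mulrCA -ekD (addrC l) subrK.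
Qed.

Lemma trig_jhD F G x : T F -> T G -> trig (jh (fun x => F x + G x)) x = trig (jh F) x + trig (jh G) x.
Proof. by move=> hF hG; rewrite jhD // trigD //; exact: jh_rapid. Qed.
Lemma trig_jhZ c F x : T F -> trig (jh (fun x => c * F x)) x = c * trig (jh F) x.
Proof. by move=> hF; rewrite jhZ // trigZ //; exact: jh_rapid. Qed.
Lemma trig_jh_sum (I : Type) (s : seq I) (F : I -> X -> C) x : (forall i, T (F i)) ->
  trig (jh (fun x => \sum_(i <- s) F i x)) x = \sum_(i <- s) trig (jh (F i)) x.
Proof.
move=> h; elim: s => [|i s IH].
  rewrite big_nil -[RHS](mul0r (trig (jh (fun=> 0)) x)) -trig_jhZ; last exact: tst0.
  by congr (trig (jh _) x); apply/funext => y; rewrite big_nil mul0r.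
rewrite big_cons -IH -trig_jhD //; last exact: tst_sum.
by congr (trig (jh _) x); apply/funext => y; rewrite big_cons.
Qed.

(** Multiplication by [ek l] shifts the coefficients by [l], and a shift multiplies the series at
    [y] by [ek l y]. *)
Lemma trig_jh_ideal l G y : T G -> trig (jh (fun x => (ek l x - ek l y) * G x)) y = 0.
Proof.
move=> hG; have e : (fun x => (ek l x - ek l y) * G x) = fun x => G x * ek l x + (- ek l y) * G x.
  by apply/funext => x; ring.
rewrite e trig_jhD; [|exact: tst_ek|exact: tstZ].
by rewrite trig_jhZ // jh_shift trig_shift ?mulNr ?subrr //; exact: jh_rapid.
Qed.

(* [h x = sin (x_j - y_j) / (x_j - y_j)], extended smoothly. *)
Lemma sinc (j : 'I_m) (y : X) : exists h : X -> R, [/\ smo setT h,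
  forall x : X, (x 0 j - y 0 j) * h x = sin (x 0 j - y 0 j) &
  forall x : X, `|x 0 j - y 0 j| < 1 -> h x != 0].
Proof.
pose f (x : X) : R := sin (x 0 j - y 0 j).
have hd : smo setT (fun x : X => x 0 j - y 0 j).
  by apply: (smoothB openT); [exact: smooth_coord|exact: smooth_cst].
have hf : smo setT f by exact: (smooth_sin_cos false openT hd).
have [h [hs hy hE]] := hadamard y hf.
pose Phi (x : X) : X := (x 0 j - y 0 j) *: delta_mx 0 j + y.
have e (x : X) : (x 0 j - y 0 j) * h j (Phi x) = sin (x 0 j - y 0 j).
  have := hE (Phi x); rewrite /f subrr sin0 add0r (bigD1 j) //= big1.
    by rewrite !mxE !eqxx /= mulr1 addrK addr0 => ->.
  by move=> i /negPf ij; rewrite !mxE ij andbF mulr0 add0r subrr mul0r.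
exists (h j \o Phi); split=> // [|x hx].
  apply: (smooth_comp openT openT _ (hs j)) => // i.
  rewrite (_ : (fun x => Phi x 0 i) = fun x : X => (x 0 j - y 0 j) * (i == j)%:R + y 0 i).
    apply: (smoothD openT); last exact: smooth_cst.
    by apply: (smoothM openT) => //; exact: smooth_cst.
  by apply/funext => x; rewrite !mxE eqxx.
have [t0|t0] := eqVneq (x 0 j - y 0 j) 0.
  rewrite /= /Phi t0 scale0r add0r hy.
  have d : is_derive y (delta_mx 0 j) f 1.
    apply/is_derive_line; rewrite (_ : (fun t => _) = @sin R).
      by have := is_derive_sin (0 : R); rewrite cos0.
    by apply/funext => t; rewrite /f !mxE !eqxx /= mulr1 addrK.
  by rewrite /partial; have [_ ->] := d; exact: oner_neq0.
apply/eqP => h0; have := e x; rewrite -/(comp (h j) Phi x) h0 mulr0 => /esym/eqP.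
apply/negP; have pi1 : 1 < pi :> R by apply: lt_le_trans (pi_ge2 R); exact: ltr1n.
have [tn|tp|t00] := ltgtP (x 0 j - y 0 j) 0; last by rewrite t00 eqxx in t0.
  rewrite -oppr_eq0 -sinN gt_eqF // sin_gt0_pi // oppr_gt0 tn /=.
  by rewrite (le_lt_trans (ler_norm _)) // normrN (lt_trans hx).
by rewrite gt_eqF // sin_gt0_pi // tp /= (le_lt_trans (ler_norm _)) // (lt_trans hx).
Qed.

(** By Hadamard's lemma a function vanishing at [y] is a sum of multiples of [x_j - y_j], and on the
    ball these are multiples of [ek (d j) x - ek (d j) y]; each term is then killed by
    [trig_jh_ideal]. *)
Lemma trig_jh_vanish F y : T F -> `|y - q| < r -> F y = 0 -> trig (jh F) y = 0.
Proof.
move=> hF hy Fy; have [H [hs _ hE]] := chadamard y (tst_csm hF).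
have [th [tht thF _]] := tst_unit r0 hF.
have /choice[s hs'] : forall j, exists h : X -> R, [/\ smo setT h,
  forall x : X, (x 0 j - y 0 j) * h x = sin (x 0 j - y 0 j) &
  forall x : X, `|x 0 j - y 0 j| < 1 -> h x != 0] by move=> j; exact: sinc.
pose d (j : 'I_m) : K := delta_mx 0 j.
(* With t = x_j - y_j one has (e^(it) - 1)(1 + e^(-it)) = 2i sin t, and t is sin t divided by
   [s j x], which is nonzero for |t| < 1. This is the resulting cofactor of
   [ek (d j) x - ek (d j) y]. *)
pose Q j x := th x * (H j x * ((s j x)^-1)%:C * (1 + ek (- d j) x * ek (d j) y) * (ek (- d j) y / ('i * 2))).
have near1 x j : `|x - q| < r -> `|x 0 j - y 0 j| < 1.
  move=> hx; have -> : x 0 j - y 0 j = ((x - q) - (y - q)) 0 j by rewrite !mxE; ring.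
  apply: le_lt_trans (coord_le_norm _ _) _; apply: le_lt_trans (ler_normB _ _) _.
  by apply: lt_le_trans (ltrD hx hy) _; rewrite -mulr2n -mulr_natr.
have tQ j : T (Q j).
  have [hth [r' hr' er']] := tht; apply: (tst_local hr') => [|x /er' e]; last by rewrite /Q e mul0r.
  have oA := @open_in _ _ q r; have [s1 s2 s3] := hs' j.
  have sT (G : X -> C) : csm setT G -> csm [set x | `|x - q| < r] G by exact: csm_sub.
  apply: (csmM oA); first exact: sT.
  apply: (csmM oA); last exact: csm_cst.
  apply: (csmM oA); last first.
    apply: (csmD oA); first exact: csm_cst.
    by apply: (csmM oA); [exact: csm_ek|exact: csm_cst].
  apply: (csmM oA); first exact: sT.
  apply: csm_real; apply: (smooth_inv oA); last by apply: smooth_sub s1.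
  by move=> x /= hx; apply: s3; exact: near1.
have -> : F = fun x => \sum_j (ek (d j) x - ek (d j) y) * Q j x.
  apply/funext => x; rewrite -thF hE Fy add0r mulr_sumr; apply: eq_bigr => j _.
  have [hx|hx] := leP r `|x - q|.
    by rewrite /Q (tst_supp tht hx) !mul0r mulr0.
  have [s1 s2 s3] := hs' j; have sx := s3 x (near1 x j hx).
  have key : (x 0 j - y 0 j)%:C = (ek (d j) x - ek (d j) y) *
      (((s j x)^-1)%:C * (1 + ek (- d j) x * ek (d j) y) * (ek (- d j) y / ('i * 2))).
    have -> : x 0 j - y 0 j = sin (x 0 j - y 0 j) * (s j x)^-1 by rewrite -s2 mulfK.
    have hc (z : X) : ek (d j) z * ek (- d j) z = 1 by rewrite -ekD subrr ek0.
    have e1 : ek (d j) x * ek (- d j) y = cis (x 0 j - y 0 j).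
      by rewrite ekN /ek -cisN -cisD !kdot_deltal.
    have e2 : ek (- d j) x * ek (d j) y = cis (- (x 0 j - y 0 j)).
      by rewrite opprB ekN /ek -cisN -cisD !kdot_deltal addrC.
    have -> : (ek (d j) x - ek (d j) y) *
      (((s j x)^-1)%:C * (1 + ek (- d j) x * ek (d j) y) * (ek (- d j) y / ('i * 2))) =
      (ek (d j) x * ek (- d j) y - ek (d j) y * ek (- d j) y) * (1 + ek (- d j) x * ek (d j) y) / ('i * 2)
       * ((s j x)^-1)%:C by ring.
    rewrite hc e1 e2 rmorphM /=; congr (_ * _).
    have -> : (cis (x 0 j - y 0 j) - 1) * (1 + cis (- (x 0 j - y 0 j))) =
       cis (x 0 j - y 0 j) * cis (- (x 0 j - y 0 j)) - 1 + cis (x 0 j - y 0 j) - cis (- (x 0 j - y 0 j)) by ring.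
    rewrite -cisD subrr cis0 subrr add0r.
    have i2 : 'i * 2 != 0 :> C by rewrite mulf_neq0 ?neq0Ci ?pnatr_eq0.
    apply: (mulIf i2); rewrite divfK // /cis cosN sinN.
    by apply: complexP; rewrite ?(cReM, cImM, cReD, cImD, cReN, cImN) /=; ring.
  by rewrite /Q key; ring.
rewrite trig_jh_sum => [|j]; last first.
  by apply: tstMl => //; apply: (csmB openT); [exact: csm_ek openT|exact: csm_cst].
by apply: big1 => j _; exact: trig_jh_ideal.
Qed.

(** Subtracting [F y] times a cutoff equal to 1 at [y] shows that the value at [y] is [F y] times
    the series of the cutoff. That factor has zero gradient, so it is the same at [y] and at the
    center. *)
Lemma trig_jh_const : exists c, forall F y, T F -> `|y - q| < r -> trig (jh F) y = c * F y.
Proof.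
have mid (b : R) : b < r -> 0 < b -> T (fun x => (bump q b ((b + r) / 2) x)%:C).
  move=> br b0; have [h1 h2] := midf_lt br; exact: tst_bump.
have bq (b : R) (x : X) : b < r -> 0 < b -> `|x - q| <= b -> (bump q b ((b + r) / 2) x)%:C = 1 :> C.
  by move=> br b0 xb; rewrite bump_eq1 ?(ltW b0) // (midf_lt br).1.
have rh : r / 2 < r by rewrite ltr_pdivrMr // ltr_pMr // ltr1n.
have rh0 : 0 < r / 2 by rewrite divr_gt0.
exists (trig (jh (fun x => (bump q (r / 2) ((r / 2 + r) / 2) x)%:C)) q) => F y hF hy.
set th0 := fun x => _ : C.
pose b := (Num.max `|y - q| (r / 2) + r) / 2.
have mr : Num.max `|y - q| (r / 2) < r by rewrite gt_max hy.
have [b1 b2] := midf_lt mr; rewrite -/b in b1 b2.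
have yb : `|y - q| < b by apply: le_lt_trans b1; rewrite le_max lexx.
have b0 : 0 < b by apply: le_lt_trans yb.
pose th x : C := (bump q b ((b + r) / 2) x)%:C.
have tth : T th by exact: mid.
have tth0 : T th0 by exact: mid.
have th1 (z : X) : `|z - q| <= b -> th z = 1 by move=> hz; exact: (bq b z b2 b0 hz).
have th01 : th0 q = 1 by apply: bq; rewrite ?subrr ?normr0 ?(ltW rh0).
clearbody th th0 b.
have qq : `|q - q| < r by rewrite subrr normr0.
have e1 : trig (jh th) q = trig (jh th0) q.
  have : trig (jh (fun x => th x + (-1) * th0 x)) q = 0.
    apply: trig_jh_vanish; [exact: (tstD tth (tstZ (-1) tth0))|exact: qq|].
    by rewrite th01 th1 ?subrr ?normr0 ?ltW // mulr1 subrr.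
  rewrite (trig_jhD q tth (tstZ (-1) tth0)) (trig_jhZ (-1) q tth0).
  by rewrite mulN1r => /eqP; rewrite subr_eq0 => /eqP.
have e2 : trig (jh F) y = F y * trig (jh th) y.
  have : trig (jh (fun x => F x + (- F y) * th x)) y = 0.
    apply: trig_jh_vanish; [exact: (tstD hF (tstZ (- F y) tth))|exact: hy|].
    by rewrite th1 ?mulr1 ?subrr // ltW.
  rewrite (trig_jhD y hF (tstZ (- F y) tth)) (trig_jhZ (- F y) y tth).
  by rewrite mulNr => /eqP; rewrite subr_eq0 => /eqP.
rewrite e2 mulrC -e1; congr (_ * _).
(* Where [th] is constant its derivatives vanish, hence by [trig_jh_vanish] so do the derivatives of
   the series. *)
have dz j x : `|x - q| < b -> cpartial j (trig (jh th)) x = 0.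
  move=> xb; rewrite cpartial_trig; last exact: jh_rapid.
  rewrite -jh_Dk //; apply: trig_jh_vanish; [exact: tst_partial|exact: lt_trans b2|].
  rewrite -(cpartial_cst j 1 x); apply: (cpartial_ext _ (@open_in _ _ q b)) => // z /= zb.
  by rewrite th1 // ltW.
have [c1 c2] := csm_trig (jh_rapid tth).
have main (g : X -> R) : smo setT g -> (forall j x, `|x - q| < b -> partial j g x = 0) -> g y = g q.
  move=> hg gz; have d s := is_derive_seg q s y hg.
  have [|s] := @MVT R (fun s => g (seg q s y)) _ 0 1 ltr01 (fun s _ => d s).
    apply: continuous_subspaceT => s; apply: differentiable_continuous.
    by apply/derivable1_diffP; have [] := d s.
  rewrite in_itv /= /seg scale1r scale0r add0r subrK => /andP[s0 s1] /eqP.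
  rewrite big1 ?mul0r ?subr_eq0 => [|j _]; first by move/eqP.
  rewrite gz ?mulr0 // addrK normrZ; apply: le_lt_trans yb.
  by rewrite ler_piMl // ger0_norm ltW.
apply: complexP.
  apply: (main (fun x => complex.Re (trig (jh th) x)) c1) => j x /(dz j).
  by move/(congr1 (@complex.Re R)).
apply: (main (fun x => complex.Im (trig (jh th) x)) c2) => j x /(dz j).
by move/(congr1 (@complex.Im R)).
Qed.

Lemma jh_sqr F : T F -> has_sum (fun k => (nrm (jh F k) ^+ 2)%:C)
    (JC (fun x => conjc (F x) * trig (jh F) x)).
Proof.
move=> hF; have := JC_trig (tstC hF) (jh_rapid hF); congr has_sum; apply/funext => k.
have -> : JC (fun x => conjc (F x) * ek k x) = conjc (jh F k).
  rewrite /jh -JCC; last exact: tst_ek.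
  by congr JC; apply/funext => x; rewrite conjcM ekN conjcK.
exact: mul_conjc.
Qed.

(** The sum of the squared moduli of the coefficients of [f] equals the constant times [J (f^2)];
    both are positive when [J f] is nonzero. *)
Lemma J_normalization : exists2 c : R, 0 < c & forall F y, T F -> `|y - q| < r ->
  trig (jh F) y = c%:C * F y.
Proof.
have [c hc] := trig_jh_const; have [f hf Jf] := J_neq0; pose F x : C := (f x)%:C.
have eF : JC (fun x => conjc (F x) * trig (jh F) x) = c * (J (fun x => f x * f x))%:C.
  have -> : (fun x => conjc (F x) * trig (jh F) x) = fun x => c * (f x * f x)%:C.
    apply/funext => x; have [hx|hx] := ltP `|x - q| r.
      by rewrite hc // /F conjcR mulrCA -rmorphM.
    have e : F x = 0 := tst_supp hf hx; have fx : f x = 0 := congr1 (@complex.Re R) e.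
    by rewrite e fx conjcZ !mul0r mulr0.
  have ff : T (fun x => (f x * f x)%:C).
    by under eq_fun do rewrite rmorphM; apply: tstM => //; exact: tst_csm hf.
  rewrite JCZ //; congr (_ * _); apply: complexP => //=.
  by have := JZ 0 hf; rewrite mul0r; under eq_fun do rewrite mul0r.
have ff : T (fun x => (f x * f x)%:C).
  by under eq_fun do rewrite rmorphM; apply: tstM => //; exact: tst_csm hf.
have := jh_sqr hf; rewrite -/F eF => hs.
have [B hB] := jh_rapid hf 0.
have hB' s : uniq s -> \sum_(k <- s) nrm (jh F k) ^+ 2 <= B ^+ 2.
  case: hB => _ hB /hB; apply: le_trans; apply: ler_sum => k _; by rewrite powRr0 mul1r.
have [y y0 hy] := has_sum_nonneg (fun k => sqr_ge0 (nrm (jh F k))) hB'.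
have ey := has_sum_unique hs hy.
(* The coefficient of index 0 is [J f]. *)
have jp : 0 < nrm (jh F 0) ^+ 2.
  rewrite exprn_gt0 // lt_neqAle nrm_ge0 andbT eq_sym.
  apply: contraNneq Jf => /nrm0_eq0; rewrite /jh.
  have -> : (fun x => F x * ek (- 0) x) = F.
    by apply/funext => x; rewrite oppr0 ek0 mulr1.
  by rewrite /JC => /(congr1 (@complex.Re R)) /= ->.
have yp : 0 < y.
  apply: lt_le_trans jp _; apply: le_eps => e e0.
  have [s0 h0] := hy _ e0; pose u := undup (0 :: s0).
  have uu : uniq u by exact: undup_uniq.
  have su : {subset s0 <= u} by move=> k ks; rewrite mem_undup inE ks orbT.
  have := h0 u uu su.
  rewrite -(rmorph_sum (real_complex R)) -rmorphB nrm_real ler_norml => /andP[_].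
  have : nrm (jh F 0) ^+ 2 <= \sum_(k <- u) nrm (jh F k) ^+ 2.
    rewrite -[leLHS](big_seq1 (@GRing.add R) 0 (fun k => nrm (jh F k) ^+ 2)).
    apply: ler_sum_uniq_sub => // [k|k]; first exact: sqr_ge0.
    by rewrite inE => /eqP ->; rewrite mem_undup inE eqxx.
  lra.
have J0 : 0 < J (fun x => f x * f x).
  rewrite lt_neqAle; apply/andP; split; last by apply: J_ge0 => // x; rewrite -expr2 sqr_ge0.
  apply/eqP => J0; move: ey; rewrite -J0 mulr0 => /(congr1 (@complex.Re R)) /= y00.
  by rewrite -y00 ltxx in yp.
exists (y / J (fun x => f x * f x)); first by rewrite divr_gt0.
move=> G z hG hz; rewrite hc // rmorphM /= -ey fmorphV mulrK //.
by rewrite unitfE; apply/eqP => /(congr1 (@complex.Re R)) /= e; rewrite e ltxx in J0.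
Qed.

Section Normalized.
Variable c : R.
Hypothesis c0 : 0 < c.
Hypothesis hc : forall F y, T F -> `|y - q| < r -> trig (jh F) y = c%:C * F y.

Definition fh F : K -> C := fun k => c%:C^-1 * jh F k.

Let cC : c%:C != 0 :> C.
Proof. by rewrite -(rmorph0 (real_complex R)) (inj_eq (@complexI R)) gt_eqF. Qed.

Lemma fh_rapid F : T F -> rapid (fh F).
Proof. by move=> /jh_rapid h s; have [B hB] := h s; exists (nrm c%:C^-1 * B); exact: bdZ. Qed.
Lemma fh_inv F y : T F -> `|y - q| < r -> trig (fh F) y = F y.
Proof. by move=> hF hy; rewrite /fh trigZ ?hc ?mulKf //; exact: jh_rapid. Qed.
Lemma fhD F G : T F -> T G -> fh (fun x => F x + G x) = fun k => fh F k + fh G k.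
Proof. by move=> hF hG; apply/funext => k; rewrite /fh jhD // mulrDr. Qed.
Lemma fhZ z F : T F -> fh (fun x => z * F x) = fun k => z * fh F k.
Proof. by move=> hF; apply/funext => k; rewrite /fh jhZ // mulrCA. Qed.
Lemma fh_sum (I : Type) (s : seq I) (F : I -> X -> C) : (forall i, T (F i)) ->
  fh (fun x => \sum_(i <- s) F i x) = fun k => \sum_(i <- s) fh (F i) k.
Proof.
move=> h; apply/funext => k; rewrite /fh -mulr_sumr; congr (_ * _).
rewrite /jh -JC_sum => [|i]; last exact: tst_ek.
by congr JC; apply/funext => x; rewrite mulr_suml.
Qed.
Lemma fh_Dk j F : T F -> fh (cpartial j F) = Dk j (fh F).
Proof. by move=> hF; apply/funext => k; rewrite /fh jh_Dk // /Dk mulrCA. Qed.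
Lemma fh_star F : T F -> fh (fun x => conjc (F x)) = star (fh F).
Proof.
move=> hF; apply/funext => k; rewrite /fh /star conjcM conjcV conjcR; congr (_ * _).
rewrite /jh -JCC; last exact: tst_ek.
by congr JC; apply/funext => x; rewrite conjcM -ekN !opprK.
Qed.
Lemma fh_shift l F : fh (fun x => F x * ek l x) = fun k => fh F (k - l).
Proof. by apply/funext => k; rewrite /fh jh_shift. Qed.
(** The first factor is expanded by the inversion formula under [J]; each exponential then shifts
    the coefficients of the second one. *)
Lemma fh_conv F G : T F -> T G -> fh (fun x => F x * G x) = conv (fh F) (fh G).
Proof.
move=> hF hG; apply/funext => k; rewrite /conv /gop; apply/esym/has_sum_csum.
have h := has_sumZ c%:C^-1 (JC_trig (tst_ek (- k) hG) (fh_rapid hF)).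
have e : JC (fun x => G x * ek (- k) x * trig (fh F) x) = jh (fun x => F x * G x) k.
  congr JC; apply/funext => x; have [hx|hx] := ltP `|x - q| r; first by rewrite fh_inv //; ring.
  by rewrite (tst_supp hG hx) !(mulr0, mul0r).
rewrite e in h; move: h; congr has_sum; apply/funext => l.
rewrite /fh /jh mulrCA; congr (_ * (_ * JC _)); apply/funext => x.
by rewrite -mulrA -ekD opprB addrC.
Qed.
(** A finitely supported sequence is a trigonometric polynomial. This is how cut off truncations
    become coefficient sequences of genuine test functions. *)
Lemma fh_finite F (v : K -> C) (t : seq K) : T F -> uniq t -> (forall k, k \notin t -> v k = 0) ->
  conv (fh F) v = fh (fun x => F x * \sum_(k <- t) v k * ek k x).
Proof.
move=> hF ut hv; 
have -> : (fun x => F x * \sum_(k <- t) v k * ek k x) = fun x => \sum_(k <- t) F x * (v k * ek k x).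
  by apply/funext => x; rewrite mulr_sumr.
rewrite fh_sum => [|k]; last first.
  by apply: tstM => //; apply: csmZ; [exact: openT|exact: csm_ek openT].
apply/funext => k; rewrite /conv /gop.
have h1 : cancel (fun l => k - l) (fun l => k - l) by move=> l; rewrite subKr.
apply: has_sum_csum.
have : has_sum (fun l => fh F (k - l) * v l) (\sum_(l <- t) fh F (k - l) * v l).
  by apply: has_sum_finite => // l /hv ->; rewrite mulr0.
move/(has_sum_map h1 h1).
have -> : \sum_(l <- t) fh F (k - l) * v l = \sum_(l <- t) fh (fun x => F x * (v l * ek l x)) k.
  apply: eq_bigr => l _.
  have -> : (fun x => F x * (v l * ek l x)) = fun x => v l * (F x * ek l x) by apply/funext => x; ring.
  by rewrite fhZ ?fh_shift ?(mulrC (v l)) //; exact: tst_ek.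
by congr has_sum; apply/funext => l /=; rewrite subKr.
Qed.
Lemma fh_inj F G x : T F -> T G -> fh F = fh G -> F x = G x.
Proof.
move=> hF hG e; have [hx|hx] := ltP `|x - q| r; first by rewrite -(fh_inv hF hx) e fh_inv.
by rewrite (tst_supp hF hx) (tst_supp hG hx).
Qed.

Lemma tst_sqr F : T F -> rT (fun x => nrm (F x) ^+ 2).
Proof.
move=> hF; have -> : (fun x => (nrm (F x) ^+ 2)%:C) = fun x => F x * conjc (F x).
  by apply/funext => x; rewrite mul_conjc.
by apply: tstM => //; apply: csmC openT (tst_csm hF).
Qed.
Lemma fh_parseval F : T F -> has_sum (fun k => (nrm (fh F k) ^+ 2)%:C)
    (c^-1 * J (fun x => nrm (F x) ^+ 2))%:C.
Proof.
move=> hF; have := has_sumZ (c ^- 2)%:C (jh_sqr hF).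
have -> : JC (fun x => conjc (F x) * trig (jh F) x) = (c * J (fun x => nrm (F x) ^+ 2))%:C.
  have -> : (fun x => conjc (F x) * trig (jh F) x) = fun x => c%:C * (nrm (F x) ^+ 2)%:C.
    apply/funext => x; have [hx|hx] := ltP `|x - q| r.
      by rewrite hc // mulrCA -mul_conjc [conjc _ * _]mulrC.
    by rewrite (tst_supp hF hx) conjcZ mul0r nrm0 expr0n mulr0.
  have h2 := tst_sqr hF.
  rewrite JCZ // rmorphM /=; congr (_ * _); apply: complexP => //=.
  by have := JZ 0 h2; rewrite mul0r; under eq_fun do rewrite mul0r.
have -> : (c ^- 2)%:C * (c * J (fun x => nrm (F x) ^+ 2))%:C = (c^-1 * J (fun x => nrm (F x) ^+ 2))%:C :> C.
  by rewrite -rmorphM; congr (_%:C); field; rewrite gt_eqF.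
congr has_sum; apply/funext => k; rewrite -rmorphM; congr (_%:C).
have -> : nrm (fh F k) = c^-1 * nrm (jh F k).
  by rewrite /fh nrmM -fmorphV nrm_real ger0_norm // invr_ge0 ltW.
by rewrite exprMn exprVn.
Qed.
Lemma fh_bd0 F B : T F -> bd 0 (fh F) B <-> 0 <= B /\ J (fun x => nrm (F x) ^+ 2) <= c * B ^+ 2.
Proof.
move=> hF; have hs := fh_parseval hF.
have e s : \sum_(k <- s) (w k `^ 0 * nrm (fh F k)) ^+ 2 = \sum_(k <- s) nrm (fh F k) ^+ 2.
  by apply: eq_bigr => k _; rewrite powRr0 mul1r.
split=> [[B0 h]|[B0 h]]; split=> //.
  rewrite mulrC -ler_pdivrMr // mulrC.
  apply: le_eps => e1 e0; have [s0 h0] := hs _ e0.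
  have us : uniq (undup s0) by exact: undup_uniq.
  have sub : {subset s0 <= undup s0} by move=> k; rewrite mem_undup.
  have := h0 _ us sub; rewrite -(rmorph_sum (real_complex R)) -rmorphB nrm_real ler_norml => /andP[+ _].
  have := h _ us; rewrite e; lra.
move=> t ut; rewrite e; apply: (@le_trans _ _ (c^-1 * J (fun x => nrm (F x) ^+ 2))).
  apply: le_eps => e1 e0; have [s0 h0] := hs _ e0.
  have [u1 u2 u3] := uniq_undup_cat s0 t.
  have := h0 _ u1 u2; rewrite -(rmorph_sum (real_complex R)) -rmorphB nrm_real ler_norml => /andP[_].
  have := @ler_sum_uniq_sub _ _ (fun k => nrm (fh F k) ^+ 2) t _ (fun k => sqr_ge0 _) ut u1 u3; lra.
by rewrite ler_pdivrMl.
Qed.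

End Normalized.
End Fourier.

(** * Functions and vector fields in a chart *)

Section ManifoldCalculus.
Context {R : realType} {m : nat} {M : smooth_manifold R m}.
Local Notation X := ('rV[R]_m).
Local Notation C := R[i].
Implicit Types (d : chart R m M) (V O : set M) (x p : M) (y : X).

Section OneChart.
Variable d : chart R m M.
Hypothesis Ad : atlas d.

Lemma dom_open : open (chart_dom d). Proof. by have [] := atlas_chart Ad. Qed.
Lemma img_open : open (chart_img d). Proof. by have [] := atlas_chart Ad. Qed.
Lemma chart_mapK x : chart_dom d x -> chart_inv d (chart_map d x) = x.
Proof. by have [_ _ h _ _] := atlas_chart Ad; exact: h. Qed.
Lemma img_map x : chart_dom d x -> chart_img d (chart_map d x).
Proof. by exists x. Qed.
Lemma dom_inv y : chart_img d y -> chart_dom d (chart_inv d y).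
Proof. by case=> x dx <-; rewrite chart_mapK. Qed.
Lemma chart_invK y : chart_img d y -> chart_map d (chart_inv d y) = y.
Proof. by case=> x dx <-; rewrite chart_mapK. Qed.
Lemma map_continuous x : chart_dom d x -> {for x, continuous (chart_map d)}.
Proof.
have [ho _ _ + _] := atlas_chart Ad; rewrite (continuous_open_subspace _ ho) => h dx.
by apply: h; rewrite inE.
Qed.
Lemma inv_continuous y : chart_img d y -> {for y, continuous (chart_inv d)}.
Proof.
have [_ ho _ _ +] := atlas_chart Ad; rewrite (continuous_open_subspace _ ho) => h dx.
by apply: h; rewrite inE.
Qed.
Lemma chart_image O : chart_map d @` (chart_dom d `&` O) = [set y | chart_img d y /\ O (chart_inv d y)].
Proof.
apply/seteqP; split=> [_ [x [dx Ox] <-]|y [iy Oy]].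
  by split; [exact: img_map|rewrite chart_mapK].
by exists (chart_inv d y); [split=> //; exact: dom_inv|exact: chart_invK].
Qed.
Lemma open_image O : open O -> open (chart_map d @` (chart_dom d `&` O)).
Proof.
move=> oO; rewrite chart_image openE => y [iy Oy].
have h1 : \forall z \near y, chart_img d z by apply: near_open => //; exact: img_open.
have h2 : \forall z \near y, O (chart_inv d z).
  by apply: (inv_continuous iy); exact: open_nbhs_nbhs.
by apply: filterS2 h1 h2 => z; split.
Qed.

End OneChart.

Lemma smooth_realP V (f : M -> R) : smooth_real V f <->
  forall d, atlas d -> smo (chart_map d @` (chart_dom d `&` V)) (f \o chart_inv d).
Proof. by split=> h d Ad; apply/smo_rV; exact: h. Qed.

Lemma smooth_real_sub V O (f : M -> R) : O `<=` V -> smooth_real V f -> smooth_real O f.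
Proof.
move=> OV /smooth_realP h; apply/smooth_realP => d Ad; apply: smooth_sub (h d Ad).
by move=> _ [x [dx /OV Vx] <-]; exists x.
Qed.

Lemma smooth_real_local V (f : M -> R) : (forall x, V x -> exists O g,
  [/\ open O, O x, smooth_real O g & forall z, O z -> f z = g z]) -> smooth_real V f.
Proof.
move=> h; apply/smooth_realP => d Ad; apply: smooth_cover => _ [x [dx Vx] <-].
have [W [g [oW Wx /smooth_realP hg fg]]] := h x Vx.
exists (chart_map d @` (chart_dom d `&` W)); first by exists x.
apply: smooth_ext (hg d Ad); first exact: open_image.
by rewrite chart_image // => y [_ /fg e] /=; rewrite e.
Qed.

Lemma smooth_real_chart d O (f : M -> R) : atlas d -> open O -> O `<=` chart_dom d ->
  smo (chart_map d @` (chart_dom d `&` O)) (f \o chart_inv d) -> smooth_real O f.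
Proof.
move=> Ad oO Od hf; apply/smooth_realP => e Ae.
have oe := open_image Ae oO.
apply: (@smooth_ext _ _ _ ((f \o chart_inv d) \o (fun y => chart_map d (chart_inv e y)))) => //.
  by rewrite chart_image // => y [iy /Od dy] /=; rewrite chart_mapK.
apply: (smooth_comp oe (open_image Ad oO) _ hf).
  by rewrite !chart_image // => y [iy Oy]; split; [apply: img_map; exact: Od|rewrite chart_mapK //; exact: Od].
move=> j; have /smo_rV h := atlas_compat Ae Ad j; apply: smooth_sub h.
by move=> _ [x [ex Ox] <-]; exists x => //; split => //; exact: Od.
Qed.

Lemma smoothP V (f : M -> C) : smooth V f <->
  forall d, atlas d -> csm (chart_map d @` (chart_dom d `&` V)) (f \o chart_inv d).
Proof.
split=> [[/smooth_realP h1 /smooth_realP h2] d Ad|h].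
  by split; [exact: h1|exact: h2].
by split; apply/smooth_realP => d Ad; have [] := h d Ad.
Qed.

Lemma msmooth_sub V O (f : M -> C) : O `<=` V -> smooth V f -> smooth O f.
Proof. by move=> OV [h1 h2]; split; apply: smooth_real_sub OV _. Qed.

Lemma msmooth_local V (f : M -> C) : (forall x, V x -> exists O g,
  [/\ open O, O x, smooth O g & forall z, O z -> f z = g z]) -> smooth V f.
Proof.
move=> h; split; apply: smooth_real_local => x /h[W [g [oW Wx [g1 g2] fg]]].
  by exists W, (fun x => complex.Re (g x)); split=> // z /fg ->.
by exists W, (fun x => complex.Im (g x)); split=> // z /fg ->.
Qed.

Lemma msmooth_chart d O (f : M -> C) : atlas d -> open O -> O `<=` chart_dom d ->
  csm (chart_map d @` (chart_dom d `&` O)) (f \o chart_inv d) -> smooth O f.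
Proof. by move=> Ad oO Od [h1 h2]; split; apply: smooth_real_chart Ad oO Od _. Qed.

Lemma msmooth_cst V (k : C) : smooth V (fun=> k).
Proof. by apply/smoothP => d Ad; exact: csm_cst. Qed.
Lemma msmoothD V (f g : M -> C) : open V -> smooth V f -> smooth V g -> smooth V (f + g).
Proof.
move=> oV /smoothP hf /smoothP hg; apply/smoothP => d Ad.
exact: (csmD (open_image Ad oV) (hf d Ad) (hg d Ad)).
Qed.
Lemma msmoothM V (f g : M -> C) : open V -> smooth V f -> smooth V g -> smooth V (f * g).
Proof.
move=> oV /smoothP hf /smoothP hg; apply/smoothP => d Ad.
exact: (csmM (open_image Ad oV) (hf d Ad) (hg d Ad)).
Qed.
Lemma msmoothZ V (k : C) (f : M -> C) : open V -> smooth V f -> smooth V (k *: f).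
Proof.
move=> oV /smoothP hf; apply/smoothP => d Ad.
exact: (csmZ k (open_image Ad oV) (hf d Ad)).
Qed.
Lemma msmoothC V (f : M -> C) : open V -> smooth V f -> smooth V (conjf f).
Proof.
move=> oV /smoothP hf; apply/smoothP => d Ad; exact: (csmC (open_image Ad oV) (hf d Ad)).
Qed.
Lemma msmooth0 V : smooth V 0. Proof. exact: msmooth_cst. Qed.

Section Pull.
Variable c : chart R m M.
Hypothesis Ac : atlas c.

(* A function on [R^m] read in the chart [c] and extended by zero to the manifold. *)
Definition pull (F : X -> C) : M -> C := fun x =>
  if `[< chart_dom c x >] then F (chart_map c x) else 0.

Lemma pull_dom F x : chart_dom c x -> pull F x = F (chart_map c x).
Proof. by move=> dx; rewrite /pull asboolT. Qed.
Lemma pull_out F x : ~ chart_dom c x -> pull F x = 0.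
Proof. by move=> dx; rewrite /pull asboolF. Qed.
Lemma pullD F G : pull (fun y => F y + G y) = pull F + pull G.
Proof.
apply/funext => x; rewrite [RHS]/GRing.add /=; have [dx|dx] := pselect (chart_dom c x).
  by rewrite !pull_dom.
by rewrite !pull_out // addr0.
Qed.
Lemma pullM F G : pull (fun y => F y * G y) = pull F * pull G.
Proof.
apply/funext => x; rewrite [RHS]/GRing.mul /=; have [dx|dx] := pselect (chart_dom c x).
  by rewrite !pull_dom.
by rewrite !pull_out // mulr0.
Qed.
Lemma pullZ k F : pull (fun y => k * F y) = k *: pull F.
Proof.
apply/funext => x; rewrite [RHS]/GRing.scale /=; have [dx|dx] := pselect (chart_dom c x).
  by rewrite !pull_dom.
by rewrite !pull_out // [X in _ = X]mulr0.
Qed.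
Lemma pullC F : pull (fun y => conjc (F y)) = conjf (pull F).
Proof.
apply/funext => x; rewrite /conjf; have [dx|dx] := pselect (chart_dom c x).
  by rewrite !pull_dom.
by rewrite !pull_out // conjcZ.
Qed.
Lemma pull_push F (f : M -> C) : pull (fun y => F y * f (chart_inv c y)) = pull F * f.
Proof.
apply/funext => x; rewrite [RHS]/GRing.mul /=; have [dx|dx] := pselect (chart_dom c x).
  by rewrite !pull_dom // chart_mapK.
by rewrite !pull_out // mul0r.
Qed.
Lemma pull_sum (I : Type) (s : seq I) (F : I -> X -> C) :
  pull (fun y => \sum_(i <- s) F i y) = \sum_(i <- s) pull (F i).
Proof.
elim: s => [|i s IH].
  rewrite big_nil; apply/funext => x; rewrite /pull big_nil; by case: ifP.
by rewrite big_cons -IH -pullD; congr pull; apply/funext => y; rewrite big_cons.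
Qed.

Section Ball.
Variables (q : X) (r : R).
Hypothesis r0 : 0 < r.
Hypothesis ball_img : forall y, `|y - q| <= r -> chart_img c y.

Let supp_compact s : 0 <= s -> s <= r -> compact (chart_inv c @` [set y | `|y - q| <= s]).
Proof.
move=> s0 sr; apply: continuous_compact; last exact: (@compact_ball _ _ q s s0).
have [_ _ _ _ h] := atlas_chart Ac; apply: continuous_subspaceW h => y /= ys.
by apply: ball_img; exact: le_trans ys sr.
Qed.

(** The transported support is compact, hence closed because the manifold is Hausdorff; this makes
    the extension by zero smooth at points outside the chart. *)
Lemma pull_smooth F : tst q r F -> smooth setT (pull F).
Proof.
move=> [hF [s /andP[s0 sr] e]].
have cK := supp_compact (ltW s0) (ltW sr).
have clK := compact_closed (manifold_hausdorff (s := M)) cK.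
apply: msmooth_local => x _; have [dx|dx] := pselect (chart_dom c x).
  exists (chart_dom c), (pull F); split=> //; first exact: dom_open.
  apply: (msmooth_chart Ac (dom_open Ac)) => //.
  apply: (csm_ext (open_image Ac (dom_open Ac)) _ (csm_sub (@subsetT _ _) hF)).
  by rewrite chart_image // => y [iy dy] /=; rewrite pull_dom // chart_invK.
exists (~` (chart_inv c @` [set y | `|y - q| <= s])), (fun=> 0); split.
- exact: closed_openC.
- by move=> [y /= ys e1]; apply: dx; rewrite -e1; apply/dom_inv/ball_img => //; exact: le_trans ys (ltW sr).
- exact: msmooth_cst.
move=> z hz; have [dz|dz] := pselect (chart_dom c z); last exact: pull_out.
rewrite pull_dom // e // leNgt; apply/negP => /ltW h; apply: hz.
by exists (chart_map c z) => //; exact: chart_mapK.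
Qed.

Lemma pull_test V F : (forall y, `|y - q| < r -> V (chart_inv c y)) -> tst q r F ->
  test_function V (pull F).
Proof.
move=> hV hF; have [_ [s /andP[s0 sr] e]] := hF.
have cK := supp_compact (ltW s0) (ltW sr).
have clK := compact_closed (manifold_hausdorff (s := M)) cK.
have sK : tsupport (pull F) `<=` chart_inv c @` [set y | `|y - q| <= s].
  rewrite [X in _ `<=` X](proj1 (closure_id _) clK); apply: closureS => x /=.
  have [dx|dx] := pselect (chart_dom c x); last by rewrite pull_out ?eqxx.
  rewrite pull_dom // => Fx; exists (chart_map c x); last exact: chart_mapK.
  by rewrite /= leNgt; apply: contra Fx => /ltW /e ->.
split; first exact: pull_smooth.
- by apply: subclosed_compact cK sK; exact: closed_closure.
- by move=> x /sK[y /= ys <-]; apply: hV; exact: le_lt_trans ys sr.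
Qed.

Lemma csm_push V (f : M -> C) : open V -> smooth V f -> (forall y, `|y - q| < r -> V (chart_inv c y)) ->
  csm [set y | `|y - q| < r] (fun y => f (chart_inv c y)).
Proof.
move=> oV /smoothP/(_ c Ac) hf hV; apply: csm_sub hf => y /= ys.
have iy := ball_img (ltW ys).
by exists (chart_inv c y); [split; [exact: dom_inv|exact: hV]|exact: chart_invK].
Qed.

Lemma tst_push V (f : M -> C) F : open V -> smooth V f ->
  (forall y, `|y - q| < r -> V (chart_inv c y)) -> tst q r F ->
  tst q r (fun y => F y * f (chart_inv c y)).
Proof.
move=> oV hf hV hF; have [h1 [s sr e]] := hF.
apply: (tst_local sr) => [|y /e ->]; last by rewrite mul0r.
apply: (csmM (@open_in _ _ q r)); first by apply: csm_sub h1.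
exact: csm_push hf hV.
Qed.

End Ball.
End Pull.
End ManifoldCalculus.

(** * Algebra of derivations *)

Section VectorFieldOps.
Context {R : realType} {m : nat} {M : smooth_manifold R m}.
Local Notation C := R[i].
Implicit Types (Y Z : operator M) (f g : M -> C).

Lemma vf_smooth Y f : complex_vector_field Y -> smooth setT f -> smooth setT (Y f).
Proof. by case=> h _ _ _; exact: h. Qed.
Lemma vf_D Y f g : complex_vector_field Y -> smooth setT f -> smooth setT g ->
  Y (f + g) = Y f + Y g.
Proof. by case=> _ _ h _ hf hg; have := h 1 f g hf hg; rewrite !scale1r. Qed.
Lemma vf_0 Y : complex_vector_field Y -> Y 0 = 0.
Proof.
move=> hY; have h := vf_D hY (msmooth0 setT) (msmooth0 setT).
by apply: (addrI (Y 0)); rewrite -h addr0 addr0.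
Qed.
Lemma vf_Z Y k f : complex_vector_field Y -> smooth setT f -> Y (k *: f) = k *: Y f.
Proof.
move=> hY hf; have [_ _ h _] := hY; have := h k f 0 hf (msmooth0 setT).
by rewrite addr0 (vf_0 hY) addr0.
Qed.
Lemma vf_M Y f g : complex_vector_field Y -> smooth setT f -> smooth setT g ->
  Y (f * g) = Y f * g + f * Y g.
Proof. by case=> _ _ _; exact. Qed.
Lemma vf_sum Y (I : Type) (s : seq I) (F : I -> M -> C) : complex_vector_field Y ->
  (forall i, smooth setT (F i)) -> Y (\sum_(i <- s) F i) = \sum_(i <- s) Y (F i).
Proof.
move=> hY hF; elim: s => [|i s IH]; first by rewrite !big_nil vf_0.
rewrite !big_cons vf_D ?IH //; elim: s {IH} => [|j s IH]; first by rewrite big_nil; exact: msmooth0.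
by rewrite big_cons; exact: (msmoothD openT (hF j) IH).
Qed.

Lemma conjfK f : conjf (conjf f) = f.
Proof. by apply/funext => x; rewrite /conjf conjcK. Qed.
Lemma conjfM f g : conjf (f * g) = conjf f * conjf g.
Proof. by apply/funext => x; rewrite /conjf conjcM. Qed.
Lemma conjfD f g : conjf (f + g) = conjf f + conjf g.
Proof. by apply/funext => x; rewrite /conjf [LHS]rmorphD. Qed.
Lemma conjfZ k f : conjf (k *: f) = conjc k *: conjf f.
Proof. by apply/funext => x; rewrite /conjf [LHS]conjcM. Qed.

Lemma smooth_conjf f : smooth setT (conjf f) <-> smooth setT f.
Proof.
by split=> [h|]; [rewrite -(conjfK f)|]; apply: msmoothC => //; exact: openT.
Qed.

Lemma cvf_conj Y : complex_vector_field Y -> complex_vector_field (field_conj Y).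
Proof.
move=> hY; split=> [f hf|f hf|k f g hf hg|f g hf hg]; rewrite /field_conj.
- by apply/smooth_conjf/(vf_smooth hY)/smooth_conjf.
- have [_ h _ _] := hY; rewrite h; first by apply/funext => x; exact: conjcZ.
  by move/smooth_conjf.
- have sf := proj2 (smooth_conjf f) hf; have sg := proj2 (smooth_conjf g) hg.
  have skf : smooth setT (conjc k *: conjf f) by apply: msmoothZ => //; exact: openT.
  by rewrite conjfD conjfZ (vf_D hY) // (vf_Z _ hY) // conjfD conjfZ conjcK.
have sf := proj2 (smooth_conjf f) hf; have sg := proj2 (smooth_conjf g) hg.
by rewrite conjfM (vf_M hY) // conjfD !conjfM !conjfK.
Qed.

Lemma cvf_D Y Z : complex_vector_field Y -> complex_vector_field Z -> complex_vector_field (Y + Z).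
Proof.
move=> hY hZ; split=> [f hf|f hf|k f g hf hg|f g hf hg]; rewrite [(Y + Z) _]/=.
- by apply: msmoothD; [exact: openT|exact: vf_smooth|exact: vf_smooth].
- have [_ h1 _ _] := hY; have [_ h2 _ _] := hZ.
  by rewrite [LHS](_ : _ = Y f + Z f) // (h1 f hf) (h2 f hf) addr0.
- have skf : smooth setT (k *: f) by apply: msmoothZ => //; exact: openT.
  rewrite [LHS](_ : _ = Y (k *: f + g) + Z (k *: f + g)) //.
  rewrite [RHS](_ : _ = k *: (Y f + Z f) + (Y g + Z g)) //.
  by rewrite (vf_D hY skf hg) (vf_D hZ skf hg) (vf_Z k hY hf) (vf_Z k hZ hf) scalerDr addrACA.
rewrite [LHS](_ : _ = Y (f * g) + Z (f * g)) //.
rewrite [RHS](_ : _ = (Y f + Z f) * g + f * (Y g + Z g)) //.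
by rewrite (vf_M hY hf hg) (vf_M hZ hf hg) mulrDl mulrDr addrACA.
Qed.

Lemma cvf_scale phi Y : smooth setT phi -> complex_vector_field Y -> complex_vector_field (field_scale phi Y).
Proof.
move=> hp hY; split=> [f hf|f hf|k f g hf hg|f g hf hg]; rewrite /field_scale.
- by apply: msmoothM; [exact: openT|done|exact: vf_smooth].
- by have [_ h1 _ _] := hY; rewrite (h1 f hf) mulr0.
- have skf : smooth setT (k *: f) by apply: msmoothZ => //; exact: openT.
  rewrite (vf_D hY skf hg) (vf_Z k hY hf); apply/funext => x.
  rewrite [LHS](_ : _ = phi x * (k * Y f x + Y g x)) //.
  by rewrite [RHS](_ : _ = k * (phi x * Y f x) + phi x * Y g x) //; ring.
by rewrite (vf_M hY hf hg) mulrDr mulrA (mulrCA phi f).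
Qed.

Lemma cvf_0 : complex_vector_field (0 : operator M).
Proof.
split=> [f hf|//|k f g hf hg|f g hf hg]; first exact: msmooth0.
  by rewrite [LHS](_ : _ = 0) // [RHS](_ : _ = k *: 0 + 0) // scaler0 addr0.
by rewrite [LHS](_ : _ = 0) // [RHS](_ : _ = 0 * g + f * 0) // mul0r mulr0 addr0.
Qed.

Lemma cvf_bracket Y Z : complex_vector_field Y -> complex_vector_field Z -> complex_vector_field (bracket Y Z).
Proof.
move=> hY hZ; have sY f := vf_smooth (f := f) hY; have sZ f := vf_smooth (f := f) hZ.
split=> [f hf|f hf|k f g hf hg|f g hf hg]; rewrite /bracket.
- have := msmoothD openT (sY _ (sZ _ hf)) (msmoothZ (-1) openT (sZ _ (sY _ hf))).
  by rewrite scaleN1r.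
- have [_ h1 _ _] := hY; have [_ h2 _ _] := hZ.
  by rewrite (h1 f hf) (h2 f hf) (vf_0 hY) (vf_0 hZ) subrr.
- have skf : smooth setT (k *: f) by apply: msmoothZ => //; exact: openT.
  have skY : smooth setT (k *: Y f) by apply: msmoothZ; [exact: openT|exact: sY].
  have skZ : smooth setT (k *: Z f) by apply: msmoothZ; [exact: openT|exact: sZ].
  rewrite (vf_D hZ skf hg) (vf_D hY skf hg) (vf_Z k hZ hf) (vf_Z k hY hf).
  rewrite (vf_D hY skZ (sZ _ hg)) (vf_D hZ skY (sY _ hg)).
  rewrite (vf_Z k hY (sZ _ hf)) (vf_Z k hZ (sY _ hf)) scalerBr.
  by rewrite opprD addrACA.
rewrite (vf_M hZ hf hg) (vf_M hY hf hg).
have sm (a b : M -> C) : smooth setT a -> smooth setT b -> smooth setT (a * b).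
  by move=> ha hb; exact: (msmoothM openT ha hb).
have sYf := sY _ hf; have sYg := sY _ hg; have sZf := sZ _ hf; have sZg := sZ _ hg.
rewrite (vf_D hY (sm _ _ sZf hg) (sm _ _ hf sZg)) (vf_D hZ (sm _ _ sYf hg) (sm _ _ hf sYg)).
rewrite (vf_M hY sZf hg) (vf_M hY hf sZg) (vf_M hZ sYf hg) (vf_M hZ hf sYg).
apply/funext => x.
rewrite [LHS](_ : _ = Y (Z f) x * g x + Z f x * Y g x + (Y f x * Z g x + f x * Y (Z g) x) -
  (Z (Y f) x * g x + Y f x * Z g x + (Z f x * Y g x + f x * Z (Y g) x))) //.
by rewrite [RHS](_ : _ = (Y (Z f) x - Z (Y f) x) * g x + f x * (Y (Z g) x - Z (Y g) x)) //; ring.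
Qed.

Lemma field_conj_bracket Y Z : complex_vector_field Y -> complex_vector_field Z ->
  field_conj (bracket Y Z) = bracket (field_conj Y) (field_conj Z).
Proof.
move=> hY hZ; apply/funext => f; rewrite /field_conj /bracket !conjfK.
by apply/funext => x; rewrite /conjf [LHS](rmorphB (@conjc R)).
Qed.

Lemma rvf_bracket Y Z : real_vector_field Y -> real_vector_field Z -> real_vector_field (bracket Y Z).
Proof.
move=> [hY eY] [hZ eZ]; split; first exact: cvf_bracket.
by rewrite field_conj_bracket // eY eZ.
Qed.
Lemma rvf_D Y Z : real_vector_field Y -> real_vector_field Z -> real_vector_field (Y + Z).
Proof.
move=> [hY eY] [hZ eZ]; split; first exact: cvf_D.
rewrite -[in RHS]eY -[in RHS]eZ; apply/funext => f; rewrite /field_conj.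
by rewrite [LHS](_ : _ = conjf (Y (conjf f) + Z (conjf f))) // conjfD.
Qed.
Lemma rvf_scale (phi : M -> R) Y : smooth_real setT phi -> real_vector_field Y ->
  real_vector_field (field_scale (complex_of phi) Y).
Proof.
move=> hp [hY eY]; split.
  apply: (cvf_scale _ hY); split; first exact: hp.
  by apply/smooth_realP => d Ad; exact: smooth_cst.
rewrite -[in RHS]eY; apply/funext => f; rewrite /field_conj /field_scale conjfM.
by congr (_ * _); apply/funext => x; rewrite /conjf /complex_of conjcR.
Qed.
Lemma rvf_0 : real_vector_field (0 : operator M).
Proof.
split; first exact: cvf_0.
by apply/funext => f; apply/funext => x; rewrite /field_conj /conjf conjcZ.
Qed.
Lemma rvf_conjD Y : complex_vector_field Y -> real_vector_field (Y + field_conj Y).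
Proof.
move=> hY; split; first exact: (cvf_D hY (cvf_conj hY)).
apply/funext => f; rewrite {1}/field_conj.
rewrite [LHS](_ : _ = conjf (Y (conjf f) + field_conj Y (conjf f))) // conjfD.
by rewrite /field_conj !conjfK addrC.
Qed.

End VectorFieldOps.

Section LocalForm.
Context {R : realType} {m : nat} {M : smooth_manifold R m}.
Local Notation X := ('rV[R]_m).
Local Notation C := R[i].
Variable c : chart R m M.
Hypothesis Ac : atlas c.
(** The closed ball of radius [r2] lies in the image of the chart. Coordinate functions are cut off
    between [r] and [r2], components of fields between [r0] and [r], and test functions live in the
    ball of radius [r0], where both cutoffs are 1. *)
Variables (q : X) (r0 r r2 : R).
Hypothesis r00 : 0 < r0.
Hypothesis r0r : r0 < r.
Hypothesis rr2 : r < r2.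
Hypothesis ball_img : forall y, `|y - q| <= r2 -> chart_img c y.
Implicit Types (Y Z : operator M) (F : X -> C).

Let rp : 0 < r := lt_trans r00 r0r.
Let r2p : 0 < r2 := lt_trans rp rr2.
Local Notation pl := (pull c).

(** Stopping at the midpoint leaves the margin inside radius [b] that [tst] requires. *)
Definition cut (a b : R) (y : X) : C := (bump q a ((a + b) / 2) y)%:C.

Lemma tst_cut a b : 0 < a -> a < b -> tst q b (cut a b).
Proof. move=> a0 ab; have [h1 h2] := midf_lt ab; have b0 := lt_trans a0 ab.
exact: tst_bump. Qed.
Lemma cut1 a b y : 0 < a -> a < b -> `|y - q| <= a -> cut a b y = 1.
Proof. by move=> a0 ab h; rewrite /cut bump_eq1 ?(ltW a0) //; exact: (midf_lt ab).1. Qed.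
Lemma conj_cut a b y : conjc (cut a b y) = cut a b y.
Proof. exact: conjcR. Qed.

(* The coordinate functions, made global; [lc Y j] is the [j]-th component of [Y], cut off. *)
Definition kappa (j : 'I_m) : M -> C := pl (fun y => cut r r2 y * (y 0 j)%:C).

Definition lc Y (j : 'I_m) : X -> C := fun y => cut r0 r y * Y (kappa j) (chart_inv c y).

Definition vx (a : 'I_m -> X -> C) F : X -> C := fun y => \sum_j a j y * cpartial j F y.

Lemma csm_coordC (j : 'I_m) : csm setT (fun y : X => (y 0 j)%:C).
Proof. by apply: csm_real; exact: smooth_coord. Qed.
Lemma ball_img_r y : `|y - q| <= r -> chart_img c y.
Proof. by move=> h; apply: ball_img; apply: le_trans h (ltW rr2). Qed.
Lemma tst2 F : tst q r F -> tst q r2 F.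
Proof. by apply: tst_mono; exact: ltW. Qed.
Lemma smooth_pl F : tst q r2 F -> smooth setT (pl F).
Proof. exact: pull_smooth. Qed.
Lemma smooth_kappa j : smooth setT (kappa j).
Proof. by apply: smooth_pl; apply: tstM; [exact: tst_cut|exact: csm_coordC]. Qed.
Lemma tst_lc Y j : complex_vector_field Y -> tst q r (lc Y j).
Proof.
move=> hY; apply: (tst_push Ac ball_img_r openT) => //; last exact: tst_cut.
by apply: vf_smooth => //; exact: smooth_kappa.
Qed.

(** A derivation kills constants near a point and is therefore local; Hadamard's formula at [y] then
    leaves only the derivatives of the coordinates. *)
Lemma vf_local_form Y f y : complex_vector_field Y -> smooth setT f -> `|y - q| < r ->
  Y f (chart_inv c y) = \sum_j Y (kappa j) (chart_inv c y) * cpartial j (fun y => f (chart_inv c y)) y.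
Proof.
move=> hY hf yr; set x := chart_inv c y.
have iy : chart_img c y by apply: ball_img_r; exact: ltW.
have dx : chart_dom c x by exact: dom_inv.
have mx : chart_map c x = y by exact: chart_invK.
pose chi := cut r r2; have tchi : tst q r2 chi by exact: tst_cut.
have chi1 z : `|z - q| < r -> chi z = 1 by move=> h; apply: cut1 => //; exact: ltW.
pose F z := chi z * f (chart_inv c z).
have tF : tst q r2 F by exact: (tst_push Ac ball_img openT).
have [H [sH eH hH]] := chadamard y (tst_csm tF).
have sc := smooth_pl tchi; have sF := smooth_pl tF.
have px G : pl G x = G y by rewrite pull_dom // mx.
have pc1 : pl chi x = 1 by rewrite px chi1.
(* A smaller cutoff absorbs [chi]; the Leibniz rule for that product at [x], where both are 1, gives
   the claim. *)
have Yc0 : Y (pl chi) x = 0.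
  pose b := (`|y - q| + r) / 2; have [b1 b2] := midf_lt yr; rewrite -/b in b1 b2.
  have b0 : 0 < b by exact: le_lt_trans b1.
  have tp : tst q r2 (cut b r) by apply: tst2; exact: tst_cut.
  have e : pl (cut b r) * pl chi = pl (cut b r).
    rewrite -pullM; congr pull; apply/funext => z; have [hz|hz] := ltP `|z - q| r.
      by rewrite chi1 ?mulr1.
    by rewrite (tst_supp (tst_cut b0 b2) hz) mul0r.
  have sp := smooth_pl tp.
  have := congr1 (fun h => h x) (vf_M hY sp sc).
  rewrite e [RHS](_ : _ = Y (pl (cut b r)) x * pl chi x + pl (cut b r) x * Y (pl chi) x) //.
  rewrite pc1 mulr1 px cut1 ?mul1r ?(ltW b1) // => h.
  by apply: (addrI (Y (pl (cut b r)) x)); rewrite -h addr0.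
(* Hadamard's formula multiplied by the square of [chi], so that all factors are global smooth
   functions to which the Leibniz rule applies. *)
have key : pl chi * (pl chi * pl F) = F y *: (pl chi * pl chi) +
   \sum_j (kappa j + (- (y 0 j)%:C) *: pl chi) * pl (fun z => chi z * H j z).
  have e1 j : (kappa j + (- (y 0 j)%:C) *: pl chi) * pl (fun z => chi z * H j z) =
      pl (fun z => chi z * chi z * ((z 0 j - y 0 j)%:C * H j z)).
    rewrite /kappa -pullZ -pullD -pullM; congr pull; apply/funext => z.
    rewrite -/chi rmorphB /=; ring.
  under eq_bigr do rewrite e1.
  rewrite -pull_sum -!pullM -pullZ -pullD; congr pull; apply/funext => z.
  by rewrite [in LHS]hH -mulr_sumr; ring.
have sk j : smooth setT (kappa j + (- (y 0 j)%:C) *: pl chi).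
  by apply: msmoothD; [exact: openT|exact: smooth_kappa|apply: msmoothZ => //; exact: openT].
have sh j : smooth setT (pl (fun z => chi z * H j z)) by apply: smooth_pl; exact: tstM.
have skh j : smooth setT ((kappa j + (- (y 0 j)%:C) *: pl chi) * pl (fun z => chi z * H j z)).
  exact: (msmoothM openT (sk j) (sh j)).
have scc : smooth setT (pl chi * pl chi) by apply: msmoothM => //; exact: openT.
have sf2 : smooth setT (pl chi * f) by apply: msmoothM => //; exact: openT.
have eF : pl F = pl chi * f by exact: pull_push.
have HL : Y (pl chi * (pl chi * pl F)) x = Y f x.
  have scF : smooth setT (pl chi * pl F) by apply: msmoothM => //; exact: openT.
  rewrite (vf_M hY sc scF).
  rewrite [LHS](_ : _ = Y (pl chi) x * (pl chi * pl F) x + pl chi x * Y (pl chi * pl F) x) //.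
  rewrite Yc0 mul0r add0r pc1 mul1r (vf_M hY sc sF).
  rewrite [LHS](_ : _ = Y (pl chi) x * pl F x + pl chi x * Y (pl F) x) //.
  rewrite Yc0 mul0r add0r pc1 mul1r eF (vf_M hY sc hf).
  rewrite [LHS](_ : _ = Y (pl chi) x * f x + pl chi x * Y f x) //.
  by rewrite Yc0 mul0r add0r pc1 mul1r.
rewrite -HL key.
have sumsm (s : seq 'I_m) : smooth setT (\sum_(j <- s) (kappa j + (- (y 0 j)%:C) *: pl chi) * pl (fun z => chi z * H j z)).
  elim: s => [|j s IH]; first by rewrite big_nil; exact: msmooth0.
  by rewrite big_cons; exact: (msmoothD openT (skh j) IH).
rewrite (vf_D hY (msmoothZ (F y) openT scc) (sumsm _)).
rewrite (vf_sum _ hY) // (vf_Z _ hY) // (vf_M hY sc sc).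
have sumE (s : seq 'I_m) (G : 'I_m -> M -> C) : (\sum_(j <- s) G j) x = \sum_(j <- s) G j x.
  by elim: s => [|j s IH]; rewrite ?big_nil // !big_cons -IH.
rewrite [LHS](_ : _ = F y * (Y (pl chi) x * pl chi x + pl chi x * Y (pl chi) x) +
  (\sum_j Y ((kappa j + (- (y 0 j)%:C) *: pl chi) * pl (fun z => chi z * H j z))) x) //.
rewrite Yc0 mul0r mulr0 addr0 mulr0 add0r sumE; apply: eq_bigr => j _.
rewrite (vf_M hY (sk j) (sh j)).
rewrite [LHS](_ : _ = Y (kappa j + (- (y 0 j)%:C) *: pl chi) x * pl (fun z => chi z * H j z) x +
  (kappa j + (- (y 0 j)%:C) *: pl chi) x * Y (pl (fun z => chi z * H j z)) x) //.
have -> : (kappa j + (- (y 0 j)%:C) *: pl chi) x = 0.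
  rewrite [LHS](_ : _ = kappa j x + (- (y 0 j)%:C) * pl chi x) //.
  by rewrite /kappa !px -/chi chi1 // mul1r mulr1 subrr.
rewrite mul0r addr0 (vf_D hY (smooth_kappa j)); last by apply: msmoothZ => //; exact: openT.
rewrite (vf_Z _ hY sc) [LHS](_ : _ = (Y (kappa j) x + (- (y 0 j)%:C) * Y (pl chi) x) * pl (fun z => chi z * H j z) x) //.
rewrite Yc0 mulr0 addr0 px chi1 // mul1r eH; congr (_ * _).
by apply: (cpartial_ext j (@open_in _ _ q r)) => // z /= zr; rewrite /F chi1 ?mul1r.
Qed.

Lemma pull_inv F y : chart_img c y -> pl F (chart_inv c y) = F y.
Proof. by move=> iy; rewrite pull_dom ?chart_invK //; exact: dom_inv. Qed.

(** On the support of [F] the cutoff in [lc] is 1. Off the ball, [F = th F] and the Leibniz rule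
    give 0, since both factors vanish there. *)
Lemma vf_pull Y F : complex_vector_field Y -> tst q r0 F -> Y (pl F) = pl (vx (lc Y) F).
Proof.
move=> hY hF; have hF2 : tst q r2 F by apply: tst_mono hF; apply: ltW; exact: lt_trans rr2.
have sF := smooth_pl hF2.
apply/funext => x; have [[dx xr]|xr] := pselect (chart_dom c x /\ `|chart_map c x - q| < r).
  set y := chart_map c x in xr *; have ex : x = chart_inv c y by rewrite chart_mapK.
  have iy : chart_img c y by exact: img_map.
  rewrite {1}ex (vf_local_form hY sF xr) pull_dom // -/y; apply: eq_bigr => j _.
  have -> : cpartial j (fun y => pl F (chart_inv c y)) y = cpartial j F y.
    by apply: (cpartial_ext j (img_open Ac)) => // z; exact: pull_inv.
  rewrite /lc; have [yr0|yr0] := leP `|y - q| r0; first by rewrite cut1 ?mul1r.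
  have -> : cpartial j F y = 0 by apply: (tst_supp (tst_partial r00 j hF)); exact: ltW.
  by rewrite !mulr0.
have out G : tst q r G -> pl G x = 0.
  move=> hG; have [dx|dx] := pselect (chart_dom c x); last exact: pull_out.
  rewrite pull_dom // (tst_supp hG) // leNgt; apply/negP => h; exact: xr.
have hFr : tst q r F by apply: tst_mono hF; exact: ltW.
have tv : tst q r (vx (lc Y) F).
  apply: tst_sum => // j; apply: tstMl; first exact: tst_partial.
  exact: tst_csm (tst_lc j hY).
have [th [tth thF _]] := tst_unit rp hFr.
rewrite (out _ tv) -[in LHS](_ : pl th * pl F = pl F); last first.
  by rewrite -pullM; congr pull; apply/funext => y; exact: thF.
rewrite (vf_M hY (smooth_pl (tst2 tth)) sF).
rewrite [LHS](_ : _ = Y (pl th) x * pl F x + pl th x * Y (pl F) x) //.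
by rewrite !out // mulr0 mul0r addr0.
Qed.

Lemma tst_vx Y F s q' : complex_vector_field Y -> tst q' s F -> 0 < s -> tst q' s (vx (lc Y) F).
Proof.
move=> hY hF s0; apply: tst_sum => // j; apply: tstMl; first exact: tst_partial.
exact: tst_csm (tst_lc j hY).
Qed.

Lemma lc_conj Y j : complex_vector_field Y -> lc (field_conj Y) j = fun y => conjc (lc Y j y).
Proof.
move=> hY; apply/funext => y; rewrite /lc conjcM conj_cut; congr (_ * _).
have e : conjf (kappa j) = kappa j.
  by rewrite /kappa -pullC; congr pull; apply/funext => z; rewrite conjcM conj_cut conjcR.
by rewrite /field_conj e.
Qed.
Lemma lc_D Y Z j : lc (Y + Z) j = fun y => lc Y j y + lc Z j y.
Proof. by apply/funext => y; rewrite /lc -mulrDr. Qed.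
Lemma lc_0 j : lc 0 j = fun=> 0.
Proof. by apply/funext => y; rewrite /lc [X in _ * X](_ : _ = 0) // mulr0. Qed.
Lemma lc_scale phi Y j : lc (field_scale phi Y) j = fun y => phi (chart_inv c y) * lc Y j y.
Proof. by apply/funext => y; rewrite /lc /field_scale mulrCA. Qed.

End LocalForm.

(** * The volume measure in a chart *)

Section IteratedIntegral.
Context {R : realType}.
Local Notation lam := (@lebesgue_measure R).

(** Comparison through the simple functions lying below requires no measurability, which would be
    awkward to supply for the inner iterated integrals. *)
Lemma ge0_integral_mono (f g : R -> \bar R) : (forall x, (0 <= f x)%E) ->
  (forall x, (f x <= g x)%E) -> (\int[lam]_x f x <= \int[lam]_x g x)%E.
Proof.
move=> f0 fg; have g0 x : (0 <= g x)%E by apply: le_trans (f0 x) (fg x).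
rewrite !ge0_integralTE //; apply: ereal_sup_le => _ [h hf <-].
by exists h => // x; apply: le_trans (hf x) (fg x).
Qed.

Lemma integral_rV_ge0 m (f : 'rV[R]_m -> \bar R) : (forall x, (0 <= f x)%E) -> (0 <= integral_rV f)%E.
Proof.
elim: m f => [|m IH] f f0 /=; first exact: f0.
by apply: integral_ge0 => x _; apply: IH => v; exact: f0.
Qed.

Lemma integral_rV_mono m (f g : 'rV[R]_m -> \bar R) : (forall x, (0 <= f x)%E) ->
  (forall x, (f x <= g x)%E) -> (integral_rV f <= integral_rV g)%E.
Proof.
elim: m f g => [|m IH] f g f0 fg /=; first exact: fg.
apply: ge0_integral_mono => x; first by apply: integral_rV_ge0 => v; exact: f0.
by apply: IH => v; [exact: f0|exact: fg].
Qed.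

Definition box m (a : 'rV[R]_m) (e : R) : set 'rV[R]_m :=
  [set x | forall j, a 0 j <= x 0 j < a 0 j + e].

(** The explicit integrals needed are those of boxes: densities are squeezed between constants on
    small boxes. *)
Lemma integral_rV_box m (a : 'rV[R]_m) (e c : R) : 0 <= e -> 0 <= c ->
  integral_rV (fun x => (c * \1_(box a e) x)%:E) = (c * e ^+ m)%:E.
Proof.
move=> e0; elim: m a c => [|m IH] a c c0 /=.
  by rewrite indicE mem_set ?mulr1 //= => -[].
pose a' : 'rV[R]_m := \row_j a 0 (rshift 1 j).
pose I := `[a 0 (@lshift 1 m 0), a 0 (@lshift 1 m 0) + e[%classic.
have bE (x : R) (v : 'rV[R]_m) : \1_(box a e) (row_mx x%:M v) = \1_I x * \1_(box a' e) v :> R.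
  have rl : (row_mx x%:M v : 'rV[R]_m.+1) 0 (@lshift 1 m 0) = x.
    by apply: etrans (row_mxEl _ _ _ _) _; rewrite mxE eqxx.
  have rr j : (row_mx x%:M v : 'rV[R]_m.+1) 0 (@rshift 1 m j) = v 0 j by exact: row_mxEr.
  rewrite !indicE -natrM mulnb; congr (_%:R); congr (nat_of_bool _).
  apply/idP/andP => [/set_mem h|[/set_mem h1 /set_mem h2]].
    split; apply/mem_set.
      by have := h (@lshift 1 m 0); rewrite rl /I /= in_itv.
    by move=> j; have := h (@rshift 1 m j); rewrite rr mxE.
  apply/mem_set => j; case: (@split_ordP 1 m j) => i ->.
    by rewrite (ord1 i) rl; move: h1; rewrite /I /= in_itv.
  by rewrite rr; have := h2 i; rewrite mxE.
have inner x : integral_rV (fun v : 'rV[R]_m => (c * \1_(box a e) (row_mx x%:M v))%:E) =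
    ((c * e ^+ m)%:E * (\1_I x)%:E)%E.
  have := IH a' (c * \1_I x); rewrite mulr_ge0 // => /(_ isT).
  under [in LHS]eq_fun do rewrite -mulrA -bE.
  by move=> ->; rewrite -EFinM; congr (_%:E); ring.
under eq_integral do rewrite inner.
have mI : measurable (I : set (measurableTypeR R)) by exact: measurable_itv.
rewrite ge0_integralZl_EFin; last 4 first.
- exact: measurableT.
- by move=> x _; rewrite lee_fin.
- by apply/measurable_EFinP; exact: measurable_indic.
- by rewrite mulr_ge0 ?exprn_ge0.
rewrite (integral_indic _ measurableT mI) setIT.
have eI : lam I = e%:E.
  have := lebesgue_measure_itv `[a 0 (@lshift 1 m 0), a 0 (@lshift 1 m 0) + e[%R.
  rewrite /= lte_fin ltrDl; case: ltP => [_ ->|e0' ->].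
    by rewrite -EFinB addrAC subrr add0r.
  by congr (_%:E); apply/le_anti; rewrite e0 e0'.
apply: etrans (congr1 (fun z => (c * e ^+ m)%:E * z)%E eI) _.
by rewrite -EFinM exprSr mulrA.
Qed.

(** Along the segment from the identity to [A] the forms stay positive definite, so the determinant,
    a polynomial in the parameter, has no zero there and keeps the sign it has at the identity. *)
Lemma pos_def_det n (A : 'M[R]_n) : (forall u : 'rV[R]_n, u != 0 -> 0 < (u *m A *m u^T) 0 0) ->
  0 < \det A.
Proof.
move=> hA; pose B : 'M[{poly R}]_n := \matrix_(i, j) ('X * ((A - 1%:M) i j)%:P + ((1%:M : 'M[R]_n) i j)%:P).
have hB t : (\det B).[t] = \det (t *: (A - 1%:M) + 1%:M).
  rewrite -[LHS]/(horner_eval t _) -det_map_mx; congr (\det _); apply/matrixP => i j.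
  have Bij : B i j = 'X * ((A - 1%:M) i j)%:P + ((1%:M : 'M[R]_n) i j)%:P  by rewrite mxE.
  by rewrite mxE Bij /= /horner_eval hornerD hornerM hornerX !hornerC [in RHS]mxE [in RHS]mxE.
have nz t : 0 <= t <= 1 -> (\det B).[t] != 0.
  case/andP=> t0 t1; rewrite hB; apply/negP => /det0P[u u0 hu].
  have e : u *m (t *: (A - 1%:M) + 1%:M) *m u^T = t *: (u *m A *m u^T - u *m u^T) + u *m u^T.
    by rewrite mulmxDr -scalemxAr mulmxBr !mulmx1 mulmxDl -scalemxAl mulmxBl.
  have {e} := congr1 (fun v : 'M[R]_(1, 1) => v 0 0) e; rewrite hu mul0mx.
  have p1 := hA u u0; set a := u *m A *m u^T in p1 *; set b := u *m u^T.
  have p2 : 0 < b 0 0.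
    have [i ui] : exists i, u 0 i != 0.
      apply/existsP; apply: contraR u0; rewrite negb_exists => /forallP h.
      by apply/eqP/rowP => i; rewrite mxE; have := h i; rewrite negbK => /eqP.
    rewrite mxE (bigD1 i) //= ltr_pwDl // ?mxE -?expr2 ?exprn_even_gt0 //.
    by apply: sumr_ge0 => j _; rewrite mxE -expr2 sqr_ge0.
  have -> : (t *: (a - b) + b) 0 0 = t * (a 0 0 - b 0 0) + b 0 0.
    by clearbody a b; rewrite !mxE.
  rewrite mxE => e; move: p1 p2 e; nra.
have P1 : (\det B).[1] = \det A by rewrite hB scale1r subrK.
have P0 : (\det B).[0] = 1 by rewrite hB scale0r add0r det1.
rewrite ltNge; apply/negP => dA.
have [|x] := @poly_ivt R (- \det B) 0 1 ler01.
  by rewrite !hornerE P0 P1 oppr_ge0 dA oppr_le0 ler01.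
move=> /nz/negP h; rewrite rootE hornerN oppr_eq0; exact: h.
Qed.

End IteratedIntegral.

Section Density.
Context {R : realType} {m : nat} {M : smooth_manifold R m}.
Local Notation X := ('rV[R]_m).
Implicit Types (f g : M -> R).

Section At.
Variables (d : chart R m M) (p : M).
Hypothesis Ad : atlas d.
Hypothesis dp : chart_dom d p.

Lemma coord_vectorE (i : 'I_m) f : smooth_real setT f ->
  coord_vector d p i f = partial i (f \o chart_inv d) (chart_map d p).
Proof. by move=> h; rewrite /coord_vector asboolT. Qed.

Lemma smooth_coord_rep f : smooth_real setT f -> smo (chart_img d) (f \o chart_inv d).
Proof. by move=> /smooth_realP/(_ d Ad); rewrite setIT. Qed.

Lemma coord_vector_tangent (i : 'I_m) : tangent_space p (coord_vector d p i).
Proof.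
have sd f : smooth_real setT f -> derivable (f \o chart_inv d) (chart_map d p) (delta_mx 0 i).
  by move=> /smooth_coord_rep h; exact: (@smooth_derivable R m (chart_img d) (f \o chart_inv d) (chart_map d p) i h (img_map dp)).
have rM f g : smooth_real setT f -> smooth_real setT g -> smooth_real setT (f * g).
  move=> /smooth_realP hf /smooth_realP hg; apply/smooth_realP => e Ae.
  exact: (smoothM (open_image Ae openT) (hf e Ae) (hg e Ae)).
have rL (k : R) f g : smooth_real setT f -> smooth_real setT g -> smooth_real setT (k *: f + g).
  move=> /smooth_realP hf /smooth_realP hg; apply/smooth_realP => e Ae.
  have oe := open_image Ae openT.
  exact: (smoothD oe (smoothM oe (smooth_cst _ k) (hf e Ae)) (hg e Ae)).
split=> [f hf|k f g hf hg|f g hf hg].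
- by rewrite /coord_vector asboolF.
- rewrite (coord_vectorE i hf) (coord_vectorE i hg) (coord_vectorE i (rL k f g hf hg)).
  rewrite /partial; have := deriveD (derivableZ (k := k) (sd f hf)) (sd g hg).
  by rewrite deriveZ; [exact: id|exact: sd].
rewrite (coord_vectorE i hf) (coord_vectorE i hg) (coord_vectorE i (rM f g hf hg)).
rewrite /partial; have := deriveM (sd f hf) (sd g hg).
have -> : (f \o chart_inv d) (chart_map d p) = f p by rewrite /= chart_mapK.
have -> : (g \o chart_inv d) (chart_map d p) = g p by rewrite /= chart_mapK.
move=> h; apply: (etrans h); rewrite /GRing.scale /=; ring.
Qed.

(** A fold of the shape [k * v + w], to which the linearity axiom of the metric applies
    literally. *)
Definition vec (s : seq 'I_m) (u : 'I_m -> R) : functional M :=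
  foldr (fun i v f => u i * coord_vector d p i f + v f) (fun=> 0) s.

Lemma vecE s u f : vec s u f = \sum_(i <- s) u i * coord_vector d p i f.
Proof. by elim: s => [|i s IH]; rewrite ?big_nil // big_cons /= IH. Qed.

Lemma tangent_lin (k : R) v w : tangent_space p v -> tangent_space p w ->
  tangent_space p (fun f => k * v f + w f).
Proof.
move=> [v1 v2 v3] [w1 w2 w3]; split=> [f hf|l f g hf hg|f g hf hg].
- by rewrite v1 // w1 // mulr0 addr0.
- by rewrite v2 // w2 //; ring.
by rewrite v3 // w3 //; ring.
Qed.

Lemma tangent_0 : tangent_space p (fun=> 0).
Proof. by split=> // *; ring. Qed.

Lemma vec_tangent s u : tangent_space p (vec s u).
Proof.
elim: s => [|i s IH] /=; first exact: tangent_0.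
by apply: tangent_lin => //; exact: coord_vector_tangent.
Qed.

Variable g : riemannian_metric M.

Lemma metric_0l z : tangent_space p z -> metric g p (fun=> 0) z = 0.
Proof.
move=> hz; have := metric_linear g (-1) tangent_0 tangent_0 hz.
rewrite (_ : (fun f => -1 * 0 + 0) = fun=> 0); last by apply/funext => f; ring.
by move=> ->; ring.
Qed.

Lemma metric_vecl s u z : tangent_space p z ->
  metric g p (vec s u) z = \sum_(i <- s) u i * metric g p (coord_vector d p i) z.
Proof.
move=> hz; elim: s => [|i s IH]; first by rewrite big_nil metric_0l.
by rewrite big_cons -IH -metric_linear //; [exact: coord_vector_tangent|exact: vec_tangent].
Qed.

Lemma metric_vec u : metric g p (vec (index_enum _) u) (vec (index_enum _) u) =
  \sum_i \sum_j u i * u j * gram g d p i j.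
Proof.
rewrite metric_vecl; last exact: vec_tangent.
apply: eq_bigr => i _; rewrite Defs.metric_sym; [|exact: coord_vector_tangent|exact: vec_tangent].
rewrite metric_vecl; last exact: coord_vector_tangent.
rewrite mulr_sumr; apply: eq_bigr => j _; rewrite mxE Defs.metric_sym; [|exact: coord_vector_tangent..].
ring.
Qed.

(** Cut off coordinates are global functions dual to the coordinate vectors, which are therefore
    independent; positivity of the metric then gives a positive Gram determinant. *)
Lemma coord_functions (j : 'I_m) : exists2 f, smooth_real setT f &
  forall i, coord_vector d p i f = (i == j)%:R.
Proof.
set y := chart_map d p; have iy : chart_img d y by exact: img_map.
have /nbhs_ballP[r2 /= r20 hb] : nbhs y (chart_img d) by apply: near_open => //; exact: img_open.
have bi z : `|z - y| <= r2 / 2 -> chart_img d z.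
  move=> h; apply: hb; rewrite -ball_normE /= distrC; apply: le_lt_trans h _.
  by rewrite ltr_pdivrMr // ltr_pMr // ltr1n.
have r4 : 0 < r2 / 4 by rewrite divr_gt0.
have r42 : r2 / 4 < r2 / 2 by rewrite ltr_pM2l // ltf_pV2 ?posrE // ltr_nat.
have sk := smooth_kappa Ad (q := y) (r0 := r2 / 8) (r := r2 / 4) (r2 := r2 / 2).
have r8 : 0 < r2 / 8 by rewrite divr_gt0.
have r84 : r2 / 8 < r2 / 4 by rewrite ltr_pM2l // ltf_pV2 ?posrE // ltr_nat.
have {}sk := sk r8 r84 r42 bi j.
have [sR sI] := sk; exists (fun x => complex.Re (kappa d y (r2 / 4) (r2 / 2) j x)) => // i.
rewrite coord_vectorE // -/y.
have e : forall z, `|z - y| < r2 / 4 ->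
   ((fun x => complex.Re (kappa d y (r2 / 4) (r2 / 2) j x)) \o chart_inv d) z = z 0 j.
  move=> z zr; rewrite /= /kappa pull_inv //; last by apply: bi; apply: ltW; exact: lt_trans r42.
  by rewrite cut1 ?mul1r // ltW.
rewrite (partial_ext i (@open_in _ _ y (r2 / 4)) _ e) /=; last by rewrite subrr normr0.
rewrite /partial; suff [_ ->] : is_derive y (delta_mx 0 i) (fun x : X => x 0 j) (i == j)%:R by [].
apply/is_derive_line.
have -> : (fun h : R => (h *: delta_mx 0 i + y) 0 j) = (fun h => h * (i == j)%:R + y 0 j).
  by apply/funext => h; rewrite !mxE eqxx /= [j == i]eq_sym.
by apply: is_derive_eq; rewrite addr0 scaler0 add0r [_%:A]mulr1.
Qed.

Lemma gram_det_gt0 : 0 < \det (gram g d p).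
Proof.
apply: pos_def_det => u u0.
have -> : (u *m gram g d p *m u^T) 0 0 = metric g p (vec (index_enum _) (fun i => u 0 i)) (vec (index_enum _) (fun i => u 0 i)).
  rewrite metric_vec mxE exchange_big; apply: eq_bigr => j _ /=.
  rewrite mxE mulr_suml; apply: eq_bigr => i _; rewrite !mxE; ring.
apply: metric_pos; first exact: vec_tangent.
move=> v0; move/negP: u0; apply; apply/eqP/rowP => j; rewrite mxE.
have [f hf cf] := coord_functions j.
have := congr1 (fun v => v f) v0; rewrite /= vecE (bigD1 j) //= big1 => [|i /negPf ij].
  by rewrite cf eqxx mulr1 addr0.
by rewrite cf ij mulr0.
Qed.

End At.

Definition rho (g : riemannian_metric M) (d : chart R m M) (y : X) : R :=
  Num.sqrt (\det (gram g d (chart_inv d y))).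

Lemma rho_gt0 (g : riemannian_metric M) (d : chart R m M) y : atlas d -> chart_img d y -> 0 < rho g d y.
Proof. by move=> Ad iy; rewrite /rho sqrtr_gt0; apply: gram_det_gt0 => //; exact: dom_inv. Qed.

Lemma smooth_rho (g : riemannian_metric M) (d : chart R m M) : atlas d -> smo (chart_img d) (rho g d).
Proof.
move=> Ad; have oi := img_open Ad; apply: (smooth_sqrt oi) => [y iy|].
  by apply: gram_det_gt0 => //; exact: dom_inv.
apply: (smooth_det oi) => i j; apply/smo_rV.
have -> : (fun x => gram g d (chart_inv d x) i j) = fun x => metric g (chart_inv d x)
    (coord_vector d (chart_inv d x) i) (coord_vector d (chart_inv d x) j).
  by apply/funext => x; rewrite mxE.
exact: metric_smooth.
Qed.

End Density.

(** * Integration in a chart by Riemann sums *)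

Section ChartMeasure.
Context {R : realType} {m : nat} {M : smooth_manifold R m}.
Local Notation X := ('rV[R]_m).
Local Notation C := R[i].
Variables (g : riemannian_metric M) (mu : {measure set (borel M) -> \bar R}).
Hypothesis mu_vol : riemannian_volume g mu.
Variable c : chart R m M.
Hypothesis Ac : atlas c.
Variables (q : X) (r r2 : R).
Hypothesis r0 : 0 < r.
Hypothesis rr2 : r < r2.
Hypothesis ball_img : forall y, `|y - q| <= r2 -> chart_img c y.
Local Notation rh := (rho g c).
Local Notation rT f := (tst q r (fun y => (f y)%:C)).

Definition rpull (f : X -> R) : M -> R := fun x => complex.Re (pull c (fun y => (f y)%:C) x).

Definition cell (a : X) (e : R) : set M := [set x | chart_dom c x /\ box a e (chart_map c x)].

Lemma open_measurableM (A : set M) : open A -> measurable (A : set (borel M)).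
Proof. by move=> oA; apply: sub_sigma_algebra. Qed.

Lemma measurable_cell a e : measurable (cell a e : set (borel M)).
Proof.
have half (j : 'I_m) (t : R) : measurable ([set x | chart_dom c x /\ chart_map c x 0 j < t] : set (borel M)).
  apply: open_measurableM; rewrite openE => x [dx xt].
  have h1 : \forall z \near x, chart_dom c z by apply: open_nbhs_nbhs; split=> //; exact: dom_open.
  have h2 : \forall z \near x, chart_map c z 0 j < t.
    have cv : chart_map c z 0 j @[z --> x] --> chart_map c x 0 j.
      exact: (cvg_comp (chart_map c) (fun y : X => y 0 j) (map_continuous Ac dx) (@coord_continuous _ _ _ 0 j _)).
    exact: (cvgr_lt _ cv _ xt).
  by apply: filterS2 h1 h2 => z.
have H (s : seq 'I_m) : measurable ([set x | chart_dom c x /\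
    forall j, j \in s -> a 0 j <= chart_map c x 0 j < a 0 j + e] : set (borel M)).
  elim: s => [|j s IH].
    rewrite (_ : [set x | _] = chart_dom c); first by apply: open_measurableM; exact: dom_open.
    by apply/seteqP; split=> x //= -[].
  rewrite (_ : [set x | _] = ([set x | chart_dom c x /\ forall j, j \in s -> a 0 j <= chart_map c x 0 j < a 0 j + e]
     `&` ([set x | chart_dom c x /\ chart_map c x 0 j < a 0 j + e] `\` [set x | chart_dom c x /\ chart_map c x 0 j < a 0 j]))).
    by apply: measurableI => //; apply: measurableD; exact: half.
  apply/seteqP; split=> x /=.
    move=> [dx h]; split; first by split=> // i si; apply: h; rewrite inE si orbT.
    have /andP[h1 h2] := h j (mem_head _ _); split=> // -[_]; by rewrite ltNge h1.
  move=> [[dx h] [[_ h2] h1]]; split=> // i; rewrite inE => /orP[/eqP ->|]; last exact: h.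
  by rewrite h2 andbT leNgt; apply/negP => h3; apply: h1.
rewrite (_ : cell a e = [set x | chart_dom c x /\
    forall j, j \in enum 'I_m -> a 0 j <= chart_map c x 0 j < a 0 j + e]) //.
by apply/seteqP; split=> x [dx h]; split=> // j *; apply: h; rewrite ?mem_enum.
Qed.

(** The volume of a small cell is squeezed between the extreme values of the density. Integrals are
    reached from here through Riemann sums, without a change of variables formula. *)
Lemma mu_cell a e lo hi : 0 <= e -> 0 <= lo -> (forall y, box a e y -> chart_img c y /\ lo <= rh y <= hi) ->
  ((lo * e ^+ m)%:E <= mu (cell a e) <= (hi * e ^+ m)%:E)%E \/ hi < 0.
Proof.
move=> e0 l0 hb; have [hi0|hi0] := ltP hi 0; first by right.
left; rewrite (mu_vol Ac (measurable_cell a e)); last by move=> x [].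
have eB : chart_map c @` cell a e = box a e.
  apply/seteqP; split=> [_ [x [dx bx] <-] //|y by_].
  have [iy _] := hb y by_; exists (chart_inv c y); last exact: chart_invK.
  by split; [exact: dom_inv|rewrite chart_invK].
rewrite eB -(integral_rV_box a e0 l0) -(integral_rV_box a e0 hi0); apply/andP; split.
  apply: integral_rV_mono => y; rewrite lee_fin; first by rewrite mulr_ge0.
  rewrite indicE mulrC; case: (boolP (y \in box a e)) => [/set_mem /hb[_ /andP[h _]]|_].
    by rewrite !mul1r.
  by rewrite !mul0r.
apply: integral_rV_mono => y; rewrite lee_fin; first by rewrite mulr_ge0 ?sqrtr_ge0.
rewrite indicE mulrC; case: (boolP (y \in box a e)) => [/set_mem /hb[_ /andP[_ h]]|_].
  by rewrite !mulr1.
by rewrite !mulr0.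
Qed.

Lemma smooth_real_continuous (f : M -> R) : smooth_real setT f -> continuous f.
Proof.
move=> /smooth_realP hf x; have [d Ad dx] : exists2 d : chart R m M, atlas d & chart_dom d x.
  by have : [set: M] x by []; rewrite -(atlas_cover M) => -[d Ad dx]; exists d.
 have := hf d Ad; rewrite setIT => sf.
have cf : {for chart_map d x, continuous (f \o chart_inv d)} by exact: (smooth_continuous sf (img_map dx)).
have ch : (f \o chart_inv d) (chart_map d z) @[z --> x] --> (f \o chart_inv d) (chart_map d x).
  exact: (cvg_comp (chart_map d) (f \o chart_inv d) (map_continuous Ad dx) cf).
move: ch; rewrite /= chart_mapK // => ch; apply: cvg_trans ch; apply: near_eq_cvg.
have : \forall z \near x, chart_dom d z by apply: open_nbhs_nbhs; split=> //; exact: dom_open.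
by apply: filterS => z dz /=; rewrite chart_mapK.
Qed.

Lemma continuous_measurableM (f : M -> R) : continuous f -> measurable_fun setT (f : borel M -> R).
Proof.
move=> cf; apply: (measurability _ (RGenOInfty.measurableE R)) => _ [_ [a ->] <-].
apply: measurableI; first exact: measurableT.
apply: open_measurableM; rewrite preimage_itvoy.
exact: (open_comp (fun x _ => cf x) (@open_gt R a)).
Qed.

Let ball_r y : `|y - q| <= r -> chart_img c y.
Proof. by move=> h; apply: ball_img; exact: le_trans h (ltW rr2). Qed.

Lemma rpull_smooth f : rT f -> smooth_real setT (rpull f).
Proof. by move=> hf; exact: (pull_smooth Ac ball_r hf).1. Qed.

Lemma rpull_measurable f : rT f -> measurable_fun setT (rpull f : borel M -> R).
Proof. by move=> /rpull_smooth/smooth_real_continuous; exact: continuous_measurableM. Qed.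

(** [W] is the half-open cube around the ball; its finite volume makes bounded measurable functions
    vanishing outside it integrable. *)
Definition corner : X := \row_j (q 0 j - r).
Definition W : set M := cell corner (r * 2).

Lemma box_ball y : box corner (r * 2) y -> `|y - q| <= r.
Proof.
move=> h; apply: norm_le_coord; first exact: ltW.
by move=> j; have := h j; rewrite !mxE ler_norml => /andP[]; lra.
Qed.
Lemma ball_box y : `|y - q| < r -> box corner (r * 2) y.
Proof.
move=> h j; rewrite mxE; have := le_lt_trans (coord_le_norm (y - q) j) h.
by rewrite !mxE ltr_norml => /andP[]; lra.
Qed.

Lemma rpull_dom f x : chart_dom c x -> rpull f x = f (chart_map c x).
Proof. by move=> dx; rewrite /rpull pull_dom. Qed.
Lemma rpull_outW f x : rT f -> ~ W x -> rpull f x = 0.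
Proof.
move=> hf hx; have [dx|dx] := pselect (chart_dom c x); last by rewrite /rpull pull_out.
rewrite rpull_dom //; apply: (congr1 (@complex.Re R) (_ : (f (chart_map c x))%:C = 0)).
apply: (tst_supp hf); rewrite leNgt; apply/negP => h; apply: hx; split=> //; exact: ball_box.
Qed.

Lemma tst_smo f : rT f -> smo setT f.
Proof. by move=> /tst_csm[]. Qed.

Lemma tst_smo2 f s : tst q s (fun y => (f y)%:C) -> smo setT f.
Proof. by move=> /tst_csm[]. Qed.

(** The density and its inverse are cut off so as to be smooth on the whole space; on the ball of
    radius [r] they are unchanged. *)
Definition grho (y : X) : R := complex.Re (cut q r r2 y * (rh y)%:C).
Definition irho (y : X) : R := complex.Re (cut q r r2 y * ((rh y)^-1)%:C).

Let csm_rho : csm [set y | `|y - q| < r2] (fun y => (rh y)%:C).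
Proof.
apply: csm_real; apply: smooth_sub (smooth_rho g Ac) => y /= h.
by apply: ball_img; exact: ltW.
Qed.
Let csm_irho : csm [set y | `|y - q| < r2] (fun y => ((rh y)^-1)%:C).
Proof.
have oA := @open_in _ _ q r2; have img y : `|y - q| < r2 -> chart_img c y.
  by move=> h; apply: ball_img; exact: ltW.
apply: csm_real; apply: (smooth_inv oA) => [y /= h|].
  by rewrite gt_eqF // rho_gt0 //; exact: img.
by apply: smooth_sub (smooth_rho g Ac) => y; exact: img.
Qed.

Let loc F : csm [set y | `|y - q| < r2] F -> tst q r2 (fun y => cut q r r2 y * F y).
Proof.
move=> hF; have [h1 [s sr e]] := tst_cut q r0 rr2; have r20 := lt_trans r0 rr2.
apply: (tst_local sr) => [|y /e ->]; last by rewrite mul0r.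
by apply: (csmM (@open_in _ _ q r2)) => //; apply: csm_sub h1.
Qed.

Lemma tst_grho : tst q r2 (fun y => (grho y)%:C). Proof. exact: tst_Re (loc csm_rho). Qed.
Lemma tst_irho : tst q r2 (fun y => (irho y)%:C). Proof. exact: tst_Re (loc csm_irho). Qed.
Lemma grhoE y : `|y - q| <= r -> grho y = rh y.
Proof. by move=> h; rewrite /grho cut1 ?mul1r. Qed.
Lemma irhoE y : `|y - q| <= r -> irho y = (rh y)^-1.
Proof. by move=> h; rewrite /irho cut1 ?mul1r. Qed.

Lemma rho_lower : exists2 lo, 0 < lo & forall y, `|y - q| <= r -> lo <= rh y.
Proof.
have [B B0 hB] := bounded_on_ball q (tst_smo2 tst_irho) (ltW r0).
exists (B + 1)^-1 => [|y hy]; first by rewrite invr_gt0 ltr_wpDl.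
have p : 0 < rh y by apply: rho_gt0 => //; exact: ball_r.
have := hB y hy; rewrite irhoE // ger0_norm ?invr_ge0 ?(ltW p) // => h.
by rewrite -[leRHS]invrK lef_pV2 ?posrE ?invr_gt0 ?ltr_wpDl // (le_trans h) // lerDl.
Qed.

Lemma mu_W : exists2 V : R, 0 <= V & mu W = V%:E.
Proof.
have [B B0 hB] := bounded_on_ball q (tst_smo2 tst_grho) (ltW r0).
have := @mu_cell corner (r * 2) 0 B; rewrite mulr_ge0 ?(ltW r0) // => /(_ isT (lexx _)).
case=> [y /box_ball hy|/andP[]|].
- have iy := ball_r hy; split=> //; rewrite (ltW (rho_gt0 _ _ _)) //=.
  by have := hB y hy; rewrite grhoE //; apply: le_trans; exact: ler_norm.
- rewrite mul0r -/W => h0 h1; exists (fine (mu W)); first by rewrite fine_ge0.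
  by rewrite fineK // ge0_fin_numE // (le_lt_trans h1) // ltry.
by rewrite ltNge B0.
Qed.

Lemma measurableW : measurable (W : set (borel M)). Proof. exact: measurable_cell. Qed.

Lemma integrable_W (phi : M -> R) B : measurable_fun setT (phi : borel M -> R) ->
  (forall x, ~ W x -> phi x = 0) -> (forall x, `|phi x| <= B) ->
  mu.-integrable setT (EFin \o phi : borel M -> \bar R).
Proof.
move=> mphi phi0 phiB; have [V V0 eV] := mu_W.
have -> : (EFin \o phi : borel M -> \bar R) = (EFin \o phi) \_ W.
  by apply/funext => x; rewrite patchE; case: ifPn => // /negP h; rewrite /= phi0 // => /mem_set.
apply/(integrable_mkcond _ measurableW).
apply: measurable_bounded_integrable; first exact: measurableW.
- by apply: (@le_lt_trans _ _ V%:E); [rewrite -eV|rewrite ltry].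
- exact: measurable_funTS.
exists B; split; first exact: num_real.
by move=> M' BM' x _ /=; apply: le_trans (phiB x) (ltW BM').
Qed.

Lemma rpull_bounded f : rT f -> exists2 B, 0 <= B & forall x, `|rpull f x| <= B.
Proof.
move=> hf; have [B B0 hB] := tst_bounded r0 hf; exists B => // x.
have [dx|dx] := pselect (chart_dom c x); last by rewrite /rpull pull_out // normr0.
by rewrite rpull_dom //; have := hB (chart_map c x); rewrite nrm_real.
Qed.

Lemma rpull_integrable f : rT f -> mu.-integrable setT (EFin \o rpull f : borel M -> \bar R).
Proof.
move=> hf; have [B B0 hB] := rpull_bounded hf.
by apply: (integrable_W (rpull_measurable hf) _ hB) => x; exact: rpull_outW.
Qed.

Definition mint (phi : M -> R) : R := \int[mu]_x (phi x : R).

Lemma mintD phi psi : mu.-integrable setT (EFin \o phi : borel M -> \bar R) ->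
  mu.-integrable setT (EFin \o psi : borel M -> \bar R) ->
  mint (fun x => phi x + psi x) = mint phi + mint psi.
Proof. by move=> h1 h2; exact: (RintegralD measurableT h1 h2). Qed.
Lemma mintZ k phi : mu.-integrable setT (EFin \o phi : borel M -> \bar R) ->
  mint (fun x => k * phi x) = k * mint phi.
Proof. by move=> h; exact: (RintegralZl k measurableT h). Qed.
Lemma mint_le phi psi : mu.-integrable setT (EFin \o phi : borel M -> \bar R) ->
  mu.-integrable setT (EFin \o psi : borel M -> \bar R) ->
  (forall x, phi x <= psi x) -> mint phi <= mint psi.
Proof. by move=> h1 h2 h; exact: (le_Rintegral measurableT h1 h2 (fun x _ => h x)). Qed.
Lemma mint_ge0 phi : (forall x, 0 <= phi x) -> 0 <= mint phi.
Proof. by move=> h; apply: Rintegral_ge0 => x _; exact: h. Qed.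
Lemma mint_norm phi : mu.-integrable setT (EFin \o phi : borel M -> \bar R) ->
  `|mint phi| <= mint (fun x => `|phi x|).
Proof. by move=> h; exact: (le_normr_Rintegral measurableT h). Qed.

Lemma indic_integrable a e : (cell a e `<=` W) ->
  mu.-integrable setT (EFin \o (\1_(cell a e) : M -> R) : borel M -> \bar R).
Proof.
move=> sub; apply: (@integrable_W _ 1) => [|x hx|x].
- by apply: measurable_indic; exact: measurable_cell.
- by rewrite indicE memNset // => /sub.
by rewrite indicE; case: (_ \in _); rewrite ?normr1 ?normr0.
Qed.

Lemma mint_indic a e : mint (\1_(cell a e) : M -> R) = fine (mu (cell a e)).
Proof.
rewrite /mint /Rintegral (integral_indic _ measurableT) ?setIT //.
exact: measurable_cell.
Qed.

Lemma integrable_simple (I : Type) (s : seq I) (k : I -> R) (a : I -> X) e :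
  (forall i, cell (a i) e `<=` W) ->
  mu.-integrable setT (EFin \o (fun x => \sum_(i <- s) k i * \1_(cell (a i) e) x) : borel M -> \bar R) /\
  mint (fun x => \sum_(i <- s) k i * \1_(cell (a i) e) x) = \sum_(i <- s) k i * fine (mu (cell (a i) e)).
Proof.
move=> sub; elim: s => [|i s [IH1 IH2]].
  under eq_fun do rewrite big_nil; rewrite big_nil; split.
    by apply: (@integrable_W _ 0) => [|//|x]; [exact: measurable_cst|rewrite normr0].
  have h := @Rintegral_cst _ _ _ mu setT measurableT 0.
  by apply: etrans h _; rewrite mul0r.
have ii := indic_integrable (sub i).
have iz : mu.-integrable setT (EFin \o (fun x => k i * \1_(cell (a i) e) x) : borel M -> \bar R).
  by have := integrableZl measurableT (k i) ii.
under eq_fun do rewrite big_cons; rewrite big_cons; split.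
  by have := integrableD measurableT iz IH1.
by rewrite mintD // mintZ // mint_indic IH2.
Qed.

Definition unif (f : X -> R) := forall eta : R, 0 < eta -> exists2 del : R, 0 < del & forall x z : X,
  `|x - q| <= r -> `|z| <= del -> `|f (z + x) - f x| <= eta.

Lemma smo_unif f : smo setT f -> unif f.
Proof.
move=> hf eta eta0; have cf : continuous f by move=> x; exact: (smooth_continuous hf).
have /compact_near_coveringP H := @compact_ball R m q r (ltW r0).
have H1 := H _ (nbhs (0 : X)) (fun z x => `|f (z + x) - f x| <= eta) (nbhs_filter _).
have hloc : forall x, `|x - q| <= r -> \forall x' \near x & z \near (0 : X), `|f (z + x') - f x'| <= eta.
  move=> x _; have e2 : 0 < eta / 2 by rewrite divr_gt0.
  have h1 : \forall p \near (x, (0 : X)), `|f x - f (p.2 + p.1)| <= eta / 2.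
    have cv : (p.2 + p.1) @[p --> (x, (0 : X))] --> x.
      by rewrite -[X in _ --> X]add0r; apply: cvgD; [exact: cvg_snd|exact: cvg_fst].
    have := cvg_comp (fun p : X * X => p.2 + p.1) f cv (cf x).
    by move=> /cvgrPdist_le/(_ _ e2).
  have h2 : \forall p \near (x, (0 : X)), `|f x - f p.1| <= eta / 2.
    have cv : p.1 @[p --> (x, (0 : X))] --> x by exact: cvg_fst.
    have := cvg_comp (fun p : X * X => p.1) f cv (cf x).
    by move=> /cvgrPdist_le/(_ _ e2).
  near=> p; rewrite -(subrKA (f x)) (le_trans (ler_normD _ _)) // [leRHS]splitr.
  by apply: lerD; [rewrite distrC; near: p; exact: h1|near: p; exact: h2].
have /nbhs_ballP[d /= d0 hd] := H1 hloc; exists (d / 2); first by rewrite divr_gt0.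
move=> x z xr zd; apply: (hd z) => //; rewrite -ball_normE /= sub0r normrN.
by apply: le_lt_trans zd _; rewrite ltr_pdivrMr // ltr_pMr // ltr1n.
Unshelve. all: by end_near. Qed.

Section Grid.
Variable n : nat.
Let e : R := r * 2 / n.+1%:R.
Let e0 : 0 < e. Proof. by rewrite divr_gt0 // mulr_gt0. Qed.
Let en : e * n.+1%:R = r * 2. Proof. by rewrite divfK // pnatr_eq0. Qed.
Local Notation I := {ffun 'I_m -> 'I_n.+1}.

(** Lower corners of a regular grid of the cube [W]; the cells are half-open, so each point lies in
    exactly one. *)
Definition cn (i : I) : X := \row_j (q 0 j - r + e * (i j)%:R).

Let ei (k : 'I_n.+1) : 0 <= e * k%:R /\ e * k%:R + e <= r * 2.
Proof.
split; first by rewrite mulr_ge0 // ltW.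
by rewrite -en -[X in _ + X]mulr1 -mulrDr ler_wpM2l ?(ltW e0) // natr1 ler_nat.
Qed.

Lemma cn_ball i : `|cn i - q| <= r.
Proof.
apply: norm_le_coord; first exact: ltW.
move=> j; rewrite !mxE ler_norml; have [h1 h2] := ei (i j); move: h1 h2 e0.
by set z := e * _; move=> h1 h2 h3; apply/andP; split; lra.
Qed.

Lemma box_cn i y : box (cn i) e y -> box corner (r * 2) y /\ `|y - cn i| <= e.
Proof.
move=> h; split; last first.
  apply: norm_le_coord; first exact: ltW.
  by move=> j; have := h j; rewrite !mxE ler_norml => /andP[]; set z := e * _; move: e0; lra.
move=> j; have := h j; have [h1 h2] := ei (i j); rewrite !mxE => /andP[]; move: h1 h2 e0.
by set z := e * _; move=> h1 h2 h3 h4 h5; apply/andP; split; lra.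
Qed.

Lemma cell_cn_W i : cell (cn i) e `<=` W.
Proof. by move=> x [dx /box_cn[h _]]. Qed.

Lemma cn_locate y : box corner (r * 2) y -> exists i, forall i', box (cn i') e y <-> i' = i.
Proof.
move=> hy; pose t j := (y 0 j - q 0 j + r) / e.
have t0 j : 0 <= t j.
  by rewrite divr_ge0 ?(ltW e0) //; have := hy j; rewrite mxE => /andP[]; lra.
have tn j : (Num.truncn (t j) < n.+1)%N.
  rewrite ltnS truncn_le_nat ltr_pdivrMr // mulrC en.
  by have := hy j; rewrite mxE => /andP[]; lra.
exists [ffun j => Ordinal (tn j)] => i'.
have E : box (cn i') e y <-> forall j, Num.truncn (t j) = i' j :> nat.
  have H j : (cn i' 0 j <= y 0 j < cn i' 0 j + e) = (Num.truncn (t j) == i' j :> nat).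
    rewrite truncn_eq // ler_pdivlMr // ltr_pdivrMr // -natr1 mulrDl mul1r mxE ![_ * e]mulrC.
    by set z := e * _; congr (_ && _); apply/idP/idP; lra.
  split=> h j; have := h j; first by rewrite H => /eqP.
  by rewrite H => ->.
rewrite E; split=> [h|-> j]; last by rewrite ffunE.
by apply/ffunP => j; rewrite ffunE; apply: val_inj; rewrite /= h.
Qed.

Lemma riemann h eta : rT h -> (forall i y, box (cn i) e y -> `|h y - h (cn i)| <= eta) ->
  `|mint (rpull h) - \sum_i h (cn i) * fine (mu (cell (cn i) e))| <= eta * fine (mu W).
Proof.
move=> hh osc; have [si sE] := @integrable_simple I (index_enum _) (fun i => h (cn i)) cn e cell_cn_W.
set S := fun x => _ in si sE; have ih := rpull_integrable hh.
have iN : mu.-integrable setT (EFin \o (fun x => -1 * S x) : borel M -> \bar R).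
  by have := integrableZl measurableT (-1) si.
have -> : mint (rpull h) - \sum_i h (cn i) * fine (mu (cell (cn i) e)) =
    mint (fun x => rpull h x + -1 * S x).
  by rewrite mintD // mintZ // sE mulN1r.
have id : mu.-integrable setT (EFin \o (fun x => rpull h x + -1 * S x) : borel M -> \bar R).
  by have := integrableD measurableT ih iN.
apply: le_trans (mint_norm id) _.
have iW := indic_integrable (@subset_refl _ (cell corner (r * 2))).
have ieW : mu.-integrable setT (EFin \o (fun x => eta * \1_W x) : borel M -> \bar R).
  by have := integrableZl measurableT eta iW.
rewrite -mint_indic -mintZ //; apply: mint_le => //.
  by have := integrable_abse id.
move=> x; rewrite /S; have [Wx|Wx] := pselect (W x).
  have [dx bx] := Wx; have [i hi] := cn_locate bx.
  have ind i' : \1_(cell (cn i') e) x = (i' == i)%:R :> R.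
    rewrite indicE; congr (_%:R); congr nat_of_bool.
    apply/idP/eqP => [/set_mem[_ /hi]//|ii]; apply/mem_set; split=> //; exact/hi.
  rewrite (bigD1 i) //= big1 => [|i' /negPf ii]; last by rewrite ind ii mulr0.
  rewrite ind eqxx mulr1 addr0 mulN1r rpull_dom // indicE mem_set // mulr1.
  by apply: osc; exact/hi.
rewrite rpull_outW // big1 => [|i _].
  by rewrite mulr0 add0r normr0 indicE memNset // mulr0.
by rewrite indicE memNset ?mulr0 // => /(@cell_cn_W i).
Qed.

(** A cyclic shift is a bijection of the grid, which makes the telescoping a mere reindexing. *)
Definition shift_idx (j : 'I_m) (i : I) : I := [ffun l => if l == j then ordS (i l) else i l].

Lemma shift_idx_inj j : injective (shift_idx j).
Proof.
move=> i i' h; apply/ffunP => l; have := congr1 (fun f : I => f l) h; rewrite !ffunE.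
by case: ifP => // _ /(can_inj (@ordSK _)).
Qed.

(** The cyclic shift agrees with the translation by [e] except at the last index, where the
    translated point lies on one face of the cube and the shifted corner on the opposite face; [f]
    vanishes on both. *)
Lemma sum_shift f j : rT f -> \sum_i (f (e *: delta_mx 0 j + cn i) - f (cn i)) = 0.
Proof.
move=> hf; have f0 (y : X) : (exists l, r <= `|y 0 l - q 0 l|) -> f y = 0.
  move=> [l hl]; apply: (congr1 (@complex.Re R) (_ : (f y)%:C = 0)); apply: (tst_supp hf).
  by apply: le_trans hl _; have := coord_le_norm (y - q : X) l; rewrite !mxE.
rewrite sumrB (reindex_inj (@shift_idx_inj j)) /=.
apply/eqP; rewrite subr_eq0; apply/eqP; rewrite [RHS](reindex_inj (@shift_idx_inj j)) /=.
rewrite -(reindex_inj (@shift_idx_inj j) (P := xpredT) (F := fun i => f (e *: delta_mx 0 j + cn i))).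
apply: eq_bigr => i _; have [ij|ij] := eqVneq (i j : nat) n.
  rewrite !f0 //.
    exists j; rewrite !mxE ffunE eqxx /= ij modnn mulr0 addr0 addrAC subrr add0r normrN ger0_norm //.
    exact: ltW.
  exists j; rewrite !mxE !eqxx /= ij mulr1.
  have -> : e + (q 0 j - r + e * n%:R) - q 0 j = r by have := en; rewrite -natr1 mulrDr mulr1; lra.
  by rewrite ger0_norm // ltW.
congr f; apply/rowP => l; rewrite !mxE !ffunE eqxx /=; case: eqP => [->|_]; last by rewrite mulr0 add0r.
have ijn : (i j < n)%N by rewrite ltn_neqAle ij -ltnS ltn_ord.
have e1 : e * true%:R = e by exact: mulr1.
by rewrite e1 /= modn_small ?ltnS // -[(i j).+1%:R]natr1; ring.
Qed.

Lemma grid_volume : (\sum_(i : I) e ^+ m) = (r * 2) ^+ m.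
Proof.
by rewrite sumr_const card_ffun !card_ord -[LHS]mulr_natr natrX -exprMn en.
Qed.

End Grid.

Lemma cpartial_real (f : X -> R) j : cpartial j (fun y => (f y)%:C) = fun y => (partial j f y)%:C.
Proof. by apply/funext => y; rewrite /cpartial /= [X in _ +i* X]derive_cst. Qed.

(* Integration against Lebesgue measure: the density of [mu] is divided out. *)
Definition Jint (f : X -> R) : R := mint (rpull (fun y => f y * irho y)).

Lemma tst_mulr f h s : rT f -> tst q s (fun y => (h y)%:C) -> rT (fun y => f y * h y).
Proof. by move=> hf hh; under eq_fun do rewrite rmorphM; apply: tstM => //; exact: tst_csm hh. Qed.

(** Sums of difference quotients of [f] over the grid vanish by [sum_shift], and they are close to
    Riemann sums of the derivative. Integration by parts is obtained in this way without Fubini. *)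
Lemma Jint_partial f j : rT f -> Jint (partial j f) = 0.
Proof.
move=> hf; set gg := partial j f.
have hg : rT gg by have := tst_partial r0 j hf; rewrite cpartial_real.
pose h y := gg y * irho y; have hh : rT h by exact: tst_mulr tst_irho.
have [lo lo0 hlo] := rho_lower; have [V V0 eV] := mu_W.
have [B B0 hB] := tst_bounded r0 hh.
have {}hB y : `|h y| <= B by have := hB y; rewrite nrm_real.
set c1 := V + B * (r * 2) ^+ m + (r * 2) ^+ m.
have c10 : 0 <= c1 by rewrite !addr_ge0 ?mulr_ge0 ?exprn_ge0 ?mulr_ge0 ?(ltW r0).
(* [eta <= lo] keeps the lower density bound given to [mu_cell] nonnegative. *)
suff key eta : 0 < eta -> eta <= lo -> `|Jint gg| <= eta * c1.
  apply/eqP; rewrite -normr_le0; apply: le_eps => z z0; rewrite add0r.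
  pose eta := Num.min lo (z / (c1 + 1)).
  have p : 0 < c1 + 1 by rewrite ltr_wpDl.
  have eta0 : 0 < eta by rewrite lt_min lo0 divr_gt0.
  apply: le_trans (key eta eta0 _) _; first by rewrite ge_min lexx.
  apply: (@le_trans _ _ (z / (c1 + 1) * (c1 + 1))); last by rewrite divfK // gt_eqF.
  by rewrite ler_pM ?(ltW eta0) // ?ge_min ?lexx ?orbT // lerDl.
move=> eta0 etalo.
have [d1 d10 u1] := smo_unif (tst_smo hh) eta0.
have [d2 d20 u2] := smo_unif (tst_smo2 tst_grho) eta0.
have [d3 d30 u3] := smo_unif (tst_smo hg) eta0.
pose del := Num.min d1 (Num.min d2 d3).
have del0 : 0 < del by rewrite !lt_min d10 d20 d30.
pose n := Num.truncn (r * 2 / del).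
pose e := r * 2 / n.+1%:R.
have e0 : 0 < e by rewrite divr_gt0 // mulr_gt0.
have edel : e <= del.
  by rewrite ler_pdivrMr // [leRHS]mulrC -ler_pdivrMr // ltW // truncnS_gt.
have [e1 e2 e3] : [/\ e <= d1, e <= d2 & e <= d3].
  by split; apply: le_trans edel _; rewrite ?ge_min ?lexx ?orbT.
have osc (f' : X -> R) (d : R) i y : (forall x z : X, `|x - q| <= r -> `|z| <= d -> `|f' (z + x) - f' x| <= eta) ->
    e <= d -> box (@cn n i) e y -> `|f' y - f' (@cn n i)| <= eta.
  move=> u ed /box_cn[_ hy]; have := u (@cn n i) (y - @cn n i) (cn_ball i) (le_trans hy ed).
  by rewrite subrK.
have R1 := @riemann n h eta hh (fun i y => osc h d1 i y u1 e1).
rewrite eV /= -/e in R1.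
have cellE i : `|fine (mu (cell (@cn n i) e)) - rh (@cn n i) * e ^+ m| <= eta * e ^+ m.
  have ci := cn_ball i; have ri : lo <= rh (@cn n i) by exact: hlo.
  have := @mu_cell (@cn n i) e (rh (@cn n i) - eta) (rh (@cn n i) + eta) (ltW e0).
  rewrite subr_ge0 (le_trans etalo ri) => /(_ isT); case=> [y by_|/andP[h1 h2]|].
  - have [/box_ball yr _] := box_cn by_; split; first exact: ball_r.
    have := osc grho d2 i y u2 e2 by_; rewrite (grhoE yr) (grhoE ci) ler_norml => /andP[].
    by move: (rh y) (rh _) => z1 z2 h1 h2; apply/andP; split; lra.
  - have fm : mu (cell (@cn n i) e) \is a fin_num.
      by rewrite ge0_fin_numE // (le_lt_trans h2) // ltry.
    rewrite -(fineK fm) !lee_fin in h1 h2.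
    rewrite ler_norml; apply/andP; split; move: h1 h2; rewrite mulrBl mulrDl; lra.
  by move=> h1; exfalso; move: h1 ri; lra.
(* The volume of a cell is replaced by density times [e ^+ m]; the density then cancels against
   [irho], leaving a plain Riemann sum of [gg]. *)
have R2 : `|\sum_(i : {ffun 'I_m -> 'I_n.+1}) h (cn i) * fine (mu (cell (cn i) e)) - \sum_(i : {ffun 'I_m -> 'I_n.+1}) gg (cn i) * e ^+ m|
    <= B * eta * (r * 2) ^+ m.
  rewrite -sumrB (le_trans (ler_norm_sum _ _ _)) // -(grid_volume n) mulr_sumr.
  apply: ler_sum => i _.
  have -> : gg (cn i) * e ^+ m = h (cn i) * (rh (cn i) * e ^+ m).
    rewrite /h irhoE ?cn_ball // mulrA; congr (_ * _); rewrite divfK // gt_eqF //.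
    by apply: rho_gt0 => //; apply: ball_r; exact: cn_ball.
  rewrite -mulrBr normrM -mulrA; apply: ler_pM => //; exact: cellE.
have R3 : `|\sum_(i : {ffun 'I_m -> 'I_n.+1}) gg (cn i) * e ^+ m| <= eta * (r * 2) ^+ m.
  rewrite -mulr_suml normrM (ger0_norm (exprn_ge0 _ (ltW e0))).
  have : `|\sum_(i : {ffun 'I_m -> 'I_n.+1}) gg (cn i)| <= \sum_(i : {ffun 'I_m -> 'I_n.+1}) eta.
    (* Difference quotients may be subtracted because their sum is 0; each one is within [eta] of
       the derivative. *)
    have -> : \sum_(i : {ffun 'I_m -> 'I_n.+1}) gg (cn i) =
       \sum_(i : {ffun 'I_m -> 'I_n.+1}) (gg (cn i) - e^-1 * (f (e *: delta_mx 0 j + cn i) - f (cn i))).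
      by rewrite sumrB -mulr_sumr (sum_shift n j hf) mulr0 subr0.
    apply: le_trans (ler_norm_sum _ _ _) _; apply: ler_sum => i _.
    have := @mvt_line R m f (cn i) j e (gg (cn i)) eta.
    have dn (s : R) : `|s| <= `|e| -> `|(s *: delta_mx 0 j : X)| <= d3.
      move=> se; apply: norm_le_coord; first exact: ltW.
      move=> l; rewrite !mxE eqxx /=; case: eqP => _; last by rewrite mulr0 normr0 ltW.
      by rewrite mulr1; apply: le_trans se _; rewrite ger0_norm // ltW.
    move=> mv; have H : `|f (e *: delta_mx 0 j + cn i) - f (cn i) - e * gg (cn i)| <= eta * `|e|.
      apply: mv => [s _|s se].
        exact: (@smooth_derivable R m setT f _ j (tst_smo hf)).
      by apply: u3; [exact: cn_ball|exact: dn].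
    have -> : gg (cn i) - e^-1 * (f (e *: delta_mx 0 j + cn i) - f (cn i)) =
      e^-1 * - (f (e *: delta_mx 0 j + cn i) - f (cn i) - e * gg (cn i)).
      by field; rewrite gt_eqF.
    rewrite normrM normrN (ger0_norm (ltW _)) ?invr_gt0 // ler_pdivrMl // [leRHS]mulrC.
    by rewrite (ger0_norm (ltW e0)) in H.
  move=> H; apply: le_trans (ler_wpM2r (exprn_ge0 _ (ltW e0)) H) _.
  by rewrite mulr_suml -mulr_sumr (grid_volume n).
rewrite /Jint -/h /c1; move: R1 R2 R3; rewrite -/h.
set a1 := mint _; set a2 := \sum_i h _ * _; set a3 := \sum_i gg _ * _; set v := (r * 2) ^+ m.
move=> R1 R2 R3; have -> : a1 = (a1 - a2) + (a2 - a3) + a3 by ring.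
apply: le_trans (ler_normD _ _) _; rewrite !mulrDr; apply: lerD; last exact: R3.
apply: le_trans (ler_normD _ _) _; apply: lerD; first exact: R1.
by rewrite mulrA [eta * B]mulrC.
Qed.

Let iint f : rT f -> mu.-integrable setT (EFin \o rpull (fun y => f y * irho y) : borel M -> \bar R).
Proof. by move=> hf; apply: rpull_integrable; exact: tst_mulr tst_irho. Qed.

Lemma rpullE f x : rpull f x = if `[< chart_dom c x >] then f (chart_map c x) else 0.
Proof. by rewrite /rpull /pull; case: ifP. Qed.

Lemma Jint_D f h : rT f -> rT h -> Jint (fun y => f y + h y) = Jint f + Jint h.
Proof.
move=> hf hh; rewrite /Jint -mintD; [|exact: iint..].
by congr mint; apply/funext => x; rewrite !rpullE; case: ifP; rewrite ?addr0 ?mulrDl.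
Qed.
Lemma Jint_Z k f : rT f -> Jint (fun y => k * f y) = k * Jint f.
Proof.
move=> hf; rewrite /Jint -mintZ; last exact: iint.
by congr mint; apply/funext => x; rewrite !rpullE; case: ifP; rewrite ?mulr0 ?mulrA.
Qed.

Lemma irho_ge0 y : `|y - q| <= r -> 0 <= irho y.
Proof. by move=> h; rewrite irhoE // invr_ge0 ltW // rho_gt0 //; exact: ball_r. Qed.

Lemma irho_bound : exists2 A, 0 < A & forall y, `|y - q| <= r -> irho y <= A /\ 1 <= A * irho y.
Proof.
have [B1 B10 h1] := bounded_on_ball q (tst_smo2 tst_irho) (ltW r0).
have [B2 B20 h2] := bounded_on_ball q (tst_smo2 tst_grho) (ltW r0).
exists (B1 + B2 + 1) => [|y hy]; first by rewrite ltr_wpDl ?addr_ge0.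
have p : 0 < rh y by apply: rho_gt0 => //; exact: ball_r.
have := h1 y hy; have := h2 y hy; rewrite irhoE // grhoE // !ger0_norm ?invr_ge0 ?(ltW p) // => a b.
split; first by apply: le_trans b _; rewrite -addrA lerDl addr_ge0.
by rewrite ler_pdivlMr // mul1r; apply: le_trans a _; rewrite addrAC lerDr addr_ge0.
Qed.

Lemma rpull_le f h : rT f -> rT h -> (forall y, `|y - q| <= r -> f y <= h y) ->
  mint (rpull f) <= mint (rpull h).
Proof.
move=> hf hh le; apply: mint_le; [exact: rpull_integrable..|] => x; rewrite !rpullE.
case: ifP => // _; set y := chart_map c x; have [yr|yr] := leP `|y - q| r; first exact: le.
have z f' : rT f' -> f' y = 0.
  by move=> h'; apply: (congr1 (@complex.Re R) (_ : (f' y)%:C = 0)); apply: (tst_supp h'); exact: ltW.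
by rewrite !z.
Qed.

Lemma Jint_ge0 f : rT f -> (forall y, 0 <= f y) -> 0 <= Jint f.
Proof.
move=> hf f0; apply: mint_ge0 => x; rewrite rpullE; case: ifP => // _.
set y := chart_map c x; have [yr|yr] := leP `|y - q| r; first by rewrite mulr_ge0 ?irho_ge0.
suff -> : f y = 0 by rewrite mul0r.
by apply: (congr1 (@complex.Re R) (_ : (f y)%:C = 0)); apply: (tst_supp hf); exact: ltW.
Qed.

Lemma Jint_bound : exists2 A, 0 <= A & forall f B, rT f -> (forall y, `|f y| <= B) -> `|Jint f| <= A * B.
Proof.
have [A A0 hA] := irho_bound; have [V V0 eV] := mu_W.
exists (A * V) => [|f B hf hB]; first by rewrite mulr_ge0 ?(ltW A0).
have B0 : 0 <= B by exact: le_trans (hB q).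
have ih := iint hf; apply: le_trans (mint_norm ih) _.
have iW := indic_integrable (@subset_refl _ (cell corner (r * 2))).
have ieW : mu.-integrable setT (EFin \o (fun x => (A * B) * \1_W x) : borel M -> \bar R).
  by have := integrableZl measurableT (A * B) iW.
have -> : A * V * B = mint (fun x => (A * B) * \1_W x).
  by rewrite mintZ // mint_indic -/W eV /=; ring.
apply: mint_le => //; first by have := integrable_abse ih.
move=> x; have [Wx|Wx] := pselect (W x); last first.
  by rewrite rpull_outW ?normr0 ?indicE ?memNset ?mulr0 //; exact: tst_mulr tst_irho.
have [dx /box_ball yr] := Wx; rewrite rpull_dom // indicE mem_set // mulr1 normrM mulrC.
apply: ler_pM => //; have [h _] := hA _ yr.
by rewrite ger0_norm //; exact: irho_ge0.
Qed.

Lemma Jint_neq0 : exists2 f, rT f & Jint f != 0.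
Proof.
have [A A0 hA] := irho_bound; have [lo lo0 hlo] := rho_lower.
have [B B0 hB] := bounded_on_ball q (tst_smo2 tst_grho) (ltW r0).
pose a : R := r / 4; have a0 : 0 < a by rewrite divr_gt0.
have ar : a < r by rewrite ltr_pdivrMr // ltr_pMr // ltr1n.
pose f y := complex.Re (cut q a r y); have tf : rT f by exact: tst_Re (tst_cut q a0 ar).
have f0 y : 0 <= f y by exact: bump_ge0.
exists f => //; rewrite gt_eqF //.
pose b : X := \row_j (q 0 j - a); pose e := r / 2.
have e0 : 0 < e by rewrite divr_gt0.
have bq y : box b e y -> `|y - q| <= a.
  move=> h; apply: norm_le_coord; first exact: ltW.
  move=> j; have := h j; rewrite !mxE ler_norml => /andP[]; rewrite /e /a => h1 h2.
  by apply/andP; split; lra.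
have bqr y : box b e y -> `|y - q| <= r by move=> /bq h; exact: le_trans h (ltW ar).
have cW : cell b e `<=` W.
  by move=> x [dx /bq h]; split=> //; apply: ball_box; exact: le_lt_trans h ar.
have := @mu_cell b e lo B (ltW e0) (ltW lo0); case=> [y /bqr hy|/andP[h1 h2]|].
- split; first exact: ball_r.
  rewrite hlo //=; have := hB y hy; rewrite grhoE //; apply: le_trans; exact: ler_norm.
- have fm : mu (cell b e) \is a fin_num.
    by rewrite ge0_fin_numE // (le_lt_trans h2) // ltry.
  rewrite -(fineK fm) lee_fin in h1.
  apply: (@lt_le_trans _ _ (A^-1 * fine (mu (cell b e)))).
    by rewrite mulr_gt0 ?invr_gt0 // (lt_le_trans _ h1) // mulr_gt0 // exprn_gt0.
  have ic := indic_integrable cW.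
  rewrite -mint_indic -mintZ //; apply: mint_le.
  + by have := integrableZl measurableT A^-1 ic.
  + exact: iint.
  move=> x; have [cx|cx] := pselect (cell b e x); last first.
    rewrite indicE memNset // mulr0 rpullE; case: ifP => // _; set y := chart_map c x.
    have [yr|yr] := leP `|y - q| r; first by rewrite mulr_ge0 ?irho_ge0.
    suff -> : f y = 0 by rewrite mul0r.
    by apply: (congr1 (@complex.Re R) (_ : (f y)%:C = 0)); apply: (tst_supp tf); exact: ltW.
  have [dx bx] := cx; rewrite indicE mem_set // mulr1 rpull_dom //.
  have -> : f (chart_map c x) = 1 by rewrite /f cut1 //; exact: bq.
  rewrite mul1r -[leLHS]mulr1 ler_pdivrMl //; exact: (hA _ (bqr _ bx)).2.
by rewrite ltNge B0.
Qed.

Lemma cintegral_pull F : cintegral mu (pull c (fun y => F y * (irho y)%:C)) = JC Jint F.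
Proof.
rewrite /cintegral /JC; congr (_ +i* _); rewrite /Jint /mint; congr Rintegral; apply/funext => x.
  by rewrite rpullE /pull; case: ifP => // _; rewrite mulrC realcM /= mulrC.
by rewrite rpullE /pull; case: ifP => // _; rewrite mulrC realcM /= mulrC.
Qed.

Lemma normL2_pull : exists2 A, 0 < A & forall F, tst q r F -> exists N,
  [/\ normL2_sqr mu (pull c F) = N%:E, N <= A * Jint (fun y => nrm (F y) ^+ 2) &
      Jint (fun y => nrm (F y) ^+ 2) <= A * N].
Proof.
have [A A0 hA] := irho_bound; exists A => // F hF.
have hN := tst_sqr hF; have iN := rpull_integrable hN.
have hNi : rT (fun y => nrm (F y) ^+ 2 * irho y) by exact: tst_mulr tst_irho.
exists (mint (rpull (fun y => nrm (F y) ^+ 2))); split.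
- rewrite /normL2_sqr /mint /Rintegral fineK; last exact: (integrable_fin_num measurableT iN).
  apply: eq_integral => x _; rewrite rpullE /pull; case: ifP => // _.
  by rewrite -/(nrm 0) nrm0 expr0n.
- have hZ : rT (fun y => A * (nrm (F y) ^+ 2 * irho y)).
    by have := tstZ A%:C hNi; under eq_fun do rewrite -rmorphM.
  have -> : A * Jint (fun y => nrm (F y) ^+ 2) = mint (rpull (fun y => A * (nrm (F y) ^+ 2 * irho y))).
    rewrite /Jint -mintZ; last exact: rpull_integrable.
    by congr mint; apply/funext => x; rewrite !rpullE; case: ifP; rewrite ?mulr0.
  apply: rpull_le => // y yr; rewrite mulrCA ler_peMr ?sqr_ge0 //; exact: (hA _ yr).2.
have hZ : rT (fun y => A * nrm (F y) ^+ 2).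
  by have := tstZ A%:C hN; under eq_fun do rewrite -rmorphM.
rewrite -mintZ //; have -> : (fun x => A * rpull (fun y => nrm (F y) ^+ 2) x) = rpull (fun y => A * nrm (F y) ^+ 2).
  by apply/funext => x; rewrite !rpullE; case: ifP; rewrite ?mulr0.
by apply: rpull_le => // y yr; rewrite mulrC ler_wpM2r ?sqr_ge0 //; exact: (hA _ yr).1.
Qed.

End ChartMeasure.

Section FourierSpec.
Context {R : realType} {m : nat}.
Local Notation X := ('rV[R]_m).
Local Notation K := ('rV[int]_m).
Local Notation C := R[i].

(* What is used of a positive functional [J] with [J (d_j f) = 0]: up to the factor [c], the
   numbers [J (F e_-k)] are Fourier coefficients of [F]. *)
Record fourier (q : X) (r : R) (J : (X -> R) -> R) (c : R) : Prop := Fourier {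
  f_pos : 0 < c;
  f_JCD : forall F G, tst q r F -> tst q r G -> JC J (fun x => F x + G x) = JC J F + JC J G;
  f_JCZ : forall z F, tst q r F -> JC J (fun x => z * F x) = z * JC J F;
  f_JCC : forall F, tst q r F -> JC J (fun x => conjc (F x)) = conjc (JC J F);
  f_JC_partial : forall F j, tst q r F -> JC J (cpartial j F) = 0;
  f_JC_trig : forall F a, tst q r F -> rapid a ->
    has_sum (fun k => a k * JC J (fun x => F x * ek k x)) (JC J (fun x => F x * trig a x));
  f_rapid : forall F, tst q r F -> rapid (fh J c F);
  f_inv : forall F y, tst q r F -> `|y - q| < r -> trig (fh J c F) y = F y;
  f_D : forall F G, tst q r F -> tst q r G ->
    fh J c (fun x => F x + G x) = fun k => fh J c F k + fh J c G k;
  f_Z : forall z F, tst q r F -> fh J c (fun x => z * F x) = fun k => z * fh J c F k;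
  f_Dk : forall F j, tst q r F -> fh J c (cpartial j F) = Dk j (fh J c F);
  f_star : forall F, tst q r F -> fh J c (fun x => conjc (F x)) = star (fh J c F);
  f_conv : forall F G, tst q r F -> tst q r G ->
    fh J c (fun x => F x * G x) = conv (fh J c F) (fh J c G);
  f_finite : forall F (v : K -> C) (t : seq K), tst q r F -> uniq t ->
    (forall k, k \notin t -> v k = 0) ->
    conv (fh J c F) v = fh J c (fun x => F x * \sum_(k <- t) v k * ek k x);
  f_inj : forall F G x, tst q r F -> tst q r G -> fh J c F = fh J c G -> F x = G x;
  f_bd0 : forall F B, tst q r F ->
    bd 0 (fh J c F) B <-> 0 <= B /\ J (fun x => nrm (F x) ^+ 2) <= c * B ^+ 2 }.

Lemma fourier_exists (q : X) (r : R) (J : (X -> R) -> R) :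
  let rT f := tst q r (fun x => (f x)%:C) in
  0 < r -> r * 2 <= 1 ->
  (forall f g, rT f -> rT g -> J (fun x => f x + g x) = J f + J g) ->
  (forall c f, rT f -> J (fun x => c * f x) = c * J f) ->
  (exists2 A, 0 <= A & forall f B, rT f -> (forall x, `|f x| <= B) -> `|J f| <= A * B) ->
  (forall f, rT f -> (forall x, 0 <= f x) -> 0 <= J f) ->
  (forall f j, rT f -> J (partial j f) = 0) ->
  (exists2 f, rT f & J f != 0) ->
  exists c, fourier q r J c.
Proof.
move=> rT r0 r1 JD JZ Jb J0 Jp Jn.
have [c c0 hc] := J_normalization r0 r1 JD JZ Jb J0 Jp Jn; exists c; split.
- exact: c0.
- by move=> F G; exact: JCD.
- by move=> z F; exact: JCZ.
- by move=> F; exact: JCC.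
- by move=> F j; exact: JC_partial.
- by move=> F a; exact: JC_trig.
- by move=> F; exact: (fh_rapid r0 JD JZ Jb Jp).
- by move=> F y; exact: (fh_inv r0 JD JZ Jb Jp c0 hc).
- by move=> F G; exact: fhD.
- by move=> z F; exact: (fhZ JD JZ).
- by move=> F j; exact: (fh_Dk r0 JD JZ Jp).
- by move=> F; exact: (fh_star JZ).
- by move=> F G; exact: (fh_conv r0 JD JZ Jb Jp c0 hc).
- by move=> F v t; exact: (fh_finite r0 JD JZ).
- by move=> F G x; exact: (fh_inj r0 JD JZ Jb Jp c0 hc).
- by move=> F B; exact: (fh_bd0 r0 JD JZ Jb Jp c0 hc).
Qed.

Lemma f_sum q r J c (I : Type) (s : seq I) (F : I -> X -> C) : fourier q r J c -> 0 < r ->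
  (forall i, tst q r (F i)) ->
  fh J c (fun x => \sum_(i <- s) F i x) = fun k => \sum_(i <- s) fh J c (F i) k.
Proof.
move=> h r0 hF; elim: s => [|i s IH].
  transitivity (fh J c (fun x : X => 0 * (fun=> 0) x)); last first.
    by rewrite (f_Z h 0 (tst0 q r0)); apply/funext => k; rewrite big_nil mul0r.
  by congr fh; apply/funext => x; rewrite big_nil mul0r.
transitivity (fh J c (fun x => F i x + \sum_(i <- s) F i x)).
  by congr fh; apply/funext => x; rewrite big_cons.
by rewrite (f_D h (hF i) (tst_sum r0 s hF)) IH; apply/funext => k; rewrite big_cons.
Qed.

Lemma f_N q r J c F : fourier q r J c -> 0 < r -> tst q r F ->
  fh J c (fun x => - F x) = fun k => - fh J c F k.
Proof.
move=> h r0 hF; transitivity (fh J c (fun x : X => -1 * F x)).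
  by congr fh; apply/funext => x; rewrite mulN1r.
by rewrite (f_Z h (-1) hF); apply/funext => k; rewrite mulN1r.
Qed.

Lemma f_B q r J c F G : fourier q r J c -> 0 < r -> tst q r F -> tst q r G ->
  fh J c (fun x => F x - G x) = fun k => fh J c F k - fh J c G k.
Proof. by move=> h r0 hF hG; rewrite (f_D h hF (tstN hG)) (f_N h r0 hG). Qed.

Lemma f_vx q r J c (a : 'I_m -> X -> C) F : fourier q r J c -> 0 < r ->
  (forall j, tst q r (a j)) -> tst q r F ->
  fh J c (vx a F) = vf (fun j => fh J c (a j)) (fh J c F).
Proof.
move=> h r0 ha hF; rewrite /vx (f_sum _ h r0); last first.
  move=> j; exact: (tstM (ha j) (tst_csm (tst_partial r0 j hF))).
apply/funext => k; apply: eq_bigr => j _.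
by rewrite (f_conv h (ha j) (tst_partial r0 j hF)) (f_Dk h _ hF).
Qed.

End FourierSpec.

(** * The subelliptic estimate *)

Section Dominated.
Context {R : realType} {m : nat} {M : smooth_manifold R m}.
Local Notation X := ('rV[R]_m).
Local Notation K := ('rV[int]_m).
Local Notation C := R[i].
Variable c : chart R m M.
Hypothesis Ac : atlas c.
Variables (q : X) (r0 r r2 : R).
Hypothesis r00 : 0 < r0.
Hypothesis r0r : r0 < r.
Hypothesis rr2 : r < r2.
Hypothesis ball_img : forall y, `|y - q| <= r2 -> chart_img c y.
Variables (J : (X -> R) -> R) (cn : R).
Hypothesis hJ : fourier q r J cn.
Implicit Types (Y Z : operator M) (F G : X -> C).

Let rp : 0 < r := lt_trans r00 r0r.
Local Notation fh := (fh J cn).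
Local Notation pl := (pull c).
Local Notation lcc := (lc c q r0 r r2).

Definition lcf Y : 'I_m -> K -> C := fun j => fh (lcc Y j).

Let up F : tst q r0 F -> tst q r F. Proof. exact: tst_mono (ltW r0r). Qed.

Lemma cvf_ext Y Z : complex_vector_field Y -> complex_vector_field Z ->
  (forall f, smooth setT f -> Y f = Z f) -> Y = Z.
Proof.
move=> [_ Y0 _ _] [_ Z0 _ _] h; apply/funext => f.
by case: (pselect (smooth setT f)) => [/h // | nf]; rewrite Y0 // Z0.
Qed.

Lemma tstl Y j : complex_vector_field Y -> tst q r (lcc Y j).
Proof. exact: (tst_lc Ac r00 r0r rr2 ball_img). Qed.

Lemma rapid_lcf Y : complex_vector_field Y -> rapidf (lcf Y).
Proof. by move=> hY j; exact: (f_rapid hJ (tstl j hY)). Qed.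

Lemma f_vx_lc Y F : complex_vector_field Y -> tst q r F -> fh (vx (lcc Y) F) = vf (lcf Y) (fh F).
Proof. by move=> hY hF; exact: (f_vx hJ rp (fun j => tstl j hY) hF). Qed.

Lemma lcf_conj Y : complex_vector_field Y -> lcf (field_conj Y) = starf (lcf Y).
Proof.
move=> hY; apply/funext => j; rewrite /lcf /starf -(f_star hJ (tstl j hY)).
by rewrite (lc_conj _ _ _ _ _ _ hY).
Qed.

Lemma lcf_real Y : real_vector_field Y -> starf (lcf Y) = lcf Y.
Proof. by case=> hY eY; rewrite -lcf_conj // eY. Qed.

Lemma pull_inj F G : tst q r F -> tst q r G -> pl F = pl G -> F = G.
Proof.
move=> hF hG e; apply/funext => y; have [h|h] := ltP `|y - q| r; last first.
  by rewrite (tst_supp hF h) (tst_supp hG h).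
have iy : chart_img c y by apply: ball_img; exact: le_trans (ltW h) (ltW rr2).
by rewrite -(pull_inv Ac F iy) e (pull_inv Ac G iy).
Qed.

Lemma pullB F G : pl (fun y => F y - G y) = pl F - pl G.
Proof.
apply/funext => x; rewrite [RHS]/GRing.add /=; rewrite [X in _ = _ + X]/GRing.opp /= /pull.
by case: ifP => //; rewrite subr0.
Qed.

Lemma pull_lc Y F : complex_vector_field Y -> tst q r0 F -> Y (pl F) = pl (vx (lcc Y) F).
Proof. exact: (vf_pull Ac r00 r0r rr2 ball_img). Qed.

Lemma tstx Y F s q' : complex_vector_field Y -> tst q' s F -> 0 < s -> tst q' s (vx (lcc Y) F).
Proof. exact: (tst_vx Ac r00 r0r rr2 ball_img). Qed.

(** For [F] supported in radius [r0] the cutoffs of the components are invisible, and injectivity of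
    [pull] transports the bracket from the manifold. For other functions the cutoffs would
    interfere. *)
Lemma vf_bracket Y Z F : complex_vector_field Y -> complex_vector_field Z -> tst q r0 F ->
  vf (lcf (bracket Y Z)) (fh F) = com (vf (lcf Y)) (vf (lcf Z)) (fh F).
Proof.
move=> hY hZ hF; have hB := cvf_bracket hY hZ.
have hYF := tstx hY hF r00; have hZF := tstx hZ hF r00.
have hYZ := tstx hY hZF r00; have hZY := tstx hZ hYF r00.
have e : vx (lcc (bracket Y Z)) F = fun y => vx (lcc Y) (vx (lcc Z) F) y - vx (lcc Z) (vx (lcc Y) F) y.
  apply: pull_inj; [exact: up (tstx hB hF r00) | exact: (tstB (up hYZ) (up hZY)) |].
  rewrite -(pull_lc hB hF) /bracket (pull_lc hZ hF) (pull_lc hY hF) (pull_lc hY hZF) (pull_lc hZ hYF).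
  by rewrite pullB.
rewrite -(f_vx_lc hB (up hF)) e (f_B hJ rp (up hYZ) (up hZY)).
by rewrite (f_vx_lc hY (up hZF)) (f_vx_lc hZ (up hYF)) (f_vx_lc hZ (up hF)) (f_vx_lc hY (up hF)).
Qed.

Lemma vf_lcD Y Z F : complex_vector_field Y -> complex_vector_field Z -> tst q r F ->
  vf (lcf (Y + Z)) (fh F) = fun k => vf (lcf Y) (fh F) k + vf (lcf Z) (fh F) k.
Proof.
move=> hY hZ hF; have hYF := tstx hY hF rp; have hZF := tstx hZ hF rp.
rewrite -(f_vx_lc (cvf_D hY hZ) hF) -(f_vx_lc hY hF) -(f_vx_lc hZ hF).
rewrite -(f_D hJ hYF hZF); congr fh; apply/funext => y; rewrite /vx -big_split; apply: eq_bigr => j _.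
by rewrite /= lc_D mulrDl.
Qed.

Lemma vf_lc0 F : tst q r F -> vf (lcf 0) (fh F) = fun=> 0.
Proof.
move=> hF; rewrite -(f_vx_lc cvf_0 hF).
have -> : vx (lcc 0) F = fun y : X => 0 * (fun=> 0) y.
  by apply/funext => y; rewrite /vx mul0r big1 // => j _; rewrite lc_0 mul0r.
by rewrite (f_Z hJ 0 (tst0 q rp)); apply/funext => k; rewrite mul0r.
Qed.

Definition local_scale (phi : M -> C) : X -> C := fun y => cut q r0 r y * phi (chart_inv c y).

Lemma tst_local_scale phi : smooth setT phi -> tst q r (local_scale phi).
Proof.
move=> hp; apply: (tst_push Ac (r:=r) _ openT hp) => //; last exact: (tst_cut q r00 r0r).
by move=> y hy; apply: ball_img; exact: le_trans hy (ltW rr2).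
Qed.

Lemma vf_lc_scale phi Y F : smooth setT phi -> complex_vector_field Y -> tst q r0 F ->
  vf (lcf (field_scale phi Y)) (fh F) = conv (fh (local_scale phi)) (vf (lcf Y) (fh F)).
Proof.
move=> hp hY hF; have hS := cvf_scale hp hY; have hYF := tstx hY hF r00.
rewrite -(f_vx_lc hS (up hF)) -(f_vx_lc hY (up hF)) -(f_conv hJ (tst_local_scale hp) (up hYF)).
congr fh; apply/funext => y; have [h|h] := lerP r0 `|y - q|.
  by rewrite (tst_supp hYF h) (tst_supp (tstx hS hF r00) h) mulr0.
rewrite /local_scale cut1 ?(ltW h) // mul1r /vx mulr_sumr; apply: eq_bigr => j _.
by rewrite lc_scale mulrA.
Qed.

Section Generators.
Variables (n : nat) (L : 'I_n -> operator M).
Hypothesis hL : forall j, complex_vector_field (L j).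

Definition Lbd F B := bd 0 (fh F) B /\ forall j, bd 0 (vf (lcf (L j)) (fh F)) B.

(** Formulated as a set of operators so that it can be shown to be a distribution of fields, and so
    to contain the generated one. *)
Definition dominated : set (operator M) := [set Y | complex_vector_field Y /\
  exists2 A, 0 <= A & forall F B, tst q r0 F -> Lbd F B -> bd 0 (vf (lcf Y) (fh F)) (A * B)].

Lemma dominated_dist : field_distribution dominated.
Proof.
split=> [Y [] // | | Y Z [hY [A A0 bY]] [hZ [B B0 bZ]] | phi Y hp [hY [A A0 bY]]].
- split; first exact: cvf_0.
  exists 0 => // F B hF [[B0 _] _]; rewrite vf_lc0 ?mul0r; first exact: bd_0.
  exact: up.
- split; first exact: cvf_D.
  exists (A + B); first exact: addr_ge0.
  move=> F D hF hD; rewrite (vf_lcD hY hZ (up hF)) mulrDl.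
  by apply: bdD; [exact: bY | exact: bZ].
- split; first exact: cvf_scale.
  have [k k0 hk] := op1_bd 0 (op_conv (f_rapid hJ (tst_local_scale hp))).
  exists (k * A); first exact: mulr_ge0.
  move=> F D hF hD; rewrite (vf_lc_scale hp hY hF) -mulrA.
  by apply: (hk _ _ 0); [rewrite addr0 | exact: bY].
Qed.

Lemma dominated_gen Y : generated_distribution (range L) Y -> dominated Y.
Proof.
apply; split; first exact: dominated_dist.
move=> _ [j _ <-]; split; first exact: hL.
by exists 1 => // F B hF [_ hB]; rewrite mul1r.
Qed.

Variable mu : {measure set (borel M) -> \bar R}.
Hypothesis L2_pull : exists2 A, 0 < A & forall F, tst q r F -> exists N,
  [/\ normL2_sqr mu (pl F) = N%:E, N <= A * J (fun y => nrm (F y) ^+ 2) &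
      J (fun y => nrm (F y) ^+ 2) <= A * N].

(** The defining inequality is applied on the relatively compact chart ball of radius [r0]; the
    fields [L'] occurring in it belong to the generated distribution and are therefore dominated by
    the generators. *)
Lemma dominated_subelliptic Y :
  subelliptic_fields mu (generated_distribution (range L)) Y -> dominated Y.
Proof.
move=> [hY sub]; split=> //.
pose U : set M := [set x | chart_dom c x /\ `|chart_map c x - q| < r0].
have oU : open U.
  rewrite openE => x [dx hx]; apply: filterI.
    exact: open_nbhs_nbhs (conj (dom_open Ac) dx).
  have nb : nbhs (chart_map c x) [set y : X | `|y - q| < r0].
    by apply: open_nbhs_nbhs; split; [exact: open_in | exact: hx].
  exact: (map_continuous Ac dx nb).
have cK : compact (chart_inv c @` [set y | `|y - q| <= r0]).
  apply: continuous_compact; last exact: (@compact_ball _ _ q r0 (ltW r00)).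
  have [_ _ _ _ h] := atlas_chart Ac; apply: continuous_subspaceW h => y /= ys.
  by apply: ball_img; exact: le_trans ys (ltW (lt_trans r0r rr2)).
have cU : compact (closure U).
  apply: (subclosed_compact _ cK); first exact: closed_closure.
  have cl : closed (chart_inv c @` [set y | `|y - q| <= r0]).
    exact: (compact_closed (@manifold_hausdorff _ _ M) cK).
  rewrite closureE; apply: smallest_sub => // x [dx hx].
  by exists (chart_map c x); [exact: ltW | rewrite (chart_mapK Ac)].
have [k [L' [D [hL' D0 hD]]]] := sub U oU cU.
have domL j := dominated_gen (hL' j).
have cL' j : complex_vector_field (L' j) by have [] := domL j.
have /choice[Aj hAj] : forall j, exists A, 0 <= A /\ forall F B, tst q r0 F -> Lbd F B ->
    bd 0 (vf (lcf (L' j)) (fh F)) (A * B).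
  by move=> j; have [_ [A A0 hA]] := domL j; exists A.
have [A A0 hA] := L2_pull.
pose S := \sum_j Aj j ^+ 2 + 1.
have S0 : 0 <= S by rewrite addr_ge0 // sumr_ge0 // => j _; exact: sqr_ge0.
(* One factor [A] compares [J] with the norm of the manifold, the other compares back; the square
   root undoes the squares of norms. *)
pose E := Num.sqrt (A * D * A * S).
exists E; first exact: sqrtr_ge0.
move=> F B hF hB; have tU : test_function U (pl F).
  apply: (pull_test Ac _ _ hF) => y hy.
    by apply: ball_img; exact: le_trans hy (ltW (lt_trans r0r rr2)).
  have iy : chart_img c y by apply: ball_img; exact: le_trans (ltW hy) (ltW (lt_trans r0r rr2)).
  by split; [exact: (dom_inv Ac iy) | rewrite (chart_invK Ac iy)].
have hYF := tstx hY hF r00; have B0 : 0 <= B by case: hB => [[]].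
rewrite -(f_vx_lc hY (up hF)); apply/(f_bd0 hJ _ (up hYF)); split.
  by rewrite mulr_ge0 // sqrtr_ge0.
have [N [eN _ N2]] := hA _ (up hYF).
have [NF [eNF NF1 _]] := hA _ (up hF).
have /choice[NL hNL] : forall j, exists N, [/\ normL2_sqr mu (L' j (pl F)) = N%:E &
    N <= A * (cn * (Aj j * B) ^+ 2)].
  move=> j; have hjF := tstx (cL' j) hF r00; have [N' [eN' N1 _]] := hA _ (up hjF).
  exists N'; rewrite (pull_lc (cL' j) hF); split=> //; apply: le_trans N1 _; apply: ler_wpM2l; first exact: ltW.
  have := (hAj j).2 F B hF hB; rewrite -(f_vx_lc (cL' j) (up hF)).
  by case/(f_bd0 hJ _ (up hjF)).
have NFB : NF <= A * (cn * B ^+ 2).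
  apply: le_trans NF1 _; apply: ler_wpM2l; first exact: ltW.
  by case: hB => /(f_bd0 hJ _ (up hF))[].
have := hD _ tU; rewrite (pull_lc hY hF) eN eNF.
under eq_bigr do rewrite (hNL _).1.
rewrite sumEFin -EFinD -EFinM lee_fin => le1.
apply: le_trans N2 _; rewrite exprMn sqr_sqrtr; last by rewrite !mulr_ge0 // ltW.
have -> : cn * (A * D * A * S * B ^+ 2) = A * (D * (A * (cn * S * B ^+ 2))) by ring.
apply: ler_wpM2l; first exact: ltW.
apply: le_trans le1 _; apply: ler_wpM2l; first exact: ltW.
have -> : A * (cn * S * B ^+ 2) = \sum_j A * (cn * (Aj j * B) ^+ 2) + A * (cn * B ^+ 2).
  rewrite -mulr_sumr -mulr_sumr -mulrDr -mulrDr /S; congr (_ * _).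
  rewrite -mulrA; congr (_ * _); rewrite mulrDl mul1r mulr_suml; congr (_ + _).
  by apply: eq_bigr => j _; rewrite exprMn.
by apply: lerD => //; apply: ler_sum => j _; have [] := hNL j.
Qed.

End Generators.
End Dominated.

Section Gain.
Context {R : realType} {m : nat} {M : smooth_manifold R m}.
Local Notation X := ('rV[R]_m).
Local Notation K := ('rV[int]_m).
Local Notation C := R[i].
Variable c : chart R m M.
Hypothesis Ac : atlas c.
Variables (q : X) (r0 r r2 : R).
Hypothesis r00 : 0 < r0.
Hypothesis r0r : r0 < r.
Hypothesis rr2 : r < r2.
Hypothesis ball_img : forall y, `|y - q| <= r2 -> chart_img c y.
Variables (J : (X -> R) -> R) (cn : R).
Hypothesis hJ : fourier q r J cn.
Implicit Types (Y Z : operator M) (F G : X -> C).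

Let rp : 0 < r := lt_trans r00 r0r.
Local Notation fh := (fh J cn).
Local Notation lcc := (lc c q r0 r r2).
Local Notation lcf := (lcf c q r0 r r2 J cn).

Let up F : tst q r0 F -> tst q r F. Proof. exact: tst_mono (ltW r0r). Qed.
Let rlc Y : complex_vector_field Y -> rapidf (lcf Y).
Proof. exact: (rapid_lcf Ac r00 r0r rr2 ball_img hJ). Qed.
Let rF F : tst q r0 F -> rapid (fh F). Proof. by move=> h; exact: (f_rapid hJ (up h)). Qed.

Variables (n : nat) (L : 'I_n -> operator M) (X0 : operator M).
Hypothesis hL : forall j, complex_vector_field (L j).
Hypothesis hX0 : real_vector_field X0.
Variable mu : {measure set (borel M) -> \bar R}.
Hypothesis L2_pull : exists2 A, 0 < A & forall F, tst q r F -> exists N,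
  [/\ normL2_sqr mu (pull c F) = N%:E, N <= A * J (fun y => nrm (F y) ^+ 2) &
      J (fun y => nrm (F y) ^+ 2) <= A * N].
Local Notation gen := (generated_distribution (range L)).
Local Notation Lbd := (Lbd c q r0 r r2 J cn L).
Local Notation dominated := (dominated c q r0 r r2 J cn L).

Definition energy F B := Lbd F B /\ bd (- (1 / 2)) (vf (lcf X0) (fh F)) B.

(** Order [d - 1] on the derivative is what a bound of order [d] on the function itself would give.
    The constant is uniform over test functions in the ball, so gains survive sums and
    multiplication by functions. *)
Definition gain d Y := exists2 A, 0 <= A & forall F B, tst q r0 F -> energy F B ->
  bd (d - 1) (vf (lcf Y) (fh F)) (A * B).

Definition gains : set (operator M) := [set Y | real_vector_field Y /\
  exists2 d, 0 < d <= 1 & gain d Y].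

Lemma energy_ge0 F B : energy F B -> 0 <= B. Proof. by case=> [[[]]]. Qed.

Lemma gain_mono d e Y : e <= d -> gain d Y -> gain e Y.
Proof.
move=> ed [A A0 h]; exists A => // F B hF hB.
by apply: bd_mono (h F B hF hB); rewrite lerD2r.
Qed.

Lemma gains_0 : gains 0.
Proof.
split; first exact: rvf_0.
exists 1; first by rewrite ltr01 lexx.
exists 0 => // F B hF hB; rewrite mul0r (vf_lc0 Ac r00 r0r rr2 ball_img hJ (up hF)).
exact: bd_0.
Qed.

Lemma gains_D Y Z : gains Y -> gains Z -> gains (Y + Z).
Proof.
move=> [hY [d d01 gY]] [hZ [e e01 gZ]]; split; first exact: rvf_D.
have d0 : 0 < d by case/andP: d01. have e0 : 0 < e by case/andP: e01.
exists (Num.min d e).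
  by rewrite lt_min d0 e0 /= ge_min; case/andP: d01 => _ ->.
have [A A0 hA] : gain (Num.min d e) Y by apply: gain_mono gY; rewrite ge_min lexx.
have [B B0 hB] : gain (Num.min d e) Z by apply: gain_mono gZ; rewrite ge_min lexx orbT.
exists (A + B); first exact: addr_ge0.
move=> F D hF hD; rewrite (vf_lcD Ac r00 r0r rr2 ball_img hJ hY.1 hZ.1 (up hF)) mulrDl.
by apply: bdD; [exact: hA | exact: hB].
Qed.

Lemma gains_scale (phi : M -> R) Y : smooth_real setT phi -> gains Y ->
  gains (field_scale (complex_of phi) Y).
Proof.
move=> hp [hY [d d01 [A A0 gY]]]; split; first exact: rvf_scale.
have sp : smooth setT (complex_of phi).
  by split; [exact: hp | exact: (msmooth0 setT).2].
exists d => //.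
have hS := tst_local_scale Ac r00 r0r rr2 ball_img sp.
have [k k0 hk] := op1_bd (d - 1) (op_conv (f_rapid hJ hS)).
exists (k * A); first exact: mulr_ge0.
move=> F D hF hD; rewrite (vf_lc_scale Ac r00 r0r rr2 ball_img hJ sp hY.1 hF) -mulrA.
by apply: (hk _ _ (d - 1)); [rewrite addr0 | exact: gY].
Qed.

Lemma gains_subspace : real_subspace gains.
Proof.
split; [exact: gains_0 | exact: gains_D |].
by move=> k Y hY; apply: (gains_scale (phi := fun=> k)) => //; exact: (msmooth_cst setT k%:C).1.
Qed.

Lemma gains_X0 : gains X0.
Proof.
split=> //; exists (1 / 2); first by lra.
exists 1 => // F B hF [_ h]; rewrite (_ : 1 / 2 - 1 = - (1 / 2) :> R); last lra.
by rewrite [1 * B]mul1r.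
Qed.

Lemma gains_T0 Y : T0 gen Y -> gains Y.
Proof.
move=> [Z hZ <-]; have [cZ [A A0 hA]] := dominated_gen Ac r00 r0r rr2 ball_img hJ hL hZ.
split; first exact: rvf_conjD.
exists (1 / 2); first by lra.
have [D D0 hD] := real_part_gain (rlc cZ).
exists (D * (1 + A)); first by rewrite mulr_ge0 // addr_ge0.
move=> F B hF hB; have B0 := energy_ge0 hB.
rewrite (vf_lcD Ac r00 r0r rr2 ball_img hJ cZ (cvf_conj cZ) (up hF)).
rewrite (lcf_conj Ac r00 r0r rr2 ball_img hJ cZ) -mulrA.
have -> : 1 / 2 - 1 = - (1 / 2) :> R by lra.
apply: hD; first exact: rF.
- by apply: bd_le hB.1.1; rewrite mulrDl mul1r lerDl mulr_ge0.
- by apply: bd_le (hA F B hF hB.1); rewrite mulrDl mul1r lerDr.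
Qed.

Lemma gains_bracket A Y : real_subelliptic_fields mu gen A -> gains Y -> gains (bracket A Y).
Proof.
move=> [sA hA] [hY [d /andP[d0 d1] [B B0 gY]]]; split; first exact: rvf_bracket.
have [_ [k k0 hk]] := dominated_subelliptic Ac r00 r0r rr2 ball_img hJ hL L2_pull sA.
exists (d / 2); first by rewrite divr_gt0 //=; lra.
have hAY := cvf_bracket hA.1 hY.1.
have [D D0 hD] := bracket_gain (rlc hA.1) (rlc hY.1) (rlc hAY)
  (lcf_real Ac r00 r0r rr2 ball_img hJ hA) (lcf_real Ac r00 r0r rr2 ball_img hJ hY) d1.
exists (D * (1 + k + B)); first by rewrite mulr_ge0 // !addr_ge0.
move=> F E hF hE; have E0 := energy_ge0 hE.
have kE : 0 <= k * E by exact: mulr_ge0.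
have BE : 0 <= B * E by exact: mulr_ge0.
rewrite -mulrA !mulrDl mul1r; apply: hD.
- exact: rF.
- exact: (vf_bracket Ac r00 r0r rr2 ball_img hJ hA.1 hY.1 hF).
- by apply: bd_le hE.1.1; rewrite -addrA lerDl addr_ge0.
- by apply: bd_le (hk F E hF hE.1); rewrite -addrA addrCA lerDl addr_ge0.
- by apply: bd_le (gY F E hF hE); rewrite lerDr addr_ge0.
Qed.

Lemma real_span_sub (S : set (operator M)) : S `<=` gains -> real_span S `<=` gains.
Proof. by move=> h Y; apply; split; [exact: gains_subspace | exact: h]. Qed.

Lemma gains_Tsum : Tsum mu gen `<=` gains.
Proof.
apply: real_span_sub => Y [h _]; elim: h Y => [|h IH] Y; first exact: gains_T0.
by apply: real_span_sub => _ [A hA [Z hZ <-]]; exact: (gains_bracket hA (IH _ hZ)).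
Qed.

Lemma gains_T'0 : T'0 mu gen X0 `<=` gains.
Proof.
move=> _ [phi [Z [hp hZ ->]]]; apply: gains_D; last exact: gains_Tsum.
by exact: (gains_scale hp gains_X0).
Qed.

Definition gain_multiplier : set (operator M) := [set A | real_vector_field A /\
  forall Y, gains Y -> gains (bracket A Y)].

Lemma gain_multiplier_lie : lie_subalgebra gain_multiplier.
Proof.
have [g0 gD gZ] := gains_subspace.
have gS (k : R) Y : gains Y -> gains (field_scale (cst k%:C) Y) by exact: gZ.
split=> [A [] // | | A B [hA gA] [hB gB]].
- split=> [|A B [hA gA] [hB gB]|k A [hA gA]].
  + split; first exact: rvf_0.
    move=> Y gY; rewrite (_ : bracket 0 Y = 0) //; apply/funext => f.
    by rewrite /bracket [0 _]/(0 f) (vf_0 gY.1.1) subr0.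
  + split; first exact: rvf_D.
    move=> Y gY; have hY := gY.1.
    rewrite (_ : bracket (A + B) Y = bracket A Y + bracket B Y); first by apply: gD; auto.
    apply: cvf_ext.
    * exact: cvf_bracket (cvf_D hA.1 hB.1) hY.1.
    * exact: cvf_D (cvf_bracket hA.1 hY.1) (cvf_bracket hB.1 hY.1).
    * move=> f sf; rewrite /bracket [(A + B) (Y f)]/(A (Y f) + B (Y f)) [(A + B) f]/(A f + B f).
      rewrite (vf_D hY.1 (vf_smooth hA.1 sf) (vf_smooth hB.1 sf)).
      by rewrite opprD addrACA.
  + have hk : real_vector_field (field_scale (cst k%:C) A).
      by apply: (rvf_scale (phi := fun=> k)) => //; exact: (msmooth_cst setT k%:C).1.
    split; first exact: hk.
    move=> Y gY; have hY := gY.1.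
    rewrite (_ : bracket _ Y = field_scale (cst k%:C) (bracket A Y)); first by apply: gS; auto.
    apply: cvf_ext.
    * exact: cvf_bracket hk.1 hY.1.
    * apply: cvf_scale (cvf_bracket hA.1 hY.1); exact: msmooth_cst.
    * move=> f sf; rewrite /bracket.
      have sc Z g : field_scale (cst k%:C) Z g = k%:C *: Z g by [].
      rewrite !sc (vf_Z _ hY.1 (vf_smooth hA.1 sf)).
      by rewrite scalerBr.
- split; first exact: rvf_bracket.
  move=> Y gY; have hY := gY.1.
  rewrite (_ : bracket (bracket A B) Y =
    bracket A (bracket B Y) + field_scale (cst (-1)%:C) (bracket B (bracket A Y))).
    by apply: gD; [exact: gA (gB _ gY) | apply: gS; exact: gB (gA _ gY)].
  have cA := hA.1; have cB := hB.1; have cY := hY.1.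
  apply: cvf_ext.
  + exact: cvf_bracket (cvf_bracket cA cB) cY.
  + apply: cvf_D; first exact: cvf_bracket cA (cvf_bracket cB cY).
    apply: cvf_scale; first exact: msmooth_cst.
    exact: cvf_bracket cB (cvf_bracket cA cY).
  + move=> f sf; have sA := vf_smooth cA sf; have sB := vf_smooth cB sf; have sY := vf_smooth cY sf.
    have vB Z g h : complex_vector_field Z -> smooth setT g -> smooth setT h -> Z (g - h) = Z g - Z h.
      move=> hZ sg sh; rewrite -scaleN1r (vf_D hZ sg (msmoothZ _ openT sh)).
      by rewrite (vf_Z _ hZ sh) scaleN1r.
    have addf (S Z : operator M) : (S + Z) f = S f + Z f by [].
    have sc Z g : field_scale (cst (-1)%:C) Z g = (-1)%:C *: Z g by [].
    rewrite addf sc.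
    rewrite (_ : (-1)%:C = -1); last by apply: complexP; rewrite //= oppr0.
    rewrite scaleN1r /bracket.
    rewrite (vB _ _ _ cY (vf_smooth cA sB) (vf_smooth cB sA)).
    rewrite (vB _ _ _ cA (vf_smooth cB sY) (vf_smooth cY sB)).
    rewrite (vB _ _ _ cB (vf_smooth cA sY) (vf_smooth cY sA)).
    have addE (u v : M -> C) x : (u + v) x = u x + v x by [].
    have oppE (u : M -> C) x : (- u) x = - u x by [].
    by apply/funext => x; rewrite !(addE, oppE); ring.
Qed.

Lemma gains_T'sum : T'sum mu gen X0 `<=` gains.
Proof.
have alg A : subelliptic_algebra mu gen A -> gain_multiplier A.
  apply; split; first exact: gain_multiplier_lie.
  by move=> B hB; split; [exact: hB.2 | move=> Y gY; exact: gains_bracket].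
apply: real_span_sub => Y [h _]; elim: h Y => [|h IH] Y; first exact: gains_T'0.
by apply: real_span_sub => _ [A hA [Z hZ <-]]; apply: (alg A hA).2; exact: IH.
Qed.

End Gain.

(** * From gains of a frame to a gain of the function *)

Section Frame.
Context {R : realType} {m : nat} {M : smooth_manifold R m}.
Local Notation X := ('rV[R]_m).
Local Notation K := ('rV[int]_m).
Local Notation C := R[i].
Local Notation w := (@wt R m).

(** As the weight is 1 plus the sum of the |k_j|, weight times |v| equals |v| plus the sum of the
    moduli of the derivatives, termwise. *)
Lemma bd_gradient s (v : K -> C) A B : bd s v A -> (forall j, bd s (Dk j v) B) ->
  bd (s + 1) v (A + \sum_(j < m) B).
Proof.
move=> hA hB.
have hn (u : K -> C) D : bd s u D -> bd s (fun k => (nrm (u k))%:C) D.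
  by apply: bd_sub => k; rewrite nrm_real ger0_norm // nrm_ge0.
apply: (bd_sub _ (bdD (hn _ _ hA) (bd_sum _ (fun j => hn _ _ (hB j))))) => k /=.
have -> : (nrm (v k))%:C + \sum_j (nrm (Dk j v k))%:C = (nrm (v k) + \sum_j nrm (Dk j v k))%:C.
  by rewrite (rmorphD (real_complex R)) (rmorph_sum (real_complex R)).
rewrite nrm_real ger0_norm; last first.
  by rewrite addr_ge0 ?nrm_ge0 // sumr_ge0 // => j _; exact: nrm_ge0.
rewrite powRD; last by rewrite wt_neq0 implybT.
rewrite powRr1 ?wt_ge0 // -mulrA; apply: ler_wpM2l; first exact: powR_ge0.
rewrite /wt mulrDl mul1r lerD2l mulr_suml; apply: ler_sum => j _.
rewrite /Dk !nrmM nrm_i mul1r ler_wpM2r ?nrm_ge0 //.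
by rewrite -(rmorph_int (real_complex R)) nrm_real -intr_norm; exact: lexx.
Qed.

Variable c : chart R m M.
Hypothesis Ac : atlas c.
Variables (p : M) (r0 r r2 : R).
Hypothesis dp : chart_dom c p.
Local Notation q := (chart_map c p).
Hypothesis r00 : 0 < r0.
Hypothesis r0r : r0 < r.
Hypothesis rr2 : r < r2.
Hypothesis ball_img : forall y, `|y - q| <= r2 -> chart_img c y.
Local Notation lcc := (lc c q r0 r r2).

Lemma lc_real Y j y : real_vector_field Y -> lcc Y j y = (complex.Re (lcc Y j y))%:C.
Proof.
move=> [hY eY]; have := lc_conj c q r0 r r2 j hY; rewrite eY => /(congr1 (fun f => f y)) /=.
by case: (lcc Y j y) => a b [] e; apply: complexP => //=; lra.
Qed.

Lemma lc_at_center Y (i j : 'I_m) : real_vector_field Y -> field_at Y p = coord_vector c p i ->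
  lcc Y j q = (i == j)%:R.
Proof.
move=> hY e; rewrite lc_real // /lc cut1 //; last by rewrite subrr normr0 ltW.
rewrite mul1r (chart_mapK Ac dp).
have rp := lt_trans r00 r0r; have r2p := lt_trans rp rr2.
pose k : M -> R := fun x => complex.Re (kappa c q r r2 j x).
have ek : complex_of k = kappa c q r r2 j.
  apply/funext => x; rewrite /complex_of /k /kappa /pull; case: ifP => // _.
  by rewrite /cut -(rmorphM (real_complex R)).
have sk : smooth_real setT k by exact: (smooth_kappa Ac r00 r0r rr2 ball_img j).1.
have := congr1 (fun v => v k) e; rewrite /field_at ek => ->.
rewrite /coord_vector asboolT //.
have -> : partial i (k \o chart_inv c) q = partial i (fun y : X => y 0 j) q.
  have loc (y : X) : `|y - q| < r -> (k \o chart_inv c) y = y 0 j.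
    move=> hy; have iy : chart_img c y by apply: ball_img; exact: le_trans (ltW hy) (ltW rr2).
    by rewrite /= /k /kappa (pull_inv Ac _ iy) cut1 ?(ltW hy) // mul1r.
  by rewrite (partial_ext i (@open_in _ _ q r) _ loc) /= ?subrr ?normr0.
rewrite /partial; suff [_ ->] : is_derive q (delta_mx 0 i) (fun x : X => x 0 j) (i == j)%:R.
  by case: (i == j).
apply/is_derive_line.
have -> : (fun h : R => (h *: delta_mx 0 i + q) 0 j) = (fun h => h * (i == j)%:R + q 0 j).
  by apply/funext => h; rewrite !mxE eqxx /= [j == i]eq_sym.
by apply: is_derive_eq; rewrite addr0 scaler0 add0r [_%:A]mulr1.
Qed.

(** The components of the fields form the identity matrix at the center, so their determinant is
    nonzero on a small ball; Cramer's formula, cut off there, recovers the coordinate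
    derivatives. *)
Lemma frame_inverse (Y : 'I_m -> operator M) : (forall i, real_vector_field (Y i)) ->
  (forall i, field_at (Y i) p = coord_vector c p i) ->
  exists r1 (b : 'I_m -> 'I_m -> X -> C), [/\ 0 < r1 < r0, forall i j, tst q r0 (b i j) &
    forall F j y, tst q r1 F -> cpartial j F y = \sum_i b i j y * vx (lcc (Y i)) F y].
Proof.
move=> hY eY; pose A (y : X) : 'M[R]_m := \matrix_(i, j) complex.Re (lcc (Y i) j y).
have sA i j : smo setT (fun y => A y i j).
  have [h _] := tst_csm (tst_lc Ac r00 r0r rr2 ball_img j (hY i).1).
  by apply: smooth_ext h => //; [exact: openT | move=> y _; rewrite mxE].
have sdet : smo setT (fun y => \det (A y)) by apply: smooth_det => //; exact: openT.
have A1 : A q = 1%:M.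
  apply/matrixP => i j; rewrite !mxE (lc_at_center j (hY i) (eY i)).
  by case: (i == j).
have [r3 /andP[r30 r3r] hdet] : exists2 r3, 0 < r3 < r0 & forall y, `|y - q| <= r3 -> \det (A y) != 0.
  have cd := smooth_continuous sdet (I : setT q).
  have : \forall y \near q, \det (A y) != 0.
    by apply: (cvgr_neq0 _ cd); rewrite A1 det1 oner_neq0.
  move=> /nbhs_ballP[e /= e0 he]; exists (Num.min (e / 2) (r0 / 2)).
    have h2 : r0 / 2 < r0 by rewrite ltr_pdivrMr // ltr_pMr // ltr1n.
    by rewrite lt_min !divr_gt0 //= gt_min h2 orbT.
  move=> y; rewrite le_min => /andP[h _]; apply: he; rewrite -ball_normE /= distrC.
  by apply: le_lt_trans h _; lra.
pose b i j : X -> C := fun y => cut q (r3 / 2) r3 y * (\adj (A y) j i / \det (A y))%:C.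
have sb i j : tst q r0 (b i j).
  have h20 : 0 < r3 / 2 by rewrite divr_gt0.
  have h23 : r3 / 2 < r3 by lra.
  have hc := tst_cut q h20 h23; have [_ [s s0 hs]] := hc.
  apply: tst_mono (ltW r3r) _; apply: (tst_local s0); last by move=> y hy; rewrite /b hs // mul0r.
  have oin := @open_in _ _ q r3.
  apply: csmM => //; first exact: csm_sub (tst_csm hc).
  apply: csm_real; apply: smoothM => //; last first.
    apply: smooth_inv => //; first by move=> y hy; apply: hdet; exact: ltW.
    exact: smooth_sub sdet.
  apply: (smooth_ext oin (f := fun y => (-1) ^+ (i + j) * \det (row' i (col' j (A y))))).
    by move=> y _; rewrite [RHS]mxE.
  apply: smoothM => //; first exact: smooth_cst.
  apply: smooth_det => // k l.
  apply: (smooth_ext oin (f := fun y => A y (lift i k) (lift j l))); first by move=> y _; rewrite !mxE.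
  exact: smooth_sub (sA _ _).
exists (r3 / 2), b; split=> //; first by rewrite divr_gt0 //=; lra.
move=> F j y hF; have [h|h] := leP (r3 / 2) `|y - q|.
  rewrite (tst_supp (tst_partial _ j hF) h); last by rewrite divr_gt0.
  rewrite big1 // => i _; rewrite (tst_supp (tst_vx Ac r00 r0r rr2 ball_img (hY i).1 hF _) h) ?mulr0 //.
  by rewrite divr_gt0.
have dA : \det (A y) != 0 by apply: hdet; lra.
have inv : forall l, \sum_i (\adj (A y) j i / \det (A y)) * A y i l = (j == l)%:R.
  move=> l; have := congr1 (fun B : 'M[R]_m => B j l) (mul_adj_mx (A y)); rewrite mxE [RHS]mxE => e.
  under eq_bigr do rewrite mulrAC.
  by rewrite -mulr_suml e; case: (j == l); rewrite ?mulr1n ?mulr0n ?mul0r ?divff.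
rewrite /b cut1 ?(ltW h) ?divr_gt0 //; last by lra.
under eq_bigr do rewrite mul1r /vx mulr_sumr.
rewrite exchange_big /=.
under eq_bigr => l _.
  under eq_bigr => i _.
    rewrite (lc_real _ _ (hY i)) mulrA -(rmorphM (real_complex R)) /=.
    rewrite (_ : complex.Re _ = A y i l); last by rewrite mxE.
    over.
  rewrite -mulr_suml -(rmorph_sum (real_complex R)) /= inv.
  over.
rewrite (bigD1 j) //= eqxx mul1r big1 ?addr0 // => l nl.
by rewrite eq_sym (negbTE nl) mul0r.
Qed.

End Frame.

Section Estimate.
Context {R : realType} {m : nat} {M : smooth_manifold R m}.
Local Notation X := ('rV[R]_m).
Local Notation K := ('rV[int]_m).
Local Notation C := R[i].
Variable c : chart R m M.
Hypothesis Ac : atlas c.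
Variables (p : M) (r0 r r2 : R).
Hypothesis dp : chart_dom c p.
Local Notation q := (chart_map c p).
Hypothesis r00 : 0 < r0.
Hypothesis r0r : r0 < r.
Hypothesis rr2 : r < r2.
Hypothesis ball_img : forall y, `|y - q| <= r2 -> chart_img c y.
Variables (J : (X -> R) -> R) (cn : R).
Hypothesis hJ : fourier q r J cn.
Variables (n : nat) (L : 'I_n -> operator M) (X0 : operator M).
Hypothesis hL : forall j, complex_vector_field (L j).
Hypothesis hX0 : real_vector_field X0.
Variable mu : {measure set (borel M) -> \bar R}.
Hypothesis L2_pull : exists2 A, 0 < A & forall F, tst q r F -> exists N,
  [/\ normL2_sqr mu (pull c F) = N%:E, N <= A * J (fun y => nrm (F y) ^+ 2) &
      J (fun y => nrm (F y) ^+ 2) <= A * N].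
Hypothesis span : [set field_at Y p | Y in
  T'sum mu (generated_distribution (range L)) X0] = tangent_space p.

Theorem subelliptic_estimate : exists r1 d, [/\ 0 < r1 < r0, 0 < d <= 1 &
  exists2 A, 0 <= A & forall F B, tst q r1 F -> energy c q r0 r r2 J cn L X0 F B ->
    bd d (fh J cn F) (A * B)].
Proof.
have /choice[Y hY] : forall i : 'I_m, exists Y, gains c q r0 r r2 J cn L X0 Y /\
    field_at Y p = coord_vector c p i.
  move=> i; have := coord_vector_tangent Ac dp i; rewrite -span => -[Y hY e].
  exists Y; split; [exact: (gains_T'sum Ac r00 r0r rr2 ball_img hJ hL hX0 L2_pull hY) | exact: e].
have rY i : real_vector_field (Y i) by have [[]] := hY i.
have /choice[d hd] : forall i, exists d, 0 < d <= 1 /\ gain c q r0 r r2 J cn L X0 d (Y i).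
  by move=> i; have [[_ [d d01 gd]] _] := hY i; exists d.
(* A product of numbers in (0, 1] is a positive lower bound of all of them, also when there are
   none. *)
pose e := \prod_i d i.
have e0 : 0 < e by apply: prodr_gt0 => i _; case: (hd i) => /andP[].
have e1 : e <= 1 by apply: prodr_ile1 => i _; case: (hd i) => /andP[/ltW -> ->].
have ed i : e <= d i.
  have /andP[d0 _] := (hd i).1; rewrite /e (bigD1 i) //= ger_pMr //.
  by apply: prodr_ile1 => j _; case: (hd j) => /andP[/ltW -> ->].
have [r1 [b [r1r0 tb eb]]] := frame_inverse Ac dp r00 r0r rr2 ball_img rY (fun i => (hY i).2).
have /andP[r10 r1r0'] := r1r0.
have up F s : s <= r -> tst q s F -> tst q r F by move=> h; exact: tst_mono h.
have r0r' := ltW r0r; have r1r' := ltW (lt_trans r1r0' r0r).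
have rp : 0 < r := lt_trans r00 r0r.
have /choice[A hA] : forall i, exists A, 0 <= A /\ forall F B, tst q r0 F ->
    energy c q r0 r r2 J cn L X0 F B -> bd (e - 1) (vf (lcf c q r0 r r2 J cn (Y i)) (fh J cn F)) (A * B).
  by move=> i; have [A A0 h] := gain_mono (ed i) (hd i).2; exists A.
have /choice[k hk] : forall ij : 'I_m * 'I_m, exists k, 0 <= k /\ forall v B,
    bd (e - 1) v B -> bd (e - 1) (conv (fh J cn (b ij.1 ij.2)) v) (k * B).
  move=> ij; have [k k0 h] := op1_bd (e - 1) (op_conv (f_rapid hJ (up _ _ r0r' (tb ij.1 ij.2)))).
  by exists k; split=> // v B; apply: h; rewrite addr0.
exists r1, e; split; [exact: r1r0 | by rewrite e0 | ].
pose S := \sum_j \sum_i k (i, j) * A i.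
have S0 j : 0 <= \sum_i k (i, j) * A i.
  by apply: sumr_ge0 => i _; apply: mulr_ge0; [exact: (hk _).1 | exact: (hA _).1].
exists (1 + \sum_(j < m) S); first by rewrite addr_ge0 // sumr_ge0 // => j _; exact: sumr_ge0.
move=> F B hF hB; have B0 : 0 <= B by case: hB => [[[]]].
have hF0 : tst q r0 F by apply: tst_mono hF; exact: ltW.
have hFr := up _ _ r1r' hF.
rewrite mulrDl mul1r mulr_suml (_ : e = e - 1 + 1); last by rewrite subrK.
apply: bd_gradient; first by apply: bd_mono hB.1.1; rewrite subr_le0.
move=> j; rewrite -(f_Dk hJ j hFr).
have tYF i : tst q r (vx (lc c q r0 r r2 (Y i)) F).
  exact: (tst_vx Ac r00 r0r rr2 ball_img (rY i).1 hFr rp).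
have -> : cpartial j F = fun y => \sum_i b i j y * vx (lc c q r0 r r2 (Y i)) F y.
  by apply/funext => y; exact: eb.
rewrite (f_sum _ hJ rp); last by move=> i; exact: (tstM (up _ _ r0r' (tb i j)) (tst_csm (tYF i))).
apply: (@bd_le _ _ _ _ (\sum_i k (i, j) * (A i * B))).
  under eq_bigr do rewrite mulrA.
  apply: (@le_trans _ _ ((\sum_i k (i, j) * A i) * B)); first by rewrite mulr_suml.
  apply: ler_wpM2r => //; rewrite /S [leRHS](bigD1 j) //= lerDl.
  by apply: sumr_ge0 => l _; exact: S0.
apply: bd_sum => i; rewrite (f_conv hJ (up _ _ r0r' (tb i j)) (tYF i)).
apply: (hk (i, j)).2; rewrite (f_vx_lc Ac r00 r0r rr2 ball_img hJ (rY i).1 hFr).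
exact: (hA i).2.
Qed.

End Estimate.

(** * Regularity of distributions *)

Section FundamentalLemma.
Context {R : realType} {m : nat} {M : smooth_manifold R m}.
Local Notation X := ('rV[R]_m).
Local Notation C := R[i].
Variables (g : riemannian_metric M) (mu : {measure set (borel M) -> \bar R}).
Hypothesis mu_vol : riemannian_volume g mu.

Lemma Jint_fourier c q r r2 : atlas c -> 0 < r -> r < r2 -> r * 2 <= 1 ->
  (forall y, `|y - q| <= r2 -> chart_img c y) ->
  exists cn, fourier q r (Jint g mu c q r r2) cn.
Proof.
move=> Ac r0 rr2 r1 bi; apply: (fourier_exists r0 r1).
- by move=> f h; exact: (Jint_D mu_vol Ac r0 rr2 bi).
- by move=> k f; exact: (Jint_Z mu_vol Ac r0 rr2 bi).
- exact: (Jint_bound mu_vol Ac r0 rr2 bi).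
- by move=> f; exact: (Jint_ge0 g mu Ac r0 rr2 bi).
- by move=> f j; exact: (Jint_partial mu_vol Ac r0 rr2 bi).
- exact: (Jint_neq0 mu_vol Ac r0 rr2 bi).
Qed.

Lemma chart_ball (V : set M) c p : atlas c -> chart_dom c p -> open V -> V p ->
  exists2 e : R, 0 < e & forall y : X, `|y - chart_map c p| <= e -> chart_img c y /\ V (chart_inv c y).
Proof.
move=> Ac dp oV Vp; have oW := open_image Ac oV.
have : nbhs (chart_map c p) (chart_map c @` (chart_dom c `&` V)).
  by apply: open_nbhs_nbhs; split=> //; exists p.
move=> /nbhs_ballP[e /= e0 he]; exists (e / 2); first by rewrite divr_gt0.
move=> y hy; have : (chart_map c @` (chart_dom c `&` V)) y.
  apply: he; rewrite -ball_normE /= distrC; apply: le_lt_trans hy _.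
  by rewrite ltr_pdivrMr // ltr_pMr // ltr1n.
by rewrite (chart_image Ac).
Qed.

(** The Fourier coefficients of a cut off smooth function are integrals against test functions, so
    equal integrals give equal coefficients, and inversion gives equal values at the center. *)
Lemma cintegral_inj (V : set M) (f1 f2 : M -> C) x : open V -> smooth V f1 -> smooth V f2 ->
  (forall phi, test_function V phi -> cintegral mu (f1 * phi) = cintegral mu (f2 * phi)) ->
  V x -> f1 x = f2 x.
Proof.
move=> oV s1 s2 h Vx.
have [c Ac dx] : exists2 c, atlas c & chart_dom c x.
  by have : (\bigcup_(c in @atlas _ _ M) chart_dom c) x by rewrite atlas_cover.
have [e e0 he] := chart_ball Ac dx oV Vx; set q := chart_map c x in he.
pose r2 := Num.min e (1 / 2); have r20 : 0 < r2 by rewrite lt_min e0 /= divr_gt0.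
pose r := r2 / 2; have r0 : 0 < r by rewrite divr_gt0.
have rr2 : r < r2 by rewrite /r ltr_pdivrMr // ltr_pMr // ltr1n.
have r1 : r * 2 <= 1.
  by rewrite /r divfK // /r2 ge_min; apply/orP; right; rewrite mul1r invf_le1 // ler1n.
have he' y : `|y - q| <= r2 -> chart_img c y /\ V (chart_inv c y).
  by move=> hy; apply: he; apply: le_trans hy _; rewrite ge_min lexx.
have bi y : `|y - q| <= r2 -> chart_img c y by move=> /he'[].
have [cn hJ] := Jint_fourier Ac r0 rr2 r1 bi; set J := Jint _ _ _ _ _ _ in hJ.
pose th := cut q (r / 2) r.
have r20' : 0 < r / 2 by rewrite divr_gt0.
have r2r : r / 2 < r by rewrite ltr_pdivrMr // ltr_pMr // ltr1n.
have tth : tst q r th by exact: tst_cut.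
have bir y : `|y - q| <= r -> chart_img c y by move=> hy; apply: bi; exact: le_trans hy (ltW rr2).
have Vr y : `|y - q| < r -> V (chart_inv c y).
  by move=> hy; apply: (he' _ _).2; exact: le_trans (ltW hy) (ltW rr2).
pose H (f : M -> C) : X -> C := fun y => th y * f (chart_inv c y).
have tH f : smooth V f -> tst q r (H f) by move=> sf; exact: (tst_push Ac bir oV sf Vr tth).
have eJ f k : jh J (H f) k = cintegral mu (f * pull c (fun y => th y * ek (- k) y * (irho g c q r r2 y)%:C)).
  rewrite mulrC -(pull_push Ac) /jh -cintegral_pull; congr cintegral; congr pull.
  by apply/funext => y; rewrite /H; ring.
have eq : fh J cn (H f1) = fh J cn (H f2).
  apply/funext => k; rewrite /fh !eJ; congr (_ * _); apply: h; apply: (pull_test Ac bir Vr).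
  apply: tstM; first by apply: tstM => //; apply: csm_ek; exact: openT.
  exact: tst_csm (tst_irho g Ac r0 rr2 bi).
have qq : th q = 1 by rewrite /th cut1 // subrr normr0 ltW.
have := f_inj hJ q (tH _ s1) (tH _ s2) eq.
by rewrite /H qq !mul1r /q (chart_mapK Ac dx).
Qed.

End FundamentalLemma.

(** * Fourier coefficients of a functional of finite order *)

Section Functionals.
Context {R : realType} {m : nat}.
Local Notation X := ('rV[R]_m).
Local Notation K := ('rV[int]_m).
Local Notation C := R[i].
Local Notation w := (@wt R m).
Implicit Types (F G : X -> C) (a b : K -> C).

Lemma fin_pt (N : nat) (v : K -> C) B : (forall k, nrm (v k) <= B * w k ^+ N) -> fin v.
Proof.
move=> h; have [D hD] := @wt_summable R m.
have D0 : 0 <= D by have := hD [::] isT; rewrite big_nil.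
have B0 : 0 <= B.
  by have := le_trans (nrm_ge0 _) (h 0); rewrite pmulr_lge0 // exprn_gt0 // wt_gt0.
exists (- (N + m)%:R), (B * (D + 1)); split; first by rewrite mulr_ge0 // addr_ge0.
move=> t ut; apply: (@le_trans _ _ (\sum_(k <- t) B ^+ 2 * w k `^ (- (m.*2)%:R))).
  apply: ler_sum => k _.
  have -> : w k `^ (- (m.*2)%:R) = (w k `^ (- m%:R)) ^+ 2 :> R.
    by rewrite expr2 -wtpD -opprD -mulr2n -mulrnA muln2.
  rewrite -exprMn lerXn2r ?nnegrE ?mulr_ge0 ?wtp_ge0 ?nrm_ge0 //.
  rewrite natrD opprD wtpD mulrAC ler_wpM2r ?wtp_ge0 //.
  by rewrite powRN mulrC ler_pdivrMr ?wtp_gt0 // wtp_nat.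
rewrite -mulr_sumr exprMn ler_wpM2l ?sqr_ge0 // (le_trans (hD t ut)) //.
rewrite sqrrD expr1n mulr1; have := sqr_ge0 D; lra.
Qed.

Definition citer (l : seq 'I_m) F : X -> C := foldr (fun j => cpartial j) F l.

Lemma csm_citer l F : csm setT F -> csm setT (citer l F).
Proof. by move=> hF; elim: l => //= j l; exact: csm_partial. Qed.

Lemma citerD l F G : csm setT F -> csm setT G ->
  citer l (fun y => F y + G y) = fun y => citer l F y + citer l G y.
Proof.
move=> hF hG; elim: l => //= j l ->; apply/funext => y.
by apply: (@cpartialD _ _ setT) => //; exact: csm_citer.
Qed.

Lemma citer_rcons l j F : citer (rcons l j) F = citer l (cpartial j F).
Proof. by rewrite /citer foldr_rcons. Qed.

Lemma Re_citer l F : (fun y => complex.Re (citer l F y)) = iter_partial l (fun y => complex.Re (F y)).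
Proof. by elim: l => //= j l <-. Qed.
Lemma Im_citer l F : (fun y => complex.Im (citer l F y)) = iter_partial l (fun y => complex.Im (F y)).
Proof. by elim: l => //= j l <-. Qed.

(** A weighted l^1 bound on coefficients, which controls the derivatives up to order [N] of the
    trigonometric series. *)
Definition wsum (N : nat) b A := forall t : seq K, uniq t -> \sum_(k <- t) nrm (b k) * w k ^+ N <= A.

Lemma wsum_pow N N' b A : (N <= N')%N -> wsum N' b A -> wsum N b A.
Proof.
move=> NN h t ut; apply: le_trans (h t ut); apply: ler_sum => k _; rewrite ler_wpM2l ?nrm_ge0 //.
by rewrite ler_weXn2l // wt_ge1.
Qed.

Lemma wsum_ge0 N b A : wsum N b A -> 0 <= A.
Proof. by move=> /(_ [::] isT); rewrite big_nil. Qed.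

Lemma wsum_Dk N b A j : wsum N.+1 b A -> wsum N (Dk j b) A.
Proof.
move=> h t ut; apply: le_trans (h t ut); apply: ler_sum => k _.
rewrite /Dk !nrmM nrm_i mul1r exprS mulrA ler_wpM2r ?exprn_ge0 ?wt_ge0 //.
rewrite mulrC ler_wpM2l ?nrm_ge0 //; apply: le_trans (wt_coord k j).
by rewrite -(rmorph_int (real_complex R)) nrm_real -intr_norm; exact: lexx.
Qed.

Lemma trig_bound b A x : rapid b -> wsum 0 b A -> nrm (trig b x) <= A.
Proof.
move=> hb h; apply: has_sum_bound (has_sum_trig x hb) _ => t ut.
apply: le_trans (h t ut); apply: ler_sum => k _.
by rewrite nrmM nrm_ek expr0; exact: lexx.
Qed.

(** Leibniz rule by induction on the number of derivatives: each falls on [G] or on the series,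
    where it consumes one power of the weight. *)
Lemma citer_trig_bound q r (N : nat) G : 0 < r -> tst q r G -> exists2 D, 0 <= D &
  forall b A l y, rapid b -> wsum N b A -> (size l <= N)%N ->
    nrm (citer l (fun y => G y * trig b y) y) <= D * A.
Proof.
move=> r0; elim: N G => [|N IH] G hG.
  have [D D0 hD] := tst_bounded r0 hG; exists D => // b A [|//] y hb hA _ /=.
  rewrite nrmM; apply: ler_pM; rewrite ?nrm_ge0 //; exact: trig_bound.
have [D D0 hD] := IH G hG.
have /choice[E hE] : forall j, exists E, 0 <= E /\ forall b A l y, rapid b -> wsum N b A -> (size l <= N)%N ->
    nrm (citer l (fun y => cpartial j G y * trig b y) y) <= E * A.
  by move=> j; have [E E0 hE] := IH _ (tst_partial r0 j hG); exists E.
exists (D + \sum_j E j); first by rewrite addr_ge0 // sumr_ge0 // => j _; exact: (hE j).1.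
move=> b A l y hb hA sl; have A0 := wsum_ge0 hA.
have S0 : 0 <= \sum_j E j * A by apply: sumr_ge0 => j _; rewrite mulr_ge0 // (hE j).1.
rewrite mulrDl mulr_suml; case/lastP: l sl => [_|l j].
  apply: le_trans (hD b A [::] y hb (wsum_pow (leqnSn N) hA) isT) _.
  by rewrite lerDl.
rewrite size_rcons ltnS => sl; rewrite citer_rcons.
have -> : cpartial j (fun y => G y * trig b y) =
    fun y => cpartial j G y * trig b y + G y * trig (Dk j b) y.
  apply/funext => z; rewrite (@cpartialM _ _ setT _ _ j z I (tst_csm hG) (csm_trig hb)).
  by rewrite cpartial_trig.
rewrite citerD; last 2 first.
- apply: csmM; [exact: openT | exact: csm_partial (tst_csm hG) | exact: csm_trig].
- apply: csmM; [exact: openT | exact: tst_csm hG | exact: csm_trig (rapid_Dk j hb)].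
apply: le_trans (nrmD _ _) _; rewrite addrC; apply: lerD.
  exact: hD (rapid_Dk j hb) (wsum_Dk j hA) sl.
apply: le_trans ((hE j).2 b A l y hb (wsum_pow (leqnSn N) hA) sl) _.
rewrite (bigD1 j) //= lerDl; apply: sumr_ge0 => i _; rewrite mulr_ge0 //; exact: (hE i).1.
Qed.

(** [om] is a distribution read in the chart: linear, and of finite order on every smaller ball. *)
Variables (q : X) (r : R) (om : (X -> C) -> C).
Hypothesis r0 : 0 < r.
Hypothesis om_lin : forall k F G, tst q r F -> tst q r G -> om (fun y => k * F y + G y) = k * om F + om G.
Hypothesis om_bound : forall s, 0 < s < r -> exists (N : nat) A, forall F B, tst q s F -> 0 <= B ->
  (forall l y, (size l <= N)%N -> nrm (citer l F y) <= B) -> nrm (om F) <= A * B.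

Lemma om0 : om (fun=> 0) = 0.
Proof.
have t0 := tst0 q r0; have := om_lin (-1) t0 t0.
have -> : (fun y : X => -1 * 0 + 0) = (fun=> 0 : C) by apply/funext => y; rewrite mulr0 addr0.
by rewrite mulN1r addNr.
Qed.

Lemma omZ k F : tst q r F -> om (fun y => k * F y) = k * om F.
Proof.
move=> hF; have := om_lin k hF (tst0 q r0); rewrite om0 addr0 => <-.
by congr om; apply/funext => y; rewrite addr0.
Qed.

Lemma omD F G : tst q r F -> tst q r G -> om (fun y => F y + G y) = om F + om G.
Proof.
move=> hF hG; have := om_lin 1 hF hG; rewrite mul1r => <-.
by congr om; apply/funext => y; rewrite mul1r.
Qed.

Lemma omN F : tst q r F -> om (fun y => - F y) = - om F.
Proof.
move=> hF; rewrite -mulN1r -omZ //; congr om; apply/funext => y; by rewrite mulN1r.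
Qed.

Lemma om_sum (I : Type) (t : seq I) (F : I -> X -> C) : (forall i, tst q r (F i)) ->
  om (fun y => \sum_(i <- t) F i y) = \sum_(i <- t) om (F i).
Proof.
move=> hF; elim: t => [|i t IH].
  rewrite big_nil -[RHS]om0; congr om; apply/funext => y; by rewrite big_nil.
rewrite big_cons -IH -omD //; last exact: tst_sum.
by congr om; apply/funext => y; rewrite big_cons.
Qed.

Variables (s : R) (chi : X -> C).
Hypothesis s0r : 0 < s < r.
Hypothesis hchi : tst q s chi.

Let s0 : 0 < s. Proof. by case/andP: s0r. Qed.
Let upchi : tst q r chi. Proof. by apply: tst_mono hchi; apply: ltW; case/andP: s0r. Qed.

Let om_trig : exists (N : nat) A, 0 <= A /\ forall b B, rapid b -> wsum N b B ->
  nrm (om (fun y => chi y * trig b y)) <= A * B.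
Proof.
have [N [A hA]] := om_bound s0r; have [D D0 hD] := citer_trig_bound N s0 hchi.
exists N, (`|A| * D); split; first exact: mulr_ge0.
move=> b B hb hB; have B0 := wsum_ge0 hB; rewrite -mulrA.
apply: (@le_trans _ _ (A * (D * B))); last by rewrite ler_wpM2r ?mulr_ge0 // ler_norm.
apply: hA; [exact: tstM hchi (csm_trig hb) | exact: mulr_ge0 | ].
by move=> l y sl; exact: hD.
Qed.

(** Presents a single exponential as a trigonometric series, so that the bound for series applies to
    it. *)
Let delta (l : K) : K -> C := fun k => (k == l)%:R.

Let rapid_delta l : rapid (delta l).
Proof.
apply: (@rapid_finite_supp _ _ _ [:: l]) => // k; rewrite inE /delta => /negbTE ->; by [].
Qed.

Let trig_delta l (y : X) : trig (delta l) y = ek l y.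
Proof.
rewrite /trig (@csum_finite _ _ _ [:: l]) //.
  by rewrite big_seq1 /delta eqxx mul1r.
by move=> k; rewrite inE /delta => /negbTE ->; rewrite mul0r.
Qed.

Lemma om_fin : fin (fun k => om (fun y => chi y * ek (- k) y)).
Proof.
have [N [A [A0 hA]]] := om_trig; apply: (@fin_pt N _ A) => k.
have := hA (delta (- k)) (w k ^+ N) (rapid_delta _).
have -> : (fun y => chi y * trig (delta (- k)) y) = fun y => chi y * ek (- k) y.
  by apply/funext => y; rewrite trig_delta.
apply=> t ut; apply: (@le_trans _ _ (\sum_(l <- t) if l == - k then w k ^+ N else 0)).
  apply: ler_sum => l _; rewrite /delta; case: eqP => [->|_]; last by rewrite nrm0 mul0r.
  by rewrite nrm1 mul1r wtN.
case: (boolP (- k \in t)) => ht.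
  by rewrite (bigD1_seq (- k) ht ut) /= eqxx big1 ?addr0 // => i /negbTE ->.
rewrite big_seq big1 ?exprn_ge0 ?wt_ge0 // => i it; case: eqP => // e.
by rewrite -e it in ht.
Qed.

(** The tail of the series has a small weighted l^1 norm, hence small derivatives up to the order of
    [om]; therefore [om] acts termwise. *)
Lemma om_has_sum a : rapid a ->
  has_sum (fun k => a k * om (fun y => chi y * ek k y)) (om (fun y => chi y * trig a y)).
Proof.
move=> ha; have [N [A [A0 hA]]] := om_trig => e e0.
have [B hB] := rapid_abs N%:R ha.
have hB' (t : seq K) : uniq t -> \sum_(k <- t) nrm (a k) * w k ^+ N <= B.
  by move=> /hB; apply: le_trans; apply: ler_sum => k _; rewrite wtp_nat.
have p0 k : 0 <= nrm (a k) * w k ^+ N by rewrite mulr_ge0 ?nrm_ge0 ?exprn_ge0 ?wt_ge0.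
have [y y0 hy] := has_sum_nonneg p0 hB'.
pose d := e / (A + 1); have A1 : 0 < A + 1 by rewrite ltr_wpDl.
have d2 : 0 < d / 2 by rewrite !divr_gt0.
have [t0 h0] := hy _ d2; exists t0 => t ut sub.
pose b k := if k \in t then 0 else a k.
have hb : rapid b.
  move=> v; have [D hD] := ha v; exists D; apply: bd_sub hD => k; rewrite ler_wpM2l ?wtp_ge0 //.
  by rewrite /b; case: ifP => // _; rewrite nrm0 nrm_ge0.
have eb x : trig b x = trig a x - \sum_(k <- t) a k * ek k x.
  apply: has_sum_unique (has_sum_trig x hb) _.
  have h2 : has_sum (fun k => if k \in t then a k * ek k x else 0) (\sum_(k <- t) a k * ek k x).
    have := @has_sum_finite _ _ (fun k => if k \in t then a k * ek k x else 0) t ut.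
    rewrite (eq_big_seq (fun k => a k * ek k x)); last by move=> k kt; rewrite kt.
    by apply => k /negPf ->.
  have := has_sumB (has_sum_trig x ha) h2; congr has_sum; apply/funext => k; rewrite /b.
  by case: ifP; rewrite ?subr0 // subrr mul0r.
have wb : wsum N b d.
  move=> v uv; have [u1 u2 u3] := uniq_undup_cat t v; set u := undup (t ++ v) in u1 u2 u3.
  have es : \sum_(k <- t) nrm (a k) * w k ^+ N >= y - d / 2.
    have := h0 t ut sub; rewrite -(rmorph_sum (real_complex R)) -rmorphB nrm_real.
    by rewrite ler_norml => /andP[+ _]; lra.
  have eu : \sum_(k <- u) nrm (a k) * w k ^+ N <= y + d / 2.
    have := h0 u u1 (fun k kt => u2 k (sub k kt)); rewrite -(rmorph_sum (real_complex R)) -rmorphB nrm_real.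
    by rewrite ler_norml => /andP[_]; lra.
  apply: (@le_trans _ _ (\sum_(k <- u) nrm (b k) * w k ^+ N)).
    by apply: ler_sum_uniq_sub => // k; rewrite mulr_ge0 ?nrm_ge0 ?exprn_ge0 ?wt_ge0.
  have -> : \sum_(k <- u) nrm (b k) * w k ^+ N = \sum_(k <- u | k \notin t) nrm (a k) * w k ^+ N.
    rewrite [RHS]big_mkcond; apply: eq_bigr => k _; rewrite /b.
    by case: (k \in t); rewrite ?nrm0 ?mul0r.
  have := sum_uniq_sub (fun k => nrm (a k) * w k ^+ N) ut u1 u2; lra.
have tek k : tst q r (fun y => chi y * ek k y) by apply: tstM => //; apply: csm_ek; exact: openT.
have tak : tst q r (fun y => chi y * trig a y) by apply: tstM => //; exact: csm_trig.
have eo : om (fun y => chi y * trig b y) =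
    om (fun y => chi y * trig a y) - \sum_(k <- t) a k * om (fun y => chi y * ek k y).
  transitivity (om (fun y => chi y * trig a y + - \sum_(k <- t) a k * (chi y * ek k y))).
    congr om; apply/funext => x; rewrite eb mulrBr mulr_sumr; congr (_ - _).
    by apply: eq_bigr => k _; rewrite mulrCA.
  have ts : forall k, tst q r (fun y => a k * (chi y * ek k y)) by move=> k; exact: tstZ.
  rewrite omD //; last by apply: tstN; exact: tst_sum.
  rewrite omN; last exact: tst_sum.
  rewrite om_sum //; congr (_ - _); apply: eq_bigr => k _; exact: omZ.
rewrite nrmBC -eo; apply: le_trans (hA b d hb wb) _; rewrite /d.
have -> : A * (e / (A + 1)) = e * (A / (A + 1)) by rewrite mulrCA.
rewrite ger_pMr // ler_pdivrMr // mul1r lerDl; exact: ler01.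
Qed.

End Functionals.

(** * The transposed operator in a chart *)

Section Transpose.
Context {R : realType} {m : nat} {M : smooth_manifold R m}.
Local Notation X := ('rV[R]_m).
Local Notation K := ('rV[int]_m).
Local Notation C := R[i].
Variable c : chart R m M.
Hypothesis Ac : atlas c.
Variables (q : X) (r0 r r2 : R).
Hypothesis r00 : 0 < r0.
Hypothesis r0r : r0 < r.
Hypothesis rr2 : r < r2.
Hypothesis ball_img : forall y, `|y - q| <= r2 -> chart_img c y.
Variables (J : (X -> R) -> R) (cn : R).
Hypothesis hJ : fourier q r J cn.
Variables (mu : {measure set (borel M) -> \bar R}) (ir : X -> R).
Hypothesis tir : csm setT (fun y => (ir y)%:C).
Hypothesis cint_pull : forall F, cintegral mu (pull c (fun y => F y * (ir y)%:C)) = JC J F.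
Hypothesis cinj : forall (f1 f2 : M -> C), smooth setT f1 -> smooth setT f2 ->
  (forall phi, test_function setT phi -> cintegral mu (f1 * phi) = cintegral mu (f2 * phi)) -> f1 = f2.
Implicit Types (Y Z : operator M) (F G : X -> C).

Let rp : 0 < r := lt_trans r00 r0r.
Local Notation fh := (fh J cn).
Local Notation lcc := (lc c q r0 r r2).
Local Notation lcf := (lcf c q r0 r r2 J cn).
Let up F : tst q r0 F -> tst q r F. Proof. exact: tst_mono (ltW r0r). Qed.
Let tl Y j : complex_vector_field Y -> tst q r (lcc Y j).
Proof. exact: (tstl Ac r00 r0r rr2 ball_img). Qed.
Let bir y : `|y - q| <= r -> chart_img c y.
Proof. by move=> h; apply: ball_img; exact: le_trans h (ltW rr2). Qed.

(** Multiplying by the inverse density [ir] turns integration against [mu] into the functional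
    [J]. *)
Definition Psi F : M -> C := pull c (fun y => F y * (ir y)%:C).

(* The formal transpose of [Y] with respect to Lebesgue measure. *)
Definition vT Y F : X -> C := fun y => - \sum_j cpartial j (fun y => lcc Y j y * F y) y.

Lemma tst_vT Y F q' s : complex_vector_field Y -> 0 < s -> tst q' s F -> tst q' s (vT Y F).
Proof.
move=> hY s0 hF; apply: tstN; apply: tst_sum => // j; apply: tst_partial => //.
exact: tstMl hF (tst_csm (tl j hY)).
Qed.

Lemma conj_vT Y F q' s : complex_vector_field Y -> 0 < s -> tst q' s F ->
  (fun y => conjc (vT (field_conj Y) F y)) = vT Y (fun y => conjc (F y)).
Proof.
move=> hY s0 hF; apply/funext => y; rewrite /vT rmorphN rmorph_sum; congr (- _).
apply: eq_bigr => j _; have tj := tl j (cvf_conj hY).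
rewrite -[LHS]/(conjc (cpartial j (fun y0 => lcc (field_conj Y) j y0 * F y0) y)).
rewrite -(@cpartialC _ _ setT) //; last first.
  by apply: csmM; [exact: openT | exact: tst_csm tj | exact: tst_csm hF].
congr (cpartial j _ y); apply/funext => z; rewrite conjcM (lc_conj _ _ _ _ _ _ hY).
by rewrite conjcK.
Qed.

Lemma f_vT Y F : complex_vector_field Y -> tst q r F ->
  fh (vT Y F) = fun k => - (vf (lcf Y) (fh F) k + dvf (lcf Y) (fh F) k).
Proof.
move=> hY hF; have tj j : tst q r (fun y => lcc Y j y * F y) by exact: tstMl hF (tst_csm (tl j hY)).
rewrite /vT (f_N hJ rp); last by apply: tst_sum => // j; exact: tst_partial.
rewrite (f_sum _ hJ rp); last by move=> j; exact: tst_partial.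
apply/funext => k; congr (- _); rewrite /vf /dvf -big_split; apply: eq_bigr => j _.
rewrite (f_Dk hJ j (tj j)) (f_conv hJ (tl j hY) hF).
have rl := f_rapid hJ (tl j hY); have rF := f_rapid hJ hF.
by rewrite (Dk_conv j rl (rapid_fin rF)).
Qed.

Lemma f_JC_sum (I : Type) (t : seq I) (F : I -> X -> C) : (forall i, tst q r (F i)) ->
  JC J (fun y => \sum_(i <- t) F i y) = \sum_(i <- t) JC J (F i).
Proof.
move=> hF; elim: t => [|i t IH].
  rewrite big_nil -[RHS](mul0r (JC J (fun=> 0))) -(f_JCZ hJ 0 (tst0 q rp)).
  by congr JC; apply/funext => y; rewrite big_nil mul0r.
rewrite big_cons -IH -(f_JCD hJ (hF i)); last exact: tst_sum.
by congr JC; apply/funext => y; rewrite big_cons.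
Qed.

Lemma tst_at (f : M -> C) F : smooth setT f -> tst q r F -> tst q r (fun y => F y * f (chart_inv c y)).
Proof. by move=> sf hF; exact: (tst_push Ac bir openT sf (fun _ _ => I) hF). Qed.

(** The two integrands differ by a divergence, which [J] annihilates. The function [f] is cut off
    first, which changes nothing where [F] lives. *)
Lemma JC_transpose Y (f : M -> C) F : complex_vector_field Y -> smooth setT f -> tst q r0 F ->
  JC J (fun y => F y * Y f (chart_inv c y)) = JC J (fun y => vT Y F y * f (chart_inv c y)).
Proof.
move=> hY sf hF; pose h := local_scale c q r0 r f.
have th : tst q r h by exact: (tst_local_scale Ac r00 r0r rr2 ball_img sf).
have hE y : `|y - q| < r0 -> h y = f (chart_inv c y).
  by move=> hy; rewrite /h /local_scale cut1 ?(ltW hy) // mul1r.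
pose W j : X -> C := fun y => lcc Y j y * F y.
have tW j : tst q r (W j) by exact: tstMl (up hF) (tst_csm (tl j hY)).
have tvF := tst_vT hY rp (up hF); have tvF0 := tst_vT hY r00 hF.
have -> : (fun y => F y * Y f (chart_inv c y)) = fun y => vT Y F y * f (chart_inv c y) +
    \sum_j cpartial j (fun y => W j y * h y) y.
  apply/funext => y; have [hy|hy] := ltP `|y - q| r0; last first.
    rewrite (tst_supp hF hy) (tst_supp tvF0 hy) !mul0r add0r big1 // => j _.
    have t0 : tst q r0 (fun y => W j y * h y).
      apply: (tstM _ (tst_csm th)); exact: tstMl hF (tst_csm (tl j hY)).
    exact: tst_supp (tst_partial r00 j t0) hy.
  rewrite (vf_local_form Ac r00 r0r rr2 ball_img hY sf (lt_trans hy r0r)) -(hE y hy) /vT.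
  rewrite mulNr mulr_suml -sumrN -big_split mulr_sumr /=; apply: eq_bigr => j _.
  rewrite (@cpartialM _ _ setT _ _ j y I (tst_csm (tW j)) (tst_csm th)) addrA addNr add0r.
  rewrite (cpartial_ext j (@open_in _ _ q r0) hy hE) /W /lc cut1 ?(ltW hy) //.
  by ring.
have tP j : tst q r (fun y => W j y * h y) by exact: tstM (tW j) (tst_csm th).
rewrite (f_JCD hJ (tst_at sf tvF)); last by apply: tst_sum => // j; exact: tst_partial.
rewrite f_JC_sum; last by move=> j; exact: tst_partial.
by rewrite [X in _ + X]big1 ?addr0 // => j _; exact: (f_JC_partial hJ j (tP j)).
Qed.

Lemma cintegral_Psi (f : M -> C) F : cintegral mu (f * Psi F) = JC J (fun y => F y * f (chart_inv c y)).
Proof.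
rewrite mulrC /Psi -(pull_push Ac) -cint_pull; congr cintegral; congr pull.
by apply/funext => y; ring.
Qed.

Variables (n : nat) (L : 'I_n -> operator M) (X0 Z : operator M) (a : M -> C).
Hypothesis hL : forall j, complex_vector_field (L j).
Hypothesis hX0 : complex_vector_field X0.
Hypothesis hZ : complex_vector_field Z.
Hypothesis sa : smooth setT a.

(** The operator of the theorem, with [Y0] replaced by a field plus its conjugate so that both can
    be transposed separately. *)
Definition hormander : operator M := fun f => a * f + X0 f + (0 +i* 1)%C *: (Z + field_conj Z) f
  + \sum_(j < n) field_conj (L j) (L j f).

Local Notation al := (local_scale c q r0 r a).

Definition hormanderT F : X -> C := fun y => al y * F y + vT X0 F y +
  (0 +i* 1)%C * (vT Z F y + vT (field_conj Z) F y) +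
  \sum_(j < n) vT (L j) (vT (field_conj (L j)) F) y.

Let hZ' := cvf_conj hZ.
Let hL' j := cvf_conj (hL j).

Let tal : tst q r al. Proof. exact: (tst_local_scale Ac r00 r0r rr2 ball_img sa). Qed.

Lemma tst_hormanderT F q' s : 0 < s -> tst q' s F -> tst q' s (hormanderT F).
Proof.
move=> s0 hF; apply: tstD; last first.
  by apply: tst_sum => // j; apply: tst_vT => //; exact: tst_vT.
apply: tstD; last by apply: tstZ; apply: tstD; apply: tst_vT.
by apply: tstD; [exact: tstMl hF (tst_csm tal) | exact: tst_vT].
Qed.

(** [transpose] is a choice, so uniqueness is needed too: two candidates have the same integrals
    against all test functions, and [cinj] makes them equal. *)
Lemma hormander_transpose F : tst q r0 F -> transpose mu hormander (Psi F) = Psi (hormanderT F).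
Proof.
move=> hF.
have hT : is_transpose mu hormander (Psi F) (Psi (hormanderT F)).
  split.
    apply: (pull_test (r := r) Ac bir) => //.
    by apply: tstM tir; exact: tst_hormanderT (up hF).
  move=> f sf; rewrite !cintegral_Psi.
  pose at_ (G : X -> C) (f : M -> C) : X -> C := fun y => G y * f (chart_inv c y).
  have ta G k : tst q r G -> smooth setT k -> tst q r (at_ G k) by move=> tG sk; exact: tst_at.
  have hFr := up hF; have tv Y G : complex_vector_field Y -> tst q r G -> tst q r (vT Y G).
    by move=> hY; exact: tst_vT.
  have tv0 Y G : complex_vector_field Y -> tst q r0 G -> tst q r0 (vT Y G).
    by move=> hY; exact: tst_vT.
  have sv Y : complex_vector_field Y -> smooth setT (Y f) by move=> hY; exact: vf_smooth.
  have saf : smooth setT (a * f) by exact: msmoothM openT sa sf.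
  have -> : (fun y => F y * hormander f (chart_inv c y)) = fun y => at_ F (a * f) y + at_ F (X0 f) y +
      (0 +i* 1)%C * (at_ F (Z f) y + at_ F (field_conj Z f) y) +
      \sum_(j < n) at_ F (field_conj (L j) (L j f)) y.
    apply/funext => y; rewrite /at_ /hormander.
    have addf (f1 f2 : M -> C) x : (f1 + f2) x = f1 x + f2 x by [].
    have -> : (\sum_(j < n) field_conj (L j) (L j f)) = fun x => \sum_(j < n) field_conj (L j) (L j f) x.
      by apply/funext => x; rewrite fct_sumE.
    have scf k (f1 : M -> C) x : (k *: f1) x = k * f1 x by [].
    have addo (Y1 Y2 : operator M) : (Y1 + Y2) f = Y1 f + Y2 f by [].
    rewrite !addf scf addo addf.
    by rewrite -mulr_sumr; ring.
  have -> : (fun y => hormanderT F y * f (chart_inv c y)) = fun y => at_ (fun y => al y * F y) f y +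
      at_ (vT X0 F) f y + (0 +i* 1)%C * (at_ (vT Z F) f y + at_ (vT (field_conj Z) F) f y) +
      \sum_(j < n) at_ (vT (L j) (vT (field_conj (L j)) F)) f y.
    by apply/funext => y; rewrite /at_ /hormanderT -mulr_suml; ring.
  have tL j : tst q r (at_ F (field_conj (L j) (L j f))).
    by apply: (ta _ _ hFr); apply: (vf_smooth (hL' j)); exact: sv.
  have tL2 j : tst q r (at_ (vT (L j) (vT (field_conj (L j)) F)) f).
    exact: (ta _ _ (tv _ _ (hL j) (tv _ _ (hL' j) hFr)) sf).
  have taF : tst q r (fun y => al y * F y) by exact: tstMl hFr (tst_csm tal).
  have t1 := ta _ _ hFr saf; have t2 := ta _ _ hFr (sv _ hX0).
  have t3 := ta _ _ hFr (sv _ hZ); have t4 := ta _ _ hFr (sv _ hZ').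
  have s1 := ta _ _ taF sf; have s2 := ta _ _ (tv _ _ hX0 hFr) sf.
  have s3 := ta _ _ (tv _ _ hZ hFr) sf; have s4 := ta _ _ (tv _ _ hZ' hFr) sf.
  rewrite (f_JCD hJ (tstD (tstD t1 t2) (tstZ _ (tstD t3 t4))) (tst_sum rp _ tL)).
  rewrite (f_JCD hJ (tstD t1 t2) (tstZ _ (tstD t3 t4))) (f_JCD hJ t1 t2).
  rewrite (f_JCZ hJ _ (tstD t3 t4)) (f_JCD hJ t3 t4) (f_JC_sum _ tL).
  rewrite (f_JCD hJ (tstD (tstD s1 s2) (tstZ _ (tstD s3 s4))) (tst_sum rp _ tL2)).
  rewrite (f_JCD hJ (tstD s1 s2) (tstZ _ (tstD s3 s4))) (f_JCD hJ s1 s2).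
  rewrite (f_JCZ hJ _ (tstD s3 s4)) (f_JCD hJ s3 s4) (f_JC_sum _ tL2).
  rewrite /at_ (JC_transpose hX0 sf hF) (JC_transpose hZ sf hF) (JC_transpose hZ' sf hF).
  congr (_ + _ + _ + _).
    congr JC; apply/funext => y; have [hy|hy] := ltP `|y - q| r0; last first.
      by rewrite (tst_supp hF hy) mulr0 !mul0r.
    rewrite /local_scale cut1 ?(ltW hy) // mul1r.
    have mulf (f1 f2 : M -> C) x : (f1 * f2) x = f1 x * f2 x by [].
    by rewrite mulf mulrA [F y * _]mulrC.
  apply: eq_bigr => j _; rewrite (JC_transpose (hL' j) (sv _ (hL j)) hF).
  exact: (JC_transpose (hL j) sf (tv0 _ _ (hL' j) hF)).
apply: xget_unique; first exact: hT.
move=> psi [[sp cp _] hpsi]; apply: cinj; [exact: sp | by have [[]] := hT | ].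
move=> phi [sphi _ _]; rewrite ![_ * phi]mulrC -hpsi //.
by have [_ ->] := hT.
Qed.

End Transpose.

Section Representation.
Context {R : realType} {m : nat} {M : smooth_manifold R m}.
Local Notation X := ('rV[R]_m).
Local Notation K := ('rV[int]_m).
Local Notation C := R[i].

Lemma tst_shift (q q' : X) (s r : R) (F : X -> C) : 0 < s -> `|q' - q| + s <= r -> tst q' s F -> tst q r F.
Proof.
move=> s0 h [cF [s' /andP[s'0 s's] e]]; split=> //; exists (`|q' - q| + s').
  rewrite ltr_wpDl //=; apply: lt_le_trans h; by rewrite ltrD2l.
move=> y hy; apply: e; rewrite -(lerD2l `|q' - q|); apply: le_trans hy _.
by rewrite [leRHS]addrC; have := ler_normD (y - q') (q' - q); rewrite addrA subrK.
Qed.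

Variable c : chart R m M.
Hypothesis Ac : atlas c.
Variables (q : X) (r0 r r2 : R).
Hypothesis r00 : 0 < r0.
Hypothesis r0r : r0 < r.
Hypothesis rr2 : r < r2.
Hypothesis ball_img : forall y, `|y - q| <= r2 -> chart_img c y.
Variables (J : (X -> R) -> R) (cn : R).
Hypothesis hJ : fourier q r J cn.
Variable ir : X -> R.
Hypothesis tir : csm setT (fun y => (ir y)%:C).
Implicit Types (Y Z : operator M) (F G : X -> C).

Let rp : 0 < r := lt_trans r00 r0r.
Local Notation fh := (fh J cn).
Local Notation lcc := (lc c q r0 r r2).
Local Notation lcf := (lcf c q r0 r r2 J cn).
Local Notation vT := (vT c q r0 r r2).

(** [om] acts on functions supported in radius [s] around [q'], inside the ball of radius [r0]
    around [q]. The cutoff in [dist_seq] is 1 up to [s1] and 0 beyond [s2], so identities are tested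
    on functions supported in radius [s1]. *)
Variables (q' : X) (s1 s2 s : R) (om : (X -> C) -> C).
Hypothesis s10 : 0 < s1.
Hypothesis s12 : s1 < s2.
Hypothesis s2s : s2 < s.
Hypothesis incl : `|q' - q| + s <= r0.
Hypothesis om_lin : forall k F G, tst q' s F -> tst q' s G -> om (fun y => k * F y + G y) = k * om F + om G.
Hypothesis om_bound : forall s', 0 < s' < s -> exists (N : nat) A, forall F B, tst q' s' F -> 0 <= B ->
  (forall l y, (size l <= N)%N -> nrm (citer l F y) <= B) -> nrm (om F) <= A * B.

Let s20 : 0 < s2 := lt_trans s10 s12.
Let sp : 0 < s := lt_trans s20 s2s.
Let up0 F : tst q' s F -> tst q r0 F. Proof. exact: tst_shift. Qed.
Let up F : tst q' s F -> tst q r F. Proof. by move/up0; exact: tst_mono (ltW r0r). Qed.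
Let up1 F : tst q' s1 F -> tst q' s F. Proof. by apply: tst_mono; exact: ltW (lt_trans s12 s2s). Qed.
Let ball1 y : `|y - q'| < s -> `|y - q| < r.
Proof.
move=> h; apply: le_lt_trans r0r; apply: le_trans incl.
have := ler_normD (y - q') (q' - q); rewrite addrA subrK => /le_trans; apply.
by rewrite addrC lerD2l ltW.
Qed.

(** The factor [ir] is there because distributions extend integration against [mu], whereas the
    coefficients refer to [J]. *)
Definition chi1 : X -> C := fun y => cut q' s1 s2 y * (ir y)%:C.
(* The Fourier coefficients of the distribution, localized by a cutoff. *)
Definition dist_seq : K -> C := fun k => om (fun y => chi1 y * ek (- k) y).
Definition twisted F : C := om (fun y => F y * (ir y)%:C).

Let tchi1 : tst q' s2 chi1. Proof. exact: tstM (tst_cut q' s10 s12) tir. Qed.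

Lemma dist_seq_fin : fin dist_seq.
Proof.
have s2s' : 0 < s2 < s by rewrite s20.
exact: (om_fin om_bound s2s' tchi1). Qed.

(** The conjugate compensates the conjugate linearity of [ip] in its second argument. *)
Definition represents (W : K -> C) (w : (X -> C) -> C) := fin W /\
  forall F, tst q' s1 F -> ip W (fh F) = w (fun y => conjc (F y)).

(** The conjugate of [F] is replaced by its Fourier series and [om] acts termwise; the cutoff makes
    this legitimate and is invisible on the support of [F]. *)
Lemma represents_dist_seq : represents dist_seq twisted.
Proof.
split; first exact: dist_seq_fin.
move=> F hF; have hFr := up (up1 hF); have hFC := tstC hF; have hFCr := up (up1 hFC).
have s2s' : 0 < s2 < s by rewrite s20.
have := om_has_sum sp om_lin om_bound s2s' tchi1 (f_rapid hJ hFCr).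
have -> : (fun y => chi1 y * trig (fh (fun y => conjc (F y))) y) = fun y => conjc (F y) * (ir y)%:C.
  apply/funext => y; rewrite /chi1; have [h|h] := ltP `|y - q'| s1; last first.
    rewrite (tst_supp hFC h) mul0r; have [h'|h'] := ltP `|y - q'| s2.
      rewrite (f_inv hJ hFCr) ?(tst_supp hFC h) ?mulr0 //; apply: ball1; exact: lt_trans s2s.
    by rewrite (tst_supp (tst_cut q' s10 s12) h') !mul0r.
  rewrite cut1 ?(ltW h) // mul1r (f_inv hJ hFCr) ?[_ * conjc _]mulrC //.
  by apply: ball1; exact: lt_trans h (lt_trans s12 s2s).
rewrite -/(twisted (fun y => conjc (F y))) => hs.
have := has_sum_map (h := -%R) (h' := -%R) (@opprK _) (@opprK _) hs.
move=> /has_sum_csum <-; rewrite /ip; congr csum; apply/funext => k.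
by rewrite /= (f_star hJ hFr) /star opprK /dist_seq mulrC.
Qed.

Lemma represents_ext W w w' : (forall F, tst q' s1 F -> w F = w' F) -> represents W w -> represents W w'.
Proof. by move=> e [fW h]; split=> // F hF; rewrite h // e //; exact: tstC. Qed.

Lemma represents_vf Y W w : complex_vector_field Y -> represents W w ->
  represents (vf (lcf Y) W) (w \o vT Y).
Proof.
move=> hY [fW h]; have rY := rapid_lcf Ac r00 r0r rr2 ball_img hJ hY.
split; first exact: fin_vf.
move=> F hF; have hFr := up (up1 hF); have rF := f_rapid hJ hFr.
have hY' := cvf_conj hY.
have tvF := tst_vT Ac r00 r0r rr2 ball_img hY' s10 hF.
have rvF := f_rapid hJ (up (up1 tvF)).
rewrite (ip_vf rY (or_introl (conj fW rF))) /=.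
rewrite -(conj_vT Ac r00 r0r rr2 ball_img hY s10 hF) -h //.
have e := f_vT Ac r00 r0r rr2 ball_img hJ hY' hFr; rewrite e in rvF.
rewrite e (lcf_conj Ac r00 r0r rr2 ball_img hJ hY) in rvF *.
rewrite -ipNr //; last by apply: dual_fr fW _; have := rapidN rvF; congr rapid; apply/funext => k; rewrite opprK.
Qed.

Lemma represents_conv A W w : tst q r A -> represents W w ->
  represents (conv (fh A) W) (fun F => w (fun y => A y * F y)).
Proof.
move=> hA [fW h]; have rA := f_rapid hJ hA; split; first exact: fin_conv.
move=> F hF; have hFr := up (up1 hF); have rF := f_rapid hJ hFr.
rewrite ip_conv //; last exact: dual_fr.
rewrite -(f_star hJ hA) -(f_conv hJ (tstC hA) hFr) h; last exact: tstMl hF (tst_csm (tstC hA)).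
by congr w; apply/funext => y; rewrite conjcM conjcK.
Qed.

Lemma representsD W1 w1 W2 w2 : represents W1 w1 -> represents W2 w2 ->
  represents (fun k => W1 k + W2 k) (fun F => w1 F + w2 F).
Proof.
move=> [f1 h1] [f2 h2]; split; first exact: finD.
move=> F hF; have rF := f_rapid hJ (up (up1 hF)).
by rewrite ipDl ?h1 ?h2 //; exact: dual_fr.
Qed.

Lemma representsZ z W w : represents W w -> represents (fun k => z * W k) (fun F => z * w F).
Proof.
move=> [f1 h1]; split; first exact: finZ.
move=> F hF; have rF := f_rapid hJ (up (up1 hF)).
by rewrite ipZl ?h1 //; exact: dual_fr.
Qed.

Lemma represents_sum (I : Type) (t : seq I) (W : I -> K -> C) (w : I -> (X -> C) -> C) :
  (forall i, represents (W i) (w i)) ->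
  represents (fun k => \sum_(i <- t) W i k) (fun F => \sum_(i <- t) w i F).
Proof.
move=> h; split; first by apply: fin_sum => i; exact: (h i).1.
move=> F hF; have rF := f_rapid hJ (up (up1 hF)).
rewrite ip_sum //; last by move=> i; exact: (h i).1.
by apply: eq_bigr => i _; exact: (h i).2.
Qed.

Variables (n : nat) (L : 'I_n -> operator M) (X0 Z : operator M) (a : M -> C).
Hypothesis hL : forall j, complex_vector_field (L j).
Hypothesis hX0 : complex_vector_field X0.
Hypothesis hZ : complex_vector_field Z.
Hypothesis sa : smooth setT a.
Local Notation Popf := (Pop (fun j => lcf (L j)) (lcf X0) (lcf Z) (fh (local_scale c q r0 r a))).

(** Each operation on sequences corresponds to transposition on functionals, so [Popf] applied to
    the coefficients represents the distribution evaluated on the transposed operator. *)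
Lemma represents_Pop : represents (Popf dist_seq)
  (fun F => twisted (hormanderT c q r0 r r2 L X0 Z a F)).
Proof.
have rU := represents_dist_seq; have hZ' := cvf_conj hZ.
have hL' j := cvf_conj (hL j).
have tal := tst_local_scale Ac r00 r0r rr2 ball_img sa.
have lc' Y : complex_vector_field Y -> starf (lcf Y) = lcf (field_conj Y).
  by move=> hY; rewrite (lcf_conj Ac r00 r0r rr2 ball_img hJ hY).
have rS : forall j, represents (vf (starf (lcf (L j))) (vf (lcf (L j)) dist_seq))
    ((twisted \o vT (L j)) \o vT (field_conj (L j))).
  by move=> j; rewrite lc' //; apply: represents_vf => //; exact: represents_vf.
have := representsD (representsD (representsD (represents_conv tal rU) (represents_vf hX0 rU))
  (representsZ 'i (representsD (represents_vf hZ rU) (represents_vf hZ' rU))))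
  (represents_sum (index_enum _) rS).
rewrite -lc' // => hr; apply: represents_ext hr => F hF; rewrite /=.
have tv Y G : complex_vector_field Y -> tst q' s1 G -> tst q' s1 (vT Y G).
  by move=> hY; exact: (tst_vT Ac r00 r0r rr2 ball_img hY s10).
have D G1 G2 : tst q' s1 G1 -> tst q' s1 G2 -> twisted (fun y => G1 y + G2 y) = twisted G1 + twisted G2.
  move=> h1 h2; rewrite /twisted -(omD om_lin); [|exact: up1 (tstM h1 tir)|exact: up1 (tstM h2 tir)].
  by congr om; apply/funext => y; rewrite mulrDl.
have Zt z G : tst q' s1 G -> twisted (fun y => z * G y) = z * twisted G.
  move=> h1; rewrite /twisted -(omZ sp om_lin); last exact: up1 (tstM h1 tir).
  by congr om; apply/funext => y; rewrite mulrA.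
have S (G : 'I_n -> X -> C) : (forall j, tst q' s1 (G j)) ->
    twisted (fun y => \sum_j G j y) = \sum_j twisted (G j).
  move=> h1; rewrite /twisted -(om_sum sp om_lin); last by move=> j; exact: up1 (tstM (h1 j) tir).
  by congr om; apply/funext => y; rewrite mulr_suml.
have t1 : tst q' s1 (fun y => local_scale c q r0 r a y * F y) by exact: tstMl hF (tst_csm tal).
have t2 := tv _ _ hX0 hF; have t3 := tv _ _ hZ hF; have t4 := tv _ _ hZ' hF.
have t5 j : tst q' s1 (vT (L j) (vT (field_conj (L j)) F)) by exact: (tv _ _ (hL j) (tv _ _ (hL' j) hF)).
rewrite /hormanderT (D _ _ (tstD (tstD t1 t2) (tstZ _ (tstD t3 t4))) (tst_sum s10 _ t5)).
by rewrite (D _ _ (tstD t1 t2) (tstZ _ (tstD t3 t4))) (D _ _ t1 t2) (Zt _ _ (tstD t3 t4)) (D _ _ t3 t4) (S _ t5).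
Qed.

(** The factor [cn] undoes the normalization of [fh]: this is how a function, seen as a
    distribution, is represented by coefficients. *)
Lemma f_pairing A F : tst q r A -> tst q r F ->
  ip (fun k => cn%:C * fh A k) (fh F) = JC J (fun y => conjc (F y) * A y).
Proof.
move=> hA hF; have rA := f_rapid hJ hA; have hFC := tstC hF.
have := f_JC_trig hJ hFC rA.
have -> : (fun y => conjc (F y) * trig (fh A) y) = fun y => conjc (F y) * A y.
  apply/funext => y; have [h|h] := ltP `|y - q| r; first by rewrite (f_inv hJ hA h).
  by rewrite (tst_supp hFC h) !mul0r.
move=> /has_sum_csum <-; rewrite /ip; congr csum; apply/funext => k.
have c0 : cn%:C != 0 :> C by rewrite fmorph_eq0 gt_eqF // (f_pos hJ).
rewrite -mulrA mulrCA; congr (_ * _); rewrite /fh conjcM conjcV conjcR mulVKf //.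
have tF : tst q r (fun y => F y * ek (- k) y) by apply: tstM => //; apply: csm_ek; exact: openT.
rewrite /jh -(f_JCC hJ tF).
by congr JC; apply/funext => y; rewrite conjcM -ekN opprK.
Qed.

End Representation.

Section Regularity.
Context {R : realType} {m : nat} {M : smooth_manifold R m}.
Local Notation X := ('rV[R]_m).
Local Notation K := ('rV[int]_m).
Local Notation C := R[i].
Variable c : chart R m M.
Hypothesis Ac : atlas c.
Variables (q : X) (r1 r0 r r2 : R).
Hypothesis r1r0 : r1 < r0.
Hypothesis r00 : 0 < r0.
Hypothesis r0r : r0 < r.
Hypothesis rr2 : r < r2.
Hypothesis ball_img : forall y, `|y - q| <= r2 -> chart_img c y.
Variables (J : (X -> R) -> R) (cn : R).
Hypothesis hJ : fourier q r J cn.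
Implicit Types (Y : operator M) (F : X -> C).

Let rp : 0 < r := lt_trans r00 r0r.
Local Notation fh := (fh J cn).
Local Notation lcf := (lcf c q r0 r r2 J cn).

Variables (n : nat) (L : 'I_n -> operator M) (X0 Z : operator M) (a : M -> C) (d : R).
Hypothesis hL : forall j, complex_vector_field (L j).
Hypothesis hX0 : real_vector_field X0.
Hypothesis hZ : dominated c q r0 r r2 J cn L Z.
Hypothesis sa : smooth setT a.
Hypothesis d01 : 0 < d <= 1.
Hypothesis est : exists2 A, 0 <= A & forall F B, tst q r1 F ->
  energy c q r0 r r2 J cn L X0 F B -> bd d (fh F) (A * B).
Local Notation Popf := (Pop (fun j => lcf (L j)) (lcf X0) (lcf Z) (fh (local_scale c q r0 r a))).

Variables (q' : X) (s : R) (U G : K -> C).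
Hypothesis s0 : 0 < s.
Hypothesis incl : `|q' - q| + s <= r1.
Hypothesis hU : fin U.
Hypothesis hG : rapid G.
Hypothesis weak : forall F, tst q' s F -> ip (Popf U) (fh F) = ip G (fh F).

Let up1 F : tst q' s F -> tst q r1 F. Proof. exact: tst_shift. Qed.
Let up F : tst q' s F -> tst q r F.
Proof. by move/up1; apply: tst_mono; exact: ltW (lt_trans r1r0 r0r). Qed.
Let rl Y : complex_vector_field Y -> rapidf (lcf Y).
Proof. exact: (rapid_lcf Ac r00 r0r rr2 ball_img hJ). Qed.
Let vxE Y F : complex_vector_field Y -> tst q' s F -> vf (lcf Y) (fh F) = fh (vx (lc c q r0 r r2 Y) F).
Proof. by move=> hY hF; rewrite (f_vx_lc Ac r00 r0r rr2 ball_img hJ hY (up hF)). Qed.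
Let tv Y F : complex_vector_field Y -> tst q' s F -> tst q' s (vx (lc c q r0 r r2 Y) F).
Proof. by move=> hY hF; exact: (tst_vx Ac r00 r0r rr2 ball_img hY hF s0). Qed.

(** Quantifying over all cutoffs lets one cutoff be replaced by its derivatives or by a larger one;
    the loss [sg] measures how much less is known of the [L j] than of [U]. *)
Definition regular t sg := forall chi, tst q' s chi -> (exists B, bd t (conv (fh chi) U) B) /\
  forall j, exists B, bd (t - sg) (conv (fh chi) (vf (lcf (L j)) U)) B.

Let bdmono p t (v : K -> C) : p <= t -> (exists B, bd t v B) -> exists B, bd p v B.
Proof. by move=> h [B hB]; exists B; exact: bd_mono hB. Qed.

Let bdconv t (b v : K -> C) : rapid b -> (exists B, bd t v B) -> exists B, bd t (conv b v) B.
Proof.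
move=> hb [B hB]; have [k k0 h] := op1_bd t (op_conv hb).
by exists (k * B); apply: (h _ _ t) => //; rewrite addr0.
Qed.

Lemma regular_mono t sg sg' : sg <= sg' -> regular t sg -> regular t sg'.
Proof.
move=> h H chi hchi; have [h1 h2] := H chi hchi; split=> // j.
by apply: bdmono (h2 j); rewrite lerD2l lerN2.
Qed.

(** [chi L_j U] is [L_j (chi U)] minus [(L_j chi) U], and a field loses one order. *)
Lemma regular_1 t : (forall chi, tst q' s chi -> exists B, bd t (conv (fh chi) U) B) -> regular t 1.
Proof.
move=> H chi hchi; split; first exact: H.
move=> j; have rc := f_rapid hJ (up hchi).
have e := vf_convE (rl (hL j)) rc hU.
have [B1 h1] := H _ hchi; have [B2 h2] := H _ (tv (hL j) hchi).
have [k k0 hk] := op1_bd (t - 1) (op_vf (rl (hL j))).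
have := hk _ _ t (esym (subrK 1 t)) h1; rewrite e (vxE (hL j) hchi) => h3.
have t1 : t - 1 <= t by rewrite gerDl oppr_le0.
exists (k * B1 + B2); have := bdB h3 (bd_mono t1 h2); congr bd.
by apply/funext => i; rewrite addrK.
Qed.

(** The bootstrap is run with a real cutoff [th] equal to 1 on the support of [chi]. Multiplying its
    result for [th^2 U] by [chi] gives back [chi U]; for [L_j U] the term in which the field falls
    on [th^2] is already controlled at order [t]. *)
Lemma regular_step t sg : 0 <= sg <= 1 -> regular t sg -> forall chi, tst q' s chi ->
  (exists B, bd (t - sg / 2 + d) (conv (fh chi) U) B) /\
  forall j, exists B, bd (t - sg / 2) (conv (fh chi) (vf (lcf (L j)) U)) B.
Proof.
move=> sg01 H chi hchi; have [th [tth ech cth]] := tst_unit s0 hchi.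
have cX0 := hX0.1; have cZ := hZ.1; have cZ' := cvf_conj cZ.
have cL' j := cvf_conj (hL j).
have sl Y : complex_vector_field Y -> starf (lcf Y) = lcf (field_conj Y).
  by move=> hY; rewrite (lcf_conj Ac r00 r0r rr2 ball_img hJ hY).
pose DV : set (K -> C) := [set v | exists2 F, tst q r1 F & v = fh F].
have mono0 F : tst q r1 F -> tst q r0 F by apply: tst_mono; exact: ltW.
have zdom : exists2 k, 0 <= k & forall v B, DV v -> bd 0 v B ->
    (forall j, bd 0 (vf (lcf (L j)) v) B) -> bd 0 (vf (lcf Z) v) (k * B).
  have [k k0 hk] := hZ.2; exists k => // _ B [F hF ->] h1 h2; apply: (hk _ _ (mono0 _ hF)).
  by split.
have sube : exists2 k, 0 <= k & forall v B, DV v -> bd 0 v B ->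
    (forall j, bd 0 (vf (lcf (L j)) v) B) -> bd (- (1 / 2)) (vf (lcf X0) v) B -> bd d v (k * B).
  have [k k0 hk] := est; exists k => // _ B [F hF ->] h1 h2 h3; apply: (hk _ _ hF).
  by split.
have fin_test (v : K -> C) (l : seq K) : uniq l -> (forall k, k \notin l -> v k = 0) ->
    exists2 F, tst q' s F & conv (fh th) v = fh F.
  move=> ul hl; exists (fun x => th x * \sum_(k <- l) v k * ek k x); last exact: (f_finite hJ (up tth) ul hl).
  apply: tstM => //; apply: csm_sum => [|k]; first exact: openT.
  by apply: csmZ; [exact: openT | apply: csm_ek; exact: openT].
have hth := f_rapid hJ (up tth).
have sth : star (fh th) = fh th.
  by rewrite -(f_star hJ (up tth)); congr fh; apply/funext => y; exact: cth.
have d01' : 0 <= d <= 1 by case/andP: d01 => /ltW -> ->.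
have HU F : tst q' s F -> exists B, bd t (conv (fh F) U) B by move=> /H[].
have HL F j : tst q' s F -> exists B, bd (t - sg) (conv (fh F) (vf (lcf (L j)) U)) B by move=> /H[].
have [h1 h2] : (exists B, bd (t - sg / 2 + d) (conv (fh th) (conv (fh th) U)) B) /\
    forall j, exists B, bd (t - sg / 2) (vf (lcf (L j)) (conv (fh th) (conv (fh th) U))) B.
  apply: (@bootstrap_step R m n (fun j => lcf (L j)) (lcf X0) (lcf Z) (fh (local_scale c q r0 r a))
    DV d (fun j => rl (hL j)) (rl cX0) (lcf_real Ac r00 r0r rr2 ball_img hJ hX0) (rl cZ)
    (f_rapid hJ (tst_local_scale Ac r00 r0r rr2 ball_img sa)) d01' zdom sube (fh th) U G t sg hth sth) => //.
  - move=> v l ul hl; have [F hF ->] := fin_test v l ul hl; exists F => //; exact: up1.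
  - by move=> v l ul hl; have [F hF ->] := fin_test v l ul hl; exact: weak.
  - exact: HU.
  - by rewrite (vxE cX0 tth); apply: HU; exact: tv.
  - by rewrite (vxE cZ tth); apply: HU; exact: tv.
  - by rewrite sl // (vxE cZ' tth); apply: HU; exact: tv.
  - by move=> j; rewrite (vxE (hL j) tth); apply: HU; exact: tv.
  - by move=> j; exact: HL.
  - by move=> j; rewrite sl // (vxE (cL' j) tth); apply: HL; exact: tv.
have tt2 : tst q' s (fun y => th y * th y) by exact: tstM tth (tst_csm tth).
have hc := f_rapid hJ (up hchi); have hc2 := f_rapid hJ (up tt2).
have e2 : conv (fh th) (conv (fh th) U) = conv (fh (fun y => th y * th y)) U.
  by rewrite (conv_convA hth hth hU) (f_conv hJ (up tth) (up tth)).
rewrite e2 in h1 h2.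
have e3 v : fin v -> conv (fh chi) (conv (fh (fun y => th y * th y)) v) = conv (fh chi) v.
  move=> fv; rewrite (conv_convA hc hc2 fv) -(f_conv hJ (up hchi) (up tt2)).
  by congr (conv (fh _) v); apply/funext => y; rewrite mulrC -!mulrA !ech.
split; first by rewrite -(e3 U hU); exact: bdconv.
move=> j; have fvU : fin (vf (lcf (L j)) U) by apply: fin_vf hU; exact: rl.
have := h2 j; rewrite (vf_convE (rl (hL j)) hc2 hU) (vxE (hL j) tt2) => h3.
have tvx := tv (hL j) tt2; have rvx := f_rapid hJ (up tvx).
have [B1] := bdconv hc h3; rewrite (convDr hc (fin_conv hc2 fvU) (fin_conv rvx hU)) (e3 _ fvU).
rewrite (conv_convA hc rvx hU) -(f_conv hJ (up hchi) (up tvx)) => h4.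
have [B2 h5] := HU _ (tstM hchi (tst_csm tvx)).
have ts : t - sg / 2 <= t by case/andP: sg01 => g0 _; rewrite gerDl oppr_le0 divr_ge0.
exists (B1 + B2); have := bdB h4 (bd_mono ts h5); congr bd.
by apply/funext => i; rewrite addrK.
Qed.

Lemma localized_rapid chi : tst q' s chi -> rapid (conv (fh chi) U).
Proof.
have [t0 [B0 hB0]] := hU.
have H0 : regular t0 1.
  apply: regular_1 => F hF; apply: bdconv; first exact: (f_rapid hJ (up hF)).
  by exists B0.
have half (k : nat) : regular t0 (2^-1 ^+ k).
  elim: k => [|k IH]; first by rewrite expr0.
  have p0 : 0 <= (2^-1 : R) ^+ k <= 1 by rewrite exprn_ge0 ?invr_ge0 //= exprn_ile1 ?invr_ge0 // invf_le1 // ler1n.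
  move=> F hF; have [_ h2] := regular_step p0 IH hF.
  split; first by have [] := IH F hF.
  by move=> j; have := h2 j; rewrite exprSr.
have Hd : regular t0 d.
  have [d0 d1] := andP d01.
  have [k hk] : exists k, (2^-1 : R) ^+ k <= d.
    exists (Num.truncn d^-1).+1.
    rewrite exprVn -[leRHS]invrK lef_pV2 ?posrE ?exprn_gt0 ?invr_gt0 //.
    apply: le_trans (ltW (truncnS_gt _)) _; rewrite -natrX ler_nat.
    by apply: ltnW; exact: ltn_expl.
  exact: regular_mono hk (half k).
have gain (k : nat) : regular (t0 + d / 2 * k%:R) d.
  elim: k => [|k IH]; first by rewrite mulr0 addr0.
  move=> F hF; have d01' : 0 <= d <= 1 by case/andP: d01 => /ltW -> ->.
  have [h1 h2] := regular_step d01' IH hF.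
  have e1 : t0 + d / 2 * k.+1%:R = t0 + d / 2 * k%:R - d / 2 + d by rewrite -natr1; field.
  have e2 : t0 + d / 2 * k.+1%:R - d = t0 + d / 2 * k%:R - d / 2 by rewrite -natr1; field.
  by split; [rewrite e1 | move=> j; rewrite e2].
move=> hchi p; have [d0 _] := andP d01.
have [k hk] : exists k : nat, p <= t0 + d / 2 * k%:R.
  have d2 : 0 < d / 2 by rewrite divr_gt0.
  exists (Num.truncn ((`|p - t0|) / (d / 2))).+1.
  rewrite -lerBlDl mulrC -ler_pdivrMr //; apply: le_trans (ltW (truncnS_gt _)).
  by rewrite ler_pM2r ?invr_gt0 // ler_norm.
by apply: bdmono hk _; have [] := gain k chi hchi.
Qed.

End Regularity.

(** * A smooth density near each point *)

Section LocalDensity.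
Context {R : realType} {m : nat} {M : smooth_manifold R m}.
Local Notation X := ('rV[R]_m).
Local Notation K := ('rV[int]_m).
Local Notation C := R[i].

Lemma iter_partial_ext (A : set X) (f h : X -> R) l x : open A -> A x -> (forall y, A y -> f y = h y) ->
  iter_partial l f x = iter_partial l h x.
Proof.
move=> oA Ax e; elim: l x Ax => [|j l IH] x Ax /=; first exact: e.
exact: (partial_ext j oA Ax IH).
Qed.

Variables (mu : {measure set (borel M) -> \bar R}).

Definition integrableC (f : M -> C) :=
  mu.-integrable setT (EFin \o (fun x => complex.Re (f x)) : borel M -> \bar R) /\
  mu.-integrable setT (EFin \o (fun x => complex.Im (f x)) : borel M -> \bar R).

(** Data for gluing: [h] represents [u] on [O], and [b] cuts test functions of [V] down to [O] while
    being 1 on the smaller [O']. Integrability is recorded because integrals will be added. *)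
Record local_density (V : set M) (u : (M -> C) -> C) (x : M) (O O' : set M) (h b : M -> C) : Prop :=
  LocalDensity {
  ld_open : open O;
  ld_open' : open O';
  ld_in : O' x;
  ld_sub' : O' `<=` O;
  ld_sub : O `<=` V;
  ld_smooth : smooth O h;
  ld_int : forall phi, test_function O phi -> u phi = cintegral mu (h * phi) /\ integrableC (h * phi);
  ld_cut : smooth setT b;
  ld_cut1 : forall z, O' z -> b z = 1;
  ld_test : forall phi, test_function V phi -> test_function O (b * phi) }.

Variable c : chart R m M.
Hypothesis Ac : atlas c.
Variables (q : X) (r1 r0 r r2 : R).
Hypothesis r1r0 : r1 < r0.
Hypothesis r00 : 0 < r0.
Hypothesis r0r : r0 < r.
Hypothesis rr2 : r < r2.
Hypothesis ball_img : forall y, `|y - q| <= r2 -> chart_img c y.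
Variables (J : (X -> R) -> R) (cn : R).
Hypothesis hJ : fourier q r J cn.
Variables (ir gr : X -> R).
Hypothesis tir : csm setT (fun y => (ir y)%:C).
Hypothesis tgr : csm setT (fun y => (gr y)%:C).
Hypothesis irgr : forall y, `|y - q| <= r -> gr y * ir y = 1.
Hypothesis cint_pull : forall F, cintegral mu (pull c (fun y => F y * (ir y)%:C)) = JC J F.
Hypothesis cinj : forall (f1 f2 : M -> C), smooth setT f1 -> smooth setT f2 ->
  (forall phi, test_function setT phi -> cintegral mu (f1 * phi) = cintegral mu (f2 * phi)) -> f1 = f2.
Hypothesis pint : forall F, tst q r F -> integrableC (pull c F).
Variables (n : nat) (L : 'I_n -> operator M) (X0 Z : operator M) (a : M -> C) (d : R).
Hypothesis hL : forall j, complex_vector_field (L j).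
Hypothesis hX0 : real_vector_field X0.
Hypothesis hZ : dominated c q r0 r r2 J cn L Z.
Hypothesis sa : smooth setT a.
Hypothesis d01 : 0 < d <= 1.
Hypothesis est : exists2 A, 0 <= A & forall F B, tst q r1 F ->
  energy c q r0 r r2 J cn L X0 F B -> bd d (fh J cn F) (A * B).
Variables (V : set M) (u : (M -> C) -> C) (f : M -> C).
Hypothesis oV : open V.
Hypothesis Vsub : forall x, V x -> chart_dom c x /\ `|chart_map c x - q| < r1.
Hypothesis hu : schwartz_distribution V u.
Hypothesis sf : smooth V f.
Hypothesis hf : forall phi, test_function V phi ->
  distribution_apply mu (hormander L X0 Z a) u phi = cintegral mu (f * phi).
Local Notation fh := (fh J cn).
Let rp : 0 < r := lt_trans r00 r0r.

Section Point.
Variable x : M.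
Hypothesis Vx : V x.
Local Notation q' := (chart_map c x).
Variable s : R.
Hypothesis s0 : 0 < s.
Hypothesis incl : `|q' - q| + s <= r1.
Hypothesis sV : forall y, `|y - q'| <= s -> chart_img c y /\ V (chart_inv c y).

Let dx : chart_dom c x. Proof. by have [] := Vsub Vx. Qed.
Let om F := u (pull c F).
(** Nested radii below [s] for the successive cutoffs. *)
Let rad (i : nat) : R := s * (i%:R / 8).
Let rad_lt i j : (i < j)%N -> rad i < rad j.
Proof. by move=> h; rewrite /rad ltr_pM2l // ltr_pM2r ?invr_gt0 // ltr_nat. Qed.
Let rad_s i : (i < 8)%N -> rad i < s.
Proof. by move=> h; rewrite /rad gtr_pMr // ltr_pdivrMr // mul1r ltr_nat. Qed.
Let rad0 i : (0 < i)%N -> 0 < rad i.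
Proof. by move=> h; rewrite /rad mulr_gt0 // divr_gt0 // ltr0n. Qed.

Let img_s y : `|y - q'| <= s -> chart_img c y. Proof. by move=> /sV[]. Qed.
Let up t F : t <= s -> tst q' t F -> tst q' s F. Proof. exact: tst_mono. Qed.
Let up0 F : tst q' s F -> tst q r0 F.
Proof. by apply: tst_shift => //; apply: le_trans incl _; exact: ltW. Qed.
Let upr F : tst q' s F -> tst q r F. Proof. by move/up0; apply: tst_mono; exact: ltW. Qed.

Let test_pull F : tst q' s F -> test_function V (pull c F).
Proof. by move=> hF; apply: (pull_test Ac img_s _ hF) => y hy; exact: (sV (ltW hy)).2. Qed.

Let om_lin k F G : tst q' s F -> tst q' s G -> om (fun y => k * F y + G y) = k * om F + om G.
Proof.
move=> hF hG; rewrite /om -hu.1; [congr u; by rewrite pullD pullZ | exact: test_pull | exact: test_pull].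
Qed.

Let om_bound s' : 0 < s' < s -> exists (N : nat) A, forall F B, tst q' s' F -> 0 <= B ->
  (forall l y, (size l <= N)%N -> nrm (citer l F y) <= B) -> nrm (om F) <= A * B.
Proof.
move=> /andP[s'0 s's]; pose KK := chart_inv c @` [set y : X | `|y - q'| <= s'].
have img_s' y : `|y - q'| <= s' -> `|y - q'| <= s by move=> h; exact: le_trans h (ltW s's).
have cK : compact KK.
  apply: continuous_compact; last exact: (@compact_ball _ _ q' s' (ltW s'0)).
  have [_ _ _ _ h] := atlas_chart Ac; apply: continuous_subspaceW h => y /= ys.
  by apply: img_s; exact: img_s'.
have KV : KK `<=` V `&` chart_dom c.
  by move=> _ [y /= hy <-]; have [h1 h2] := sV (img_s' _ hy); split=> //; exact: (dom_inv Ac h1).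
have [N [A hA]] := hu.2 c KK Ac cK KV; exists N, A => F B hF B0 hB.
have hFs : tst q' s F by apply: up hF; exact: ltW.
apply: hA; [exact: test_pull | | exact: B0 |].
  have clK := compact_closed (@manifold_hausdorff _ _ M) cK.
  rewrite /tsupport closureE; apply: smallest_sub => // z /= nz.
  have dz : chart_dom c z by apply: contrapT => ndz; rewrite pull_out ?eqxx in nz.
  exists (chart_map c z); last exact: (chart_mapK Ac dz).
  apply: contrapT => /negP; rewrite -ltNge => h; move: nz.
  by rewrite pull_dom // (tst_supp hF (ltW h)) eqxx.
move=> l z sl Kz; have [_ dz] := KV z Kz; have iz := img_map dz.
have eF y : chart_img c y -> pull c F (chart_inv c y) = F y by move=> iy; exact: pull_inv.
have oI := img_open Ac.
rewrite (iter_partial_ext l oI iz (h := fun y => complex.Re (F y))); last by move=> y iy; rewrite eF.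
rewrite (iter_partial_ext l oI iz (f := fun y => complex.Im (pull c F (chart_inv c y))) (h := fun y => complex.Im (F y))); last by move=> y iy; rewrite eF.
rewrite -Re_citer -Im_citer; have h := hB l (chart_map c z) sl.
by split; apply: le_trans h; [exact: nrm_Re | exact: nrm_Im].
Qed.

Let s1 := rad 4.
Let s2 := rad 5.
Let U := dist_seq ir q' s1 s2 om.

Let is0 : `|q' - q| + s <= r0. Proof. by apply: le_trans incl _; exact: ltW. Qed.

Let rU : represents J cn q' s1 U (twisted ir om).
Proof.
exact: (represents_dist_seq r0r hJ tir (rad0 (isT : 0 < 4)%N) (rad_lt (isT : 4 < 5)%N)
  (rad_s (isT : 5 < 8)%N) is0 om_lin om_bound).
Qed.

Let s10 : 0 < s1 := rad0 (isT : 0 < 4)%N.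
Let s12 : s1 < s2 := rad_lt (isT : 4 < 5)%N.
Let s2s : s2 < s := rad_s (isT : 5 < 8)%N.
Let s1s : s1 <= s := ltW (lt_trans s12 s2s).

Let tst_f F : tst q' s F -> tst q' s (fun y => F y * f (chart_inv c y)).
Proof. by move=> hF; apply: (tst_push Ac img_s oV sf _ hF) => y hy; exact: (sV (ltW hy)).2. Qed.

Local Notation Popf := (Pop (fun j => lcf c q r0 r r2 J cn (L j)) (lcf c q r0 r r2 J cn X0)
  (lcf c q r0 r r2 J cn Z) (fh (local_scale c q r0 r a))).

Let A : X -> C := fun y => cut q' s1 s2 y * f (chart_inv c y).
Let tA : tst q' s A.
Proof. by apply: tst_f; apply: tst_mono (tst_cut q' s10 s12); exact: ltW. Qed.

(** The equation for [u], tested on [Psi] of the conjugate of [F], becomes through the transpose an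
    identity of coefficient sequences; its right-hand side is the cut off [f], whose coefficients
    are rapid. *)
Let weak F : tst q' s1 F -> ip (Popf U) (fh F) = ip (fun k => cn%:C * fh A k) (fh F).
Proof.
move=> hF; have hFC := tstC hF; have hFs := up s1s hF; have hFCs := up s1s hFC.
have [_ ->] := represents_Pop Ac r00 r0r rr2 ball_img hJ tir s10 s12 s2s is0 om_lin om_bound
  hL hX0.1 hZ.1 sa => //.
rewrite (f_pairing hJ (upr tA) (upr hFs)).
have -> : twisted ir om (hormanderT c q r0 r r2 L X0 Z a (fun y => conjc (F y))) =
    distribution_apply mu (hormander L X0 Z a) u (Psi c ir (fun y => conjc (F y))).
  rewrite /distribution_apply.
  by rewrite (hormander_transpose Ac r00 r0r rr2 ball_img hJ tir cint_pull cinj hL hX0.1 hZ.1 sa (up0 hFCs)).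
rewrite hf; last by apply: test_pull; exact: tstM hFCs tir.
rewrite (cintegral_Psi Ac cint_pull); congr JC; apply/funext => y.
rewrite /A; have [h|h] := ltP `|y - q'| s1; first by rewrite cut1 ?(ltW h) // mul1r.
by rewrite (tst_supp hFC h) !mul0r.
Qed.

Let th := cut q' (rad 3) s1.
Let t3 : 0 < rad 3 := rad0 (isT : 0 < 3)%N.
Let t34 : rad 3 < s1 := rad_lt (isT : 3 < 4)%N.
Let tth : tst q' s1 th. Proof. exact: tst_cut. Qed.
Let W := conv (fh th) U.

Let rW : rapid W.
Proof.
have hA := f_rapid hJ (upr tA).
have hG : rapid (fun k => cn%:C * fh A k).
  by move=> t; have [B hB] := hA t; exists (nrm (cn%:C : C) * B); exact: bdZ.
have i1 : `|q' - q| + s1 <= r1 by apply: le_trans incl; rewrite lerD2l.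
exact: (localized_rapid Ac r1r0 r00 r0r rr2 ball_img hJ hL hX0 hZ sa d01 est s10 i1 rU.1 hG weak tth).
Qed.

(** The trigonometric series of the coefficients, now rapid, is the sought function; the constant
    comes from the normalization of [fh]. *)
Let dens : M -> C := fun z => (cn%:C)^-1 * trig W (chart_map c z).

Let twistedE F : tst q' (rad 3) F -> twisted ir om F = (cn%:C)^-1 * JC J (fun y => F y * trig W y).
Proof.
move=> hF; have hF1 : tst q' s1 F by apply: tst_mono hF; exact: ltW.
have hFr := upr (up s1s hF1); have hFC := tstC hF1; have hFCr := upr (up s1s hFC).
have thr := upr (up s1s tth).
have e1 : twisted ir om F = ip U (fh (fun y => conjc (F y))).
  by rewrite (rU.2 _ hFC); congr (twisted ir om _); apply/funext => y; rewrite conjcK.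
have e2 : fh (fun y => conjc (F y)) = conv (fh th) (fh (fun y => conjc (F y))).
  rewrite -(f_conv hJ thr hFCr); congr fh; apply/funext => y.
  have [h|h] := ltP `|y - q'| (rad 3); first by rewrite /th cut1 ?(ltW h) // mul1r.
  by rewrite (tst_supp (tstC hF) h) mulr0.
have sth : star (fh th) = fh th.
  by rewrite -(f_star hJ thr); congr fh; apply/funext => y; exact: conj_cut.
have rFC := f_rapid hJ hFCr.
rewrite e1 e2 -{1}sth -ip_conv; [|exact: (f_rapid hJ thr)|exact: (dual_fr rU.1 rFC)].
have /(has_sumZ (cn%:C)^-1)/has_sum_csum <- := f_JC_trig hJ hFr rW.
rewrite /ip; congr csum; apply/funext => k; rewrite -/W mulrCA; congr (_ * _).
rewrite /fh conjcM conjcV conjcR; congr (_ * _); rewrite /jh.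
have tF : tst q r (fun y => conjc (F y) * ek (- k) y).
  by apply: tstM => //; apply: csm_ek; exact: openT.
by rewrite -(f_JCC hJ tF); congr JC; apply/funext => y; rewrite conjcM conjcK -ekN opprK.
Qed.

Let nbhd (t : R) : set M := [set z | chart_dom c z /\ `|chart_map c z - q'| < t].

Let open_nbhd t : open (nbhd t).
Proof.
rewrite openE => z [dz hz]; apply: filterI.
  exact: open_nbhs_nbhs (conj (dom_open Ac) dz).
have nb : nbhs (chart_map c z) [set y : X | `|y - q'| < t].
  by apply: open_nbhs_nbhs; split; [exact: open_in | exact: hz].
exact: (map_continuous Ac dz nb).
Qed.

Let nbhd_V t : t <= s -> nbhd t `<=` V.
Proof.
move=> ts z [dz hz]; have [_] := sV (le_trans (ltW hz) ts).
by rewrite (chart_mapK Ac dz).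
Qed.

Lemma local_density_exists : exists O O' h b, local_density V u x O O' h b.
Proof.
pose t1 := rad 1; pose t2 := rad 2.
have t10 : 0 < t1 := rad0 (isT : 0 < 1)%N; have t20 : 0 < t2 := rad0 (isT : 0 < 2)%N.
have t12 : t1 < t2 := rad_lt (isT : 1 < 2)%N; have t23 : t2 < rad 3 := rad_lt (isT : 2 < 3)%N.
have t2s : t2 <= s by apply: ltW; exact: rad_s.
have t3s : rad 3 <= s by apply: ltW; exact: rad_s.
have img2 y : `|y - q'| <= t2 -> chart_img c y by move=> h; apply: img_s; exact: le_trans h t2s.
pose b := pull c (cut q' t1 t2).
exists (nbhd t2), (nbhd t1), dens, b; split.
- exact: open_nbhd.
- exact: open_nbhd.
- by split; rewrite ?subrr ?normr0.
- by move=> z [dz hz]; split=> //; exact: lt_trans t12.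
- exact: nbhd_V.
- apply: (msmooth_chart Ac) => //; first by move=> z [].
  have oI := open_image Ac (open_nbhd t2).
  apply: (csm_ext oI (F := fun y => (cn%:C)^-1 * trig W y)).
    move=> y; rewrite (chart_image Ac) => -[iy _]; by rewrite /dens /= (chart_invK Ac iy).
  by apply: csmZ => //; apply: csm_sub (csm_trig rW).
- move=> phi [sphi cphi subphi].
  pose th2 : X -> C := cut q' t2 (rad 3).
  pose F : X -> C := fun y => (th2 y * (gr y)%:C) * phi (chart_inv c y).
  have tth2 : tst q' (rad 3) th2 by exact: tst_cut.
  have img3 y : `|y - q'| <= rad 3 -> chart_img c y by move=> h; apply: img_s; exact: le_trans h t3s.
  have tF : tst q' (rad 3) F.
    by apply: (tst_push Ac img3 openT sphi _ (tstM tth2 tgr)).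
  have tFr := upr (up t3s tF).
  have phi0 z : ~ nbhd t2 z -> phi z = 0.
    move=> nz; apply: contrapT => /eqP h; apply: nz; apply: subphi.
    by apply: subset_closure; exact: h.
  (* Multiplying by the density [gr] and dividing again by means of [ir] puts the test function in
     the form to which [twistedE] applies. *)
  have ephi : phi = Psi c ir F.
    apply/funext => z; rewrite /Psi; have [dz|ndz] := pselect (chart_dom c z); last first.
      by rewrite pull_out // phi0 // => -[].
    rewrite pull_dom // /F (chart_mapK Ac dz).
    have [h|h] := ltP `|chart_map c z - q'| t2; last first.
      by rewrite phi0 ?mulr0 ?mul0r // => -[_]; rewrite ltNge h.
    rewrite /th2 cut1 ?(ltW h) // mul1r mulrAC -(rmorphM (real_complex R)) irgr ?mul1r //.
    have hz := le_trans (ltW h) t2s; apply: le_trans (ltW r0r); apply: le_trans is0.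
    have := ler_normD (chart_map c z - q') (q' - q); rewrite addrA subrK => /le_trans; apply.
    by rewrite addrC lerD2l.
  have eg y : F y * dens (chart_inv c y) = (cn%:C)^-1 * (F y * trig W y).
    have [h|h] := ltP `|y - q'| (rad 3); last by rewrite (tst_supp tF h) !mul0r mulr0.
    by rewrite /dens (chart_invK Ac (img3 y (ltW h))) mulrCA.
  have tFW : tst q r (fun y => F y * trig W y) by exact: tstM tFr (csm_trig rW).
  split.
    have -> : u phi = twisted ir om F by rewrite ephi.
    rewrite (twistedE tF) ephi (cintegral_Psi Ac cint_pull) -(f_JCZ hJ _ tFW).
    by congr JC; apply/funext => y; rewrite eg.
  rewrite ephi mulrC -(pull_push Ac).
  have -> : (fun y => F y * (ir y)%:C * dens (chart_inv c y)) =
      fun y => (cn%:C)^-1 * (F y * trig W y) * (ir y)%:C.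
    by apply/funext => y; rewrite mulrAC eg.
  by apply: pint; apply: tstM tir; exact: tstZ.
- apply: (pull_smooth Ac img2); exact: tst_cut.
- by move=> z [dz hz]; rewrite /b pull_dom // cut1 // ltW.
- move=> phi [sphi _ _]; rewrite /b -(pull_push Ac).
  apply: (pull_test Ac img2).
    move=> y hy; have iy := img2 y (ltW hy).
    by split; [exact: (dom_inv Ac iy) | rewrite (chart_invK Ac iy)].
  by apply: (tst_push Ac img2 openT sphi) => //; exact: tst_cut.
Qed.

End Point.
End LocalDensity.

Section Gluing.
Context {R : realType} {m : nat} {M : smooth_manifold R m}.
Local Notation X := ('rV[R]_m).
Local Notation C := R[i].
Variable mu : {measure set (borel M) -> \bar R}.

Lemma cintegralD (f g : M -> C) : integrableC mu f -> integrableC mu g ->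
  cintegral mu (f + g) = cintegral mu f + cintegral mu g /\ integrableC mu (f + g).
Proof.
move=> [f1 f2] [g1 g2].
have eR : (fun x => complex.Re ((f + g) x)) = fun x => complex.Re (f x) + complex.Re (g x).
  by apply/funext => x; exact: cReD.
have eI : (fun x => complex.Im ((f + g) x)) = fun x => complex.Im (f x) + complex.Im (g x).
  by apply/funext => x; exact: cImD.
split.
  rewrite /cintegral eR eI.
  by have := mintD f1 g1; have := mintD f2 g2; rewrite /mint => -> ->.
rewrite /integrableC eR eI; split.
  by have := integrableD measurableT f1 g1; congr (_.-integrable _ _).
by have := integrableD measurableT f2 g2; congr (_.-integrable _ _).
Qed.

Lemma cintegral0 : cintegral mu 0 = 0 /\ integrableC mu 0.
Proof.
have e0 : (EFin \o (fun x : M => complex.Re ((0 : M -> C) x)) : borel M -> \bar R) = cst 0%E by [].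
have e1 : (EFin \o (fun x : M => complex.Im ((0 : M -> C) x)) : borel M -> \bar R) = cst 0%E by [].
split; last by split; [rewrite e0 | rewrite e1]; exact: integrable0.
apply: complexP; rewrite /cintegral /= /Rintegral.
  by rewrite integral0_eq.
by rewrite integral0_eq.
Qed.

Lemma test_function_sub (V O : set M) phi : test_function O phi -> O `<=` V -> test_function V phi.
Proof. by move=> [h1 h2 h3] OV; split=> //; exact: subset_trans OV. Qed.

Lemma tsupport0 (phi : M -> C) z : ~ tsupport phi z -> phi z = 0.
Proof. by move=> h; apply: contrapT => /eqP nz; apply: h; exact: subset_closure. Qed.

(** No partition of unity is constructed: the cutoffs of a finite cover of the support are peeled
    off one at a time, and each peeling removes one open set from the cover that is needed. *)
Lemma glue_densities (V : set M) (u : (M -> C) -> C) : open V ->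
  (forall (k : C) phi psi, test_function V phi -> test_function V psi -> u (k *: phi + psi) = k * u phi + u psi) ->
  (forall (O : set M) (f1 f2 : M -> C) x, open O -> smooth O f1 -> smooth O f2 ->
    (forall phi, test_function O phi -> cintegral mu (f1 * phi) = cintegral mu (f2 * phi)) ->
    O x -> f1 x = f2 x) ->
  (forall x, V x -> exists O O' h b, local_density mu V u x O O' h b) ->
  distribution_smooth mu V u.
Proof.
move=> oV lin inj loc.
have /choice[D hD] : forall x, exists D : set M * set M * (M -> C) * (M -> C),
    V x -> local_density mu V u x D.1.1.1 D.1.1.2 D.1.2 D.2.
  move=> x; have [Vx|nVx] := pselect (V x); last by exists (setT, setT, 0, 0).
  by have [W [W' [h [b ld]]]] := loc x Vx; exists (W, W', h, b).
pose O x := (D x).1.1.1; pose O' x := (D x).1.1.2; pose h x := (D x).1.2; pose b x := (D x).2.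
have ld x : V x -> local_density mu V u x (O x) (O' x) (h x) (b x) by exact: hD.
clearbody O O' h b; clear D hD.
(* Taking each density at its own base point is unambiguous, because two densities representing [u]
   on a common open set agree there. *)
pose f z := h z z.
have agree x z : V x -> O x z -> f z = h x z.
  move=> Vx Oxz; have lx := ld x Vx; have Vz := ld_sub lx Oxz; have lz := ld z Vz.
  rewrite /f; apply: (inj (O x `&` O z) (h z) (h x)).
  - exact: openI (ld_open lx) (ld_open lz).
  - exact: (msmooth_sub (@subIsetr _ _ _) (ld_smooth lz)).
  - exact: (msmooth_sub (@subIsetl _ _ _) (ld_smooth lx)).
  - move=> phi tphi.
    have [<- _] := ld_int lz (test_function_sub tphi (@subIsetr _ _ _)).
    by have [<- _] := ld_int lx (test_function_sub tphi (@subIsetl _ _ _)).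
  - split=> //; exact: ld_sub' lz _ (ld_in lz).
have sf : smooth V f.
  apply: msmooth_local => x Vx; have lx := ld x Vx.
  exists (O x), (h x); split; [exact: ld_open lx | exact: ld_sub' lx _ (ld_in lx) | exact: ld_smooth lx |].
  by move=> z Oz; exact: agree.
exists f => // phi tphi.
suff main : forall l : seq M, (forall x, x \in l -> V x) -> forall phi, test_function V phi ->
    (forall z, tsupport phi z -> exists2 x, x \in l & O' x z) ->
    u phi = cintegral mu (f * phi) /\ integrableC mu (f * phi).
  have [_ cphi subphi] := tphi; move: cphi; rewrite compact_cover => cphi.
  have [|z hz|l lV cov] := cphi M V O'.
  - by move=> x Vx; exact: ld_open' (ld x Vx).
  - by have Vz := subphi z hz; exists z => //; exact: ld_in (ld z Vz).
  - have lV' x : x \in (finmap.enum_fset l) -> V x by move=> xl; have := lV x xl; rewrite inE.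
    have cov' z : tsupport phi z -> exists2 x, x \in (finmap.enum_fset l) & O' x z.
      by move=> /cov[x /= xl hx]; exists x.
    by have [] := main _ lV' phi tphi cov'.
elim=> [_ psi tpsi cov|x l IH lV psi tpsi cov].
  have -> : psi = 0.
    by apply/funext => z; apply: tsupport0 => /cov[].
  rewrite mulr0; have [-> i0] := cintegral0; split=> //.
  have t0 : test_function V 0.
    have := tpsi; congr test_function; apply/funext => z; apply: tsupport0 => /cov[].
    by [].
  have := lin (-1) 0 0 t0 t0; rewrite scaler0 addr0 => ->.
  by rewrite mulN1r addNr.
have Vx : V x by apply: lV; rewrite inE eqxx.
have lx := ld x Vx; have [spsi cpsi subpsi] := tpsi.
have tb := ld_test lx tpsi; have tbV := test_function_sub tb (ld_sub lx).
have [sb _ _] := tb.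
(* On [O' x] the cutoff is 1, so the support of this difference misses [O' x] and is covered by the
   rest of the list. *)
pose psi' := psi - b x * psi.
have supp' : tsupport psi' `<=` tsupport psi.
  apply: closureS => z /=; apply: contraNN => /eqP e.
  have -> : psi' z = psi z - b x z * psi z by [].
  by rewrite e mulr0 subrr.
have tpsi' : test_function V psi'.
  split.
  - rewrite /psi' -scaleN1r; exact: (msmoothD openT spsi (msmoothZ _ openT sb)).
  - exact: (subclosed_compact (@closed_closure _ _) cpsi supp').
  - exact: subset_trans supp' subpsi.
have cov' z : tsupport psi' z -> exists2 y, y \in l & O' y z.
  move=> hz; have [y] := cov z (supp' z hz); rewrite inE => /orP[/eqP->|yl] Oy; last by exists y.
  have nz : nbhs z (O' x) by apply: open_nbhs_nbhs; split=> //; exact: ld_open' lx.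
  have [t [/= nt Ot]] := hz _ nz; exfalso; move: nt.
  have -> : psi' t = psi t - b x t * psi t by [].
  by rewrite (ld_cut1 lx Ot) mul1r subrr eqxx.
have [u' i'] := IH (fun y yl => lV y (mem_behead (s := x :: l) yl)) psi' tpsi' cov'.
have [ub ib] := ld_int lx tb.
have efb : f * (b x * psi) = h x * (b x * psi).
  apply/funext => z; have mulE (f1 f2 : M -> C) : (f1 * f2) z = f1 z * f2 z by [].
  have [Oz|nOz] := pselect (O x z); first by rewrite [LHS]mulE [RHS]mulE (agree x z Vx Oz).
  have [_ _ sbO] := tb; rewrite [LHS]mulE [RHS]mulE.
  by rewrite (tsupport0 (phi := b x * psi)) ?mulr0 // => /sbO.
have ef : f * psi = h x * (b x * psi) + f * psi'.
  by rewrite -efb /psi' -mulrDr addrC subrK.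
have [e1 e2] := cintegralD ib i'; rewrite ef e1; split; last exact: e2.
have -> : psi = 1 *: (b x * psi) + psi' by rewrite scale1r /psi' addrC subrK.
by rewrite lin // mul1r ub u' scale1r /psi' [b x * psi + _]addrC subrK.
Qed.

End Gluing.

Lemma complex_part_rpull (R : realType) (m : nat) (M : smooth_manifold R m) (c : chart R m M)
    (F : 'rV[R]_m -> R[i]) :
  (fun x => complex.Re (pull c F x)) = rpull c (fun y => complex.Re (F y)) /\
  (fun x => complex.Im (pull c F x)) = rpull c (fun y => complex.Im (F y)).
Proof.
by split; apply/funext => x; rewrite /rpull /pull; case: ifP.
Qed.

Theorem theorem4p4 (R : realType) (m : nat) (M : smooth_manifold R m)
  (g : riemannian_metric M) (mu : {measure set (borel M) -> \bar R})
  (mu_vol : riemannian_volume g mu)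
  (n : nat) (L : 'I_n -> operator M)
  (L_field : forall j, complex_vector_field (L j))
  (X0 : operator M) (X0_field : real_vector_field X0)
  (Y0 : operator M) (Y0_T0 : T0 (generated_distribution (range L)) Y0)
  (a : M -> R[i]) (a_smooth : smooth setT a)
  (p : M)
  (T'_p : [set field_at X p | X in
             T'sum mu (generated_distribution (range L)) X0] = tangent_space p) :
  hypoelliptic_at mu
    (fun u => a * u + X0 u + (0 +i* 1)%C *: Y0 u
              + \sum_(j < n) field_conj (L j) (L j u)) p.
Proof.
have [c Ac dp] : exists2 c, atlas c & chart_dom c p.
  by have : (\bigcup_(c in @atlas _ _ M) chart_dom c) p by rewrite atlas_cover.
have [Z hZ eZ] := Y0_T0.
have [e e0 he] := chart_ball Ac dp openT I; set q := chart_map c p in he.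
(* The bound 1/2 ensures [r * 2 <= 1], the smallness under which the exponentials separate
   points. *)
pose r2 := Num.min e (1 / 2); have r20 : 0 < r2 by rewrite lt_min e0 /= divr_gt0.
have half_lt (x : R) : 0 < x -> x / 2 < x by move=> x0; rewrite ltr_pdivrMr // ltr_pMr // ltr1n.
pose r := r2 / 2; have rp : 0 < r by rewrite divr_gt0.
have rr2 : r < r2 by exact: half_lt.
have r_1 : r * 2 <= 1.
  by rewrite /r divfK // /r2 ge_min; apply/orP; right; rewrite mul1r invf_le1 // ler1n.
pose r0 := r / 2; have r00 : 0 < r0 by rewrite divr_gt0.
have r0r : r0 < r by exact: half_lt.
have bi y : `|y - q| <= r2 -> chart_img c y.
  by move=> hy; apply: (he _ _).1; apply: le_trans hy _; rewrite ge_min lexx.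
have bir y : `|y - q| <= r -> chart_img c y by move=> hy; apply: bi; exact: le_trans hy (ltW rr2).
have [cn hJ] := Jint_fourier mu_vol Ac rp rr2 r_1 bi.
have L2 := normL2_pull mu_vol Ac rp rr2 bi.
have cpull := cintegral_pull g mu c q r r2.
have tir := tst_csm (tst_irho g Ac rp rr2 bi); have tgr := tst_csm (tst_grho g Ac rp rr2 bi).
have irgr y : `|y - q| <= r -> grho g c q r r2 y * irho g c q r r2 y = 1.
  move=> hy; rewrite (grhoE g c rp rr2 hy) (irhoE g c rp rr2 hy) divff // gt_eqF //.
  exact: rho_gt0 (bir y hy).
have cinj (f1 f2 : M -> R[i]) : smooth setT f1 -> smooth setT f2 ->
    (forall phi, test_function setT phi -> cintegral mu (f1 * phi) = cintegral mu (f2 * phi)) -> f1 = f2.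
  by move=> s1 s2 h; apply/funext => x; exact: (cintegral_inj mu_vol openT s1 s2 h I).
have pint F : tst q r F -> integrableC mu (pull c F).
  move=> hF; have [eR eI] := complex_part_rpull c F; rewrite /integrableC eR eI; split.
    exact: (rpull_integrable mu_vol Ac rp rr2 bi (tst_Re hF)).
  exact: (rpull_integrable mu_vol Ac rp rr2 bi (tst_Im hF)).
(* The functional and the densities are generalized: what remains of them is the list of properties
   just proved. *)
move: cpull hJ L2 tir tgr irgr.
move: (Jint _ _ _ _ _ _) (irho _ _ _ _ _) (grho _ _ _ _ _) => J ir gr cpull hJ L2 tir tgr irgr.
have domZ := dominated_gen Ac r00 r0r rr2 bi hJ L_field hZ.
have [r1 [d [/andP[r10 r1r0] d01 est]]] :=
  subelliptic_estimate Ac dp r00 r0r rr2 bi hJ L_field X0_field L2 T'_p.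
exists [set x | chart_dom c x /\ `|chart_map c x - q| < r1]; split.
- rewrite openE => x [dx hx]; apply: filterI.
    exact: open_nbhs_nbhs (conj (dom_open Ac) dx).
  have nb : nbhs (chart_map c x) [set y : 'rV[R]_m | `|y - q| < r1].
    by apply: open_nbhs_nbhs; split; [exact: open_in | exact: hx].
  exact: (map_continuous Ac dx nb).
- by split; rewrite ?subrr ?normr0.
- move=> V oV subV u hu [f sf hf].
  apply: (glue_densities oV hu.1) => [W f1 f2 x oW s1 s2 h Wx|x Vx].
    exact: (cintegral_inj mu_vol oW s1 s2 h Wx).
  have [dx hx] := subV x Vx.
  have [e' e'0 he'] := chart_ball Ac dx oV Vx.
  (* The ball around [x] has to lie both in [V] and in the ball around [q] where the subelliptic
     estimate holds. *)
  pose s := Num.min e' (r1 - `|chart_map c x - q|).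
  have s0 : 0 < s by rewrite lt_min e'0 subr_gt0.
  have incl : `|chart_map c x - q| + s <= r1.
    by rewrite -lerBrDl ge_min lexx orbT.
  have sV y : `|y - chart_map c x| <= s -> chart_img c y /\ V (chart_inv c y).
    by move=> hy; apply: he'; apply: le_trans hy _; rewrite ge_min lexx.
  have hf' phi : test_function V phi ->
      distribution_apply mu (hormander L X0 Z a) u phi = cintegral mu (f * phi).
    by move=> hp; rewrite -hf // -eZ.
  exact: (local_density_exists Ac r1r0 r00 r0r rr2 bi hJ tir tgr irgr cpull cinj pint
    L_field X0_field domZ a_smooth d01 est oV subV hu sf hf' Vx s0 incl sV).
Qed.
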